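(* Fix $0<\delta_2<1$, $0<\delta_1<\min\{\delta_2,1-\delta_2\}$, an integer $N\geq1$, and $a_1,\dots,a_N\in\mathbb{C}$ with $|a_i|<\delta_1$ for all $i$. Let $F$ be a meromorphic function on $\mathbb{C}$ such that all its poles have real part strictly larger than $\delta_2$, $F$ is non-zero on and inside the circle $C_{\delta_1}$, and for every $\kappa>0$ \[ \int_{\pm\ell_{\delta_2}}|dw|\,e^{\pi(\frac N2-1)|\mathrm{Im}(w)|}|\mathrm{Im}(w)|^{\kappa}|F(w)|<\infty, \qquad \int_{\ell'_{\delta_1,\delta_2,M}}|dw|\,e^{\pi(\frac N2-1)|\mathrm{Im}(w)|}|\mathrm{Im}(w)|^{\kappa}|F(w)|\xrightarrow[|M|\to\infty]{}0. \] Then \[ \int_{-\ell_{\delta_1}}\!\!\cdots\!\int_{-\ell_{\delta_1}} s_N(dw_1,\dots,dw_N)\prod_{i,j=1}^N\Gamma(a_j-w_i)\prod_{j=1}^N\frac{F(w_j)}{F(a_j)}=\det(I+K)_{L^2(C_{\delta_1})}, \] where $\det(I+K)_{L^2(C_{\delta_1})}$ is the Fredholm determinant of the operator $K:L^2(C_{\delta_1})\to L^2(C_{\delta_1})$ with integral kernel \[ K(v,v')=\frac{1}{2\pi\mathrm{i}}\int_{\ell_{\delta_2}}dw\,\frac{\pi}{\sin(\pi(v-w))}\frac{F(w)}{F(v)}\frac{1}{w-v'}\prod_{m=1}^N\frac{\Gamma(v-a_m)}{\Gamma(w-a_m)}. \]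
   Context: Contours: $C_\delta$ is the positively oriented circle centered at the origin with radius $\delta$; $\ell_\delta$ is the vertical line from $-\mathrm{i}\infty+\delta$ to $\mathrm{i}\infty+\delta$; $-\ell_\delta$ is the vertical line from $-\mathrm{i}\infty-\delta$ to $\mathrm{i}\infty-\delta$; $\ell'_{\delta_1,\delta_2,M}$ is the horizontal segment from $-\delta_1+\mathrm{i}M$ to $\delta_2+\mathrm{i}M$. For a simple smooth contour $\gamma$, $L^2(\gamma)$ means $L^2(\gamma,\mu)$ where $\mu$ is the path (arc-length-oriented) measure along $\gamma$ divided by $2\pi\mathrm{i}$; the Fredholm determinant is given by its Fredholm series expansion with respect to this measure. The Sklyanin measure on $\mathbb{C}^N$ is \[ s_N(dw_1,\dots,dw_N)=\frac{1}{(2\pi\mathrm{i})^N N!}\prod_{\substack{i,j=1\\ i\neq j}}^N\frac{1}{\Gamma(w_i-w_j)}\prod_{i=1}^N dw_i . \] *)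

(* Defs.v *)
From Stdlib Require Import Reals List Arith Factorial.
From Coquelicot Require Import Coquelicot.

Open Scope R_scope.

Definition Cexp (z : C) : C :=
  (exp (fst z) * cos (snd z), exp (fst z) * sin (snd z)).

Definition Csin (z : C) : C :=
  Cdiv (Cminus (Cexp (Cmult Ci z)) (Cexp (Copp (Cmult Ci z))))
       (Cmult (RtoC 2) Ci).

Fixpoint Csum (n : nat) (f : nat -> C) : C :=
  match n with O => RtoC 0 | S m => Cplus (Csum m f) (f m) end.
Fixpoint Cprod (n : nat) (f : nat -> C) : C :=
  match n with O => RtoC 1 | S m => Cmult (Cprod m f) (f m) end.

(* Gauss' product: 1/Gamma(z) = lim_{n->oo} z(z+1)...(z+n) / (n! n^z),
   an entire function (vanishing exactly at 0,-1,-2,...).  Limits of the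
   real and imaginary parts are taken separately. *)
Definition gauss_seq (z : C) (n : nat) : C :=
  Cdiv (Cprod (S n) (fun k => Cplus z (RtoC (INR k))))
       (Cmult (RtoC (INR (fact n))) (Cexp (Cmult z (RtoC (ln (INR n)))))).

Definition RecipGamma (z : C) : C :=
  (real (Lim_seq (fun n => fst (gauss_seq z n))),
   real (Lim_seq (fun n => snd (gauss_seq z n)))).

(* Gamma z = 1 / (1/Gamma z); only used away from the poles 0,-1,-2,... *)
Definition CGamma (z : C) : C := Cinv (RecipGamma z).

Fixpoint cdet (n : nat) (M : nat -> nat -> C) : C :=
  match n with
  | O => RtoC 1
  | S m => Csum (S m) (fun j =>
             Cmult (Cmult (RtoC ((-1) ^ j)) (M O j))
                   (cdet m (fun i k => M (S i) (if Nat.ltb k j then k else S k))))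
  end.

Definition meromorphic_with_poles (F : C -> C) (P : C -> Prop) : Prop :=
  (forall z : C, exists r : R, 0 < r /\
      forall p : C, P p -> Cmod (Cminus p z) < r -> p = z)
  /\ (forall z : C, ~ P z -> @ex_derive C_AbsRing C_NormedModule F z)
  /\ (forall p : C, P p ->
        filterlim (fun w => Cmod (F w)) (locally' p) (Rbar_locally p_infty)).

(* |t|^kappa (with 0^kappa = 0, kappa > 0) *)
Definition powabs (t kappa : R) : R :=
  if Req_EM_T t 0 then 0 else Rpower (Rabs t) kappa.

(* vertical line Re w = c, w = c + i t, t from -oo to +oo; dw = i dt *)
Definition vline (c t : R) : C := (c, t).

(* positively oriented circle of radius r: v = r e^{i theta}, theta in [0,2pi];
   dv = i v dtheta *)
Definition circ (r theta : R) : C := (r * cos theta, r * sin theta).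
Definition circ_deriv (r theta : R) : C := Cmult Ci (circ r theta).

Fixpoint is_iter_RInt_gen (n : nat) (f : list R -> C) (v : C) : Prop :=
  match n with
  | O => v = f nil
  | S m => exists g : R -> C,
      (forall t : R, is_iter_RInt_gen m (fun ts => f (t :: ts)) (g t))
      /\ @is_RInt_gen C_R_NormedModule g
           (Rbar_locally m_infty) (Rbar_locally p_infty) v
  end.

Fixpoint iter_RInt (n : nat) (f : list R -> C) (a b : R) : C :=
  match n with
  | O => f nil
  | S m => @RInt C_R_CompleteNormedModule
             (fun t => iter_RInt m (fun ts => f (t :: ts)) a b) a b
  end.

Definition two_pi_i : C := Cmult (RtoC (2 * PI)) Ci.

(* integrand of the left-hand side, in the variables t_i with
   w_i = -delta1 + i t_i on -l_{delta1}, including the Sklyanin density and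
   the Jacobians dw_i = i dt_i *)
Definition lhs_integrand (N : nat) (delta1 : R) (a : nat -> C) (F : C -> C)
    (ts : list R) : C :=
  let w := fun i => vline (- delta1) (nth i ts 0) in
  Cmult (Cinv (Cmult (Cpow two_pi_i N) (RtoC (INR (fact N)))))
  (Cmult (Cprod N (fun i => Cprod N (fun j =>
            if Nat.eqb i j then RtoC 1 else RecipGamma (Cminus (w i) (w j)))))
  (Cmult (Cprod N (fun i => Cprod N (fun j => CGamma (Cminus (a j) (w i)))))
  (Cmult (Cprod N (fun j => Cdiv (F (w j)) (F (a j))))
         (Cprod N (fun i => Ci))))).

(* the kernel K(v,v'): w = delta2 + i t on l_{delta2}, dw = i dt *)
Definition kernelK (N : nat) (delta2 : R) (a : nat -> C) (F : C -> C)
    (v v' : C) : C :=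
  Cdiv (@RInt_gen C_R_CompleteNormedModule (fun t =>
          let w := vline delta2 t in
          Cmult Ci
          (Cmult (Cdiv (RtoC PI) (Csin (Cmult (RtoC PI) (Cminus v w))))
          (Cmult (Cdiv (F w) (F v))
          (Cmult (Cinv (Cminus w v'))
                 (Cprod N (fun m => Cdiv (CGamma (Cminus v (a m)))
                                         (CGamma (Cminus w (a m)))))))))
        (Rbar_locally m_infty) (Rbar_locally p_infty))
       two_pi_i.

(* n-th term of the Fredholm series of det(I+K) on L^2(C_{delta1}, dv/(2 pi i)):
   (1/n!) int_{C^n} det[K(v_i,v_j)]_{i,j<n} prod_i dv_i/(2 pi i) *)
Definition fredholm_term (N : nat) (delta1 delta2 : R) (a : nat -> C)
    (F : C -> C) (n : nat) : C :=
  Cmult (Cinv (RtoC (INR (fact n))))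
    (iter_RInt n (fun ths =>
       let v := fun i => circ delta1 (nth i ths 0) in
       Cmult (cdet n (fun i j => kernelK N delta2 a F (v i) (v j)))
             (Cprod n (fun i => Cdiv (circ_deriv delta1 (nth i ths 0)) two_pi_i)))
     0 (2 * PI)).

(* Main.v *)
Require Import Defs.
From Stdlib Require Import Reals List Arith Factorial Lra Lia Psatz ClassicalEpsilon FunctionalExtensionality.
From Coquelicot Require Import Coquelicot.
From HB Require structures.
From mathcomp Require all_boot all_order all_algebra all_fingroup boolp zify.

(** Write [h(w) = F(w) prod_m 1/Gamma(w - a_m)], [V(z) = e^(2 i pi z) / (2 i pi)] and
    [s(z) = sin(pi z)/pi], so that [V(x) - V(y) = e^(i pi (x+y)) s(x - y)]. Newton interpolation
    at the nodes [a_m] expands [1/(w - v')] into a sum of [N] products, up to a remainder with a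
    factor [prod_m (v' - a_m)]; interpolation at the nodes [V(a_m)] expands [1/s(v - w)] likewise,
    up to a remainder with a factor [prod_m (V(v) - V(a_m))]. Divided by [h(v)], both remainders
    are holomorphic inside the circle, hence disappear from every circle integral by Cauchy's
    theorem. The Fredholm series thus terminates and equals a determinant [det (1 + M)] of size
    [N]. Moving the line [Re w = delta2] to [Re w = - delta1] crosses the poles [a_m], and the
    residues supply exactly the summand [1]: [1 + M = G L] with [G] triangular and [L] a matrix
    of integrals over [Re w = - delta1]. On the other side, the reflection formula turns the
    Sklyanin density into a product of two Vandermonde determinants, and Andreief's identity gives
    [det L] times a constant, which is the product of the diagonal of [G]. *)

Local Open Scope R_scope.
Local Notation C := Complex.C.

Lemma RtoC_neq0 (x : R) : x <> 0 -> RtoC x <> RtoC 0.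
Proof. intros H E; apply H; injection E; auto. Qed.

Lemma Cmod_minus_sym (x y : C) : Cmod (x - y) = Cmod (y - x).
Proof. rewrite <- Cmod_opp. f_equal. ring. Qed.

Lemma Cmod_minus_triangle (x y z : C) : Cmod (x - z) <= Cmod (x - y) + Cmod (y - z).
Proof. replace (x - z)%C with ((x - y) + (y - z))%C by ring. apply Cmod_triangle. Qed.

Lemma Cmod_le_plus (x y : C) : Cmod x <= Cmod y + Cmod (x - y).
Proof. replace x with (y + (x - y))%C at 1 by ring. apply Cmod_triangle. Qed.

Lemma Cmod_ReIm (z : C) : Cmod z <= Rabs (fst z) + Rabs (snd z).
Proof.
  unfold Cmod. apply Rsqr_incr_0_var.
  - rewrite Rsqr_sqrt by nra. unfold Rsqr.
    generalize (Rabs_pos (fst z)) (Rabs_pos (snd z)) (Rsqr_abs (fst z)) (Rsqr_abs (snd z)).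
    unfold Rsqr. nra.
  - generalize (Rabs_pos (fst z)) (Rabs_pos (snd z)); lra.
Qed.

Lemma Re_le_Cmod (z : C) : Rabs (fst z) <= Cmod z.
Proof. apply re_le_Cmod. Qed.

Lemma Im_le_Cmod (z : C) : Rabs (snd z) <= Cmod z.
Proof. eapply Rle_trans; [|apply Rmax_Cmod]. apply Rmax_r. Qed.

Lemma Cminus_neq0 (x y : C) : x <> y -> (x - y <> 0)%C.
Proof. intros H E; apply H. replace x with ((x - y) + y)%C by ring; rewrite E; ring. Qed.

(** * Continuity and complex differentiability *)

Definition Ccont (f : C -> C) (z : C) : Prop :=
  forall eps, 0 < eps -> exists d, 0 < d /\
    forall w, Cmod (w - z) < d -> Cmod (f w - f z) < eps.

Definition Rcont (f : R -> C) (t : R) : Prop :=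
  forall eps, 0 < eps -> exists d, 0 < d /\
    forall s, Rabs (s - t) < d -> Cmod (f s - f t) < eps.

Definition near (z : C) (Q : C -> Prop) : Prop :=
  exists d, 0 < d /\ forall w, Cmod (w - z) < d -> Q w.

Definition Cder (f : C -> C) (z l : C) : Prop :=
  forall eps, 0 < eps -> exists d, 0 < d /\
    forall w, Cmod (w - z) < d -> Cmod (f w - f z - l * (w - z)) <= eps * Cmod (w - z).

Definition hol (f : C -> C) (z : C) : Prop := exists l, Cder f z l.

Lemma near_and (z : C) (Q1 Q2 : C -> Prop) :
  near z Q1 -> near z Q2 -> near z (fun w => Q1 w /\ Q2 w).
Proof.
  intros [d1 [H1 K1]] [d2 [H2 K2]]. exists (Rmin d1 d2).
  split; [now apply Rmin_glb_lt|]. intros w Hw.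
  split; [apply K1|apply K2]; eapply Rlt_le_trans; eauto; [apply Rmin_l|apply Rmin_r].
Qed.

Lemma near_imp (z : C) (Q1 Q2 : C -> Prop) :
  (forall w, Q1 w -> Q2 w) -> near z Q1 -> near z Q2.
Proof. intros H [d [Hd K]]; exists d; auto. Qed.

Lemma near_self (z : C) (Q : C -> Prop) : near z Q -> Q z.
Proof. intros [d [Hd K]]; apply K. replace (z - z)%C with (RtoC 0) by ring. now rewrite Cmod_0. Qed.

Lemma Ccont_near (f : C -> C) (z : C) (eps : R) :
  Ccont f z -> 0 < eps -> near z (fun w => Cmod (f w - f z) < eps).
Proof. intros H He; exact (H eps He). Qed.

Lemma near_Ccont (f : C -> C) (z : C) :
  (forall eps, 0 < eps -> near z (fun w => Cmod (f w - f z) < eps)) -> Ccont f z.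
Proof. auto. Qed.

Lemma Ccont_const (c z : C) : Ccont (fun _ => c) z.
Proof.
  intros eps He; exists 1; split; [lra|]; intros w _.
  replace (c - c)%C with (RtoC 0) by ring. now rewrite Cmod_0.
Qed.

Lemma Ccont_id (z : C) : Ccont (fun w => w) z.
Proof. intros eps He; exists eps; auto. Qed.

Lemma Ccont_plus (f g : C -> C) (z : C) :
  Ccont f z -> Ccont g z -> Ccont (fun w => f w + g w)%C z.
Proof.
  intros Hf Hg. apply near_Ccont; intros eps He.
  eapply near_imp;
    [|apply near_and; [apply (Ccont_near f z (eps/2) Hf)|apply (Ccont_near g z (eps/2) Hg)]; lra].
  intros w [H1 H2]. cbv beta in *.
  replace (f w + g w - (f z + g z))%C with ((f w - f z) + (g w - g z))%C by ring.
  eapply Rle_lt_trans; [apply Cmod_triangle|lra].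
Qed.

Lemma Ccont_mult (f g : C -> C) (z : C) :
  Ccont f z -> Ccont g z -> Ccont (fun w => f w * g w)%C z.
Proof.
  intros Hf Hg. apply near_Ccont; intros eps He.
  pose proof (Cmod_ge_0 (f z)) as P1. pose proof (Cmod_ge_0 (g z)) as P2.
  set (A := Cmod (f z) + Cmod (g z) + 1). assert (HA : 1 <= A) by (unfold A; lra).
  set (e := Rmin 1 (eps / (2 * A))).
  assert (He1 : 0 < e) by (unfold e; apply Rmin_glb_lt; [lra|apply Rdiv_lt_0_compat; lra]).
  assert (He2 : e <= 1) by apply Rmin_l.
  assert (He3 : e * (2 * A) <= eps).
  { assert (e <= eps / (2 * A)) by apply Rmin_r.
    apply Rmult_le_compat_r with (r := 2 * A) in H; [|lra].
    replace (eps / (2 * A) * (2 * A)) with eps in H by (field; lra). exact H. }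
  eapply near_imp;
    [|apply near_and; [apply (Ccont_near f z e Hf)|apply (Ccont_near g z e Hg)]; lra].
  intros w [H1 H2]. cbv beta in *.
  replace (f w * g w - f z * g z)%C
    with ((f w - f z) * (g w - g z) + (f w - f z) * g z + f z * (g w - g z))%C by ring.
  eapply Rle_lt_trans; [apply Cmod_triangle|].
  eapply Rle_lt_trans; [apply Rplus_le_compat_r; apply Cmod_triangle|].
  rewrite !Cmod_mult.
  pose proof (Cmod_ge_0 (f w - f z)). pose proof (Cmod_ge_0 (g w - g z)).
  unfold A in *. nra.
Qed.

Lemma near_neq0 (f : C -> C) (z : C) : Ccont f z -> f z <> 0 ->
  near z (fun w => Cmod (f z) / 2 < Cmod (f w)).
Proof.
  intros Hf Hz. apply Cmod_gt_0 in Hz.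
  eapply near_imp; [|apply (Ccont_near f z (Cmod (f z) / 2) Hf); lra].
  intros w H; cbv beta in *. pose proof (Cmod_le_plus (f z) (f w)).
  rewrite (Cmod_minus_sym (f z)) in H0. lra.
Qed.

Lemma Ccont_inv (f : C -> C) (z : C) :
  Ccont f z -> f z <> 0 -> Ccont (fun w => / f w)%C z.
Proof.
  intros Hf Hz. apply near_Ccont; intros eps He.
  assert (P : 0 < Cmod (f z)) by now apply Cmod_gt_0.
  eapply near_imp;
    [|apply near_and; [apply (near_neq0 f z Hf Hz)|
        apply (Ccont_near f z (eps * (Cmod (f z) * Cmod (f z) / 2)) Hf)]].
  2: { apply Rmult_lt_0_compat; [lra|]. nra. }
  intros w [H1 H2]; cbv beta in *.
  assert (Hw : f w <> 0) by (apply Cmod_gt_0; lra).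
  replace (/ f w - / f z)%C with ((f z - f w) / (f w * f z))%C by (field; auto).
  rewrite Cmod_div by (apply Cmult_neq_0; auto). rewrite Cmod_mult, Cmod_minus_sym.
  apply Rmult_lt_reg_r with (Cmod (f w) * Cmod (f z)); [nra|].
  unfold Rdiv; rewrite Rmult_assoc, Rinv_l, Rmult_1_r by nra.
  eapply Rlt_le_trans; [exact H2|]. apply Rmult_le_compat_l; [lra|]. nra.
Qed.

Lemma Ccont_comp (f g : C -> C) (z : C) :
  Ccont g z -> Ccont f (g z) -> Ccont (fun w => f (g w)) z.
Proof.
  intros Hg Hf eps He. destruct (Hf eps He) as [d [Hd K]].
  destruct (Hg d Hd) as [d' [Hd' K']]. exists d'; split; auto.
Qed.

Lemma Ccont_ext_near (f g : C -> C) (z : C) :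
  near z (fun w => f w = g w) -> Ccont f z -> Ccont g z.
Proof.
  intros H Hf. apply near_Ccont; intros eps He. pose proof (near_self _ _ H) as E; cbv beta in E.
  eapply near_imp; [|apply near_and; [exact H|apply (Ccont_near f z eps Hf He)]].
  intros w [H1 H2]; cbv beta in *. rewrite <- E, <- H1; auto.
Qed.

(* Caratheodory's form of differentiability reduces the rules below to rules for continuity. *)
Lemma Cder_carath (f : C -> C) (z l : C) :
  Cder f z l <-> exists phi, Ccont phi z /\ phi z = l /\
     near z (fun w => f w = f z + phi w * (w - z))%C.
Proof.
  split.
  - intros H.
    exists (fun w => if excluded_middle_informative (w = z) then l else (f w - f z) / (w - z))%C.
    split; [|split].
    + intros eps He. destruct (H (eps/2)) as [d [Hd K]]; [lra|]. exists d; split; auto.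
      intros w Hw. destruct (excluded_middle_informative (z = z)) as [_|n]; [|now destruct n].
      destruct (excluded_middle_informative (w = z)) as [_|n].
      * replace (l - l)%C with (RtoC 0) by ring. now rewrite Cmod_0.
      * apply Cminus_neq0 in n. assert (P : 0 < Cmod (w - z)) by now apply Cmod_gt_0.
        replace ((f w - f z) / (w - z) - l)%C with ((f w - f z - l * (w - z)) / (w - z))%C
          by (field; auto).
        rewrite Cmod_div by auto. apply Rmult_lt_reg_r with (Cmod (w - z)); auto.
        unfold Rdiv; rewrite Rmult_assoc, Rinv_l, Rmult_1_r by lra.
        eapply Rle_lt_trans; [now apply K|]. nra.
    + destruct (excluded_middle_informative (z = z)) as [_|n]; [|now destruct n]. auto.
    + exists 1; split; [lra|]; intros w _.
      destruct (excluded_middle_informative (w = z)) as [->|n]; [ring|].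
      apply Cminus_neq0 in n. field; auto.
  - intros [phi [Hc [E H]]] eps He.
    destruct (near_and _ _ _ H (Ccont_near phi z eps Hc He)) as [d [Hd K]].
    exists d; split; auto. intros w Hw. destruct (K w Hw) as [K1 K2].
    rewrite K1. replace (f z + phi w * (w - z) - f z - l * (w - z))%C
      with ((phi w - phi z) * (w - z))%C by (rewrite E; ring).
    rewrite Cmod_mult. apply Rmult_le_compat_r; [apply Cmod_ge_0|lra].
Qed.

Lemma Cder_cont (f : C -> C) (z l : C) : Cder f z l -> Ccont f z.
Proof.
  intros H. apply Cder_carath in H. destruct H as [phi [Hc [_ H]]].
  apply Ccont_ext_near with (fun w => f z + phi w * (w - z))%C.
  - eapply near_imp; [|exact H]. auto.
  - apply Ccont_plus; [apply Ccont_const|]. apply Ccont_mult; auto.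
    apply Ccont_plus; [apply Ccont_id|apply Ccont_const].
Qed.

Lemma hol_cont (f : C -> C) (z : C) : hol f z -> Ccont f z.
Proof. intros [l H]; eapply Cder_cont; eauto. Qed.

Lemma Cder_const (c z : C) : Cder (fun _ => c) z 0.
Proof.
  apply Cder_carath. exists (fun _ => 0%C). split; [apply Ccont_const|split; auto].
  exists 1; split; [lra|]; intros; ring.
Qed.

Lemma Cder_id (z : C) : Cder (fun w => w) z 1.
Proof.
  apply Cder_carath. exists (fun _ => 1%C). split; [apply Ccont_const|split; auto].
  exists 1; split; [lra|]; intros; ring.
Qed.

Lemma Cder_plus (f g : C -> C) (z a b : C) :
  Cder f z a -> Cder g z b -> Cder (fun w => f w + g w)%C z (a + b).
Proof.
  intros Hf Hg. apply Cder_carath in Hf. apply Cder_carath in Hg. apply Cder_carath.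
  destruct Hf as [p [Cp [Ep Np]]]. destruct Hg as [q [Cq [Eq Nq]]].
  exists (fun w => p w + q w)%C. split; [now apply Ccont_plus|split; [congruence|]].
  eapply near_imp; [|apply near_and; [exact Np|exact Nq]].
  intros w [H1 H2]; cbv beta in *. rewrite H1, H2. ring.
Qed.

Lemma Cder_mult (f g : C -> C) (z a b : C) :
  Cder f z a -> Cder g z b -> Cder (fun w => f w * g w)%C z (a * g z + f z * b).
Proof.
  intros Hf Hg. pose proof (Cder_cont _ _ _ Hg) as Gc.
  apply Cder_carath in Hf. apply Cder_carath in Hg. apply Cder_carath.
  destruct Hf as [p [Cp [Ep Np]]]. destruct Hg as [q [Cq [Eq Nq]]].
  exists (fun w => p w * g w + f z * q w)%C.
  split; [apply Ccont_plus; apply Ccont_mult; auto; apply Ccont_const|].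
  split; [congruence|].
  eapply near_imp; [|apply near_and; [exact Np|exact Nq]].
  intros w [H1 H2]; cbv beta in *. rewrite H1, H2. ring.
Qed.

Lemma Cder_inv (f : C -> C) (z a : C) :
  Cder f z a -> f z <> 0 -> Cder (fun w => / f w)%C z (- a / (f z * f z)).
Proof.
  intros Hf Hz. pose proof (Cder_cont _ _ _ Hf) as Fc.
  apply Cder_carath in Hf. apply Cder_carath.
  destruct Hf as [p [Cp [Ep Np]]].
  exists (fun w => - (1) * p w * / (f w * f z))%C.
  split; [|split].
  - apply Ccont_mult; [apply Ccont_mult; auto; apply Ccont_const|].
    apply (Ccont_inv (fun w => f w * f z)%C); [apply Ccont_mult; auto; apply Ccont_const|].
    now apply Cmult_neq_0.
  - rewrite Ep. field; auto.
  - eapply near_imp; [|apply near_and; [exact Np|exact (near_neq0 f z Fc Hz)]].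
    intros w [H1 H2]; cbv beta in *. pose proof (Cmod_ge_0 (f z)).
    assert (f w <> 0) by (apply Cmod_gt_0; lra).
    assert (E : (p w * (w - z) = f w - f z)%C) by (rewrite H1; ring).
    replace (- (1) * p w * / (f w * f z) * (w - z))%C
      with (- (1) * (p w * (w - z)) * / (f w * f z))%C by ring.
    rewrite E. field; auto.
Qed.

Lemma Cder_comp (f g : C -> C) (z a b : C) :
  Cder g z b -> Cder f (g z) a -> Cder (fun w => f (g w)) z (a * b).
Proof.
  intros Hg Hf. pose proof (Cder_cont _ _ _ Hg) as Gc.
  apply Cder_carath in Hf. apply Cder_carath in Hg. apply Cder_carath.
  destruct Hf as [p [Cp [Ep Np]]]. destruct Hg as [q [Cq [Eq Nq]]].
  exists (fun w => p (g w) * q w)%C.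
  split; [apply Ccont_mult; auto; now apply (Ccont_comp p g)|split; [congruence|]].
  destruct Np as [d [Hd Kd]].
  eapply near_imp; [|apply near_and; [exact Nq|exact (Ccont_near g z d Gc Hd)]].
  intros w [H1 H2]; cbv beta in *. rewrite (Kd (g w) H2).
  replace (g w - g z)%C with (q w * (w - z))%C by (rewrite H1; ring). ring.
Qed.

Lemma Cder_ext_near (f g : C -> C) (z l : C) :
  near z (fun w => f w = g w) -> Cder f z l -> Cder g z l.
Proof.
  intros H Hf. pose proof (near_self _ _ H) as E; cbv beta in E.
  apply Cder_carath in Hf. apply Cder_carath. destruct Hf as [p [Cp [Ep Np]]].
  exists p; split; auto; split; auto.
  eapply near_imp; [|apply near_and; [exact H|exact Np]].
  intros w [H1 H2]; cbv beta in *. now rewrite <- H1, <- E.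
Qed.

Lemma hol_const (c z : C) : hol (fun _ => c) z.
Proof. eexists; apply Cder_const. Qed.
Lemma hol_id (z : C) : hol (fun w => w) z.
Proof. eexists; apply Cder_id. Qed.
Lemma hol_plus (f g : C -> C) (z : C) : hol f z -> hol g z -> hol (fun w => f w + g w)%C z.
Proof. intros [a Ha] [b Hb]; eexists; apply Cder_plus; eauto. Qed.
Lemma hol_mult (f g : C -> C) (z : C) : hol f z -> hol g z -> hol (fun w => f w * g w)%C z.
Proof. intros [a Ha] [b Hb]; eexists; apply Cder_mult; eauto. Qed.
Lemma hol_inv (f : C -> C) (z : C) : hol f z -> f z <> 0 -> hol (fun w => / f w)%C z.
Proof. intros [a Ha] Hz; eexists; apply Cder_inv; eauto. Qed.
Lemma hol_comp (f g : C -> C) (z : C) : hol g z -> hol f (g z) -> hol (fun w => f (g w)) z.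
Proof. intros [a Ha] [b Hb]; eexists; apply Cder_comp; eauto. Qed.
Lemma hol_ext_near (f g : C -> C) (z : C) :
  near z (fun w => f w = g w) -> hol f z -> hol g z.
Proof. intros H [a Ha]; eexists; eapply Cder_ext_near; eauto. Qed.
Lemma hol_ext (f g : C -> C) (z : C) : (forall w, f w = g w) -> hol f z -> hol g z.
Proof. intros H; apply hol_ext_near. exists 1; split; [lra|auto]. Qed.
Lemma hol_opp (f : C -> C) (z : C) : hol f z -> hol (fun w => - f w)%C z.
Proof.
  intros H. apply hol_ext with (fun w => (- (1)) * f w)%C; [intros; ring|].
  apply hol_mult; auto; apply hol_const.
Qed.
Lemma hol_minus (f g : C -> C) (z : C) : hol f z -> hol g z -> hol (fun w => f w - g w)%C z.
Proof. intros; apply hol_plus; auto; now apply hol_opp. Qed.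
Lemma hol_div (f g : C -> C) (z : C) :
  hol f z -> hol g z -> g z <> 0 -> hol (fun w => f w / g w)%C z.
Proof. intros; apply hol_mult; auto; now apply hol_inv. Qed.
Lemma hol_Cprod (n : nat) (f : nat -> C -> C) (z : C) :
  (forall i, (i < n)%nat -> hol (f i) z) -> hol (fun w => Cprod n (fun i => f i w)) z.
Proof. induction n; intros H; simpl; [apply hol_const|apply hol_mult; auto]. Qed.
Lemma hol_Csum (n : nat) (f : nat -> C -> C) (z : C) :
  (forall i, (i < n)%nat -> hol (f i) z) -> hol (fun w => Csum n (fun i => f i w)) z.
Proof. induction n; intros H; simpl; [apply hol_const|apply hol_plus; auto]. Qed.

Lemma ex_derive_hol (f : C -> C) (z : C) :
  @ex_derive C_AbsRing C_NormedModule f z -> hol f z.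
Proof.
  intros [l [_ H]]. exists l. intros eps He.
  specialize (H z (fun P HP => HP)).
  destruct (H (mkposreal eps He)) as [d Hd].
  exists d; split; [apply cond_pos|]. intros w Hw.
  specialize (Hd w Hw). simpl in Hd.
  eapply Rle_trans; [|exact Hd]. right. unfold norm; simpl. f_equal.
  unfold minus, plus, opp, scal; simpl. unfold mult; simpl. ring.
Qed.

(** * Integrals of complex-valued functions of a real variable *)

Definition is_cint (f : R -> C) (a b : R) (v : C) : Prop := @is_RInt C_R_NormedModule f a b v.
Definition cint (f : R -> C) (a b : R) : C := @RInt C_R_CompleteNormedModule f a b.

Definition Rder (f : R -> C) (t : R) (l : C) : Prop :=
  forall eps, 0 < eps -> exists d, 0 < d /\
    forall s, Rabs (s - t) < d ->
      Cmod (f s - f t - l * RtoC (s - t)) <= eps * Rabs (s - t).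

Lemma Rcont_continuous (f : R -> C) (t : R) :
  Rcont f t -> @continuous R_UniformSpace C_UniformSpace f t.
Proof.
  intros H P [eps HP]. destruct (H eps (cond_pos eps)) as [d [Hd K]].
  exists (mkposreal d Hd). intros s Hs. apply HP.
  apply C_NormedModule_mixin_compat1. apply K. exact Hs.
Qed.

Lemma ex_cint (f : R -> C) (a b : R) :
  (forall t, Rmin a b <= t <= Rmax a b -> Rcont f t) -> is_cint f a b (cint f a b).
Proof.
  intros H. apply (@RInt_correct C_R_CompleteNormedModule).
  apply (@ex_RInt_continuous C_R_CompleteNormedModule).
  intros t Ht. apply Rcont_continuous; auto.
Qed.

Lemma cint_unique (f : R -> C) (a b : R) (v : C) : is_cint f a b v -> cint f a b = v.
Proof. apply (@is_RInt_unique C_R_CompleteNormedModule). Qed.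

Lemma is_cint_ext (f g : R -> C) (a b : R) (v : C) :
  (forall t, Rmin a b < t < Rmax a b -> f t = g t) -> is_cint f a b v -> is_cint g a b v.
Proof. apply (@is_RInt_ext C_R_NormedModule). Qed.

Lemma is_cint_plus (f g : R -> C) (a b : R) (u v : C) :
  is_cint f a b u -> is_cint g a b v -> is_cint (fun t => f t + g t)%C a b (u + v).
Proof. apply (@is_RInt_plus C_R_NormedModule). Qed.

Lemma is_cint_scal (f : R -> C) (a b : R) (c v : C) :
  is_cint f a b v -> is_cint (fun t => c * f t)%C a b (c * v).
Proof.
  intros H.
  pose proof (is_RInt_fct_extend_fst _ _ _ _ H) as H1.
  pose proof (is_RInt_fct_extend_snd _ _ _ _ H) as H2.
  apply is_RInt_fct_extend_pair; simpl.
  - apply (@is_RInt_minus R_NormedModule (fun t => fst c * fst (f t)) (fun t => snd c * snd (f t))).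
    + apply (@is_RInt_scal R_NormedModule (fun t => fst (f t))); auto.
    + apply (@is_RInt_scal R_NormedModule (fun t => snd (f t))); auto.
  - apply (@is_RInt_plus R_NormedModule (fun t => fst c * snd (f t)) (fun t => snd c * fst (f t))).
    + apply (@is_RInt_scal R_NormedModule (fun t => snd (f t))); auto.
    + apply (@is_RInt_scal R_NormedModule (fun t => fst (f t))); auto.
Qed.

Lemma is_cint_scal_r (f : R -> C) (a b : R) (c v : C) :
  is_cint f a b v -> is_cint (fun t => f t * c)%C a b (v * c).
Proof.
  intros H. rewrite Cmult_comm. eapply is_cint_ext; [|apply is_cint_scal, H].
  intros; cbv beta; ring.
Qed.

Lemma is_cint_minus (f g : R -> C) (a b : R) (u v : C) :
  is_cint f a b u -> is_cint g a b v -> is_cint (fun t => f t - g t)%C a b (u - v).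
Proof. apply (@is_RInt_minus C_R_NormedModule). Qed.

Lemma is_cint_Chasles (f : R -> C) (a b c : R) (u v : C) :
  is_cint f a b u -> is_cint f b c v -> is_cint f a c (u + v).
Proof. apply (@is_RInt_Chasles C_R_NormedModule). Qed.

Lemma is_cint_swap (f : R -> C) (a b : R) (v : C) : is_cint f a b v -> is_cint f b a (- v).
Proof. apply (@is_RInt_swap C_R_NormedModule). Qed.

Lemma is_cint_uniq (f : R -> C) (a b : R) (u v : C) : is_cint f a b u -> is_cint f a b v -> u = v.
Proof. intros H1 H2. rewrite <- (cint_unique _ _ _ _ H1). now apply cint_unique. Qed.

Lemma is_cint_point (f : R -> C) (a : R) : is_cint f a a 0.
Proof. apply (@is_RInt_point C_R_NormedModule). Qed.

Lemma is_cint_norm (f : R -> C) (a b M : R) (v : C) :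
  a <= b -> (forall t, a <= t <= b -> Cmod (f t) <= M) -> is_cint f a b v ->
  Cmod v <= (b - a) * M.
Proof.
  intros Hab H Hv. rewrite Cmod_norm.
  apply (norm_RInt_le_const (V := C_R_NormedModule) f a b v M); auto.
  intros t Ht. rewrite <- Cmod_norm. auto.
Qed.

Lemma is_cint_norm_abs (f : R -> C) (a b M : R) (v : C) :
  (forall t, Rmin a b <= t <= Rmax a b -> Cmod (f t) <= M) -> is_cint f a b v ->
  Cmod v <= Rabs (b - a) * M.
Proof.
  intros H Hv. destruct (Rle_dec a b) as [L|L].
  - rewrite Rabs_pos_eq by lra. apply (is_cint_norm f); auto.
    rewrite Rmin_left, Rmax_right in H; auto.
  - rewrite Rabs_minus_sym, Rabs_pos_eq by lra. rewrite <- Cmod_opp.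
    apply (is_cint_norm f); [lra| |now apply is_cint_swap].
    rewrite Rmin_right, Rmax_left in H by lra; auto.
Qed.

Lemma is_cint_le (f : R -> C) (g : R -> R) (a b lg : R) (v : C) :
  a <= b -> (forall t, a <= t <= b -> Cmod (f t) <= g t) -> is_cint f a b v ->
  is_RInt g a b lg -> Cmod v <= lg.
Proof.
  intros Hab H Hv Hg. rewrite Cmod_norm.
  apply (norm_RInt_le (V := C_R_NormedModule) f g a b v lg); auto.
  intros t Ht. rewrite <- Cmod_norm. auto.
Qed.

Lemma is_cint_const (c : C) (a b : R) : is_cint (fun _ => c) a b (RtoC (b - a) * c).
Proof.
  replace (RtoC (b - a) * c)%C with (scal (b - a) c : C_R_NormedModule).
  - apply (@is_RInt_const C_R_NormedModule).
  - apply injective_projections; simpl; unfold scal; simpl; unfold mult; simpl; ring.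
Qed.

Lemma Rder_is_derive (f : R -> C) (t : R) (l : C) :
  Rder f t l -> @is_derive R_AbsRing C_R_NormedModule f t l.
Proof.
  intros H. split; [apply is_linear_scal_l|].
  intros x Hx.
  apply (@is_filter_lim_locally_unique R_AbsRing (AbsRing_NormedModule R_AbsRing)) in Hx. subst x.
  intros [eps He]. destruct (H eps He) as [d [Hd K]].
  exists (mkposreal d Hd). intros s Hs. simpl.
  specialize (K s Hs). rewrite <- Cmod_norm.
  eapply Rle_trans; [|exact K]. right. f_equal.
  apply injective_projections; simpl; unfold minus, plus, opp, scal; simpl; unfold mult; simpl; ring.
Qed.

Lemma is_cint_derive (F f : R -> C) (a b : R) :
  (forall t, Rmin a b <= t <= Rmax a b -> Rder F t (f t)) ->
  (forall t, Rmin a b <= t <= Rmax a b -> Rcont f t) ->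
  is_cint f a b (F b - F a).
Proof.
  intros H1 H2.
  apply (@is_RInt_derive C_R_CompleteNormedModule F f a b).
  - intros t Ht; apply Rder_is_derive; auto.
  - intros t Ht; apply Rcont_continuous; auto.
Qed.

Lemma Rder_cont (f : R -> C) (t : R) (l : C) : Rder f t l -> Rcont f t.
Proof.
  intros H eps He. destruct (H 1) as [d [Hd K]]; [lra|].
  pose proof (Cmod_ge_0 l) as Pl.
  exists (Rmin d (eps / (2 + Cmod l))). split.
  - apply Rmin_glb_lt; auto. apply Rdiv_lt_0_compat; lra.
  - intros s Hs.
    assert (H1 : Rabs (s - t) < d) by (eapply Rlt_le_trans; [exact Hs|apply Rmin_l]).
    assert (H2 : Rabs (s - t) < eps / (2 + Cmod l)) by (eapply Rlt_le_trans; [exact Hs|apply Rmin_r]).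
    specialize (K s H1).
    replace (f s - f t)%C with ((f s - f t - l * RtoC (s - t)) + l * RtoC (s - t))%C by ring.
    eapply Rle_lt_trans; [apply Cmod_triangle|]. rewrite Cmod_mult, Cmod_R.
    assert (H3 : Rabs (s - t) * (2 + Cmod l) < eps).
    { apply Rmult_lt_compat_r with (r := 2 + Cmod l) in H2; [|lra].
      replace (eps / (2 + Cmod l) * (2 + Cmod l)) with eps in H2 by (field; lra). exact H2. }
    pose proof (Rabs_pos (s - t)). nra.
Qed.

Lemma Rder_comp (F : C -> C) (g : R -> C) (t : R) (l m : C) :
  Cder F (g t) l -> Rder g t m -> Rder (fun s => F (g s)) t (l * m).
Proof.
  intros HF Hg eps He. pose proof (Cmod_ge_0 l) as Pl. pose proof (Cmod_ge_0 m) as Pm.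
  set (e1 := eps / (2 * (1 + Cmod m))).
  assert (He1 : 0 < e1) by (apply Rdiv_lt_0_compat; lra).
  destruct (HF e1 He1) as [d1 [Hd1 K1]].
  set (e2 := Rmin 1 (eps / (2 * (1 + Cmod l)))).
  assert (He2 : 0 < e2) by (apply Rmin_glb_lt; [lra|apply Rdiv_lt_0_compat; lra]).
  destruct (Hg e2 He2) as [d2 [Hd2 K2]].
  destruct (Rder_cont _ _ _ Hg d1 Hd1) as [d3 [Hd3 K3]].
  exists (Rmin d2 d3). split; [now apply Rmin_glb_lt|]. intros s Hs.
  assert (H2 : Rabs (s - t) < d2) by (eapply Rlt_le_trans; [exact Hs|apply Rmin_l]).
  assert (H3 : Rabs (s - t) < d3) by (eapply Rlt_le_trans; [exact Hs|apply Rmin_r]).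
  specialize (K3 s H3). specialize (K2 s H2). specialize (K1 _ K3).
  replace (F (g s) - F (g t) - l * m * RtoC (s - t))%C
    with ((F (g s) - F (g t) - l * (g s - g t)) + l * (g s - g t - m * RtoC (s - t)))%C by ring.
  eapply Rle_trans; [apply Cmod_triangle|]. rewrite Cmod_mult.
  assert (Hgs : Cmod (g s - g t) <= (1 + Cmod m) * Rabs (s - t)).
  { replace (g s - g t)%C with ((g s - g t - m * RtoC (s - t)) + m * RtoC (s - t))%C by ring.
    eapply Rle_trans; [apply Cmod_triangle|]. rewrite Cmod_mult, Cmod_R.
    assert (e2 <= 1) by apply Rmin_l. pose proof (Rabs_pos (s - t)). nra. }
  assert (A1 : e1 * Cmod (g s - g t) <= eps / 2 * Rabs (s - t)).
  { eapply Rle_trans; [apply Rmult_le_compat_l; [lra|exact Hgs]|].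
    right. unfold e1. field. lra. }
  assert (A2 : Cmod l * (e2 * Rabs (s - t)) <= eps / 2 * Rabs (s - t)).
  { assert (e2 <= eps / (2 * (1 + Cmod l))) by apply Rmin_r.
    rewrite <- Rmult_assoc. apply Rmult_le_compat_r; [apply Rabs_pos|].
    apply Rle_trans with ((1 + Cmod l) * (eps / (2 * (1 + Cmod l)))).
    - apply Rmult_le_compat; lra.
    - right; field; lra. }
  assert (Cmod l * Cmod (g s - g t - m * RtoC (s - t)) <= Cmod l * (e2 * Rabs (s - t)))
    by (apply Rmult_le_compat_l; auto).
  lra.
Qed.

Lemma Rcont_comp (f : C -> C) (g : R -> C) (t : R) :
  Rcont g t -> Ccont f (g t) -> Rcont (fun s => f (g s)) t.
Proof.
  intros Hg Hf eps He. destruct (Hf eps He) as [d [Hd K]].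
  destruct (Hg d Hd) as [d' [Hd' K']]. exists d'; split; auto.
Qed.

Lemma Rcont_const (c : C) (t : R) : Rcont (fun _ => c) t.
Proof.
  intros eps He; exists 1; split; [lra|]; intros.
  replace (c - c)%C with (RtoC 0) by ring. now rewrite Cmod_0.
Qed.

Lemma Rcont_mult (f g : R -> C) (t : R) :
  Rcont f t -> Rcont g t -> Rcont (fun s => f s * g s)%C t.
Proof.
  intros Hf Hg.
  assert (L : forall k, Rcont k t -> Ccont (fun z => k (fst z)) (RtoC t)).
  { intros k Hk eps He. destruct (Hk eps He) as [d [Hd K]]. exists d; split; auto.
    intros w Hw. apply K. eapply Rle_lt_trans; [|exact Hw]. apply (Re_le_Cmod (w - RtoC t)). }
  pose proof (Ccont_mult _ _ _ (L f Hf) (L g Hg)) as H.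
  intros eps He. destruct (H eps He) as [d [Hd K]]. exists d; split; auto.
  intros s Hs. apply (K (RtoC s)). rewrite <- RtoC_minus, Cmod_R. auto.
Qed.

Lemma Rcont_plus (f g : R -> C) (t : R) :
  Rcont f t -> Rcont g t -> Rcont (fun s => f s + g s)%C t.
Proof.
  intros Hf Hg eps He. destruct (Hf (eps/2)) as [d [Hd K]]; [lra|].
  destruct (Hg (eps/2)) as [d' [Hd' K']]; [lra|].
  exists (Rmin d d'); split; [now apply Rmin_glb_lt|]. intros s Hs.
  assert (H1 : Rabs (s - t) < d) by (eapply Rlt_le_trans; [exact Hs|apply Rmin_l]).
  assert (H2 : Rabs (s - t) < d') by (eapply Rlt_le_trans; [exact Hs|apply Rmin_r]).
  replace (f s + g s - (f t + g t))%C with ((f s - f t) + (g s - g t))%C by ring.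
  specialize (K s H1). specialize (K' s H2).
  eapply Rle_lt_trans; [apply Cmod_triangle|]. lra.
Qed.

Lemma Rcont_ext (f g : R -> C) (t : R) : (forall s, f s = g s) -> Rcont f t -> Rcont g t.
Proof.
  intros H Hf eps He. destruct (Hf eps He) as [d [Hd K]]. exists d; split; auto.
  intros s Hs. rewrite <- !H; auto.
Qed.

Lemma Rder_hline (x y : R) : Rder (fun t => (t, y)) x 1.
Proof.
  intros eps He; exists 1; split; [lra|]; intros s _.
  replace ((s, y) - (x, y) - 1 * RtoC (s - x))%C with (RtoC 0).
  - rewrite Cmod_0. apply Rmult_le_pos; [lra|apply Rabs_pos].
  - apply injective_projections; simpl; ring.
Qed.

Lemma Rder_vline (x y : R) : Rder (fun t => (x, t)) y Ci.
Proof.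
  intros eps He; exists 1; split; [lra|]; intros s _.
  replace ((x, s) - (x, y) - Ci * RtoC (s - y))%C with (RtoC 0).
  - rewrite Cmod_0. apply Rmult_le_pos; [lra|apply Rabs_pos].
  - apply injective_projections; simpl; ring.
Qed.

Lemma Rcont_hline (f : C -> C) (x y : R) : Ccont f (x, y) -> Rcont (fun t => f (t, y)) x.
Proof. intros H. apply (Rcont_comp f (fun t => (t, y))); auto. eapply Rder_cont, Rder_hline. Qed.

Lemma Rcont_vline (f : C -> C) (x y : R) : Ccont f (x, y) -> Rcont (fun t => f (x, t)) y.
Proof. intros H. apply (Rcont_comp f (fun t => (x, t))); auto. eapply Rder_cont, Rder_vline. Qed.

Lemma is_cint_path (F f : C -> C) (g dg : R -> C) (a b : R) :
  (forall t, Rmin a b <= t <= Rmax a b -> Cder F (g t) (f (g t))) ->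
  (forall t, Rmin a b <= t <= Rmax a b -> Ccont f (g t)) ->
  (forall t, Rmin a b <= t <= Rmax a b -> Rder g t (dg t)) ->
  (forall t, Rmin a b <= t <= Rmax a b -> Rcont dg t) ->
  is_cint (fun t => f (g t) * dg t)%C a b (F (g b) - F (g a)).
Proof.
  intros H1 H2 H3 H4. apply (is_cint_derive (fun t => F (g t))).
  - intros t Ht. apply Rder_comp; auto.
  - intros t Ht. apply Rcont_mult; auto. apply Rcont_comp; auto. eapply Rder_cont; auto.
Qed.

(** * Goursat's lemma and primitives *)

Definition rect_int (f : C -> C) (x1 x2 y1 y2 : R) : C :=
  (cint (fun x => f (x, y1)) x1 x2 + Ci * cint (fun y => f (x2, y)) y1 y2
   - cint (fun x => f (x, y2)) x1 x2 - Ci * cint (fun y => f (x1, y)) y1 y2)%C.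

Definition in_box (x1 x2 y1 y2 : R) (z : C) : Prop := x1 <= fst z <= x2 /\ y1 <= snd z <= y2.

Section BoxIntegrals.
Variables (f : C -> C) (X1 X2 Y1 Y2 : R).
Hypothesis Hc : forall z, in_box X1 X2 Y1 Y2 z -> Ccont f z.

Lemma is_cint_hbox (x x' y : R) : X1 <= x <= X2 -> X1 <= x' <= X2 -> Y1 <= y <= Y2 ->
  is_cint (fun t => f (t, y)) x x' (cint (fun t => f (t, y)) x x').
Proof.
  intros H1 H2 H3. apply ex_cint. intros t Ht. apply Rcont_hline, Hc. split; simpl; auto.
  unfold Rmin, Rmax in Ht. destruct (Rle_dec x x'); lra.
Qed.

Lemma is_cint_vbox (x y y' : R) : X1 <= x <= X2 -> Y1 <= y <= Y2 -> Y1 <= y' <= Y2 ->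
  is_cint (fun t => f (x, t)) y y' (cint (fun t => f (x, t)) y y').
Proof.
  intros H1 H2 H3. apply ex_cint. intros t Ht. apply Rcont_vline, Hc. split; simpl; auto.
  unfold Rmin, Rmax in Ht. destruct (Rle_dec y y'); lra.
Qed.

Lemma cint_hChasles (x x' x'' y : R) :
  X1 <= x <= X2 -> X1 <= x' <= X2 -> X1 <= x'' <= X2 -> Y1 <= y <= Y2 ->
  cint (fun t => f (t, y)) x x'' = (cint (fun t => f (t, y)) x x' + cint (fun t => f (t, y)) x' x'')%C.
Proof. intros. apply cint_unique. eapply is_cint_Chasles; apply is_cint_hbox; auto. Qed.

Lemma cint_vChasles (x y y' y'' : R) :
  X1 <= x <= X2 -> Y1 <= y <= Y2 -> Y1 <= y' <= Y2 -> Y1 <= y'' <= Y2 ->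
  cint (fun t => f (x, t)) y y'' = (cint (fun t => f (x, t)) y y' + cint (fun t => f (x, t)) y' y'')%C.
Proof. intros. apply cint_unique. eapply is_cint_Chasles; apply is_cint_vbox; auto. Qed.

Lemma rect_split_x (x1 x x2 y1 y2 : R) :
  X1 <= x1 <= X2 -> X1 <= x <= X2 -> X1 <= x2 <= X2 -> Y1 <= y1 <= Y2 -> Y1 <= y2 <= Y2 ->
  rect_int f x1 x2 y1 y2 = (rect_int f x1 x y1 y2 + rect_int f x x2 y1 y2)%C.
Proof.
  intros. unfold rect_int.
  rewrite (cint_hChasles x1 x x2 y1), (cint_hChasles x1 x x2 y2) by auto. ring.
Qed.

Lemma rect_split_y (x1 x2 y1 y y2 : R) :
  X1 <= x1 <= X2 -> X1 <= x2 <= X2 -> Y1 <= y1 <= Y2 -> Y1 <= y <= Y2 -> Y1 <= y2 <= Y2 ->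
  rect_int f x1 x2 y1 y2 = (rect_int f x1 x2 y1 y + rect_int f x1 x2 y y2)%C.
Proof.
  intros. unfold rect_int.
  rewrite (cint_vChasles x1 y1 y y2), (cint_vChasles x2 y1 y y2) by auto. ring.
Qed.

Lemma rect_int_norm (x1 x2 y1 y2 M : R) :
  X1 <= x1 -> x1 <= x2 -> x2 <= X2 -> Y1 <= y1 -> y1 <= y2 -> y2 <= Y2 ->
  (forall z, in_box x1 x2 y1 y2 z -> Cmod (f z) <= M) ->
  Cmod (rect_int f x1 x2 y1 y2) <= 2 * (x2 - x1 + (y2 - y1)) * M.
Proof.
  intros H1 H2 H3 H4 H5 H6 HM. unfold rect_int.
  assert (A : forall y, y1 <= y <= y2 -> Cmod (cint (fun t => f (t, y)) x1 x2) <= (x2 - x1) * M).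
  { intros y Hy. apply (is_cint_norm (fun t => f (t, y))); auto.
    - intros t Ht. apply HM. split; simpl; lra.
    - apply is_cint_hbox; lra. }
  assert (B : forall x, x1 <= x <= x2 -> Cmod (cint (fun t => f (x, t)) y1 y2) <= (y2 - y1) * M).
  { intros x Hx. apply (is_cint_norm (fun t => f (x, t))); auto.
    - intros t Ht. apply HM. split; simpl; lra.
    - apply is_cint_vbox; lra. }
  unfold Cminus.
  eapply Rle_trans; [apply Cmod_triangle|].
  eapply Rle_trans; [apply Rplus_le_compat_r, Cmod_triangle|].
  eapply Rle_trans; [apply Rplus_le_compat_r, Rplus_le_compat_r, Cmod_triangle|].
  rewrite !Cmod_opp, !Cmod_mult, Cmod_Ci.
  pose proof (A y1). pose proof (A y2). pose proof (B x1). pose proof (B x2). lra.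
Qed.
End BoxIntegrals.

Lemma rect_int_primitive (F f : C -> C) (x1 x2 y1 y2 : R) :
  x1 <= x2 -> y1 <= y2 ->
  (forall z, in_box x1 x2 y1 y2 z -> Cder F z (f z)) ->
  (forall z, in_box x1 x2 y1 y2 z -> Ccont f z) ->
  rect_int f x1 x2 y1 y2 = 0.
Proof.
  intros Hx Hy HF Hf.
  assert (A : forall y, y1 <= y <= y2 -> cint (fun t => f (t, y)) x1 x2 = (F (x2, y) - F (x1, y))%C).
  { intros y Hyy. apply cint_unique. eapply is_cint_ext;
      [|apply (is_cint_path F f (fun t => (t, y)) (fun _ => 1%C))].
    - intros; cbv beta; ring.
    - intros t Ht. rewrite Rmin_left, Rmax_right in Ht by auto. apply HF; split; simpl; lra.
    - intros t Ht. rewrite Rmin_left, Rmax_right in Ht by auto. apply Hf; split; simpl; lra.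
    - intros; apply Rder_hline.
    - intros; apply Rcont_const. }
  assert (B : forall x, x1 <= x <= x2 -> (Ci * cint (fun t => f (x, t)) y1 y2 = F (x, y2) - F (x, y1))%C).
  { intros x Hxx.
    assert (E : is_cint (fun t => f (x, t) * Ci)%C y1 y2 (F (x, y2) - F (x, y1))).
    { apply (is_cint_path F f (fun t => (x, t)) (fun _ => Ci)).
      - intros t Ht. rewrite Rmin_left, Rmax_right in Ht by auto. apply HF; split; simpl; lra.
      - intros t Ht. rewrite Rmin_left, Rmax_right in Ht by auto. apply Hf; split; simpl; lra.
      - intros; apply Rder_vline.
      - intros; apply Rcont_const. }
    assert (E2 : is_cint (fun t => f (x, t) * Ci)%C y1 y2 (cint (fun t => f (x, t)) y1 y2 * Ci)).
    { apply is_cint_scal_r. apply (is_cint_vbox f x1 x2 y1 y2 Hf); lra. }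
    rewrite <- (is_cint_uniq _ _ _ _ _ E2 E). ring. }
  unfold rect_int. rewrite (A y1), (A y2), (B x1), (B x2) by lra. ring.
Qed.

Lemma rect_int_minus (f g : C -> C) (x1 x2 y1 y2 : R) :
  x1 <= x2 -> y1 <= y2 ->
  (forall z, in_box x1 x2 y1 y2 z -> Ccont f z) ->
  (forall z, in_box x1 x2 y1 y2 z -> Ccont g z) ->
  rect_int (fun z => f z - g z)%C x1 x2 y1 y2 = (rect_int f x1 x2 y1 y2 - rect_int g x1 x2 y1 y2)%C.
Proof.
  intros Hx Hy Hf Hg. unfold rect_int.
  assert (A : forall y, y1 <= y <= y2 -> cint (fun x => f (x, y) - g (x, y))%C x1 x2 =
    (cint (fun x => f (x, y)) x1 x2 - cint (fun x => g (x, y)) x1 x2)%C).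
  { intros y H. apply cint_unique, is_cint_minus;
      [apply (is_cint_hbox f x1 x2 y1 y2 Hf)|apply (is_cint_hbox g x1 x2 y1 y2 Hg)]; lra. }
  assert (B : forall x, x1 <= x <= x2 -> cint (fun y => f (x, y) - g (x, y))%C y1 y2 =
    (cint (fun y => f (x, y)) y1 y2 - cint (fun y => g (x, y)) y1 y2)%C).
  { intros y H. apply cint_unique, is_cint_minus;
      [apply (is_cint_vbox f x1 x2 y1 y2 Hf)|apply (is_cint_vbox g x1 x2 y1 y2 Hg)]; lra. }
  rewrite !A, !B by lra. ring.
Qed.

Section Goursat.
Variables (f : C -> C) (eps : R).
Hypothesis Heps : 0 < eps.

Definition box : Type := ((R * R) * (R * R))%type.
Definition bx1 (b : box) := fst (fst b).
Definition bx2 (b : box) := snd (fst b).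
Definition by1 (b : box) := fst (snd b).
Definition by2 (b : box) := snd (snd b).
Definition bsize (b : box) := bx2 b - bx1 b + (by2 b - by1 b).
Definition bgood (b : box) : Prop :=
  Cmod (rect_int f (bx1 b) (bx2 b) (by1 b) (by2 b)) <= 2 * eps * (bsize b * bsize b).

Definition q1 (b : box) : box :=
  ((bx1 b, (bx1 b + bx2 b) / 2), (by1 b, (by1 b + by2 b) / 2)).
Definition q2 (b : box) : box :=
  (((bx1 b + bx2 b) / 2, bx2 b), (by1 b, (by1 b + by2 b) / 2)).
Definition q3 (b : box) : box :=
  ((bx1 b, (bx1 b + bx2 b) / 2), ((by1 b + by2 b) / 2, by2 b)).
Definition q4 (b : box) : box :=
  (((bx1 b + bx2 b) / 2, bx2 b), ((by1 b + by2 b) / 2, by2 b)).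

Definition bnext (b : box) : box :=
  if excluded_middle_informative (bgood (q1 b)) then
  if excluded_middle_informative (bgood (q2 b)) then
  if excluded_middle_informative (bgood (q3 b)) then q4 b else q3 b else q2 b else q1 b.

Definition bwf (b : box) : Prop := bx1 b <= bx2 b /\ by1 b <= by2 b.

Lemma bnext_cases (b : box) (Q : box -> Prop) :
  Q (q1 b) -> Q (q2 b) -> Q (q3 b) -> Q (q4 b) -> Q (bnext b).
Proof. unfold bnext. repeat destruct excluded_middle_informative; auto. Qed.

Lemma bnext_spec (b : box) : bwf b ->
  bwf (bnext b) /\ bx1 b <= bx1 (bnext b) /\ bx2 (bnext b) <= bx2 b
  /\ by1 b <= by1 (bnext b) /\ by2 (bnext b) <= by2 b /\ bsize (bnext b) = bsize b / 2.
Proof.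
  intros [H1 H2]. apply bnext_cases; unfold bwf, bsize, q1, q2, q3, q4, bx1, bx2, by1, by2 in *;
    simpl; repeat split; lra.
Qed.

Lemma bnext_bad (b : box) : bwf b ->
  (forall z, in_box (bx1 b) (bx2 b) (by1 b) (by2 b) z -> Ccont f z) ->
  ~ bgood b -> ~ bgood (bnext b).
Proof.
  intros [W1 W2] Hc Hb. unfold bnext.
  destruct excluded_middle_informative as [g1|]; auto.
  destruct excluded_middle_informative as [g2|]; auto.
  destruct excluded_middle_informative as [g3|]; auto.
  intros g4. apply Hb. unfold bgood in *.
  assert (S1 : forall q, q = q1 \/ q = q2 \/ q = q3 \/ q = q4 -> bsize (q b) = bsize b / 2).
  { unfold bsize, bx1, bx2, by1, by2, q1, q2, q3, q4.
    intros q [ ->|[ ->|[ ->| ->]]]; unfold bx1, bx2, by1, by2; simpl; lra. }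
  rewrite S1 in g1, g2, g3, g4 by tauto. clear S1.
  set (xm := (bx1 b + bx2 b) / 2). set (ym := (by1 b + by2 b) / 2).
  assert (Hxm : bx1 b <= xm <= bx2 b) by (unfold xm; lra).
  assert (Hym : by1 b <= ym <= by2 b) by (unfold ym; lra).
  rewrite (rect_split_x f _ _ _ _ Hc (bx1 b) xm (bx2 b)) by lra.
  rewrite (rect_split_y f _ _ _ _ Hc (bx1 b) xm (by1 b) ym (by2 b)) by lra.
  rewrite (rect_split_y f _ _ _ _ Hc xm (bx2 b) (by1 b) ym (by2 b)) by lra.
  unfold q1, q2, q3, q4, bx1, bx2, by1, by2 in g1, g2, g3, g4; simpl in g1, g2, g3, g4.
  fold (bx1 b) (bx2 b) (by1 b) (by2 b) in g1, g2, g3, g4. fold xm ym in g1, g2, g3, g4.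
  eapply Rle_trans; [apply Cmod_triangle|].
  eapply Rle_trans; [apply Rplus_le_compat; apply Cmod_triangle|].
  lra.
Qed.

Fixpoint bseq (b : box) (n : nat) : box :=
  match n with O => b | S m => bnext (bseq b m) end.

Lemma bseq_spec (b : box) (n : nat) : bwf b ->
  bwf (bseq b n) /\ bx1 b <= bx1 (bseq b n) /\ bx2 (bseq b n) <= bx2 b
  /\ by1 b <= by1 (bseq b n) /\ by2 (bseq b n) <= by2 b
  /\ bsize (bseq b n) = bsize b / 2 ^ n.
Proof.
  intros W. induction n.
  - simpl. repeat split; try apply W; try lra.
  - destruct IHn as [W' [A1 [A2 [A3 [A4 A5]]]]].
    destruct (bnext_spec _ W') as [W'' [B1 [B2 [B3 [B4 B5]]]]].
    simpl. split; [auto|]. repeat split; try lra. rewrite B5, A5.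
    field. apply pow_nonzero. lra.
Qed.

Lemma bseq_nested (b : box) (n m : nat) : bwf b ->
  bx1 (bseq b n) <= bx1 (bseq b (n + m)) /\ bx2 (bseq b (n + m)) <= bx2 (bseq b n)
  /\ by1 (bseq b n) <= by1 (bseq b (n + m)) /\ by2 (bseq b (n + m)) <= by2 (bseq b n).
Proof.
  intros W. induction m.
  - rewrite Nat.add_0_r. lra.
  - rewrite Nat.add_succ_r. simpl.
    destruct (bnext_spec (bseq b (n + m))) as [_ [B1 [B2 [B3 [B4 _]]]]];
      [now apply bseq_spec|]. lra.
Qed.

Lemma bseq_point (b : box) : bwf b ->
  exists z, forall n, in_box (bx1 (bseq b n)) (bx2 (bseq b n)) (by1 (bseq b n)) (by2 (bseq b n)) z.
Proof.
  intros W.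
  assert (L : forall lo hi : nat -> R,
    (forall n m, lo n <= lo (n + m)%nat /\ hi (n + m)%nat <= hi n) -> (forall n, lo n <= hi n) ->
    exists x, forall n, lo n <= x <= hi n).
  { intros lo hi H1 H2.
    assert (H3 : forall n m, lo n <= hi m).
    { intros n m. pose proof (H1 n m). pose proof (H1 m n). pose proof (H2 (n + m)%nat).
      rewrite (Nat.add_comm m n) in H0. lra. }
    destruct (completeness (fun x => exists n, x = lo n)) as [x [U1 U2]].
    - exists (hi O). intros x [n ->]. apply H3.
    - exists (lo O). now exists O.
    - exists x. intros n. split; [apply U1; now exists n|].
      apply U2. intros y [m ->]. apply H3. }
  destruct (L (fun n => bx1 (bseq b n)) (fun n => bx2 (bseq b n))) as [x Hx].
  { intros n m. pose proof (bseq_nested b n m W). lra. }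
  { intros n. apply (proj1 (bseq_spec b n W)). }
  destruct (L (fun n => by1 (bseq b n)) (fun n => by2 (bseq b n))) as [y Hy].
  { intros n m. pose proof (bseq_nested b n m W). lra. }
  { intros n. apply (proj1 (bseq_spec b n W)). }
  exists (x, y). intros n. split; simpl; auto.
Qed.

Lemma bgood_small (b : box) (z l : C) (d : R) : bwf b ->
  in_box (bx1 b) (bx2 b) (by1 b) (by2 b) z ->
  (forall w, in_box (bx1 b) (bx2 b) (by1 b) (by2 b) w -> Ccont f w) ->
  (forall w, Cmod (w - z) < d -> Cmod (f w - f z - l * (w - z)) <= eps * Cmod (w - z)) ->
  bsize b < d -> bgood b.
Proof.
  intros [W1 W2] Hz Hc Hd Hs. unfold bgood.
  set (g := fun w => (f z + l * (w - z))%C).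
  assert (Hg : forall w, Cder (fun w => f z * w + l * / 2 * ((w - z) * (w - z)))%C w (g w)).
  { intros w. eapply eq_rect; [apply Cder_plus|].
    - apply Cder_mult; [apply Cder_const|apply Cder_id].
    - apply Cder_mult; [apply Cder_const|].
      apply (Cder_mult (fun w => w - z)%C (fun w => w - z)%C);
        apply (Cder_plus (fun w => w) (fun _ => - z)%C); try apply Cder_id; apply Cder_const.
    - unfold g. field. }
  assert (Gc : forall w, Ccont g w).
  { intros w. unfold g. apply Ccont_plus; [apply Ccont_const|].
    apply Ccont_mult; [apply Ccont_const|].
    apply Ccont_plus; [apply Ccont_id|apply Ccont_const]. }
  assert (E : rect_int f (bx1 b) (bx2 b) (by1 b) (by2 b)
    = rect_int (fun w => f w - g w)%C (bx1 b) (bx2 b) (by1 b) (by2 b)).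
  { rewrite rect_int_minus by auto.
    rewrite (rect_int_primitive _ g _ _ _ _ W1 W2 (fun w _ => Hg w) (fun w _ => Gc w)). ring. }
  rewrite E.
  replace (2 * eps * (bsize b * bsize b)) with (2 * bsize b * (eps * bsize b)) by ring.
  apply (rect_int_norm _ (bx1 b) (bx2 b) (by1 b) (by2 b)); try lra.
  - intros w Hw. apply Ccont_plus; auto.
    apply (Ccont_ext_near (fun w => (- (1)) * g w)%C).
    + exists 1; split; [lra|]; intros; ring.
    + apply Ccont_mult; auto. apply Ccont_const.
  - intros w Hw.
    assert (Hwz : Cmod (w - z) <= bsize b).
    { eapply Rle_trans; [apply Cmod_ReIm|]. unfold bsize.
      destruct Hz as [[? ?] [? ?]]. destruct Hw as [[? ?] [? ?]]. simpl.
      apply Rplus_le_compat; apply Rabs_le; lra. }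
    unfold g. replace (f w - (f z + l * (w - z)))%C with (f w - f z - l * (w - z))%C by ring.
    eapply Rle_trans; [apply Hd; lra|]. apply Rmult_le_compat_l; lra.
Qed.

Lemma goursat_bound (b : box) : bwf b ->
  (forall z, in_box (bx1 b) (bx2 b) (by1 b) (by2 b) z -> hol f z) -> bgood b.
Proof.
  intros W Hh. destruct (excluded_middle_informative (bgood b)) as [|Hb]; auto. exfalso.
  destruct (bseq_point b W) as [z Hz].
  destruct (Hh z (Hz O)) as [l Hl]. destruct (Hl eps Heps) as [d [Hd K]].
  assert (Hn : exists n, bsize b / 2 ^ n < d).
  { destruct (pow_lt_1_zero (/2)) with (y := d / (1 + bsize b)) as [n Hn].
    - rewrite Rabs_pos_eq; lra.
    - apply Rdiv_lt_0_compat; auto. unfold bsize. destruct W; lra.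
    - assert (P : 0 <= bsize b) by (unfold bsize; destruct W; lra).
      exists n. specialize (Hn n (le_n n)).
      rewrite pow_inv, Rabs_pos_eq in Hn
        by (apply Rlt_le, Rinv_0_lt_compat, pow_lt; lra).
      apply Rle_lt_trans with ((1 + bsize b) * / 2 ^ n).
      + unfold Rdiv. apply Rmult_le_compat_r; [apply Rlt_le, Rinv_0_lt_compat, pow_lt; lra|lra].
      + apply Rmult_lt_compat_l with (r := 1 + bsize b) in Hn; [|lra].
        replace ((1 + bsize b) * (d / (1 + bsize b))) with d in Hn by (field; lra). exact Hn. }
  destruct Hn as [n Hn].
  assert (Hin : forall m w, in_box (bx1 (bseq b m)) (bx2 (bseq b m)) (by1 (bseq b m)) (by2 (bseq b m)) w ->
     Ccont f w).
  { intros m w [Hw1 Hw2]. apply hol_cont, Hh.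
    destruct (bseq_spec b m W) as [_ [B1 [B2 [B3 [B4 _]]]]]. split; lra. }
  assert (Hbad : forall m, ~ bgood (bseq b m)).
  { induction m; auto. simpl. apply bnext_bad; [now apply bseq_spec|apply Hin|auto]. }
  apply (Hbad n). apply (bgood_small _ z l d); auto.
  - now apply bseq_spec.
  - apply Hin.
  - destruct (bseq_spec b n W) as [_ [_ [_ [_ [_ E]]]]]. rewrite E. exact Hn.
Qed.
End Goursat.

Lemma Cmod_small_0 (v : C) (K : R) :
  (forall eps, 0 < eps -> Cmod v <= eps * K) -> v = 0.
Proof.
  intros H. apply Cmod_eq_0. pose proof (Cmod_ge_0 v) as P.
  destruct (Rle_lt_dec (Cmod v) 0); [lra|]. exfalso.
  pose proof (Rabs_pos K). pose proof (Rle_abs K).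
  specialize (H (Cmod v / (2 * (1 + Rabs K)))).
  assert (0 < Cmod v / (2 * (1 + Rabs K))) by (apply Rdiv_lt_0_compat; lra).
  specialize (H H2).
  assert (Cmod v / (2 * (1 + Rabs K)) * K <= Cmod v / (2 * (1 + Rabs K)) * (1 + Rabs K))
    by (apply Rmult_le_compat_l; lra).
  replace (Cmod v / (2 * (1 + Rabs K)) * (1 + Rabs K)) with (Cmod v / 2) in H3 by (field; lra).
  lra.
Qed.

Lemma goursat (f : C -> C) (x1 x2 y1 y2 : R) : x1 <= x2 -> y1 <= y2 ->
  (forall z, in_box x1 x2 y1 y2 z -> hol f z) -> rect_int f x1 x2 y1 y2 = 0.
Proof.
  intros Hx Hy Hh. set (b := ((x1, x2), (y1, y2)) : box).
  apply Cmod_small_0 with (2 * (bsize b * bsize b)). intros eps He.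
  pose proof (goursat_bound f eps He b (conj Hx Hy) Hh) as H. unfold bgood in H.
  unfold bx1, bx2, by1, by2 in H; simpl in H. lra.
Qed.

Lemma goursat_except (f : C -> C) (p : C) (x1 x2 y1 y2 : R) : x1 <= x2 -> y1 <= y2 ->
  (forall z, in_box x1 x2 y1 y2 z -> Ccont f z) ->
  (forall z, in_box x1 x2 y1 y2 z -> z <> p -> hol f z) -> rect_int f x1 x2 y1 y2 = 0.
Proof.
  intros Hx Hy Hc Hh.
  destruct (excluded_middle_informative (in_box x1 x2 y1 y2 p)) as [Hp|Hp].
  2: { apply goursat; auto. intros z Hz. apply Hh; auto. intros ->; auto. }
  destruct Hp as [Hp1 Hp2].
  destruct (Hc p (conj Hp1 Hp2) 1) as [d0 [Hd0 K0]]; [lra|].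
  set (M := Cmod (f p) + 1).
  apply Cmod_small_0 with (8 * M). intros eps He.
  set (d := Rmin (d0 / 4) eps).
  assert (Hd : 0 < d) by (apply Rmin_glb_lt; lra).
  assert (Hdd : d <= d0 / 4) by apply Rmin_l. assert (Hde : d <= eps) by apply Rmin_r.
  set (xa := Rmax x1 (fst p - d)). set (xb := Rmin x2 (fst p + d)).
  set (ya := Rmax y1 (snd p - d)). set (yb := Rmin y2 (snd p + d)).
  assert (Hxa : x1 <= xa <= fst p /\ fst p - d <= xa /\ (xa = x1 \/ xa = fst p - d)).
  { unfold xa, Rmax. destruct Rle_dec; lra. }
  assert (Hxb : fst p <= xb <= x2 /\ xb <= fst p + d /\ (xb = x2 \/ xb = fst p + d)).
  { unfold xb. clearbody d; unfold Rmin; destruct Rle_dec; lra. }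
  assert (Hya : y1 <= ya <= snd p /\ snd p - d <= ya /\ (ya = y1 \/ ya = snd p - d)).
  { unfold ya, Rmax. destruct Rle_dec; lra. }
  assert (Hyb : snd p <= yb <= y2 /\ yb <= snd p + d /\ (yb = y2 \/ yb = snd p + d)).
  { unfold yb. clearbody d; unfold Rmin; destruct Rle_dec; lra. }
  clearbody xa xb ya yb d.
  destruct Hxa as [Hxa [Hxa' Cxa]]. destruct Hxb as [Hxb [Hxb' Cxb]].
  destruct Hya as [Hya [Hya' Cya]]. destruct Hyb as [Hyb [Hyb' Cyb]].
  (* outside the small box either the sides degenerate or the box avoids p *)
  assert (D1 : forall x y y', rect_int f x x y y' = 0).
  { intros. unfold rect_int. rewrite !(cint_unique _ _ _ _ (is_cint_point _ x)). ring. }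
  assert (D2 : forall x x' y, rect_int f x x' y y = 0).
  { intros. unfold rect_int. rewrite !(cint_unique _ _ _ _ (is_cint_point _ y)). ring. }
  assert (Z1 : rect_int f x1 xa y1 y2 = 0).
  { destruct Cxa as [->|E]; [apply D1|]. apply goursat; try lra.
    intros z [A B]. apply Hh; [split; lra|]. intros ->; lra. }
  assert (Z2 : rect_int f xb x2 y1 y2 = 0).
  { destruct Cxb as [->|E]; [apply D1|]. apply goursat; try lra.
    intros z [A B]. apply Hh; [split; lra|]. intros ->; lra. }
  assert (Z3 : rect_int f xa xb y1 ya = 0).
  { destruct Cya as [->|E]; [apply D2|]. apply goursat; try lra.
    intros z [A B]. apply Hh; [split; lra|]. intros ->; lra. }
  assert (Z4 : rect_int f xa xb yb y2 = 0).
  { destruct Cyb as [->|E]; [apply D2|]. apply goursat; try lra.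
    intros z [A B]. apply Hh; [split; lra|]. intros ->; lra. }
  rewrite (rect_split_x f _ _ _ _ Hc x1 xa x2), (rect_split_x f _ _ _ _ Hc xa xb x2),
    (rect_split_y f _ _ _ _ Hc xa xb y1 ya y2), (rect_split_y f _ _ _ _ Hc xa xb ya yb y2) by lra.
  rewrite Z1, Z2, Z3, Z4.
  replace (0 + (0 + (rect_int f xa xb ya yb + 0) + 0))%C with (rect_int f xa xb ya yb) by ring.
  assert (HM : Cmod (rect_int f xa xb ya yb) <= 2 * (xb - xa + (yb - ya)) * M).
  { apply (rect_int_norm f x1 x2 y1 y2 Hc); try lra. intros z [A B].
    pose proof (Cmod_le_plus (f z) (f p)). unfold M.
    assert (Cmod (f z - f p) < 1); [|lra]. apply K0.
    eapply Rle_lt_trans; [apply Cmod_ReIm|]. simpl.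
    assert (Rabs (fst z + - fst p) <= d) by (apply Rabs_le; lra).
    assert (Rabs (snd z + - snd p) <= d) by (apply Rabs_le; lra). lra. }
  assert (0 <= M) by (unfold M; pose proof (Cmod_ge_0 (f p)); lra).
  eapply Rle_trans; [exact HM|]. 
  replace (eps * (8 * M)) with (8 * eps * M) by ring. apply Rmult_le_compat_r; auto. lra.
Qed.

Section RectSwap.
Variables (f : C -> C) (X1 X2 Y1 Y2 : R).
Hypothesis Hc : forall z, in_box X1 X2 Y1 Y2 z -> Ccont f z.
Variables (x1 x2 y1 y2 : R).
Hypotheses (Hx1 : X1 <= x1 <= X2) (Hx2 : X1 <= x2 <= X2) (Hy1 : Y1 <= y1 <= Y2) (Hy2 : Y1 <= y2 <= Y2).

Lemma rect_int_swap_x : rect_int f x2 x1 y1 y2 = (- rect_int f x1 x2 y1 y2)%C.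
Proof.
  unfold rect_int.
  rewrite (cint_unique _ x2 x1 _ (is_cint_swap _ _ _ _ (is_cint_hbox f X1 X2 Y1 Y2 Hc x1 x2 y1 Hx1 Hx2 Hy1))).
  rewrite (cint_unique _ x2 x1 _ (is_cint_swap _ _ _ _ (is_cint_hbox f X1 X2 Y1 Y2 Hc x1 x2 y2 Hx1 Hx2 Hy2))).
  ring.
Qed.

Lemma rect_int_swap_y : rect_int f x1 x2 y2 y1 = (- rect_int f x1 x2 y1 y2)%C.
Proof.
  unfold rect_int.
  rewrite (cint_unique _ y2 y1 _ (is_cint_swap _ _ _ _ (is_cint_vbox f X1 X2 Y1 Y2 Hc x1 y1 y2 Hx1 Hy1 Hy2))).
  rewrite (cint_unique _ y2 y1 _ (is_cint_swap _ _ _ _ (is_cint_vbox f X1 X2 Y1 Y2 Hc x2 y1 y2 Hx2 Hy1 Hy2))).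
  ring.
Qed.
End RectSwap.

Lemma goursat_unordered (f : C -> C) (p : C) (x1 x2 y1 y2 : R) :
  (forall z, in_box (Rmin x1 x2) (Rmax x1 x2) (Rmin y1 y2) (Rmax y1 y2) z -> Ccont f z) ->
  (forall z, in_box (Rmin x1 x2) (Rmax x1 x2) (Rmin y1 y2) (Rmax y1 y2) z -> z <> p -> hol f z) ->
  rect_int f x1 x2 y1 y2 = 0.
Proof.
  intros Hc Hh. destruct (Rle_dec x1 x2) as [Lx|Lx]; destruct (Rle_dec y1 y2) as [Ly|Ly].
  - rewrite (Rmin_left x1), (Rmax_right x1), (Rmin_left y1), (Rmax_right y1) in * by lra.
    now apply (goursat_except f p).
  - rewrite (Rmin_left x1), (Rmax_right x1), (Rmin_right y1), (Rmax_left y1) in * by lra.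
    rewrite (rect_int_swap_y f _ _ _ _ Hc), (goursat_except f p) by (auto; lra). ring.
  - rewrite (Rmin_right x1), (Rmax_left x1), (Rmin_left y1), (Rmax_right y1) in * by lra.
    rewrite (rect_int_swap_x f _ _ _ _ Hc), (goursat_except f p) by (auto; lra). ring.
  - rewrite (Rmin_right x1), (Rmax_left x1), (Rmin_right y1), (Rmax_left y1) in * by lra.
    rewrite (rect_int_swap_y f _ _ _ _ Hc), (rect_int_swap_x f _ _ _ _ Hc), (goursat_except f p)
      by (auto; lra). ring.
Qed.

Lemma primitive_disc (f : C -> C) (p : C) (rho : R) :
  (forall z, Cmod z < rho -> Ccont f z) ->
  (forall z, Cmod z < rho -> z <> p -> hol f z) ->
  exists F, forall z, Cmod z < rho -> Cder F z (f z).
Proof.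
  intros Hc Hh.
  assert (Hull : forall x y x' y', Cmod (x, y) < rho -> Rabs x' <= Rabs x -> Rabs y' <= Rabs y ->
     Cmod (x', y') < rho).
  { intros x y x' y' H H1 H2. eapply Rle_lt_trans; [|exact H]. unfold Cmod; cbn [fst snd].
    apply sqrt_le_1_alt. rewrite <- (pow2_abs x), <- (pow2_abs y), <- (pow2_abs x'), <- (pow2_abs y').
    pose proof (Rabs_pos x'). pose proof (Rabs_pos y'). nra. }
  assert (Bt : forall x t, Rmin 0 x <= t <= Rmax 0 x -> Rabs t <= Rabs x).
  { intros x t. unfold Rmin, Rmax. destruct Rle_dec; intros; unfold Rabs;
      repeat destruct Rcase_abs; lra. }
  set (F := fun z : C => (cint (fun t => f (t, 0)) 0 (fst z)
                          + Ci * cint (fun s => f (fst z, s)) 0 (snd z))%C).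
  exists F. intros [x y] Hz eps He.
  destruct (Hc (x, y) Hz (eps / 2)) as [d1 [Hd1 K1]]; [lra|].
  set (d := Rmin (d1 / 2) ((rho - Cmod (x, y)) / 2)).
  assert (Hd : 0 < d) by (apply Rmin_glb_lt; lra).
  assert (Hda : d <= d1 / 2) by apply Rmin_l.
  assert (Hdb : d <= (rho - Cmod (x, y)) / 2) by apply Rmin_r.
  exists d; split; auto. intros [x' y'] Hw.
  assert (Hx : Rabs (x' - x) < d) by (eapply Rle_lt_trans; [apply (Re_le_Cmod ((x', y') - (x, y)))|auto]).
  assert (Hy : Rabs (y' - y) < d) by (eapply Rle_lt_trans; [apply (Im_le_Cmod ((x', y') - (x, y)))|auto]).
  assert (Near : forall t s, Rmin x x' <= t <= Rmax x x' -> Rmin y y' <= s <= Rmax y y' ->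
     Cmod ((t, s) - (x, y)) < d1 /\ Cmod (t, s) < rho).
  { intros t s Ht Hs.
    assert (Rabs (t - x) < d /\ Rabs (s - y) < d).
    { apply Rabs_def2 in Hx. apply Rabs_def2 in Hy. unfold Rmin, Rmax in Ht, Hs.
      split; apply Rabs_def1; destruct (Rle_dec x x'); destruct (Rle_dec y y'); lra. }
    assert (Cmod ((t, s) - (x, y)) <= Rabs (t - x) + Rabs (s - y)) by (apply (Cmod_ReIm ((t, s) - (x, y)))).
    pose proof (Cmod_le_plus (t, s) (x, y)). lra. }
  assert (Lx : Rmin x x' <= x <= Rmax x x') by (split; [apply Rmin_l|apply Rmax_l]).
  assert (Lx' : Rmin x x' <= x' <= Rmax x x') by (split; [apply Rmin_r|apply Rmax_r]).
  assert (Ly : Rmin y y' <= y <= Rmax y y') by (split; [apply Rmin_l|apply Rmax_l]).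
  assert (Ly' : Rmin y y' <= y' <= Rmax y y') by (split; [apply Rmin_r|apply Rmax_r]).
  assert (Box0 : rect_int f x x' 0 y = 0).
  { apply (goursat_unordered f p); intros [t s] [Ht Hs]; simpl in Ht, Hs; [apply Hc|apply Hh];
      apply (Hull t y); try apply (Near t y); auto; lra. }
  assert (I1 : forall a b, (forall t, Rmin a b <= t <= Rmax a b -> Cmod (t, 0) < rho) ->
     is_cint (fun t => f (t, 0)) a b (cint (fun t => f (t, 0)) a b)).
  { intros a b H. apply ex_cint. intros t Ht. apply Rcont_hline; auto. }
  assert (I2 : forall u a b, (forall t, Rmin a b <= t <= Rmax a b -> Cmod (u, t) < rho) ->
     is_cint (fun t => f (u, t)) a b (cint (fun t => f (u, t)) a b)).
  { intros u a b H. apply ex_cint. intros t Ht. apply Rcont_vline; auto. }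
  assert (E1 : cint (fun t => f (t, 0)) 0 x' = (cint (fun t => f (t, 0)) 0 x + cint (fun t => f (t, 0)) x x')%C).
  { apply cint_unique, is_cint_Chasles with x; apply I1; intros t Ht.
    - apply (Hull x y); auto. rewrite Rabs_R0. apply Rabs_pos.
    - apply (Hull t y); try apply (Near t y); auto; [lra|]. rewrite Rabs_R0. apply Rabs_pos. }
  assert (E2 : cint (fun s => f (x', s)) 0 y' = (cint (fun s => f (x', s)) 0 y + cint (fun s => f (x', s)) y y')%C).
  { apply cint_unique, is_cint_Chasles with y; apply I2; intros t Ht.
    - apply (Hull x' y); try apply (Near x' y); auto; lra.
    - apply (Near x' t); auto. }
  assert (D : (F (x', y') - F (x, y) - f (x, y) * ((x', y') - (x, y)) =
     cint (fun t => f (t, y) - f (x, y))%C x x' + Ci * cint (fun s => f (x', s) - f (x, y))%C y y')%C).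
  { assert (J1 : cint (fun t => f (t, y) - f (x, y))%C x x'
       = (cint (fun t => f (t, y)) x x' - RtoC (x' - x) * f (x, y))%C).
    { apply cint_unique, is_cint_minus; [|apply is_cint_const].
      apply ex_cint. intros t Ht. apply Rcont_hline, Hc. apply (Near t y); auto. }
    assert (J2 : cint (fun s => f (x', s) - f (x, y))%C y y'
       = (cint (fun s => f (x', s)) y y' - RtoC (y' - y) * f (x, y))%C).
    { apply cint_unique, is_cint_minus; [|apply is_cint_const].
      apply I2. intros t Ht. apply (Near x' t); auto. }
    rewrite J1, J2. unfold F; simpl fst; simpl snd. rewrite E1, E2.
    unfold rect_int in Box0.
    replace ((x', y') - (x, y))%C with (RtoC (x' - x) + Ci * RtoC (y' - y))%C
      by (apply injective_projections; simpl; ring).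
    match type of Box0 with (?A + ?B - ?A' - ?B' = _)%C =>
      assert (EE : (A' = A + B - B')%C) by (transitivity (A' + (A + B - A' - B'))%C; [rewrite Box0|]; ring) end.
    rewrite EE. ring. }
  rewrite D.
  assert (N1 : Cmod (cint (fun t => f (t, y) - f (x, y))%C x x') <= Rabs (x' - x) * (eps / 2)).
  { apply (is_cint_norm_abs (fun t => f (t, y) - f (x, y))%C).
    - intros t Ht. apply Rlt_le, K1. apply (Near t y); auto.
    - apply ex_cint. intros t Ht. apply (Rcont_plus (fun t => f (t, y)) (fun _ => - f (x, y))%C); [|apply Rcont_const].
      apply Rcont_hline, Hc. apply (Near t y); auto. }
  assert (N2 : Cmod (cint (fun s => f (x', s) - f (x, y))%C y y') <= Rabs (y' - y) * (eps / 2)).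
  { apply (is_cint_norm_abs (fun s => f (x', s) - f (x, y))%C).
    - intros t Ht. apply Rlt_le, K1. apply (Near x' t); auto.
    - apply ex_cint. intros t Ht. apply (Rcont_plus (fun t => f (x', t)) (fun _ => - f (x, y))%C); [|apply Rcont_const].
      apply Rcont_vline, Hc. apply (Near x' t); auto. }
  eapply Rle_trans; [apply Cmod_triangle|]. rewrite Cmod_mult, Cmod_Ci.
  pose proof (Re_le_Cmod ((x', y') - (x, y))). pose proof (Im_le_Cmod ((x', y') - (x, y))).
  simpl in H, H0. unfold Rminus in *. nra.
Qed.

(** * Cauchy's theorem and formula for circles *)

Lemma Cmod_circ (r th : R) : 0 <= r -> Cmod (circ r th) = r.
Proof.
  intros H. unfold Cmod, circ; simpl.
  replace (r * cos th * (r * cos th * 1) + r * sin th * (r * sin th * 1))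
    with (r * r * (Rsqr (sin th) + Rsqr (cos th))) by (unfold Rsqr; ring).
  rewrite sin2_cos2, Rmult_1_r. now apply sqrt_square.
Qed.

Lemma Rder_pair (f g : R -> R) (t a b : R) :
  is_derive f t a -> is_derive g t b -> Rder (fun s => (f s, g s)) t (a, b).
Proof.
  intros Hf Hg eps He.
  apply is_derive_Reals in Hf. apply is_derive_Reals in Hg.
  destruct (Hf (eps/2)) as [d1 K1]; [lra|]. destruct (Hg (eps/2)) as [d2 K2]; [lra|].
  exists (Rmin d1 d2). split; [apply Rmin_glb_lt; apply cond_pos|]. intros s Hs.
  assert (H1 : Rabs (s - t) < d1) by (eapply Rlt_le_trans; [exact Hs|apply Rmin_l]).
  assert (H2 : Rabs (s - t) < d2) by (eapply Rlt_le_trans; [exact Hs|apply Rmin_r]).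
  destruct (Req_dec (s - t) 0) as [E|E].
  { replace s with t by lra.
    replace ((f t, g t) - (f t, g t) - (a, b) * RtoC (t - t))%C with (RtoC 0)
      by (apply injective_projections; simpl; ring).
    rewrite Cmod_0. apply Rmult_le_pos; [lra|apply Rabs_pos]. }
  assert (Q : forall (k : R -> R) c, Rabs ((k (t + (s - t)) - k t) / (s - t) - c) < eps / 2 ->
    Rabs (k s - k t - c * (s - t)) <= eps / 2 * Rabs (s - t)).
  { intros k c Hk. replace (t + (s - t)) with s in Hk by ring.
    replace (k s - k t - c * (s - t)) with (((k s - k t) / (s - t) - c) * (s - t)) by (field; auto).
    rewrite Rabs_mult. apply Rmult_le_compat_r; [apply Rabs_pos|lra]. }
  pose proof (Q f a (K1 _ E H1)). pose proof (Q g b (K2 _ E H2)).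
  eapply Rle_trans; [apply Cmod_ReIm|]. simpl.
  replace (f s + - f t + - (a * (s - t) - b * 0)) with (f s - f t - a * (s - t)) by ring.
  replace (g s + - g t + - (a * 0 + b * (s - t))) with (g s - g t - b * (s - t)) by ring.
  lra.
Qed.

Lemma Rder_circ (r th : R) : Rder (circ r) th (circ_deriv r th).
Proof.
  replace (circ_deriv r th) with (r * - sin th, r * cos th)
    by (unfold circ_deriv, circ, Ci; apply injective_projections; simpl; ring).
  apply (Rder_pair (fun s => r * cos s) (fun s => r * sin s)); auto_derive; auto; ring.
Qed.

Lemma Rder_circ_neg (r th : R) : Rder (fun t => circ r (- t)) th (- circ_deriv r (- th)).
Proof.
  replace (- circ_deriv r (- th))%C with (r * sin (- th), r * - cos (- th))
    by (unfold circ_deriv, circ, Ci; apply injective_projections; simpl; ring).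
  apply (Rder_pair (fun s => r * cos (- s)) (fun s => r * sin (- s))); auto_derive; auto; ring.
Qed.

Lemma Rcont_circ (r th : R) : Rcont (circ r) th.
Proof. eapply Rder_cont, Rder_circ. Qed.

Lemma Rcont_circ_deriv (r th : R) : Rcont (circ_deriv r) th.
Proof. apply Rcont_mult; [apply Rcont_const|apply Rcont_circ]. Qed.

Lemma circ_2PI (r : R) : circ r (2 * PI) = circ r 0.
Proof. unfold circ. now rewrite cos_2PI, sin_2PI, cos_0, sin_0. Qed.

Lemma circle_cauchy_except (f : C -> C) (p : C) (r rho : R) : 0 <= r < rho ->
  (forall z, Cmod z < rho -> Ccont f z) ->
  (forall z, Cmod z < rho -> z <> p -> hol f z) ->
  is_cint (fun th => f (circ r th) * circ_deriv r th)%C 0 (2 * PI) 0.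
Proof.
  intros Hr Hc Hh. destruct (primitive_disc f p rho Hc Hh) as [F HF].
  replace (RtoC 0) with (F (circ r (2 * PI)) - F (circ r 0))%C by (rewrite circ_2PI; ring).
  apply is_cint_path; intros t Ht.
  - apply HF. rewrite Cmod_circ; lra.
  - apply Hc. rewrite Cmod_circ; lra.
  - apply Rder_circ.
  - apply Rcont_circ_deriv.
Qed.

Lemma circle_cauchy (f : C -> C) (r rho : R) : 0 <= r < rho ->
  (forall z, Cmod z < rho -> hol f z) ->
  is_cint (fun th => f (circ r th) * circ_deriv r th)%C 0 (2 * PI) 0.
Proof.
  intros Hr Hh. apply (circle_cauchy_except f 0 r rho); auto.
  intros z Hz. now apply hol_cont, Hh.
Qed.

(* The circle seen from infinity: substituting [v = 1/u]. *)
Lemma circle_cauchy_inv (k : C -> C) (r rho : R) : 0 < r -> / r < rho ->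
  (forall u, Cmod u < rho -> hol k u) ->
  is_cint (fun th => k (/ circ r th) * / (circ r th * circ r th) * circ_deriv r th)%C 0 (2 * PI) 0.
Proof.
  intros Hr Hrho Hh.
  assert (Hir : 0 < / r) by now apply Rinv_0_lt_compat.
  destruct (primitive_disc k 0 rho) as [F HF]; auto.
  { intros z Hz; now apply hol_cont, Hh. }
  assert (Inv : forall t, (/ circ r t)%C = circ (/ r) (- t)).
  { intros t.
    assert (circ r t * circ (/ r) (- t) = 1)%C.
    { unfold circ. rewrite cos_neg, sin_neg. apply injective_projections; simpl.
      - transitivity (Rsqr (sin t) + Rsqr (cos t)); [unfold Rsqr; field; lra|apply sin2_cos2].
      - field; lra. }
    assert (circ r t <> 0) by (apply Cmod_gt_0; rewrite Cmod_circ; lra).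
    transitivity (/ circ r t * (circ r t * circ (/ r) (- t)))%C; [rewrite H; ring|field; auto]. }
  assert (E : is_cint (fun t => k (circ (/ r) (- t)) * - circ_deriv (/ r) (- t))%C 0 (2 * PI) 0).
  { replace (RtoC 0) with (F (circ (/ r) (- (2 * PI))) - F (circ (/ r) (- 0)))%C.
    - apply (is_cint_path F k (fun t => circ (/ r) (- t))); intros t Ht.
      + apply HF. rewrite Cmod_circ; lra.
      + apply hol_cont, Hh. rewrite Cmod_circ; lra.
      + apply Rder_circ_neg.
      + apply (Rcont_ext (fun t => (- Ci) * circ (/ r) (- t))%C).
        * intros; unfold circ_deriv; ring.
        * apply Rcont_mult; [apply Rcont_const|]. eapply Rder_cont, Rder_circ_neg.
    - unfold circ. rewrite !cos_neg, !sin_neg, cos_2PI, sin_2PI, cos_0, sin_0. ring. }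
  replace (RtoC 0) with ((- (1)) * 0)%C by ring.
  eapply is_cint_ext; [|apply is_cint_scal, E].
  intros t _. cbv beta. unfold circ_deriv. rewrite <- Inv.
  assert (circ r t <> 0) by (apply Cmod_gt_0; rewrite Cmod_circ; lra).
  field; auto.
Qed.

Lemma two_pi_i_neq0 : two_pi_i <> 0.
Proof.
  unfold two_pi_i. apply Cmult_neq_0.
  - apply RtoC_neq0. pose proof PI_RGT_0; lra.
  - intros E. injection E. lra.
Qed.

Lemma circ_neq (r th : R) (a : C) : Cmod a < r -> (circ r th - a <> 0)%C.
Proof.
  intros H. pose proof (Cmod_ge_0 a). apply Cminus_neq0. intros E.
  assert (Cmod a = r) by (rewrite <- E; apply Cmod_circ; lra). lra.
Qed.

Lemma circle_winding (r : R) (a : C) : Cmod a < r ->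
  is_cint (fun th => / (circ r th - a) * circ_deriv r th)%C 0 (2 * PI) two_pi_i.
Proof.
  intros Ha. pose proof (Cmod_ge_0 a) as Pa. assert (Hr : 0 < r) by lra.
  pose proof (circle_cauchy_inv (fun u => a / (1 - a * u))%C r (2 / (r + Cmod a)) Hr) as H.
  assert (A1 : / r < 2 / (r + Cmod a)).
  { apply Rmult_lt_reg_r with (r * (r + Cmod a)); [nra|].
    replace (/ r * (r * (r + Cmod a))) with (r + Cmod a) by (field; lra).
    replace (2 / (r + Cmod a) * (r * (r + Cmod a))) with (2 * r) by (field; lra). lra. }
  specialize (H A1).
  assert (A2 : forall u, Cmod u < 2 / (r + Cmod a) -> hol (fun u => a / (1 - a * u))%C u).
  { intros u Hu. apply hol_div; [apply hol_const| |].
    - apply hol_minus; [apply hol_const|]. apply hol_mult; [apply hol_const|apply hol_id].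
    - apply Cminus_neq0. intros E. apply (f_equal Cmod) in E. rewrite Cmod_1, Cmod_mult in E.
      apply Rmult_lt_compat_r with (r := r + Cmod a) in Hu; [|lra].
      replace (2 / (r + Cmod a) * (r + Cmod a)) with 2 in Hu by (field; lra).
      pose proof (Cmod_ge_0 u). nra. }
  specialize (H A2).
  pose proof (is_cint_const Ci 0 (2 * PI)) as H0.
  pose proof (is_cint_plus _ _ _ _ _ _ H0 H) as H1.
  replace two_pi_i with (RtoC (2 * PI - 0) * Ci + 0)%C.
  - eapply is_cint_ext; [|exact H1]. intros t _. cbv beta.
    pose proof (circ_neq r t 0). rewrite Cmod_0 in H2. specialize (H2 Hr).
    replace (circ r t - 0)%C with (circ r t) in H2 by ring.
    pose proof (circ_neq r t a Ha). unfold circ_deriv. field. split; auto.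
  - unfold two_pi_i. rewrite Rminus_0_r. ring.
Qed.

Definition ddq (f : C -> C) (a l w : C) : C :=
  if excluded_middle_informative (w = a) then l else ((f w - f a) / (w - a))%C.

Lemma ddq_neq (f : C -> C) (a l w : C) : w <> a -> ddq f a l w = ((f w - f a) / (w - a))%C.
Proof. intros H. unfold ddq. destruct excluded_middle_informative; tauto. Qed.

Lemma ddq_hol (f : C -> C) (a l w : C) : w <> a -> hol f w -> hol (ddq f a l) w.
Proof.
  intros H Hf. apply hol_ext_near with (fun w => (f w - f a) / (w - a))%C.
  - exists (Cmod (w - a)). split; [now apply Cmod_gt_0, Cminus_neq0|].
    intros u Hu. rewrite ddq_neq; auto. intros ->. rewrite Cmod_minus_sym in Hu. lra.
  - apply hol_div; [apply hol_minus; auto; apply hol_const| |now apply Cminus_neq0].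
    apply hol_minus; [apply hol_id|apply hol_const].
Qed.

Lemma ddq_cont (f : C -> C) (a l : C) : Cder f a l -> Ccont (ddq f a l) a.
Proof.
  intros H eps He. destruct (H (eps/2)) as [d [Hd K]]; [lra|]. exists d; split; auto.
  intros w Hw. unfold ddq at 2. destruct excluded_middle_informative as [_|n]; [|now destruct n].
  unfold ddq. destruct excluded_middle_informative as [_|n].
  - replace (l - l)%C with (RtoC 0) by ring. now rewrite Cmod_0.
  - apply Cminus_neq0 in n. assert (P : 0 < Cmod (w - a)) by now apply Cmod_gt_0.
    replace ((f w - f a) / (w - a) - l)%C with ((f w - f a - l * (w - a)) / (w - a))%C
      by (field; auto).
    rewrite Cmod_div by auto. apply Rmult_lt_reg_r with (Cmod (w - a)); auto.
    unfold Rdiv; rewrite Rmult_assoc, Rinv_l, Rmult_1_r by lra.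
    eapply Rle_lt_trans; [now apply K|]. nra.
Qed.

Lemma ddq_cont_all (f : C -> C) (a l w : C) : Cder f a l -> hol f w -> Ccont (ddq f a l) w.
Proof.
  intros H Hw. destruct (excluded_middle_informative (w = a)) as [->|n].
  - now apply ddq_cont.
  - now apply hol_cont, ddq_hol.
Qed.

Lemma circle_formula (f : C -> C) (r rho : R) (a : C) : r < rho -> Cmod a < r ->
  (forall z, Cmod z < rho -> hol f z) ->
  is_cint (fun th => f (circ r th) / (circ r th - a) * circ_deriv r th)%C 0 (2 * PI) (two_pi_i * f a).
Proof.
  intros Hr Ha Hh. pose proof (Cmod_ge_0 a) as Pa.
  destruct (Hh a) as [l Hl]; [lra|].
  pose proof (circle_cauchy_except (ddq f a l) a r rho) as H1.
  specialize (H1 ltac:(lra) (fun z Hz => ddq_cont_all f a l z Hl (Hh z Hz))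
    (fun z Hz n => ddq_hol f a l z n (Hh z Hz))).
  pose proof (is_cint_scal_r _ _ _ (f a) _ (circle_winding r a Ha)) as H2.
  pose proof (is_cint_plus _ _ _ _ _ _ H1 H2) as H3.
  replace (two_pi_i * f a)%C with (0 + two_pi_i * f a)%C by ring.
  eapply is_cint_ext; [|exact H3]. intros t _. cbv beta.
  pose proof (circ_neq r t a Ha).
  rewrite ddq_neq. 2: { intros E. apply H. rewrite E. ring. }
  field; auto.
Qed.

Lemma rect_winding (x1 x2 y1 y2 : R) (v : C) : x1 < fst v < x2 -> y1 < snd v < y2 ->
  rect_int (fun w => / (w - v))%C x1 x2 y1 y2 = two_pi_i.
Proof.
  destruct v as [a b]; simpl. intros Hx Hy.
  assert (Inv : forall x y, (/ ((x, y) - (a, b)))%C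
    = ((x - a) / ((x - a) ^ 2 + (y - b) ^ 2), - (y - b) / ((x - a) ^ 2 + (y - b) ^ 2))).
  { intros; unfold Cinv; simpl. auto. }
  assert (Cn : forall x y, x <> a \/ y <> b -> Ccont (fun w => / (w - (a, b)))%C (x, y)).
  { intros x y H. apply Ccont_inv.
    - apply Ccont_plus; [apply Ccont_id|apply Ccont_const].
    - apply Cminus_neq0. intros E; injection E; intros; tauto. }
  assert (A : forall y, y <> b -> cint (fun x => / ((x, y) - (a, b)))%C x1 x2 =
     (/2 * ln ((x2 - a)^2 + (y - b)^2) - /2 * ln ((x1 - a)^2 + (y - b)^2),
      - (atan ((x2 - a) / (y - b))) + atan ((x1 - a) / (y - b)))).
  { intros y Hy0. apply cint_unique.
    assert (Pq : forall x, 0 < (x - a) ^ 2 + (y - b) ^ 2).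
    { intros. assert (0 < (y - b) ^ 2) by (apply pow2_gt_0; lra). pose proof (pow2_ge_0 (x - a)). lra. }
    set (G := fun x => (/2 * ln ((x - a)^2 + (y - b)^2), - atan ((x - a) / (y - b))) : C).
    match goal with |- is_cint _ _ _ ?v => replace v with (G x2 - G x1)%C
      by (apply injective_projections; simpl; ring) end.
    apply (is_cint_derive G).
    - intros t _. rewrite Inv. unfold G.
      apply (Rder_pair (fun x => /2 * ln ((x - a)^2 + (y - b)^2)) (fun x => - atan ((x - a) / (y - b))));
        specialize (Pq t).
      + auto_derive; [simpl in Pq; lra|]. simpl. field. simpl in Pq; lra.
      + auto_derive; auto. unfold Rsqr. simpl in *. field. repeat split; lra.
    - intros t _. apply (Rcont_hline (fun w => / (w - (a, b)))%C), Cn. auto. }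
  assert (B : forall x, x <> a -> (Ci * cint (fun y => / ((x, y) - (a, b))) y1 y2)%C =
     (/2 * ln ((x - a)^2 + (y2 - b)^2) - /2 * ln ((x - a)^2 + (y1 - b)^2),
      atan ((y2 - b) / (x - a)) - atan ((y1 - b) / (x - a)))).
  { intros x Hx0.
    assert (Pq : forall y, 0 < (x - a) ^ 2 + (y - b) ^ 2).
    { intros. assert (0 < (x - a) ^ 2) by (apply pow2_gt_0; lra). pose proof (pow2_ge_0 (y - b)). lra. }
    set (G := fun y => (atan ((y - b) / (x - a)), - (/2) * ln ((x - a)^2 + (y - b)^2)) : C).
    assert (E : is_cint (fun y => / ((x, y) - (a, b)))%C y1 y2 (G y2 - G y1)%C).
    { apply (is_cint_derive G).
      - intros t _. rewrite Inv. unfold G.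
        apply (Rder_pair (fun y => atan ((y - b) / (x - a))) (fun y => - (/2) * ln ((x - a)^2 + (y - b)^2)));
          specialize (Pq t).
        + auto_derive; auto. unfold Rsqr. simpl in *. field. repeat split; lra.
        + auto_derive; [simpl in Pq; lra|]. simpl. field. simpl in Pq; lra.
      - intros t _. apply (Rcont_vline (fun w => / (w - (a, b)))%C), Cn. auto. }
    rewrite (cint_unique _ _ _ _ E). unfold G. apply injective_projections; simpl; ring. }
  unfold rect_int. rewrite (A y1), (A y2), (B x2), (B x1) by lra.
  assert (T : forall x y, 0 < x -> 0 < y -> atan (x / y) + atan (y / x) = PI / 2).
  { intros x y P1 P2. replace (x / y) with (/ (y / x)) by (field; lra).
    rewrite atan_inv by (apply Rdiv_lt_0_compat; auto). ring. }
  assert (Tn : forall x y, 0 < x -> y < 0 -> atan (x / y) + atan (y / x) = - (PI / 2)).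
  { intros x y P1 P2. rewrite <- (T x (- y)) by lra.
    replace (x / y) with (- (x / - y)) by (field; lra).
    replace (y / x) with (- (- y / x)) by (field; lra). rewrite !atan_opp. ring. }
  set (X1 := x1 - a) in *. set (X2 := x2 - a) in *. set (Y1 := y1 - b) in *. set (Y2 := y2 - b) in *.
  assert (X1 < 0 < X2) by (unfold X1, X2; lra). assert (Y1 < 0 < Y2) by (unfold Y1, Y2; lra).
  clearbody X1 X2 Y1 Y2.
  pose proof (T X2 Y2). pose proof (Tn X2 Y1). pose proof (Tn Y2 X1). pose proof (T (- X1) (- Y1)).
  replace (- X1 / - Y1) with (X1 / Y1) in H4 by (field; lra).
  replace (- Y1 / - X1) with (Y1 / X1) in H4 by (field; lra).
  unfold two_pi_i. apply injective_projections; simpl; [ring|lra].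
Qed.

Lemma rect_formula (f : C -> C) (x1 x2 y1 y2 : R) (v : C) :
  x1 < fst v < x2 -> y1 < snd v < y2 ->
  (forall z, in_box x1 x2 y1 y2 z -> hol f z) ->
  rect_int (fun w => f w / (w - v))%C x1 x2 y1 y2 = (two_pi_i * f v)%C.
Proof.
  intros Hx Hy Hh. assert (Hv : in_box x1 x2 y1 y2 v) by (split; lra).
  destruct (Hh v Hv) as [l Hl].
  assert (Cn : forall z, in_box x1 x2 y1 y2 z -> Ccont (ddq f v l) z)
    by (intros z Hz; apply ddq_cont_all; auto).
  assert (Z : rect_int (ddq f v l) x1 x2 y1 y2 = 0).
  { apply (goursat_except _ v); try lra; auto.
    intros z Hz n; apply ddq_hol; auto. }
  assert (W := rect_winding x1 x2 y1 y2 v Hx Hy).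
  assert (Sp : forall z, z <> v -> (f z / (z - v) = ddq f v l z + f v * / (z - v))%C).
  { intros z n. rewrite ddq_neq by auto. apply Cminus_neq0 in n. field; auto. }
  assert (Iv : forall z, z <> v -> Ccont (fun w => / (w - v))%C z).
  { intros z n. apply Ccont_inv; [apply Ccont_plus; [apply Ccont_id|apply Ccont_const]|].
    now apply Cminus_neq0. }
  assert (A : forall y, y1 <= y <= y2 -> y <> snd v -> cint (fun x => f (x, y) / ((x, y) - v))%C x1 x2 =
     (cint (fun x => ddq f v l (x, y)) x1 x2 + f v * cint (fun x => / ((x, y) - v)) x1 x2)%C).
  { intros y Hyy n. apply cint_unique.
    assert (n' : forall t, (t, y) <> v) by (intros t E; apply n; rewrite <- E; auto).
    eapply is_cint_ext; [intros t _; symmetry; apply Sp; auto|].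
    apply is_cint_plus; [apply (is_cint_hbox _ x1 x2 y1 y2 Cn); lra|].
    apply is_cint_scal, ex_cint. intros t _. apply (Rcont_hline (fun w => / (w - v))%C); auto. }
  assert (B : forall x, x1 <= x <= x2 -> x <> fst v -> cint (fun y => f (x, y) / ((x, y) - v))%C y1 y2 =
     (cint (fun y => ddq f v l (x, y)) y1 y2 + f v * cint (fun y => / ((x, y) - v)) y1 y2)%C).
  { intros x Hxx n. apply cint_unique.
    assert (n' : forall t, (x, t) <> v) by (intros t E; apply n; rewrite <- E; auto).
    eapply is_cint_ext; [intros t _; symmetry; apply Sp; auto|].
    apply is_cint_plus; [apply (is_cint_vbox _ x1 x2 y1 y2 Cn); lra|].
    apply is_cint_scal, ex_cint. intros t _. apply (Rcont_vline (fun w => / (w - v))%C); auto. }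
  unfold rect_int in *. rewrite (A y1), (A y2), (B x1), (B x2) by lra.
  rewrite <- W. transitivity (0 + f v * two_pi_i)%C; [|rewrite <- W; ring].
  rewrite <- Z, <- W. ring.
Qed.

(** * Lipschitz difference quotients *)

Definition Clim (u : nat -> C) (l : C) : Prop :=
  forall eps, 0 < eps -> exists N, forall n, (N <= n)%nat -> Cmod (u n - l) < eps.

Lemma Clim_cauchy (u : nat -> C) :
  (forall eps, 0 < eps -> exists N, forall n m, (N <= n)%nat -> (N <= m)%nat -> Cmod (u n - u m) < eps) ->
  exists l, Clim u l.
Proof.
  intros H.
  assert (L : forall pr : C -> R, (forall x y : C, Rabs (pr x - pr y) <= Cmod (x - y)) ->
    exists l : R, is_lim_seq (fun n => pr (u n)) l).
  { intros pr Hpr. apply ex_lim_seq_cauchy_corr. intros eps.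
    destruct (H eps (cond_pos eps)) as [N HN]. exists N. intros n m Hn Hm.
    eapply Rle_lt_trans; [apply Hpr|]. auto. }
  destruct (L fst) as [l1 H1]; [intros; apply (Re_le_Cmod (x - y))|].
  destruct (L snd) as [l2 H2]; [intros; apply (Im_le_Cmod (x - y))|].
  exists (l1, l2). intros eps He.
  apply is_lim_seq_spec in H1. apply is_lim_seq_spec in H2.
  assert (He2 : 0 < eps / 2) by lra.
  destruct (H1 (mkposreal _ He2)) as [N1 K1]. destruct (H2 (mkposreal _ He2)) as [N2 K2].
  exists (Nat.max N1 N2). intros n Hn.
  eapply Rle_lt_trans; [apply Cmod_ReIm|]. simpl.
  specialize (K1 n ltac:(lia)). specialize (K2 n ltac:(lia)). simpl in K1, K2.
  unfold Rminus in *. lra.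
Qed.

Lemma Clim_unique (u : nat -> C) (l l' : C) : Clim u l -> Clim u l' -> l = l'.
Proof.
  intros H H'. apply NNPP. intros n. apply Cminus_neq0, Cmod_gt_0 in n.
  destruct (H (Cmod (l - l') / 2)) as [N K]; [lra|].
  destruct (H' (Cmod (l - l') / 2)) as [N' K']; [lra|].
  specialize (K (Nat.max N N') ltac:(lia)). specialize (K' (Nat.max N N') ltac:(lia)).
  pose proof (Cmod_minus_triangle l (u (Nat.max N N')) l').
  rewrite (Cmod_minus_sym l (u _)) in H0. lra.
Qed.

Lemma Clim_le (u : nat -> C) (l a : C) (M : R) :
  Clim u l -> (forall n, Cmod (u n - a) <= M) -> Cmod (l - a) <= M.
Proof.
  intros H Hm. apply Rle_plus_epsilon. intros eps He. destruct (H eps He) as [N K].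
  specialize (K N (le_n N)). pose proof (Cmod_minus_triangle l (u N) a).
  rewrite (Cmod_minus_sym l (u _)) in H0. specialize (Hm N). lra.
Qed.

Definition dq (f : C -> C) (z w : C) : C := ((f w - f z) / (w - z))%C.

Definition lip_dq (f : C -> C) (z : C) (d K : R) : Prop :=
  forall w w', w <> z -> w' <> z -> Cmod (w - z) < d -> Cmod (w' - z) < d ->
    Cmod (dq f z w - dq f z w') <= K * Cmod (w - w').

Lemma lip_dq_hol (f : C -> C) (z : C) (d K : R) : 0 < d -> 0 <= K -> lip_dq f z d K -> hol f z.
Proof.
  intros Hd HK H.
  set (s := fun n : nat => (z + RtoC (d / (INR n + 2)))%C).
  assert (Pn : forall n, 0 < d / (INR n + 2)).
  { intros n. pose proof (pos_INR n). apply Rdiv_lt_0_compat; lra. }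
  assert (Ds : forall n, (s n - z)%C = RtoC (d / (INR n + 2))) by (intros; unfold s; ring).
  assert (Ms : forall n, Cmod (s n - z) = d / (INR n + 2)).
  { intros n. rewrite Ds, Cmod_R, Rabs_pos_eq; auto. apply Rlt_le, Pn. }
  assert (Ns : forall n, s n <> z).
  { intros n E. specialize (Ms n). specialize (Pn n). rewrite E in Ms.
    replace (z - z)%C with (RtoC 0) in Ms by ring. rewrite Cmod_0 in Ms. lra. }
  assert (Lt : forall n, Cmod (s n - z) < d).
  { intros n. rewrite Ms. pose proof (pos_INR n). apply Rmult_lt_reg_r with (INR n + 2); [lra|].
    unfold Rdiv. rewrite Rmult_assoc, Rinv_l by lra. nra. }
  assert (Small : forall eps, 0 < eps -> exists N, forall n, (N <= n)%nat -> d / (INR n + 2) < eps).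
  { intros eps He. destruct (archimed_cor1 (eps / d)) as [N [HN HN']]; [now apply Rdiv_lt_0_compat|].
    exists N. intros n Hn. apply le_INR in Hn. apply lt_INR in HN'. simpl in HN'.
    apply Rle_lt_trans with (d * / INR N).
    - unfold Rdiv. apply Rmult_le_compat_l; [lra|]. apply Rinv_le_contravar; lra.
    - apply Rmult_lt_compat_l with (r := d) in HN; auto.
      replace (d * (eps / d)) with eps in HN by (field; lra). exact HN. }
  destruct (Clim_cauchy (fun n => dq f z (s n))) as [l Hl].
  { intros eps He. destruct (Small (eps / (2 * (K + 1)))) as [N HN]; [apply Rdiv_lt_0_compat; lra|].
    exists N. intros n m Hn Hm.
    eapply Rle_lt_trans; [apply H; auto|].
    assert (B : Cmod (s n - s m) <= Cmod (s n - z) + Cmod (s m - z)).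
    { rewrite (Cmod_minus_sym (s m)). apply Cmod_minus_triangle. }
    rewrite !Ms in B. pose proof (HN n Hn). pose proof (HN m Hm).
    assert (Cmod (s n - s m) < 2 * (eps / (2 * (K + 1)))) by lra.
    apply Rle_lt_trans with ((K + 1) * Cmod (s n - s m)).
    - pose proof (Cmod_ge_0 (s n - s m)). nra.
    - apply Rmult_lt_compat_l with (r := K + 1) in H2; [|lra].
      replace ((K + 1) * (2 * (eps / (2 * (K + 1))))) with eps in H2 by (field; lra). exact H2. }
  assert (Key : forall w, w <> z -> Cmod (w - z) < d -> Cmod (dq f z w - l) <= K * Cmod (w - z)).
  { intros w n Hw. apply Rle_plus_epsilon. intros eps He.
    destruct (Hl (eps / 2)) as [N1 K1]; [lra|].
    destruct (Small (eps / (2 * (K + 1)))) as [N2 K2]; [apply Rdiv_lt_0_compat; lra|].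
    set (n0 := Nat.max N1 N2). specialize (K1 n0 ltac:(lia)). specialize (K2 n0 ltac:(lia)).
    pose proof (Cmod_minus_triangle (dq f z w) (dq f z (s n0)) l).
    pose proof (H w (s n0) n (Ns n0) Hw (Lt n0)).
    pose proof (Cmod_minus_triangle w z (s n0)). rewrite (Cmod_minus_sym z), Ms in H2.
    assert (K * Cmod (w - s n0) <= K * (Cmod (w - z) + d / (INR n0 + 2)))
      by (apply Rmult_le_compat_l; lra).
    assert ((K + 1) * (d / (INR n0 + 2)) <= eps / 2).
    { apply Rmult_lt_compat_l with (r := K + 1) in K2; [|lra].
      replace ((K + 1) * (eps / (2 * (K + 1)))) with (eps / 2) in K2 by (field; lra). lra. }
    specialize (Pn n0). nra. }
  exists l. intros eps He. exists (Rmin d (eps / (K + 1))). split.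
  { apply Rmin_glb_lt; auto. apply Rdiv_lt_0_compat; lra. }
  intros w Hw. destruct (excluded_middle_informative (w = z)) as [->|n].
  { replace (f z - f z - l * (z - z))%C with (RtoC 0) by ring. rewrite Cmod_0.
    apply Rmult_le_pos; [lra|apply Cmod_ge_0]. }
  assert (H1 : Cmod (w - z) < d) by (eapply Rlt_le_trans; [exact Hw|apply Rmin_l]).
  assert (H2 : Cmod (w - z) < eps / (K + 1)) by (eapply Rlt_le_trans; [exact Hw|apply Rmin_r]).
  specialize (Key w n H1). pose proof (Cminus_neq0 _ _ n) as n'.
  replace (f w - f z - l * (w - z))%C with ((dq f z w - l) * (w - z))%C by (unfold dq; field; auto).
  rewrite Cmod_mult. apply Rmult_le_compat_r; [apply Cmod_ge_0|].
  eapply Rle_trans; [exact Key|].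
  apply Rmult_lt_compat_l with (r := K + 1) in H2; [|lra].
  replace ((K + 1) * (eps / (K + 1))) with eps in H2 by (field; lra).
  pose proof (Cmod_ge_0 (w - z)). nra.
Qed.

(* Cauchy's formula turns a bound on [f] into a Lipschitz bound on its difference quotients;
   such bounds survive pointwise limits and integration over a parameter. *)
Lemma hol_bounded_lip_dq (f : C -> C) (z : C) (rho M : R) : 0 < rho ->
  (forall w, Cmod (w - z) < rho -> hol f w) ->
  (forall w, Cmod (w - z) < rho -> Cmod (f w) <= M) ->
  lip_dq f z (rho / 4) (32 * M / (rho * rho)).
Proof.
  intros Hrho Hh HM w w' n n' Hw Hw'.
  set (g := fun u => f (z + u)%C).
  assert (Hg : forall u, Cmod u < rho -> hol g u).
  { intros u Hu. unfold g. apply (hol_comp f (fun u => z + u)%C).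
    - apply hol_plus; [apply hol_const|apply hol_id].
    - apply Hh. replace (z + u - z)%C with u by ring. auto. }
  set (a := (w - z)%C) in *. set (b := (w' - z)%C) in *.
  assert (Na : a <> 0) by now apply Cminus_neq0. assert (Nb : b <> 0) by now apply Cminus_neq0.
  assert (Ew : f w = g a) by (unfold g, a; f_equal; ring).
  assert (Ew' : f w' = g b) by (unfold g, b; f_equal; ring).
  assert (Ez : f z = g 0) by (unfold g; f_equal; ring).
  unfold dq. fold a b. rewrite Ew, Ew', Ez.
  replace (w - w')%C with (a - b)%C by (unfold a, b; ring).
  assert (r4 : rho / 4 < rho / 2) by lra.
  pose proof (circle_formula g (rho / 2) rho a ltac:(lra) ltac:(lra) Hg) as Fa.
  pose proof (circle_formula g (rho / 2) rho b ltac:(lra) ltac:(lra) Hg) as Fb.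
  pose proof (circle_formula g (rho / 2) rho 0 ltac:(lra) ltac:(rewrite Cmod_0; lra) Hg) as F0.
  pose proof (is_cint_scal _ _ _ (/ a) _ (is_cint_minus _ _ _ _ _ _ Fa F0)) as Ga.
  pose proof (is_cint_scal _ _ _ (/ b) _ (is_cint_minus _ _ _ _ _ _ Fb F0)) as Gb.
  pose proof (is_cint_scal _ _ _ (/ two_pi_i) _ (is_cint_minus _ _ _ _ _ _ Ga Gb)) as G.
  assert (P : 0 < rho * rho) by nra.
  assert (Low : forall t c, Cmod c < rho / 4 -> rho / 4 <= Cmod (circ (rho / 2) t - c)).
  { intros t c Hc. pose proof (Cmod_le_plus (circ (rho / 2) t) c). rewrite Cmod_circ in H by lra. lra. }
  assert (Bd : forall t, 0 <= t <= 2 * PI ->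
    Cmod (/ two_pi_i * (a - b) * (g (circ (rho / 2) t) * / (circ (rho / 2) t - a) *
        / (circ (rho / 2) t - b) * Ci))%C
    <= / (2 * PI) * Cmod (a - b) * (M * (4 / rho) * (4 / rho))).
  { intros t _. pose proof PI_RGT_0.
    assert (Nc : forall c, Cmod c < rho / 4 -> (circ (rho / 2) t - c <> 0)%C).
    { intros c Hc. apply Cmod_gt_0. specialize (Low t c Hc). lra. }
    assert (Iv : forall c, Cmod c < rho / 4 -> Cmod (/ (circ (rho / 2) t - c)) <= 4 / rho).
    { intros c Hc. rewrite Cmod_inv by auto. replace (4 / rho) with (/ (rho / 4)) by (field; lra).
      apply Rinv_le_contravar; [lra|auto]. }
    rewrite !Cmod_mult, Cmod_Ci, Rmult_1_r.
    rewrite Cmod_inv by apply two_pi_i_neq0. unfold two_pi_i at 1.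
    rewrite Cmod_mult, Cmod_Ci, Cmod_R, Rmult_1_r, (Rabs_pos_eq (2 * PI)) by lra.
    apply Rmult_le_compat_l.
    { apply Rmult_le_pos; [apply Rlt_le, Rinv_0_lt_compat; lra|apply Cmod_ge_0]. }
    apply Rmult_le_compat; [|apply Cmod_ge_0| |auto].
    { apply Rmult_le_pos; apply Cmod_ge_0. }
    apply Rmult_le_compat; [apply Cmod_ge_0|apply Cmod_ge_0| |auto].
    unfold g. apply HM. replace (z + circ (rho / 2) t - z)%C with (circ (rho / 2) t) by ring.
    rewrite Cmod_circ; lra. }
  assert (E : is_cint (fun t => / two_pi_i * (a - b) * (g (circ (rho / 2) t) * / (circ (rho / 2) t - a) *
        / (circ (rho / 2) t - b) * Ci))%C 0 (2 * PI) ((g a - g 0) / a - (g b - g 0) / b)%C).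
  { replace ((g a - g 0) / a - (g b - g 0) / b)%C with
      (/ two_pi_i * (/ a * (two_pi_i * g a - two_pi_i * g 0) - / b * (two_pi_i * g b - two_pi_i * g 0)))%C
      by (field; repeat split; auto using two_pi_i_neq0).
    eapply is_cint_ext; [|exact G]. intros t _; cbv beta.
    assert (Nc : forall c, Cmod c < rho / 4 -> (circ (rho / 2) t - c <> 0)%C).
    { intros c Hc. apply Cmod_gt_0. specialize (Low t c Hc). lra. }
    pose proof (Nc a Hw). pose proof (Nc b Hw'). pose proof (Nc 0 ltac:(rewrite Cmod_0; lra)).
    replace (circ (rho / 2) t - 0)%C with (circ (rho / 2) t) in * by ring.
    unfold circ_deriv. field. repeat split; auto using two_pi_i_neq0. }
  pose proof PI_RGT_0 as PP. assert (PP0 : 0 <= 2 * PI) by lra.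
  eapply Rle_trans; [apply (is_cint_norm _ _ _ _ _ PP0 Bd E)|].
  assert (0 <= M).
  { eapply Rle_trans; [apply Cmod_ge_0|apply (HM z)].
    replace (z - z)%C with (RtoC 0) by ring. rewrite Cmod_0; lra. }
  pose proof (Cmod_ge_0 (a - b)).
  replace ((2 * PI - 0) * (/ (2 * PI) * Cmod (a - b) * (M * (4 / rho) * (4 / rho))))
    with (16 * (M / (rho * rho) * Cmod (a - b))) by (field; repeat split; lra).
  replace (32 * M / (rho * rho) * Cmod (a - b)) with (32 * (M / (rho * rho) * Cmod (a - b))) by (field; lra).
  assert (0 <= M / (rho * rho) * Cmod (a - b)); [|lra].
  apply Rmult_le_pos; auto. apply Rmult_le_pos; auto. apply Rlt_le, Rinv_0_lt_compat; auto.
Qed.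

Lemma hol_limit (f : nat -> C -> C) (g : C -> C) (z : C) (rho M : R) : 0 < rho -> 
  (forall n w, Cmod (w - z) < rho -> hol (f n) w) ->
  (forall n w, Cmod (w - z) < rho -> Cmod (f n w) <= M) ->
  (forall w, Cmod (w - z) < rho -> Clim (fun n => f n w) (g w)) -> hol g z.
Proof.
  intros Hrho Hh HM Hl.
  assert (P : 0 < rho * rho) by nra.
  assert (M0 : 0 <= M).
  { eapply Rle_trans; [apply Cmod_ge_0|apply (HM O z)].
    replace (z - z)%C with (RtoC 0) by ring. rewrite Cmod_0; lra. }
  assert (K0 : 0 <= 32 * M / (rho * rho)).
  { apply Rmult_le_pos; [lra|]. apply Rlt_le, Rinv_0_lt_compat; auto. }
  apply (lip_dq_hol g z (rho / 4) (32 * M / (rho * rho))); auto; [lra|].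
  intros w w' n n' Hw Hw'.
  pose proof (Cminus_neq0 _ _ n) as Nw. pose proof (Cminus_neq0 _ _ n') as Nw'.
  pose proof (proj1 (Cmod_gt_0 _) Nw) as Pw. pose proof (proj1 (Cmod_gt_0 _) Nw') as Pw'.
  apply Rle_plus_epsilon. intros eps He.
  set (e := eps / (2 * (/ Cmod (w - z) + / Cmod (w' - z)))).
  assert (Pi : 0 < / Cmod (w - z) + / Cmod (w' - z))
    by (pose proof (Rinv_0_lt_compat _ Pw); pose proof (Rinv_0_lt_compat _ Pw'); lra).
  assert (He' : 0 < e) by (apply Rdiv_lt_0_compat; lra).
  destruct (Hl w ltac:(lra) e He') as [N1 K1].
  destruct (Hl w' ltac:(lra) e He') as [N2 K2].
  destruct (Hl z) with (eps := e) as [N3 K3]; auto.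
  { replace (z - z)%C with (RtoC 0) by ring. rewrite Cmod_0; lra. }
  set (m := Nat.max N1 (Nat.max N2 N3)).
  specialize (K1 m ltac:(lia)). specialize (K2 m ltac:(lia)). specialize (K3 m ltac:(lia)).
  pose proof (hol_bounded_lip_dq (f m) z rho M Hrho (Hh m) (HM m) w w' n n' Hw Hw') as B.
  assert (D : forall u, u <> z -> Cmod (f m u - g u) < e ->
    Cmod (dq g z u - dq (f m) z u) <= 2 * e * / Cmod (u - z)).
  { intros u nu Hu. pose proof (Cminus_neq0 _ _ nu) as Nu.
    replace (dq g z u - dq (f m) z u)%C with (((f m z - g z) - (f m u - g u)) / (u - z))%C
      by (unfold dq; field; auto).
    rewrite Cmod_div by auto. apply Rmult_le_compat_r.
    - apply Rlt_le, Rinv_0_lt_compat. now apply Cmod_gt_0.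
    - unfold Cminus at 1. eapply Rle_trans; [apply Cmod_triangle|]. rewrite Cmod_opp. lra. }
  pose proof (D w n K1) as D1. pose proof (D w' n' K2) as D2.
  replace (dq g z w - dq g z w')%C with ((dq g z w - dq (f m) z w)
     + ((dq (f m) z w - dq (f m) z w') - (dq g z w' - dq (f m) z w')))%C by ring.
  eapply Rle_trans; [apply Cmod_triangle|].
  unfold Cminus at 2. 
  pose proof (Cmod_triangle (dq (f m) z w - dq (f m) z w') (- (dq g z w' - dq (f m) z w'))) as T.
  rewrite Cmod_opp in T.
  assert (2 * e * / Cmod (w - z) + 2 * e * / Cmod (w' - z) = eps).
  { unfold e. field. repeat split; lra. }
  lra.
Qed.

(** * The complex exponential and sine *)

Lemma exp_le (x y : R) : x <= y -> exp x <= exp y.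
Proof. intros [H|H]; [now apply Rlt_le, exp_increasing|subst; lra]. Qed.

Lemma Cexp_plus (a b : C) : Cexp (a + b) = (Cexp a * Cexp b)%C.
Proof.
  unfold Cexp; simpl. rewrite exp_plus, cos_plus, sin_plus.
  apply injective_projections; simpl; ring.
Qed.

Lemma Cexp_0 : Cexp 0 = 1.
Proof. unfold Cexp; simpl. rewrite exp_0, cos_0, sin_0. apply injective_projections; simpl; ring. Qed.

Lemma Cexp_neq0 (z : C) : Cexp z <> 0.
Proof.
  intros E. assert (Cexp z * Cexp (- z) = 1)%C.
  { rewrite <- Cexp_plus. replace (z + - z)%C with (RtoC 0) by ring. apply Cexp_0. }
  rewrite E in H. replace (0 * Cexp (- z))%C with (RtoC 0) in H by ring. injection H; lra.
Qed.

Lemma Cexp_opp (z : C) : Cexp (- z) = (/ Cexp z)%C.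
Proof.
  assert (Cexp z * Cexp (- z) = 1)%C.
  { rewrite <- Cexp_plus. replace (z + - z)%C with (RtoC 0) by ring. apply Cexp_0. }
  transitivity (/ Cexp z * (Cexp z * Cexp (- z)))%C; [field|rewrite H; ring]. apply Cexp_neq0.
Qed.

Lemma Cmod_Cexp (z : C) : Cmod (Cexp z) = exp (fst z).
Proof.
  unfold Cexp. change (Cmod (circ (exp (fst z)) (snd z)) = exp (fst z)).
  apply Cmod_circ. apply Rlt_le, exp_pos.
Qed.

Lemma Rder_Cexp_line (h : C) (s : R) :
  Rder (fun t => Cexp (RtoC t * h)) s (h * Cexp (RtoC s * h)).
Proof.
  destruct h as [x y]. unfold Cexp; simpl.
  set (A := s * x - 0 * y). set (B := s * y + 0 * x).
  match goal with |- Rder _ _ ?v => replace v with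
    (x * exp A * cos B - exp A * (y * sin B), x * exp A * sin B + exp A * (y * cos B)) end.
  - apply (Rder_pair (fun t => exp (t * x - 0 * y) * cos (t * y + 0 * x))
                     (fun t => exp (t * x - 0 * y) * sin (t * y + 0 * x)));
    auto_derive; auto; unfold A, B, Rminus; ring.
  - apply injective_projections; simpl; ring.
Qed.

Lemma Cexp_bound1 (h : C) : Cmod (Cexp h - 1) <= Cmod h * exp (Cmod h).
Proof.
  assert (E : is_cint (fun s => h * Cexp (RtoC s * h))%C 0 1 (Cexp (RtoC 1 * h) - Cexp (RtoC 0 * h))).
  { apply (is_cint_derive (fun s => Cexp (RtoC s * h))).
    - intros t _; apply Rder_Cexp_line.
    - intros t _. apply Rcont_mult; [apply Rcont_const|]. eapply Rder_cont, Rder_Cexp_line. }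
  replace (Cexp h - 1)%C with (Cexp (RtoC 1 * h) - Cexp (RtoC 0 * h))%C.
  2: { replace (RtoC 0 * h)%C with (RtoC 0) by ring. rewrite Cexp_0, Cmult_1_l. auto. }
  eapply Rle_trans; [apply (is_cint_norm _ 0 1 (Cmod h * exp (Cmod h)) _ Rle_0_1 ) with (2 := E)|lra].
  intros t Ht. rewrite Cmod_mult, Cmod_Cexp. apply Rmult_le_compat_l; [apply Cmod_ge_0|].
  apply exp_le. simpl. pose proof (Re_le_Cmod h). pose proof (Rle_abs (fst h)).
  pose proof (Cmod_ge_0 h). nra.
Qed.

Lemma Cexp_bound2 (h : C) : Cmod (Cexp h - 1 - h) <= Cmod h * Cmod h * exp (Cmod h).
Proof.
  assert (E : is_cint (fun s => h * (Cexp (RtoC s * h) - 1))%C 0 1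
     ((Cexp (RtoC 1 * h) - RtoC 1 * h) - (Cexp (RtoC 0 * h) - RtoC 0 * h))).
  { apply (is_cint_derive (fun s => Cexp (RtoC s * h) - RtoC s * h)%C).
    - intros t _ eps He. destruct (Rder_Cexp_line h t eps He) as [d [Hd K]].
      exists d; split; auto. intros s Hs. specialize (K s Hs).
      eapply Rle_trans; [|exact K]. right. f_equal. rewrite !RtoC_minus. ring.
    - intros t _. apply Rcont_mult; [apply Rcont_const|].
      apply Rcont_plus; [|apply Rcont_const]. eapply Rder_cont, Rder_Cexp_line. }
  replace (Cexp h - 1 - h)%C with ((Cexp (RtoC 1 * h) - RtoC 1 * h) - (Cexp (RtoC 0 * h) - RtoC 0 * h))%C.
  2: { replace (RtoC 0 * h)%C with (RtoC 0) by ring. rewrite Cexp_0, Cmult_1_l. ring. }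
  eapply Rle_trans;
    [apply (is_cint_norm _ 0 1 (Cmod h * Cmod h * exp (Cmod h)) _ Rle_0_1 ) with (2 := E)|lra].
  intros t Ht. rewrite Cmod_mult, Rmult_assoc. apply Rmult_le_compat_l; [apply Cmod_ge_0|].
  eapply Rle_trans; [apply Cexp_bound1|]. rewrite Cmod_mult, Cmod_R, Rabs_pos_eq by lra.
  pose proof (Cmod_ge_0 h). assert (t * Cmod h <= Cmod h) by nra.
  apply Rmult_le_compat; [nra|apply Rlt_le, exp_pos|auto|now apply exp_le].
Qed.

Lemma Cder_Cexp (z : C) : Cder Cexp z (Cexp z).
Proof.
  intros eps He. pose proof (exp_pos (fst z)) as Pz. pose proof (exp_pos 1) as P1.
  set (d := Rmin 1 (eps / (exp (fst z) * exp 1))).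
  exists d. split.
  { apply Rmin_glb_lt; [lra|]. apply Rdiv_lt_0_compat; nra. }
  intros w Hw.
  assert (H1 : Cmod (w - z) < 1) by (eapply Rlt_le_trans; [exact Hw|apply Rmin_l]).
  assert (H2 : Cmod (w - z) < eps / (exp (fst z) * exp 1)) by (eapply Rlt_le_trans; [exact Hw|apply Rmin_r]).
  replace w with (z + (w - z))%C at 1 by ring. rewrite Cexp_plus.
  replace (Cexp z * Cexp (w - z) - Cexp z - Cexp z * (w - z))%C
    with (Cexp z * (Cexp (w - z) - 1 - (w - z)))%C by ring.
  rewrite Cmod_mult, Cmod_Cexp.
  pose proof (Cexp_bound2 (w - z)) as B. pose proof (Cmod_ge_0 (w - z)) as P0.
  assert (exp (Cmod (w - z)) <= exp 1) by (apply exp_le; lra).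
  assert (Cmod (w - z) * (exp (fst z) * exp 1) <= eps).
  { apply Rmult_lt_compat_r with (r := exp (fst z) * exp 1) in H2; [|nra].
    replace (eps / (exp (fst z) * exp 1) * (exp (fst z) * exp 1)) with eps in H2
      by (field; split; lra). lra. }
  apply Rle_trans with (exp (fst z) * (Cmod (w - z) * Cmod (w - z) * exp 1)).
  - apply Rmult_le_compat_l; [lra|]. eapply Rle_trans; [exact B|].
    apply Rmult_le_compat_l; [nra|auto].
  - replace (exp (fst z) * (Cmod (w - z) * Cmod (w - z) * exp 1))
      with (Cmod (w - z) * (exp (fst z) * exp 1) * Cmod (w - z)) by ring.
    apply Rmult_le_compat_r; auto.
Qed.

Lemma hol_Cexp (f : C -> C) (z : C) : hol f z -> hol (fun w => Cexp (f w)) z.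
Proof. intros H. apply (hol_comp Cexp f); auto. eexists; apply Cder_Cexp. Qed.

Definition sg (z : C) : C := (Csin (RtoC PI * z) / RtoC PI)%C.

Lemma PI_neq0C : RtoC PI <> 0.
Proof. apply RtoC_neq0. apply PI_neq0. Qed.

Lemma Ci2_neq0 : (RtoC 2 * Ci <> 0)%C.
Proof. intros E; injection E; lra. Qed.

Lemma sg_opp (z : C) : sg (- z) = (- sg z)%C.
Proof.
  unfold sg, Csin.
  replace (- (Ci * (RtoC PI * - z)))%C with (Ci * (RtoC PI * z))%C by ring.
  replace (Ci * (RtoC PI * - z))%C with (- (Ci * (RtoC PI * z)))%C by ring.
  unfold Cdiv. ring.
Qed.

Lemma Csin_components (u v : R) :
  Csin (u, v) = (sin u * ((exp v + exp (- v)) / 2), cos u * ((exp v - exp (- v)) / 2)).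
Proof.
  unfold Csin, Cdiv.
  replace (/ (RtoC 2 * Ci))%C with (0, - / 2).
  2: { apply injective_projections; simpl; field. }
  unfold Cexp; simpl.
  replace (0 * u - 1 * v) with (- v) by ring. replace (0 * v + 1 * u) with u by ring.
  replace (- - v) with v by ring. rewrite cos_neg, sin_neg.
  apply injective_projections; simpl; field.
Qed.

Lemma Cmod_sqr (z : C) : Cmod z * Cmod z = fst z * fst z + snd z * snd z.
Proof.
  unfold Cmod. rewrite sqrt_sqrt; [ring|]. pose proof (pow2_ge_0 (fst z)). pose proof (pow2_ge_0 (snd z)). lra.
Qed.

Lemma sg_lower_sinh (z : C) :
  (exp (PI * Rabs (snd z)) - exp (- (PI * Rabs (snd z)))) / 2 / PI <= Cmod (sg z).
Proof.
  destruct z as [x y]. pose proof PI_RGT_0 as P. unfold sg.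
  rewrite Cmod_div by apply PI_neq0C. rewrite Cmod_R, (Rabs_pos_eq PI) by lra.
  apply Rmult_le_compat_r; [apply Rlt_le, Rinv_0_lt_compat; lra|].
  replace (RtoC PI * (x, y))%C with (PI * x, PI * y) by (apply injective_projections; simpl; ring).
  rewrite Csin_components. simpl.
  assert (E : forall a, Rsqr ((exp (Rabs a) - exp (- Rabs a)) / 2) = Rsqr ((exp a - exp (- a)) / 2)).
  { intros a. unfold Rabs. destruct Rcase_abs; [|auto]. rewrite Ropp_involutive. unfold Rsqr. field. }
  replace (PI * Rabs y) with (Rabs (PI * y)) by (rewrite Rabs_mult, (Rabs_pos_eq PI); lra).
  apply Rsqr_incr_0_var; [|apply Cmod_ge_0]. rewrite E.
  unfold Rsqr at 2. rewrite Cmod_sqr. simpl.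
  assert (Ep : exp (PI * y) * exp (- (PI * y)) = 1) by (rewrite <- exp_plus, Rplus_opp_r; apply exp_0).
  pose proof (sin2_cos2 (PI * x)) as S. unfold Rsqr in *.
  set (p := exp (PI * y)) in *. set (q := exp (- (PI * y))) in *.
  set (s := sin (PI * x)) in *. set (c := cos (PI * x)) in *.
  assert (HH : s * ((p + q) / 2) * (s * ((p + q) / 2)) + c * ((p - q) / 2) * (c * ((p - q) / 2))
    = (s * s + c * c) * ((p - q) / 2 * ((p - q) / 2)) + s * s * (p * q)) by field.
  rewrite HH, S, Ep. nra.
Qed.

Lemma sg_lower_sin (z : C) :
  Rabs (sin (PI * fst z)) * exp (PI * Rabs (snd z)) / 2 / PI <= Cmod (sg z).
Proof.
  destruct z as [x y]. pose proof PI_RGT_0 as P. unfold sg. simpl.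
  rewrite Cmod_div by apply PI_neq0C. rewrite Cmod_R, (Rabs_pos_eq PI) by lra.
  apply Rmult_le_compat_r; [apply Rlt_le, Rinv_0_lt_compat; lra|].
  replace (RtoC PI * (x, y))%C with (PI * x, PI * y) by (apply injective_projections; simpl; ring).
  rewrite Csin_components. 
  eapply Rle_trans; [|apply Re_le_Cmod]. simpl.
  rewrite Rabs_mult. unfold Rdiv. rewrite Rmult_assoc. apply Rmult_le_compat_l; [apply Rabs_pos|].
  pose proof (exp_pos (PI * y)). pose proof (exp_pos (- (PI * y))).
  rewrite (Rabs_pos_eq ((exp (PI * y) + exp (- (PI * y))) * / 2)) by lra.
  apply Rmult_le_compat_r; [lra|].
  unfold Rabs. destruct Rcase_abs; [|lra].
  replace (PI * - y) with (- (PI * y)) by ring. lra.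
Qed.

Lemma sg_neq0 (z : C) : -1 < fst z < 1 -> z <> 0 -> sg z <> 0.
Proof.
  intros Hz n E. pose proof PI_RGT_0 as P. destruct z as [x y]; simpl in Hz.
  destruct (Req_dec y 0) as [Hy|Hy].
  - assert (Hx : x <> 0) by (intros ->; subst; auto).
    pose proof (sg_lower_sin (x, y)) as L. rewrite E, Cmod_0 in L. simpl in L.
    assert (sin (PI * x) <> 0).
    { destruct (Rtotal_order x 0) as [H|[H|H]]; [|lra|].
      - pose proof (sin_gt_0 (PI * - x)). rewrite <- Ropp_mult_distr_r, sin_neg in H0.
        assert (0 < - sin (PI * x)) by (apply H0; nra). lra.
      - assert (0 < sin (PI * x)) by (apply sin_gt_0; nra). lra. }
    apply Rabs_pos_lt in H.
    assert (0 < Rabs (sin (PI * x)) * exp (PI * Rabs y) / 2 / PI); [|lra].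
    repeat apply Rdiv_lt_0_compat; try lra. apply Rmult_lt_0_compat; auto. apply exp_pos.
  - pose proof (sg_lower_sinh (x, y)) as L. rewrite E, Cmod_0 in L. simpl in L.
    apply Rabs_pos_lt in Hy.
    assert (exp (- (PI * Rabs y)) < exp (PI * Rabs y)) by (apply exp_increasing; nra).
    assert (0 < (exp (PI * Rabs y) - exp (- (PI * Rabs y))) / 2 / PI); [|lra].
    repeat apply Rdiv_lt_0_compat; lra.
Qed.

Lemma hol_sg (f : C -> C) (z : C) : hol f z -> hol (fun w => sg (f w)) z.
Proof.
  intros H. unfold sg, Csin. apply hol_div; [|apply hol_const|apply PI_neq0C].
  apply hol_div; [|apply hol_const|apply Ci2_neq0].
  apply hol_minus; apply hol_Cexp; [|apply hol_opp]; repeat apply hol_mult; auto; apply hol_const.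
Qed.

Lemma Clim_ext_S (u v : nat -> C) (l : C) : (forall n, u (S n) = v (S n)) -> Clim u l -> Clim v l.
Proof.
  intros H Hu eps He. destruct (Hu eps He) as [N K]. exists (S N). intros n Hn.
  destruct n; [lia|]. rewrite <- H; apply K; lia.
Qed.

Lemma Clim_S (u : nat -> C) (l : C) : Clim (fun n => u (S n)) l -> Clim u l.
Proof.
  intros Hu eps He. destruct (Hu eps He) as [N K]. exists (S N). intros n Hn.
  destruct n; [lia|]. apply K; lia.
Qed.

Lemma Clim_const (c : C) : Clim (fun _ => c) c.
Proof.
  intros eps He. exists O. intros n _. replace (c - c)%C with (RtoC 0) by ring. now rewrite Cmod_0.
Qed.

Lemma Clim_plus (u v : nat -> C) (l m : C) :
  Clim u l -> Clim v m -> Clim (fun n => u n + v n)%C (l + m).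
Proof.
  intros Hu Hv eps He. destruct (Hu (eps/2)) as [N K]; [lra|].
  destruct (Hv (eps/2)) as [N' K']; [lra|]. exists (Nat.max N N'). intros n Hn.
  specialize (K n ltac:(lia)). specialize (K' n ltac:(lia)).
  replace (u n + v n - (l + m))%C with ((u n - l) + (v n - m))%C by ring.
  eapply Rle_lt_trans; [apply Cmod_triangle|lra].
Qed.

Lemma Clim_mult (u v : nat -> C) (l m : C) :
  Clim u l -> Clim v m -> Clim (fun n => u n * v n)%C (l * m).
Proof.
  intros Hu Hv eps He.
  pose proof (Cmod_ge_0 l) as Pl. pose proof (Cmod_ge_0 m) as Pm.
  set (A := Cmod l + Cmod m + 1).
  set (e := Rmin 1 (eps / (2 * A))).
  assert (HA : 1 <= A) by (unfold A; lra).
  assert (He1 : 0 < e) by (apply Rmin_glb_lt; [lra|apply Rdiv_lt_0_compat; lra]).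
  assert (He2 : e <= 1) by apply Rmin_l.
  assert (He3 : e * (2 * A) <= eps).
  { assert (H : e <= eps / (2 * A)) by apply Rmin_r.
    apply Rmult_le_compat_r with (r := 2 * A) in H; [|lra].
    replace (eps / (2 * A) * (2 * A)) with eps in H by (field; lra). exact H. }
  destruct (Hu e He1) as [N K]. destruct (Hv e He1) as [N' K'].
  exists (Nat.max N N'). intros n Hn.
  specialize (K n ltac:(lia)). specialize (K' n ltac:(lia)).
  replace (u n * v n - l * m)%C
    with ((u n - l) * (v n - m) + (u n - l) * m + l * (v n - m))%C by ring.
  eapply Rle_lt_trans; [apply Cmod_triangle|].
  eapply Rle_lt_trans; [apply Rplus_le_compat_r; apply Cmod_triangle|].
  rewrite !Cmod_mult.
  pose proof (Cmod_ge_0 (u n - l)). pose proof (Cmod_ge_0 (v n - m)). unfold A in *. nra.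
Qed.

Lemma Clim_inv_INR (c : C) : Clim (fun n => c * RtoC (/ INR n))%C 0.
Proof.
  intros eps He. pose proof (Cmod_ge_0 c).
  destruct (archimed_cor1 (eps / (Cmod c + 1))) as [N [HN HN']]; [apply Rdiv_lt_0_compat; lra|].
  exists N. intros n Hn. replace (c * RtoC (/ INR n) - 0)%C with (c * RtoC (/ INR n))%C by ring.
  apply le_INR in Hn. apply lt_INR in HN'. simpl in HN'.
  rewrite Cmod_mult, Cmod_R, Rabs_pos_eq by (apply Rlt_le, Rinv_0_lt_compat; lra).
  assert (/ INR n <= / INR N) by (apply Rinv_le_contravar; lra).
  assert (0 < / INR n) by (apply Rinv_0_lt_compat; lra).
  apply Rle_lt_trans with ((Cmod c + 1) * / INR N); [nra|].
  apply Rmult_lt_compat_l with (r := Cmod c + 1) in HN; [|lra].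
  replace ((Cmod c + 1) * (eps / (Cmod c + 1))) with eps in HN by (field; lra). exact HN.
Qed.

Lemma Clim_Cmod_le (u v : nat -> C) (l m : C) :
  Clim u l -> Clim v m -> (forall n, Cmod (u (S n)) <= Cmod (v (S n))) -> Cmod l <= Cmod m.
Proof.
  intros Hu Hv H. apply Rle_plus_epsilon. intros eps He.
  destruct (Hu (eps/2)) as [N K]; [lra|]. destruct (Hv (eps/2)) as [N' K']; [lra|].
  set (n := Nat.max N N'). specialize (K (S n) ltac:(lia)). specialize (K' (S n) ltac:(lia)).
  pose proof (Cmod_le_plus l (u (S n))). pose proof (Cmod_le_plus (v (S n)) m).
  rewrite (Cmod_minus_sym l) in H0. specialize (H n). lra.
Qed.

(** * The reciprocal Gamma function *)

Lemma fact_neq0C (n : nat) : RtoC (INR (fact n)) <> 0.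
Proof. apply RtoC_neq0, INR_fact_neq_0. Qed.

Lemma gauss_ratio (z : C) (n : nat) : (1 <= n)%nat ->
  gauss_seq z (S n) = (gauss_seq z n * ((1 + z * RtoC (/ INR (S n)))
     * Cexp (- (z * RtoC (ln (INR (S n)) - ln (INR n))))))%C.
Proof.
  intros Hn. unfold gauss_seq.
  assert (HS : INR (S n) <> 0) by (apply not_0_INR; lia).
  replace (Cexp (z * RtoC (ln (INR (S n)))))%C
    with (Cexp (z * RtoC (ln (INR n))) * Cexp (z * RtoC (ln (INR (S n)) - ln (INR n))))%C.
  2: { rewrite <- Cexp_plus. f_equal. rewrite RtoC_minus. ring. }
  rewrite Cexp_opp. change (fact (S n)) with (S n * fact n)%nat.
  rewrite mult_INR, RtoC_mult. rewrite RtoC_inv by auto.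
  set (P := Cprod (S n) (fun k => (z + RtoC (INR k))%C)).
  change (Cprod (S (S n)) (fun k => (z + RtoC (INR k))%C)) with (P * (z + RtoC (INR (S n))))%C.
  field. repeat split; try apply Cexp_neq0; try apply fact_neq0C. now apply RtoC_neq0.
Qed.

Lemma ln_step (n : nat) : (1 <= n)%nat -> / INR (S n) <= ln (INR (S n)) - ln (INR n) <= / INR n.
Proof.
  intros Hn. apply le_INR in Hn. simpl in Hn.
  assert (HS : INR (S n) = INR n + 1) by apply S_INR.
  rewrite <- ln_div by lra. rewrite HS. split.
  - replace (/ (INR n + 1)) with (- ln (exp (- / (INR n + 1)))) by (rewrite ln_exp; ring).
    replace ((INR n + 1) / INR n) with (/ (1 + - / (INR n + 1))) by (field; lra).
    assert (0 < 1 + - / (INR n + 1)).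
    { replace (1 + - / (INR n + 1)) with (INR n / (INR n + 1)) by (field; lra). apply Rdiv_lt_0_compat; lra. }
    rewrite ln_Rinv by auto. apply Ropp_le_contravar, ln_le; auto. apply exp_ineq1_le.
  - replace (/ INR n) with (ln (exp (/ INR n))) at 1 by apply ln_exp.
    rewrite ln_exp. replace (/ INR n) with (ln (exp (/ INR n))) by apply ln_exp.
    apply ln_le; [apply Rdiv_lt_0_compat; lra|].
    replace ((INR n + 1) / INR n) with (1 + / INR n) by (field; lra). apply exp_ineq1_le.
Qed.

Definition gauss_A (B : R) : R := B + B * B + (1 + B) * (B * B * exp B).

Lemma gauss_ratio_bound (z : C) (B : R) (n : nat) : (1 <= n)%nat -> Cmod z <= B ->
  Cmod ((1 + z * RtoC (/ INR (S n))) * Cexp (- (z * RtoC (ln (INR (S n)) - ln (INR n)))) - 1)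
  <= gauss_A B * (/ INR n * / INR n).
Proof.
  intros Hn HB. pose proof (ln_step n Hn) as L.
  set (lam := ln (INR (S n)) - ln (INR n)) in *. set (mu := / INR (S n)) in *.
  apply le_INR in Hn. simpl in Hn.
  assert (Hmu : 0 < mu) by (apply Rinv_0_lt_compat; rewrite S_INR; lra).
  set (nu := / INR n) in *.
  assert (Hnu : 0 < nu <= 1).
  { split; [apply Rinv_0_lt_compat; lra|]. unfold nu. rewrite <- Rinv_1. apply Rinv_le_contravar; lra. }
  assert (Hd : nu - mu <= nu * nu).
  { unfold nu, mu. rewrite S_INR. replace (/ INR n - / (INR n + 1)) with (/ INR n * / (INR n + 1)) by (field; lra).
    apply Rmult_le_compat_l; [apply Rlt_le, Rinv_0_lt_compat; lra|]. apply Rinv_le_contravar; lra. }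
  set (h := (- (z * RtoC lam))%C). pose proof (Cexp_bound2 h) as E.
  pose proof (Cmod_ge_0 z) as Pz.
  assert (Hh : Cmod h <= B * nu).
  { unfold h. rewrite Cmod_opp, Cmod_mult, Cmod_R, Rabs_pos_eq by lra. nra. }
  assert (Hh' : Cmod h <= B) by nra. pose proof (Cmod_ge_0 h) as Ph.
  assert (E' : Cmod (Cexp h - 1 - h) <= (B * B * exp B) * (nu * nu)).
  { eapply Rle_trans; [exact E|].
    replace (B * B * exp B * (nu * nu)) with ((B * nu) * (B * nu) * exp B) by ring.
    apply Rmult_le_compat; [nra|apply Rlt_le, exp_pos|nra|now apply exp_le]. }
  replace ((1 + z * RtoC mu) * Cexp h - 1)%C
    with (z * RtoC (mu - lam) + (- (z * z * RtoC (mu * lam))) + (1 + z * RtoC mu) * (Cexp h - 1 - h))%C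
    by (unfold h; rewrite RtoC_minus, RtoC_mult; ring).
  eapply Rle_trans; [apply Cmod_triangle|].
  eapply Rle_trans; [apply Rplus_le_compat_r, Cmod_triangle|].
  rewrite Cmod_opp, !Cmod_mult, !Cmod_R.
  assert (T1 : Cmod z * Rabs (mu - lam) <= B * (nu * nu)).
  { apply Rmult_le_compat; auto; [apply Rabs_pos|]. rewrite Rabs_minus_sym, Rabs_pos_eq by lra. lra. }
  assert (T2 : Cmod z * Cmod z * Rabs (mu * lam) <= B * B * (nu * nu)).
  { rewrite Rabs_pos_eq by nra. apply Rmult_le_compat; nra. }
  assert (T3 : Cmod (1 + z * RtoC mu) <= 1 + B).
  { eapply Rle_trans; [apply Cmod_triangle|]. rewrite Cmod_1, Cmod_mult, Cmod_R, Rabs_pos_eq by lra. nra. }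
  assert (T4 : Cmod (1 + z * RtoC mu) * Cmod (Cexp h - 1 - h) <= (1 + B) * ((B * B * exp B) * (nu * nu))).
  { apply Rmult_le_compat; auto; apply Cmod_ge_0. }
  unfold gauss_A. lra.
Qed.

Lemma gauss_A_pos (B : R) : 0 <= B -> 0 <= gauss_A B.
Proof.
  intros H. unfold gauss_A. pose proof (exp_pos B).
  assert (0 <= B * B) by nra. assert (0 <= B * B * exp B) by (apply Rmult_le_pos; lra). nra.
Qed.

Definition gsum (n : nat) : R := 3 - 2 * / (INR n + 1).

Lemma gsum_step (n : nat) : / (INR n + 1) * / (INR n + 1) <= gsum (S n) - gsum n.
Proof.
  unfold gsum. rewrite S_INR. pose proof (pos_INR n).
  replace (3 - 2 * / (INR n + 1 + 1) - (3 - 2 * / (INR n + 1)))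
    with (/ (INR n + 1) * (2 * / (INR n + 2))) by (field; lra).
  apply Rmult_le_compat_l; [apply Rlt_le, Rinv_0_lt_compat; lra|].
  apply Rmult_le_reg_r with ((INR n + 1) * (INR n + 2)); [nra|].
  replace (/ (INR n + 1) * ((INR n + 1) * (INR n + 2))) with (INR n + 2) by (field; lra).
  replace (2 * / (INR n + 2) * ((INR n + 1) * (INR n + 2))) with (2 * (INR n + 1)) by (field; lra). lra.
Qed.

Lemma gsum_bounds (n : nat) : 1 <= gsum n <= 3.
Proof.
  unfold gsum. pose proof (pos_INR n).
  assert (0 < / (INR n + 1)) by (apply Rinv_0_lt_compat; lra).
  assert (/ (INR n + 1) <= 1) by (rewrite <- Rinv_1; apply Rinv_le_contravar; lra). lra.
Qed.

Lemma gauss_diff (z : C) (B : R) (n : nat) : Cmod z <= B ->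
  Cmod (gauss_seq z (S (S n)) - gauss_seq z (S n))
  <= Cmod (gauss_seq z (S n)) * (gauss_A B * (gsum (S n) - gsum n)).
Proof.
  intros HB. rewrite (gauss_ratio z (S n)) by lia.
  pose proof (gauss_ratio_bound z B (S n) ltac:(lia) HB) as H.
  match goal with |- Cmod (?g * ?r - ?g) <= _ => replace (g * r - g)%C with (g * (r - 1))%C by ring end.
  rewrite Cmod_mult. apply Rmult_le_compat_l; [apply Cmod_ge_0|].
  eapply Rle_trans; [exact H|]. apply Rmult_le_compat_l.
  - apply gauss_A_pos. pose proof (Cmod_ge_0 z); lra.
  - rewrite (S_INR n). apply gsum_step.
Qed.

Lemma gauss_bound_exp (z : C) (B : R) (n : nat) : Cmod z <= B ->
  Cmod (gauss_seq z (S n)) <= Cmod (gauss_seq z 1) * exp (gauss_A B * (gsum n - 1)).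
Proof.
  intros HB. pose proof (gauss_A_pos B) as PA. pose proof (Cmod_ge_0 z).
  induction n.
  - replace (gsum 0 - 1) with 0 by (unfold gsum; simpl; field). rewrite Rmult_0_r, exp_0. lra.
  - pose proof (gauss_diff z B n HB) as D.
    pose proof (Cmod_le_plus (gauss_seq z (S (S n))) (gauss_seq z (S n))) as T.
    pose proof (exp_ineq1_le (gauss_A B * (gsum (S n) - gsum n))) as X.
    pose proof (Cmod_ge_0 (gauss_seq z (S n))).
    apply Rle_trans with (Cmod (gauss_seq z (S n)) * exp (gauss_A B * (gsum (S n) - gsum n))).
    + eapply Rle_trans; [exact T|]. nra.
    + replace (gauss_A B * (gsum (S n) - 1)) with (gauss_A B * (gsum n - 1) + gauss_A B * (gsum (S n) - gsum n)) by ring.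
      rewrite exp_plus, <- Rmult_assoc. apply Rmult_le_compat_r; [apply Rlt_le, exp_pos|auto].
Qed.

Lemma gauss_1 (z : C) : gauss_seq z 1 = (z * (z + 1))%C.
Proof.
  unfold gauss_seq. simpl. rewrite ln_1.
  replace (z * RtoC 0)%C with (RtoC 0) by ring. rewrite Cexp_0.
  replace (z + 0)%C with z by ring. field.
Qed.

Definition RG_const (B : R) : R := B * (B + 1) * exp (2 * gauss_A B).

Lemma gauss_bound (z : C) (B : R) (n : nat) : Cmod z <= B -> Cmod (gauss_seq z (S n)) <= RG_const B.
Proof.
  intros HB. eapply Rle_trans; [apply (gauss_bound_exp z B n HB)|]. rewrite gauss_1, Cmod_mult.
  pose proof (Cmod_ge_0 z). pose proof (gauss_A_pos B ltac:(lra)).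
  pose proof (Cmod_triangle z 1). rewrite Cmod_1 in H1. pose proof (gsum_bounds n).
  unfold RG_const. apply Rmult_le_compat.
  - apply Rmult_le_pos; apply Cmod_ge_0.
  - apply Rlt_le, exp_pos.
  - apply Rmult_le_compat; try apply Cmod_ge_0; lra.
  - apply exp_le. nra.
Qed.

Lemma gauss_conv (z : C) : exists l, Clim (gauss_seq z) l.
Proof.
  destruct (Clim_cauchy (fun n => gauss_seq z (S n))) as [l Hl].
  2: { exists l. now apply Clim_S. }
  set (B := Cmod z). pose proof (Cmod_ge_0 z) as PB. fold B in PB.
  pose proof (gauss_A_pos B PB) as PA.
  assert (PK : 0 <= RG_const B).
  { unfold RG_const. apply Rmult_le_pos; [nra|apply Rlt_le, exp_pos]. }
  assert (D : forall n m, Cmod (gauss_seq z (S (n + m)) - gauss_seq z (S n))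
     <= RG_const B * gauss_A B * (gsum (n + m) - gsum n)).
  { intros n m. induction m.
    - rewrite Nat.add_0_r. replace (gauss_seq z (S n) - gauss_seq z (S n))%C with (RtoC 0) by ring.
      rewrite Cmod_0. lra.
    - rewrite Nat.add_succ_r.
      pose proof (gauss_diff z B (n + m) (Rle_refl _)) as D0.
      pose proof (gauss_bound z B (n + m) (Rle_refl _)) as D1.
      pose proof (Cmod_minus_triangle (gauss_seq z (S (S (n + m)))) (gauss_seq z (S (n + m))) (gauss_seq z (S n))).
      pose proof (gsum_step (n + m)).
      assert (0 <= gsum (S (n + m)) - gsum (n + m)).
      { pose proof (pos_INR (n + m)). assert (0 < / (INR (n + m) + 1)) by (apply Rinv_0_lt_compat; lra). nra. }
      assert (Cmod (gauss_seq z (S (n + m))) * (gauss_A B * (gsum (S (n + m)) - gsum (n + m)))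
        <= RG_const B * (gauss_A B * (gsum (S (n + m)) - gsum (n + m)))).
      { apply Rmult_le_compat_r; auto. apply Rmult_le_pos; auto. }
      lra. }
  intros eps He.
  set (K := RG_const B * gauss_A B * 2 + 1).
  assert (HK : 1 <= K) by (unfold K; assert (0 <= RG_const B * gauss_A B) by (apply Rmult_le_pos; auto); lra).
  destruct (archimed_cor1 (eps / (2 * K))) as [N [HN HN']]; [apply Rdiv_lt_0_compat; lra|].
  assert (D' : forall n, (N <= n)%nat -> Cmod (gauss_seq z (S n) - gauss_seq z (S N)) < eps / 2).
  { intros n Hn. replace n with (N + (n - N))%nat by lia.
    eapply Rle_lt_trans; [apply D|]. apply lt_INR in HN'. simpl in HN'.
    assert (gsum (N + (n - N)) - gsum N <= 2 * / INR N).
    { unfold gsum. pose proof (pos_INR (N + (n - N))).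
      assert (0 < / (INR (N + (n - N)) + 1)) by (apply Rinv_0_lt_compat; lra).
      assert (/ (INR N + 1) <= / INR N) by (apply Rinv_le_contravar; lra). lra. }
    apply Rle_lt_trans with (K * / INR N).
    - unfold K. assert (0 < / INR N) by (apply Rinv_0_lt_compat; lra).
      assert (RG_const B * gauss_A B * (gsum (N + (n - N)) - gsum N)
        <= RG_const B * gauss_A B * (2 * / INR N)) by (apply Rmult_le_compat_l; auto; apply Rmult_le_pos; auto).
      lra.
    - apply Rmult_lt_compat_l with (r := K) in HN; [|lra].
      replace (K * (eps / (2 * K))) with (eps / 2) in HN by (field; lra). exact HN. }
  exists N. intros n m Hn Hm. pose proof (D' n Hn). pose proof (D' m Hm).
  pose proof (Cmod_minus_triangle (gauss_seq z (S n)) (gauss_seq z (S N)) (gauss_seq z (S m))).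
  rewrite (Cmod_minus_sym (gauss_seq z (S N))) in H1. lra.
Qed.

Lemma RG_lim (z : C) : Clim (gauss_seq z) (RecipGamma z).
Proof.
  destruct (gauss_conv z) as [l Hl].
  assert (E : RecipGamma z = l).
  { unfold RecipGamma.
    assert (L : forall pr : C -> R, (forall x y : C, Rabs (pr x - pr y) <= Cmod (x - y)) ->
       Lim_seq (fun n => pr (gauss_seq z n)) = pr l).
    { intros pr Hpr. apply is_lim_seq_unique, is_lim_seq_spec. intros eps.
      destruct (Hl eps (cond_pos eps)) as [N K]. exists N. intros n Hn.
      eapply Rle_lt_trans; [apply Hpr|auto]. }
    rewrite (L fst) by (intros; apply (Re_le_Cmod (x - y))).
    rewrite (L snd) by (intros; apply (Im_le_Cmod (x - y))). simpl. now destruct l. }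
  now rewrite E.
Qed.

Lemma RG_bound (z : C) (B : R) : Cmod z <= B -> Cmod (RecipGamma z) <= RG_const B.
Proof.
  intros H. replace (RecipGamma z) with (RecipGamma z - 0)%C by ring.
  apply (Clim_le (fun n => gauss_seq z (S n))).
  - intros eps He. destruct (RG_lim z eps He) as [N K]. exists N. intros n Hn. apply K. lia.
  - intros n. replace (gauss_seq z (S n) - 0)%C with (gauss_seq z (S n)) by ring. now apply gauss_bound.
Qed.

Lemma hol_RG_at (z : C) : hol RecipGamma z.
Proof.
  apply (hol_limit (fun n w => gauss_seq w (S n)) RecipGamma z 1 (RG_const (Cmod z + 1))); [lra| | |].
  - intros n w _. unfold gauss_seq. apply hol_div.
    + apply (hol_Cprod (S (S n)) (fun k w => w + RtoC (INR k))%C).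
      intros i _. apply hol_plus; [apply hol_id|apply hol_const].
    + apply hol_mult; [apply hol_const|]. apply hol_Cexp. apply hol_mult; [apply hol_id|apply hol_const].
    + apply Cmult_neq_0; [apply fact_neq0C|apply Cexp_neq0].
  - intros n w Hw. apply gauss_bound. pose proof (Cmod_le_plus w z). lra.
  - intros w _ eps He. destruct (RG_lim w eps He) as [N K]. exists N. intros n Hn. apply K. lia.
Qed.

Lemma hol_RG (f : C -> C) (z : C) : hol f z -> hol (fun w => RecipGamma (f w)) z.
Proof. intros H. apply (hol_comp RecipGamma f); auto. apply hol_RG_at. Qed.

Lemma Cprod_shift (n : nat) (z : C) :
  (z * Cprod n (fun k => 1 + z + RtoC (INR k)) = Cprod (S n) (fun k => z + RtoC (INR k)))%C.
Proof.
  induction n.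
  - simpl. ring.
  - change (Cprod (S (S n)) (fun k => z + RtoC (INR k)))%C
      with (Cprod (S n) (fun k => z + RtoC (INR k)) * (z + RtoC (INR (S n))))%C.
    rewrite <- IHn. change (Cprod (S n) (fun k => 1 + z + RtoC (INR k)))%C
      with (Cprod n (fun k => 1 + z + RtoC (INR k)) * (1 + z + RtoC (INR n)))%C.
    rewrite S_INR, RtoC_plus. ring.
Qed.

Lemma Cexp_ln (n : nat) : Cexp (RtoC (ln (INR (S n)))) = RtoC (INR (S n)).
Proof.
  assert (H : 0 < INR (S n)) by apply lt_0_INR, Nat.lt_0_succ.
  revert H. generalize (INR (S n)). intros x H.
  unfold Cexp; simpl fst; simpl snd. rewrite exp_ln by auto.
  rewrite cos_0, sin_0. apply injective_projections; simpl; ring.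
Qed.

Lemma RG_succ (z : C) : RecipGamma z = (z * RecipGamma (1 + z))%C.
Proof.
  apply (Clim_unique (fun n => z * gauss_seq (1 + z) n)%C).
  2: { apply Clim_mult; [apply Clim_const|apply RG_lim]. }
  replace (RecipGamma z) with (RecipGamma z * (1 + 0))%C by ring.
  apply (Clim_ext_S (fun n => gauss_seq z n * (1 + (1 + z) * RtoC (/ INR n)))%C).
  - intros n.
    assert (HS : INR (S n) <> 0) by (apply not_0_INR; lia).
    unfold gauss_seq.
    replace (Cexp ((1 + z) * RtoC (ln (INR (S n)))))%C
      with (RtoC (INR (S n)) * Cexp (z * RtoC (ln (INR (S n)))))%C.
    2: { rewrite <- (Cexp_ln n), <- Cexp_plus. f_equal. ring. }
    rewrite RtoC_inv by auto.
    rewrite <- (Cprod_shift (S n)).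
    change (Cprod (S (S n)) (fun k => 1 + z + RtoC (INR k)))%C
      with (Cprod (S n) (fun k => 1 + z + RtoC (INR k)) * (1 + z + RtoC (INR (S n))))%C.
    field. repeat split; first [now apply RtoC_neq0|apply Cexp_neq0|apply fact_neq0C].
  - apply Clim_mult; [apply RG_lim|]. apply Clim_plus; [apply Clim_const|apply Clim_inv_INR].
Qed.

Lemma RG_1 : RecipGamma 1 = 1.
Proof.
  apply (Clim_unique (gauss_seq 1)); [apply RG_lim|].
  apply (Clim_ext_S (fun n => 1 + 1 * RtoC (/ INR n))%C).
  - intros n.
    assert (HS : INR (S n) <> 0) by (apply not_0_INR; lia).
    assert (F : forall m, Cprod m (fun k => (1 + RtoC (INR k))%C) = RtoC (INR (fact m))).
    { induction m; [reflexivity|].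
      change (Cprod (S m) (fun k => (1 + RtoC (INR k))%C)) with (Cprod m (fun k => (1 + RtoC (INR k))%C) * (1 + RtoC (INR m)))%C.
      rewrite IHm. change (fact (S m)) with (S m * fact m)%nat.
      rewrite mult_INR, S_INR, RtoC_mult, RtoC_plus. ring. }
    unfold gauss_seq. rewrite F.
    replace (1 * RtoC (ln (INR (S n))))%C with (RtoC (ln (INR (S n)))) by ring. rewrite Cexp_ln.
    change (fact (S (S n))) with (S (S n) * fact (S n))%nat.
    rewrite mult_INR, (S_INR (S n)), RtoC_mult, RtoC_plus, RtoC_inv by auto.
    field. split; first [now apply RtoC_neq0|apply fact_neq0C].
  - apply (eq_rect (1 + 0)%C (Clim _)); [|ring].
    apply Clim_plus; [apply Clim_const|apply Clim_inv_INR].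
Qed.

(** * Euler's reflection formula *)

Definition ccos (u : C) : C := ((Cexp (Ci * u) + Cexp (- (Ci * u))) / RtoC 2)%C.
Definition csin (u : C) : C := ((Cexp (Ci * u) - Cexp (- (Ci * u))) / (RtoC 2 * Ci))%C.

Lemma Rder_plus (f g : R -> C) (t : R) (a b : C) :
  Rder f t a -> Rder g t b -> Rder (fun s => f s + g s)%C t (a + b).
Proof.
  intros Hf Hg eps He. destruct (Hf (eps/2)) as [d [Hd K]]; [lra|].
  destruct (Hg (eps/2)) as [d' [Hd' K']]; [lra|].
  exists (Rmin d d'); split; [now apply Rmin_glb_lt|]. intros s Hs.
  assert (H1 : Rabs (s - t) < d) by (eapply Rlt_le_trans; [exact Hs|apply Rmin_l]).
  assert (H2 : Rabs (s - t) < d') by (eapply Rlt_le_trans; [exact Hs|apply Rmin_r]).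
  specialize (K s H1). specialize (K' s H2).
  replace (f s + g s - (f t + g t) - (a + b) * RtoC (s - t))%C
    with ((f s - f t - a * RtoC (s - t)) + (g s - g t - b * RtoC (s - t)))%C by ring.
  eapply Rle_trans; [apply Cmod_triangle|]. lra.
Qed.

Lemma Rder_scal (f : R -> C) (t : R) (c a : C) : Rder f t a -> Rder (fun s => c * f s)%C t (c * a).
Proof.
  intros H. apply (Rder_comp (fun z => c * z)%C f t c a); auto.
  apply (eq_rect (0 * f t + c * 1)%C (Cder (fun z => c * z)%C (f t))); [|ring].
  apply Cder_mult; [apply Cder_const|apply Cder_id].
Qed.

Lemma Rder_RtoC (f : R -> R) (t a : R) : is_derive f t a -> Rder (fun s => RtoC (f s)) t (RtoC a).
Proof. intros H. apply (Rder_pair f (fun _ => 0)); auto. apply (@is_derive_const R_AbsRing). Qed.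

(* [4 f g = (f+g)^2 - (f-g)^2] and the chain rule for the square. *)
Lemma Rder_mult (f g : R -> C) (t : R) (a b : C) :
  Rder f t a -> Rder g t b -> Rder (fun s => f s * g s)%C t (a * g t + f t * b).
Proof.
  intros Hf Hg.
  assert (Sq : forall k c, Rder k t c -> Rder (fun s => k s * k s)%C t (2 * k t * c)).
  { intros k c Hk. apply (Rder_comp (fun z => z * z)%C k t (2 * k t) c); auto.
    apply (eq_rect (1 * k t + k t * 1)%C (Cder (fun z => z * z)%C (k t))); [|ring].
    apply Cder_mult; apply Cder_id. }
  pose proof (Rder_scal _ _ (- (1)) _ Hg) as Hg'.
  pose proof (Sq _ _ (Rder_plus _ _ _ _ _ Hf Hg)) as S1.
  pose proof (Sq _ _ (Rder_plus _ _ _ _ _ Hf Hg')) as S2.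
  pose proof (Rder_plus _ _ _ _ _ (Rder_scal _ _ (/ 4) _ S1) (Rder_scal _ _ (- / 4) _ S2)) as S.
  cbv beta in S.
  intros eps He. destruct (S eps He) as [d [Hd K]]. exists d; split; auto.
  intros s Hs. specialize (K s Hs). eapply Rle_trans; [|exact K]. right. f_equal. field.
Qed.

Lemma Rder_ext (f g : R -> C) (t : R) (l : C) : (forall s, f s = g s) -> Rder f t l -> Rder g t l.
Proof.
  intros H Hf eps He. destruct (Hf eps He) as [d [Hd K]]. exists d; split; auto.
  intros s Hs. rewrite <- !H. auto.
Qed.

Lemma Rder_ccos (c : C) (t : R) : Rder (fun s => ccos (c * RtoC s)) t (- (c * csin (c * RtoC t))).
Proof.
  pose proof (Rder_Cexp_line (Ci * c) t) as H1. pose proof (Rder_Cexp_line (- (Ci * c)) t) as H2.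
  pose proof (Rder_scal _ _ (/ 2) _ (Rder_plus _ _ _ _ _ H1 H2)) as H.
  cbv beta in H.
  unfold ccos, csin.
  replace (Ci * (c * RtoC t))%C with (RtoC t * (Ci * c))%C by ring.
  replace (- (RtoC t * (Ci * c)))%C with (RtoC t * - (Ci * c))%C by ring.
  match goal with |- Rder _ _ ?v => match type of H with Rder _ _ ?w => replace v with w end end.
  - eapply Rder_ext; [|exact H]. intros s; cbv beta.
    replace (Ci * (c * RtoC s))%C with (RtoC s * (Ci * c))%C by ring.
    replace (- (RtoC s * (Ci * c)))%C with (RtoC s * - (Ci * c))%C by ring. field.
  - set (X := Cexp _). set (Y := Cexp _).
    assert (I2 : (Ci * Ci = - (1))%C) by (apply injective_projections; simpl; ring).
    assert (NI : Ci <> 0) by (intros E; injection E; lra).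
    transitivity (Ci * Ci * c * (X - Y) / (2 * Ci))%C; [field; auto|]. rewrite I2. field; auto.
Qed.

Lemma Rder_csin (c : C) (t : R) : Rder (fun s => csin (c * RtoC s)) t (c * ccos (c * RtoC t)).
Proof.
  assert (NI : Ci <> 0) by (intros E; injection E; lra).
  pose proof (Rder_Cexp_line (Ci * c) t) as H1.
  pose proof (Rder_scal _ _ (- (1)) _ (Rder_Cexp_line (- (Ci * c)) t)) as H2.
  pose proof (Rder_scal _ _ (/ (2 * Ci)) _ (Rder_plus _ _ _ _ _ H1 H2)) as H.
  cbv beta in H. unfold ccos, csin.
  replace (Ci * (c * RtoC t))%C with (RtoC t * (Ci * c))%C by ring.
  replace (- (RtoC t * (Ci * c)))%C with (RtoC t * - (Ci * c))%C by ring.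
  match goal with |- Rder _ _ ?v => match type of H with Rder _ _ ?w => replace v with w end end.
  - eapply Rder_ext; [|exact H]. intros s; cbv beta.
    replace (Ci * (c * RtoC s))%C with (RtoC s * (Ci * c))%C by ring.
    replace (- (RtoC s * (Ci * c)))%C with (RtoC s * - (Ci * c))%C by ring. field; auto.
  - field; auto.
Qed.

Lemma csin_0 : csin 0 = 0.
Proof.
  unfold csin. replace (Ci * 0)%C with (RtoC 0) by ring. replace (- 0)%C with (RtoC 0) by ring.
  field. intros E; injection E; lra.
Qed.

Lemma csin_Csin (z : C) : csin z = Csin z.
Proof. reflexivity. Qed.

(* The integral of [cos(2 z x) cos(x)^(2m)] over [0, PI/2]; its recursion in [m] produces the
   factors of Euler's product, and its ratio to the value at [z = 0] tends to 1. *)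
Definition wint (z : C) (m : nat) : C :=
  cint (fun x => ccos (2 * z * RtoC x) * RtoC (cos x ^ (2 * m)))%C 0 (PI / 2).

Lemma Rcont_wint (z : C) (m : nat) (x : R) :
  Rcont (fun x => ccos (2 * z * RtoC x) * RtoC (cos x ^ m))%C x.
Proof.
  apply Rcont_mult; [eapply Rder_cont, Rder_ccos|].
  eapply Rder_cont, Rder_RtoC. auto_derive; auto.
Qed.

Lemma is_cint_wint (z : C) (m : nat) :
  is_cint (fun x => ccos (2 * z * RtoC x) * RtoC (cos x ^ (2 * m)))%C 0 (PI / 2) (wint z m).
Proof. apply ex_cint. intros t _. apply Rcont_wint. Qed.

Lemma wint_rec (z : C) (m : nat) :
  ((RtoC (INR (S m)) * RtoC (INR (S m)) - z * z) * wint z (S m)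
   = RtoC (INR (S m)) * RtoC (INR (S m) - / 2) * wint z m)%C.
Proof.
  set (c := (2 * z)%C). set (n := (2 * S m)%nat). set (N := INR n).
  assert (EN : N = 2 * INR (S m)) by (unfold N, n; rewrite mult_INR; simpl; ring).
  set (G := fun x : R => (RtoC N * (RtoC (cos x ^ (2 * m + 1) * sin x) * ccos (c * RtoC x))
       + - c * (RtoC (cos x ^ n) * csin (c * RtoC x)))%C).
  set (g := fun x : R => ((RtoC (N * N) - c * c) * (ccos (c * RtoC x) * RtoC (cos x ^ n))
       - RtoC (N * (N - 1)) * (ccos (c * RtoC x) * RtoC (cos x ^ (2 * m))))%C).
  assert (Dg : forall x, Rder G x (g x)).
  { intros x.
    assert (D1 : Rder (fun x => RtoC (cos x ^ (2 * m + 1) * sin x)) x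
       (RtoC (N * cos x ^ n - (N - 1) * cos x ^ (2 * m)))).
    { apply Rder_RtoC. auto_derive; auto.
      replace (pred (m + (m + 0) + 1)) with (2 * m)%nat by lia.
      assert (EI : INR (m + (m + 0) + 1) = N - 1).
      { replace N with (INR (m + (m + 0) + 1) + 1); [ring|].
        unfold N. rewrite <- S_INR. f_equal. unfold n. lia. }
      rewrite EI. replace n with (2 * m + 2)%nat by (unfold n; lia).
      pose proof (sin2_cos2 x) as S. unfold Rsqr in S.
      replace (m + (m + 0))%nat with (2 * m)%nat by lia.
      rewrite !pow_add. set (p := cos x ^ (2 * m)). simpl.
      transitivity (p * (cos x * cos x) - (N - 1) * p * (sin x * sin x)); [ring|].
      replace (sin x * sin x) with (1 - cos x * cos x) by lra. ring. }
    assert (D2 : Rder (fun x => RtoC (cos x ^ n)) x (RtoC (- N * (cos x ^ (2 * m + 1) * sin x)))).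
    { assert (P : forall k, is_derive (fun x => cos x ^ k) x (- INR k * (cos x ^ pred k * sin x))).
      { intros k. auto_derive; auto. ring. }
      apply Rder_RtoC. replace (2 * m + 1)%nat with (pred n) by (unfold n; lia). apply P. }
    pose proof (Rder_scal _ _ (RtoC N) _ (Rder_mult _ _ _ _ _ D1 (Rder_ccos c x))) as A1.
    pose proof (Rder_scal _ _ (- c)%C _ (Rder_mult _ _ _ _ _ D2 (Rder_csin c x))) as A2.
    pose proof (Rder_plus _ _ _ _ _ A1 A2) as A.
    match type of A with Rder _ _ ?w => replace (g x) with w; [exact A|] end.
    unfold g. rewrite !RtoC_minus, !RtoC_mult, !RtoC_opp, !RtoC_minus. ring. }
  assert (Cg : forall x, Rcont g x).
  { intros x. unfold g, Cminus. apply Rcont_plus.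
    - apply Rcont_mult; [apply Rcont_const|apply Rcont_wint].
    - apply (Rcont_ext (fun s => (- RtoC (N * (N - 1))) * (ccos (c * RtoC s) * RtoC (cos s ^ (2 * m))))%C).
      + intros; ring.
      + apply Rcont_mult; [apply Rcont_const|apply Rcont_wint]. }
  pose proof (is_cint_derive G g 0 (PI / 2) (fun t _ => Dg t) (fun t _ => Cg t)) as I1.
  assert (E0 : G 0 = 0).
  { unfold G. rewrite sin_0. replace (c * RtoC 0)%C with (RtoC 0) by ring. rewrite csin_0, Rmult_0_r. ring. }
  assert (E1 : G (PI / 2) = 0).
  { unfold G. rewrite cos_PI2. unfold n. rewrite !pow_i by lia. rewrite Rmult_0_l. ring. }
  rewrite E0, E1 in I1.
  pose proof (is_cint_minus _ _ _ _ _ _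
     (is_cint_scal _ _ _ (RtoC (N * N) - c * c)%C _ (is_cint_wint z (S m)))
     (is_cint_scal _ _ _ (RtoC (N * (N - 1))) _ (is_cint_wint z m))) as I2.
  pose proof (is_cint_uniq _ _ _ _ _ I1 I2) as E.
  assert (E' : ((RtoC (N * N) - c * c) * wint z (S m) = RtoC (N * (N - 1)) * wint z m)%C).
  { transitivity ((RtoC (N * N) - c * c) * wint z (S m) - (0 - 0))%C; [ring|]. rewrite E. ring. }
  rewrite EN in E'. unfold c in E'.
  transitivity (/ 4 * ((RtoC (2 * INR (S m) * (2 * INR (S m))) - 2 * z * (2 * z)) * wint z (S m)))%C.
  - rewrite !RtoC_mult. field.
  - rewrite E'. replace (2 * INR (S m) * (2 * INR (S m) - 1)) with (4 * (INR (S m) * (INR (S m) - / 2))) by field.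
    rewrite !RtoC_mult. field.
Qed.

Lemma ccos_2z0 (x : R) : ccos (2 * 0 * RtoC x) = 1.
Proof.
  unfold ccos. replace (Ci * (2 * 0 * RtoC x))%C with (RtoC 0) by ring.
  replace (- 0)%C with (RtoC 0) by ring. rewrite Cexp_0. field.
Qed.

Lemma is_RInt_wallis (m : nat) : is_RInt (fun x => cos x ^ (2 * m)) 0 (PI / 2) (fst (wint 0 m)).
Proof.
  pose proof (is_RInt_fct_extend_fst _ _ _ _ (is_cint_wint 0 m)) as H.
  eapply is_RInt_ext; [|exact H]. intros x _. cbv beta. rewrite ccos_2z0. generalize (cos x ^ (2 * m)). intros p. simpl. ring.
Qed.

Lemma wallis_pos (m : nat) : 0 < fst (wint 0 m).
Proof.
  induction m.
  - pose proof (is_RInt_wallis 0) as H.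
    assert (E : is_RInt (fun x => cos x ^ (2 * 0)) 0 (PI / 2) ((PI / 2 - 0) * 1)).
    { apply (@is_RInt_const R_NormedModule). }
    rewrite <- (is_RInt_unique _ _ _ _ H), (is_RInt_unique _ _ _ _ E). pose proof PI_RGT_0. lra.
  - pose proof (wint_rec 0 m) as E. apply (f_equal fst) in E. simpl fst in E.
    assert (P : 1 <= INR (S m)) by (rewrite S_INR; pose proof (pos_INR m); lra).
    set (q := INR (S m)) in *.
    assert (E' : q * q * fst (wint 0 (S m)) = q * (q - / 2) * fst (wint 0 m)).
    { ring_simplify in E. ring_simplify. exact E. }
    assert (0 < q * (q - / 2) * fst (wint 0 m)) by (repeat apply Rmult_lt_0_compat; lra).
    rewrite <- E' in H. apply Rmult_lt_reg_l with (q * q); [nra|]. lra.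
Qed.

Lemma wint0_real (m : nat) : wint 0 m = RtoC (fst (wint 0 m)).
Proof.
  apply injective_projections; [reflexivity|]. change (snd (wint 0 m) = 0).
  pose proof (is_RInt_fct_extend_snd _ _ _ _ (is_cint_wint 0 m)) as H.
  assert (E : is_RInt (fun _ : R => 0) 0 (PI / 2) 0).
  { apply (eq_rect ((PI / 2 - 0) * 0) (is_RInt (fun _ : R => 0) 0 (PI / 2))); [|ring].
    apply (@is_RInt_const R_NormedModule). }
  etransitivity; [symmetry; apply (is_RInt_unique _ _ _ _ H)|]. apply is_RInt_unique.
  eapply is_RInt_ext; [|exact E]. intros x _. cbv beta. rewrite ccos_2z0. generalize (cos x ^ (2 * m)). intros p. simpl. ring.
Qed.

Lemma sin_ge_third (x : R) : 0 <= x <= PI / 2 -> x / 3 <= sin x.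
Proof.
  intros H. pose proof PI_4 as P4.
  destruct (pre_sin_bound x 0) as [L _]; [lra|lra|].
  unfold sin_approx, sin_term in L. simpl in L.
  assert (x * x <= 4) by nra. nra.
Qed.

Lemma ccos_bound (u : C) : Cmod (ccos u - 1) <= Cmod u * Cmod u * exp (Cmod u).
Proof.
  pose proof (Cexp_bound2 (Ci * u)) as H1. pose proof (Cexp_bound2 (- (Ci * u))) as H2.
  rewrite Cmod_opp in H2. rewrite Cmod_mult, Cmod_Ci, Rmult_1_l in H1, H2.
  replace (ccos u - 1)%C with (/ 2 * ((Cexp (Ci * u) - 1 - Ci * u) + (Cexp (- (Ci * u)) - 1 - - (Ci * u))))%C
    by (unfold ccos; field).
  rewrite Cmod_mult.
  replace (Cmod (/ 2)) with (/ 2).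
  2: { rewrite Cmod_inv by (apply RtoC_neq0; lra). rewrite Cmod_R, Rabs_pos_eq; lra. }
  pose proof (Cmod_triangle (Cexp (Ci * u) - 1 - Ci * u) (Cexp (- (Ci * u)) - 1 - - (Ci * u))). lra.
Qed.

Lemma wint_ratio_lim (z : C) : Clim (fun m => wint z m / wint 0 m)%C 1.
Proof.
  set (U := 2 * Cmod z * 2). pose proof (Cmod_ge_0 z) as Pz.
  assert (PU : 0 <= U) by (unfold U; lra).
  set (K := 4 * (Cmod z * Cmod z) * exp U * 9).
  assert (PK : 0 <= K).
  { unfold K. pose proof (exp_pos U). assert (0 <= Cmod z * Cmod z) by nra.
    assert (0 <= Cmod z * Cmod z * exp U) by (apply Rmult_le_pos; lra). lra. }
  assert (B : forall m, Cmod (wint z m / wint 0 m - 1) <= K * / (2 * INR (S m))).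
  { intros m. pose proof (wallis_pos m) as Pm.
    assert (Nm : wint 0 m <> 0) by (rewrite wint0_real; apply RtoC_neq0; lra).
    replace (wint z m / wint 0 m - 1)%C with ((wint z m - wint 0 m) / wint 0 m)%C by (field; auto).
    rewrite Cmod_div by auto. rewrite (wint0_real m) at 2. rewrite Cmod_R, Rabs_pos_eq by lra.
    assert (D : Cmod (wint z m - wint 0 m) <= K * (fst (wint 0 m) - fst (wint 0 (S m)))).
    { pose proof (is_cint_minus _ _ _ _ _ _ (is_cint_wint z m) (is_cint_wint 0 m)) as I.
      pose proof PI_RGT_0 as PP.
      assert (J : is_RInt (fun x => K * (cos x ^ (2 * m) - cos x ^ (2 * S m))) 0 (PI / 2)
         (K * (fst (wint 0 m) - fst (wint 0 (S m))))).
      { apply (@is_RInt_scal R_NormedModule).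
        apply (@is_RInt_minus R_NormedModule); apply is_RInt_wallis. }
      eapply is_cint_le; [| |exact I|exact J]; [lra|].
      intros x Hx. cbv beta.
      rewrite ccos_2z0.
      replace (ccos (2 * z * RtoC x) * RtoC (cos x ^ (2 * m)) - 1 * RtoC (cos x ^ (2 * m)))%C
        with ((ccos (2 * z * RtoC x) - 1) * RtoC (cos x ^ (2 * m)))%C by ring.
      rewrite Cmod_mult, Cmod_R.
      assert (C0 : 0 <= cos x) by (apply cos_ge_0; lra).
      assert (Cp : 0 <= cos x ^ (2 * m)) by (apply pow_le; auto).
      rewrite Rabs_pos_eq by auto.
      replace (cos x ^ (2 * S m)) with (cos x ^ (2 * m) * (cos x * cos x))
        by (replace (2 * S m)%nat with (2 * m + 2)%nat by lia; rewrite pow_add; simpl; ring).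
      pose proof (sin2_cos2 x) as S. unfold Rsqr in S.
      replace (K * (cos x ^ (2 * m) - cos x ^ (2 * m) * (cos x * cos x)))
        with (K * (sin x * sin x) * cos x ^ (2 * m))
        by (replace (sin x * sin x) with (1 - cos x * cos x) by lra; ring).
      apply Rmult_le_compat_r; auto.
      eapply Rle_trans; [apply ccos_bound|].
      pose proof (sin_ge_third x Hx) as S3. pose proof PI_4 as P4.
      rewrite !Cmod_mult, !Cmod_R, (Rabs_pos_eq 2), (Rabs_pos_eq x) by lra.
      assert (E1 : exp (2 * Cmod z * x) <= exp U) by (apply exp_le; unfold U; apply Rmult_le_compat_l; lra).
      assert (E2 : x * x <= 9 * (sin x * sin x)) by nra.
      unfold K.
      replace (2 * Cmod z * x * (2 * Cmod z * x) * exp (2 * Cmod z * x))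
        with (4 * (Cmod z * Cmod z) * (exp (2 * Cmod z * x) * (x * x))) by ring.
      replace (4 * (Cmod z * Cmod z) * exp U * 9 * (sin x * sin x))
        with (4 * (Cmod z * Cmod z) * (exp U * (9 * (sin x * sin x)))) by ring.
      apply Rmult_le_compat_l; [nra|]. apply Rmult_le_compat; [apply Rlt_le, exp_pos|nra|auto|auto]. }
    assert (R0 : fst (wint 0 m) - fst (wint 0 (S m)) = fst (wint 0 m) * / (2 * INR (S m))).
    { pose proof (wint_rec 0 m) as E. apply (f_equal fst) in E. simpl fst in E.
      assert (P : 1 <= INR (S m)) by (rewrite S_INR; pose proof (pos_INR m); lra).
      set (q := INR (S m)) in *.
      assert (E' : q * q * fst (wint 0 (S m)) = q * (q - / 2) * fst (wint 0 m)).
      { ring_simplify in E. ring_simplify. exact E. }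
      apply Rmult_eq_reg_l with (q * q); [|nra].
      rewrite Rmult_minus_distr_l, E'. field. lra. }
    rewrite R0 in D. apply Rmult_le_reg_r with (fst (wint 0 m)); auto.
    unfold Rdiv. rewrite Rmult_assoc, Rinv_l, Rmult_1_r by lra. lra. }
  intros eps He.
  destruct (archimed_cor1 (eps / (K + 1))) as [N [HN HN']]; [apply Rdiv_lt_0_compat; lra|].
  exists N. intros n Hn. eapply Rle_lt_trans; [apply B|].
  apply le_INR in Hn. apply lt_INR in HN'. simpl in HN'.
  assert (/ (2 * INR (S n)) <= / INR N) by (apply Rinv_le_contravar; [lra|rewrite S_INR; lra]).
  assert (0 < / INR N) by (apply Rinv_0_lt_compat; lra).
  apply Rle_lt_trans with ((K + 1) * / INR N).
  - assert (K * / (2 * INR (S n)) <= K * / INR N) by (apply Rmult_le_compat_l; auto). lra.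
  - apply Rmult_lt_compat_l with (r := K + 1) in HN; [|lra].
    replace ((K + 1) * (eps / (K + 1))) with eps in HN by (field; lra). exact HN.
Qed.

Lemma wint_0 (z : C) : (z * (wint z 0 / wint 0 0))%C = sg z.
Proof.
  assert (E0 : wint 0 0 = RtoC (PI / 2)).
  { rewrite wint0_real. f_equal. rewrite <- (is_RInt_unique _ _ _ _ (is_RInt_wallis 0)).
    apply is_RInt_unique. apply (eq_rect ((PI / 2 - 0) * 1) (is_RInt _ 0 (PI / 2))); [|ring].
    apply (@is_RInt_const R_NormedModule). }
  assert (E1 : (2 * z * wint z 0 = csin (RtoC PI * z))%C).
  { assert (I : is_cint (fun x => 2 * z * ccos (2 * z * RtoC x))%C 0 (PI / 2)
       (csin (2 * z * RtoC (PI / 2)) - csin (2 * z * RtoC 0))).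
    { apply (is_cint_derive (fun x => csin (2 * z * RtoC x))).
      - intros t _; apply Rder_csin.
      - intros t _. apply Rcont_mult; [apply Rcont_const|eapply Rder_cont, Rder_ccos]. }
    pose proof (is_cint_scal _ _ _ (2 * z)%C _ (is_cint_wint z 0)) as J.
    transitivity (csin (2 * z * RtoC (PI / 2)) - csin (2 * z * RtoC 0))%C.
    - eapply is_cint_uniq; [exact J|]. eapply is_cint_ext; [|exact I].
      intros x _. cbv beta. simpl pow. ring.
    - replace (2 * z * RtoC 0)%C with (RtoC 0) by ring. rewrite csin_0.
      replace (2 * z * RtoC (PI / 2))%C with (RtoC PI * z)%C; [ring|].
      rewrite RtoC_div by lra. field. }
  rewrite E0. unfold sg. rewrite <- csin_Csin, <- E1. rewrite RtoC_div by lra. field. apply PI_neq0C.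
Qed.

Lemma RG_reflect (z : C) : (RecipGamma z * RecipGamma (1 - z) = sg z)%C.
Proof.
  assert (Nm : forall m, wint 0 m <> 0).
  { intros m. rewrite wint0_real; apply RtoC_neq0. pose proof (wallis_pos m). lra. }
  (* the product of the two Gauss sequences is z prod (1 - z^2/k^2) up to a factor tending to 1 *)
  assert (Pr : forall m, (Cprod (S m) (fun k => z + RtoC (INR k)) * Cprod m (fun k => 1 - z + RtoC (INR k))
     * (wint z m / wint 0 m) = sg z * RtoC (INR (fact m) * INR (fact m)))%C).
  { induction m.
    - rewrite <- wint_0. cbn [Cprod fact INR]. rewrite Rmult_1_r. ring.
    - change (Cprod (S (S m)) (fun k => z + RtoC (INR k)))%C
        with (Cprod (S m) (fun k => z + RtoC (INR k)) * (z + RtoC (INR (S m))))%C.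
      change (Cprod (S m) (fun k => 1 - z + RtoC (INR k)))%C
        with (Cprod m (fun k => 1 - z + RtoC (INR k)) * (1 - z + RtoC (INR m)))%C.
      change (fact (S m)) with (S m * fact m)%nat. rewrite mult_INR.
      replace (1 - z + RtoC (INR m))%C with (RtoC (INR (S m)) - z)%C by (rewrite S_INR, RtoC_plus; ring).
      pose proof (wint_rec z m) as R1. pose proof (wint_rec 0 m) as R0.
      set (q := RtoC (INR (S m))) in *.
      assert (Nq : q <> 0) by (apply RtoC_neq0, not_0_INR; lia).
      assert (Nh : RtoC (INR (S m) - / 2) <> 0).
      { apply RtoC_neq0. rewrite S_INR. pose proof (pos_INR m). lra. }
      assert (E : ((q * q - z * z) * (wint z (S m) / wint 0 (S m)) = q * q * (wint z m / wint 0 m))%C).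
      { assert (E0 : (q * wint 0 (S m) = RtoC (INR (S m) - / 2) * wint 0 m)%C).
        { transitivity (/ q * ((q * q - 0 * 0) * wint 0 (S m)))%C; [field; auto|]. rewrite R0. field; auto. }
        transitivity ((q * q - z * z) * wint z (S m) / wint 0 (S m))%C; [field; auto|].
        rewrite R1. transitivity (q * q * RtoC (INR (S m) - / 2) * wint z m / (q * wint 0 (S m)))%C;
          [field; auto|]. rewrite E0. field; auto. }
      transitivity (Cprod (S m) (fun k => z + RtoC (INR k)) * Cprod m (fun k => 1 - z + RtoC (INR k))
        * ((q * q - z * z) * (wint z (S m) / wint 0 (S m))))%C; [ring|].
      rewrite E.
      transitivity (q * q * (Cprod (S m) (fun k => z + RtoC (INR k)) * Cprod m (fun k => 1 - z + RtoC (INR k))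
        * (wint z m / wint 0 m)))%C; [ring|].
      rewrite IHm. unfold q. rewrite !RtoC_mult. ring. }
  apply (Clim_unique (fun m => gauss_seq z m * gauss_seq (1 - z) m * (wint z m / wint 0 m))%C).
  - apply (eq_rect (RecipGamma z * RecipGamma (1 - z) * 1)%C (Clim _)); [|ring].
    apply Clim_mult; [|apply wint_ratio_lim]. apply Clim_mult; apply RG_lim.
  - apply (Clim_ext_S (fun m => sg z * (1 + (1 - z) * RtoC (/ INR m)))%C).
    + intros m.
      assert (HS : INR (S m) <> 0) by (apply not_0_INR; lia).
      specialize (Pr (S m)). unfold gauss_seq.
      set (c := RtoC (ln (INR (S m)))).
      assert (Ec : (Cexp (z * c) * Cexp ((1 - z) * c) = RtoC (INR (S m)))%C).
      { rewrite <- Cexp_plus. replace (z * c + (1 - z) * c)%C with c by ring. apply Cexp_ln. }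
      change (Cprod (S (S m)) (fun k => 1 - z + RtoC (INR k)))%C
        with (Cprod (S m) (fun k => 1 - z + RtoC (INR k)) * (1 - z + RtoC (INR (S m))))%C.
      set (P := Cprod (S (S m)) (fun k => z + RtoC (INR k))%C) in *.
      set (Q := Cprod (S m) (fun k => 1 - z + RtoC (INR k))%C) in *.
      set (f := RtoC (INR (fact (S m)))).
      assert (Nf : f <> 0) by apply fact_neq0C.
      assert (Nq : RtoC (INR (S m)) <> 0) by now apply RtoC_neq0.
      rewrite RtoC_inv by auto.
      transitivity (P * Q * (wint z (S m) / wint 0 (S m)) * (1 - z + RtoC (INR (S m)))
        / (f * f * (Cexp (z * c) * Cexp ((1 - z) * c))))%C.
      * rewrite Pr, Ec. rewrite RtoC_mult. fold f. field. auto.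
      * field. repeat split; auto using Cexp_neq0.
    + apply (eq_rect (sg z * (1 + 0))%C (Clim _)); [|ring].
      apply Clim_mult; [apply Clim_const|]. apply Clim_plus; [apply Clim_const|apply Clim_inv_INR].
Qed.

(** * Zeros and growth of the reciprocal Gamma function *)

Lemma RG_succ_reflect (x : C) : (x * (RecipGamma (1 + x) * RecipGamma (1 - x)) = sg x)%C.
Proof. rewrite <- RG_reflect, (RG_succ x). ring. Qed.

Lemma RG_neq0_1p (x : C) : -1 < fst x < 1 -> RecipGamma (1 + x) <> 0.
Proof.
  intros Hx E. destruct (excluded_middle_informative (x = 0)) as [->|n].
  - replace (1 + 0)%C with (RtoC 1) in E by ring. rewrite RG_1 in E. injection E; lra.
  - apply (sg_neq0 x Hx n). rewrite <- RG_succ_reflect, E. ring.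
Qed.

Lemma RG_neq0 (z : C) : -1 < fst z < 1 -> z <> 0 -> RecipGamma z <> 0.
Proof. intros Hz n. rewrite RG_succ. apply Cmult_neq_0; auto. now apply RG_neq0_1p. Qed.

Lemma gauss_mono (x y : R) (n : nat) : 1 <= x ->
  Cmod (gauss_seq (x, y) n * gauss_seq 1 n) <= Cmod (gauss_seq (x, 0) n * gauss_seq (1, y) n).
Proof.
  intros Hx.
  assert (P : forall m, Cmod (Cprod m (fun k => (x, y) + RtoC (INR k)) * Cprod m (fun k => 1 + RtoC (INR k)))%C
    <= Cmod (Cprod m (fun k => (x, 0) + RtoC (INR k)) * Cprod m (fun k => (1, y) + RtoC (INR k)))%C).
  { induction m; [simpl; lra|]. cbn [Cprod].
    replace (Cprod m (fun k => (x, y) + RtoC (INR k)) * ((x, y) + RtoC (INR m)) *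
       (Cprod m (fun k => 1 + RtoC (INR k)) * (1 + RtoC (INR m))))%C
     with ((Cprod m (fun k => (x, y) + RtoC (INR k)) * Cprod m (fun k => 1 + RtoC (INR k))) *
       (((x, y) + RtoC (INR m)) * (1 + RtoC (INR m))))%C by ring.
    replace (Cprod m (fun k => (x, 0) + RtoC (INR k)) * ((x, 0) + RtoC (INR m)) *
       (Cprod m (fun k => (1, y) + RtoC (INR k)) * ((1, y) + RtoC (INR m))))%C
     with ((Cprod m (fun k => (x, 0) + RtoC (INR k)) * Cprod m (fun k => (1, y) + RtoC (INR k))) *
       (((x, 0) + RtoC (INR m)) * ((1, y) + RtoC (INR m))))%C by ring.
    rewrite (Cmod_mult (Cprod m _ * _)), (Cmod_mult (Cprod m (fun k => (x, 0) + RtoC (INR k))%C * _)).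
    apply Rmult_le_compat; [apply Cmod_ge_0|apply Cmod_ge_0|exact IHm|].
    apply Rsqr_incr_0_var; [|apply Cmod_ge_0]. unfold Rsqr. rewrite !Cmod_sqr. simpl.
    pose proof (pos_INR m). set (k := INR m) in *.
    ring_simplify.
    assert (0 <= y * y) by nra.
    assert ((1 + k) * (1 + k) <= (x + k) * (x + k)) by nra.
    assert (0 <= (y * y) * ((x + k) * (x + k) - (1 + k) * (1 + k))) by (apply Rmult_le_pos; lra).
    nra. }
  unfold gauss_seq, Cdiv.
  set (c := RtoC (ln (INR n))). set (f := RtoC (INR (fact n))).
  assert (Nf : f <> 0) by apply fact_neq0C.
  assert (D : forall z w : C, fst z = fst w -> Cmod (/ (f * Cexp (z * c))) = Cmod (/ (f * Cexp (w * c)))).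
  { intros z w E. rewrite !Cmod_inv by (apply Cmult_neq_0; auto using Cexp_neq0).
    rewrite !Cmod_mult, !Cmod_Cexp. unfold c. simpl. rewrite E. rewrite !Rmult_0_r. auto. }
  specialize (P (S n)). rewrite !Cmod_mult in *.
  rewrite (D (x, y) (x, 0)), (D (1, y) 1) by auto.
  set (d1 := Cmod (/ (f * Cexp ((x, 0) * c)))). set (d2 := Cmod (/ (f * Cexp (1 * c)))).
  assert (0 <= d1 * d2) by (apply Rmult_le_pos; apply Cmod_ge_0).
  apply Rmult_le_compat_r with (r := d1 * d2) in P; auto. lra.
Qed.

Lemma RG_mono (x y : R) : 1 <= x ->
  Cmod (RecipGamma (x, y)) <= Cmod (RecipGamma (x, 0)) * Cmod (RecipGamma (1, y)).
Proof.
  intros Hx. rewrite <- Cmod_mult.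
  replace (RecipGamma (x, y)) with (RecipGamma (x, y) * RecipGamma 1)%C by (rewrite RG_1; ring).
  apply (Clim_Cmod_le (fun n => gauss_seq (x, y) n * gauss_seq 1 n)%C
                      (fun n => gauss_seq (x, 0) n * gauss_seq (1, y) n)%C).
  - apply Clim_mult; apply RG_lim.
  - apply Clim_mult; apply RG_lim.
  - intros n. now apply gauss_mono.
Qed.

Lemma RG_conj_mod (y : R) : Cmod (RecipGamma (1, y)) <= Cmod (RecipGamma (1, - y)).
Proof.
  apply (Clim_Cmod_le (gauss_seq (1, y)) (gauss_seq (1, - y))); try apply RG_lim.
  intros n. unfold gauss_seq.
  rewrite !Cmod_div by (apply Cmult_neq_0; auto using fact_neq0C, Cexp_neq0).
  rewrite !Cmod_mult, !Cmod_Cexp. simpl fst. rewrite !Rmult_0_r. right. f_equal.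
  generalize (S (S n)). intros m. induction m; [auto|].
  cbn [Cprod]. rewrite !Cmod_mult, IHm. f_equal. unfold Cmod; cbn [fst snd Cplus RtoC]. f_equal. ring.
Qed.

Lemma RG_line1 (y : R) : Cmod (RecipGamma (1, y)) <= exp (PI * Rabs y / 2).
Proof.
  pose proof PI_RGT_0 as P.
  destruct (Req_dec y 0) as [->|Hy].
  { replace (1, 0) with (RtoC 1) by reflexivity. rewrite RG_1, Cmod_1, Rabs_R0.
    replace (PI * 0 / 2) with 0 by field. rewrite exp_0. lra. }
  pose proof (RG_succ_reflect (0, y)) as E. apply (f_equal Cmod) in E.
  replace (1 + (0, y))%C with (1, y) in E by (apply injective_projections; simpl; ring).
  replace (1 - (0, y))%C with (1, - y) in E by (apply injective_projections; simpl; ring).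
  rewrite !Cmod_mult in E.
  assert (Ey : Cmod (0, y) = Rabs y).
  { unfold Cmod; simpl. replace (0 * (0 * 1) + y * (y * 1)) with (Rsqr y) by (unfold Rsqr; ring). apply sqrt_Rsqr_abs. }
  rewrite Ey in E.
  assert (Es : Cmod (sg (0, y)) <= Rabs y * exp (PI * Rabs y)).
  { unfold sg. rewrite Cmod_div by apply PI_neq0C. rewrite Cmod_R, (Rabs_pos_eq PI) by lra.
    replace (RtoC PI * (0, y))%C with (0, PI * y) by (apply injective_projections; simpl; ring).
    rewrite Csin_components, sin_0, cos_0.
    apply Rmult_le_reg_r with PI; auto. unfold Rdiv at 1. rewrite Rmult_assoc, Rinv_l, Rmult_1_r by lra.
    eapply Rle_trans; [apply Cmod_ReIm|]. simpl. rewrite Rmult_0_l, Rabs_R0, Rplus_0_l, Rmult_1_l.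
    assert (G : forall a, 0 <= a -> (exp a - exp (- a)) / 2 <= a * exp a).
    { intros a Ha. pose proof (exp_ineq1_le (- (2 * a))) as X.
      replace (exp (- a)) with (exp a * exp (- (2 * a))) by (rewrite <- exp_plus; f_equal; ring).
      pose proof (exp_pos a). nra. }
    assert (Rabs ((exp (PI * y) - exp (- (PI * y))) / 2) = (exp (PI * Rabs y) - exp (- (PI * Rabs y))) / 2).
    { destruct (Rle_lt_dec 0 y).
      - rewrite (Rabs_pos_eq y) by auto. apply Rabs_pos_eq.
        assert (exp (- (PI * y)) <= exp (PI * y)) by (apply exp_le; nra). lra.
      - rewrite (Rabs_left y) by auto. replace (PI * - y) with (- (PI * y)) by ring. rewrite Ropp_involutive.
        rewrite Rabs_left; [field|].
        assert (exp (PI * y) < exp (- (PI * y))) by (apply exp_increasing; nra). lra. }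
    rewrite H. pose proof (Rabs_pos y). pose proof (G (PI * Rabs y) ltac:(nra)). lra. }
  rewrite <- E in Es.
  assert (Py : 0 < Rabs y) by now apply Rabs_pos_lt.
  apply Rmult_le_reg_l in Es; auto.
  pose proof (RG_conj_mod y) as Cj. pose proof (Cmod_ge_0 (RecipGamma (1, y))) as C0.
  apply Rsqr_incr_0_var; [|apply Rlt_le, exp_pos]. unfold Rsqr. rewrite <- exp_plus.
  replace (PI * Rabs y / 2 + PI * Rabs y / 2) with (PI * Rabs y) by field.
  eapply Rle_trans; [|exact Es]. apply Rmult_le_compat_l; auto.
Qed.

Lemma RG_growth : exists K, 0 < K /\ forall z, -1 <= fst z <= 2 ->
  Cmod (RecipGamma z) <= K * ((1 + Rabs (snd z)) ^ 2 * exp (PI * Rabs (snd z) / 2)).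
Proof.
  exists (6 * (RG_const 4 + 1)).
  assert (P4 : 0 <= RG_const 4).
  { unfold RG_const. apply Rmult_le_pos; [lra|apply Rlt_le, exp_pos]. }
  split; [lra|]. intros [x y] Hz. simpl in Hz. simpl snd.
  rewrite RG_succ, (RG_succ (1 + (x, y))).
  replace (1 + (1 + (x, y)))%C with (2 + x, y) by (apply injective_projections; simpl; ring).
  rewrite !Cmod_mult.
  assert (A1 : Cmod (x, y) <= 2 + Rabs y).
  { eapply Rle_trans; [apply Cmod_ReIm|]. simpl. assert (Rabs x <= 2) by (apply Rabs_le; lra). lra. }
  assert (A2 : Cmod (1 + (x, y)) <= 3 + Rabs y).
  { eapply Rle_trans; [apply Cmod_ReIm|]. simpl. assert (Rabs (1 + x) <= 3) by (apply Rabs_le; lra).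
    rewrite Rplus_0_l. lra. }
  assert (A3 : Cmod (RecipGamma (2 + x, y)) <= (RG_const 4 + 1) * exp (PI * Rabs y / 2)).
  { eapply Rle_trans; [apply RG_mono; lra|]. apply Rmult_le_compat; try apply Cmod_ge_0; [|apply RG_line1].
    eapply Rle_trans; [apply (RG_bound _ 4)|lra].
    change (Cmod (RtoC (2 + x)) <= 4). rewrite Cmod_R. apply Rabs_le; lra. }
  pose proof (Rabs_pos y). pose proof (Cmod_ge_0 (x, y)). pose proof (Cmod_ge_0 (1 + (x, y))).
  pose proof (Cmod_ge_0 (RecipGamma (2 + x, y))). pose proof (exp_pos (PI * Rabs y / 2)).
  assert (B1 : Cmod (x, y) * Cmod (1 + (x, y)) <= 6 * (1 + Rabs y) ^ 2) by (simpl; nra).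
  assert (B0 : 0 <= Cmod (x, y) * Cmod (1 + (x, y))) by (apply Rmult_le_pos; auto).
  replace (6 * (RG_const 4 + 1) * ((1 + Rabs y) ^ 2 * exp (PI * Rabs y / 2)))
    with (6 * (1 + Rabs y) ^ 2 * ((RG_const 4 + 1) * exp (PI * Rabs y / 2))) by ring.
  rewrite <- Rmult_assoc. apply Rmult_le_compat; auto.
Qed.

(** * Determinants *)

Fixpoint Sumseq (N n : nat) (F : list nat -> C) : C :=
  match n with
  | O => F nil
  | S m => Csum N (fun k => Sumseq N m (fun f => F (k :: f)))
  end.

Fixpoint lsum {X : Type} (l : list X) (F : X -> C) : C :=
  match l with nil => RtoC 0 | x :: l' => Cplus (F x) (lsum l' F) end.

Lemma Cinv_mult_cancel (x y : C) : x <> 0 -> y <> 0 -> (/ (x * y) * x = / y)%C.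
Proof. intros; field; auto. Qed.

Module Det.
Import HB.structures.
Import all_boot all_order all_algebra all_fingroup boolp zify.
Set Implicit Arguments.
Unset Strict Implicit.
Unset Printing Implicit Defensive.
Import GRing.Theory.
Local Open Scope ring_scope.

Section DetComRing.
Variable R : comNzRingType.
Implicit Types (n : nat).

Lemma det_cross n (A : 'M[R]_n) (i0 : 'I_n) :
  exists C0 (Cab : 'I_n -> 'I_n -> R), forall (u r : 'I_n -> R) (d : R),
  \det (\matrix_(a, b) (if a == i0 then (if b == i0 then d else r b)
                        else if b == i0 then u a else A a b))
  = C0 * d + \sum_a \sum_b Cab a b * u a * r b.
Proof.
pose B b := \matrix_(a', b') (if a' == i0 then (b' == b)%:R
                              else if b' == i0 then 0 else A a' b') : 'M[R]_n.
exists (cofactor A i0 i0).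
exists (fun a b => if (a == i0) || (b == i0) then 0 else cofactor (B b) a i0).
move=> u r d; set M := \matrix_(a, b) _.
have lF (k : 'I_n) (x : 'I_n.-1) : (lift k x == k) = false.
  by rewrite eq_sym; apply/negbTE/neq_lift.
have cM b : b != i0 -> cofactor M i0 b = \sum_(a | a != i0) u a * cofactor (B b) a i0.
  move=> nb; pose M' := \matrix_(a', b') (if a' == i0 then (b' == b)%:R else M a' b') : 'M[R]_n.
  have -> : cofactor M i0 b = \det M'.
    rewrite (expand_det_row _ i0) (bigD1 b) //= big1 ?addr0 => [|j /negbTE nj].
      rewrite !mxE !eqxx mul1r; congr (_ * \det _).
      by apply/matrixP => x y; rewrite !mxE lF.
    by rewrite !mxE eqxx nj mul0r.
  rewrite (expand_det_col _ i0) (bigD1 i0) //= !mxE !eqxx (eq_sym i0) (negbTE nb) mul0r add0r.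
  apply: eq_bigr => a /negbTE na; rewrite !mxE na eqxx; congr (_ * (_ * \det _)).
  by apply/matrixP => x y; rewrite !mxE !lF; case: (_ == i0).
have c0 : cofactor M i0 i0 = cofactor A i0 i0.
  by congr (_ * \det _); apply/matrixP => x y; rewrite !mxE !lF.
rewrite (expand_det_row _ i0) (bigD1 i0) //= mxE !eqxx mulrC c0; congr (_ + _).
transitivity (\sum_(b | b != i0) \sum_(a | a != i0) cofactor (B b) a i0 * u a * r b).
  apply: eq_bigr => b nb; rewrite mxE eqxx (negbTE nb) cM // mulrC big_distrl /=.
  by apply: eq_bigr => a _; rewrite [u a * _]mulrC.
rewrite exchange_big /= [RHS](bigD1 i0) //= [X in X + _]big1 ?add0r => [|b _]; last first.
  by rewrite eqxx !mul0r.
apply: eq_bigr => a na; rewrite [RHS](bigD1 i0) //= eqxx orbT !mul0r add0r.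
by apply: eq_bigr => b nb; rewrite (negbTE na) (negbTE nb).
Qed.

Section ListDet.
Variables (T : eqType) (x0 : T) (g : bool -> T -> T -> R).

Definition ldet (s : seq T) : R :=
  \det (\matrix_(i < size s, j < size s) g (i == j) (nth x0 s i) (nth x0 s j)).

Lemma det_perm_conj n (A : 'M[R]_n) (p : 'S_n) : \det (\matrix_(i, j) A (p i) (p j)) = \det A.
Proof.
have -> : \matrix_(i, j) A (p i) (p j) = row_perm p (col_perm p A).
  by apply/matrixP => i j; rewrite !mxE.
rewrite row_permE col_permE !det_mulmx !det_perm odd_permV mulrCA -signr_addb addbb mulr1 //.
Qed.

Lemma ldet_perm (s t : seq T) : perm_eq s t -> ldet s = ldet t.
Proof.
move=> st; have sz : size t == size s by rewrite (perm_size st).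
have : perm_eq (in_tuple s) (Tuple sz) by [].
case/tuple_permP => p Ep.
have nE (i : 'I_(size s)) : nth x0 s i = nth x0 t (p i).
  have -> : nth x0 s i = tnth (in_tuple s) i by rewrite (tnth_nth x0).
  rewrite -(tnth_nth x0 (Tuple sz)) (tnth_nth x0) Ep -tnth_nth tnth_mktuple.
  by rewrite (tnth_nth x0).
rewrite /ldet -(perm_size st) -[RHS](det_perm_conj _ p); congr (\det _).
by apply/matrixP => i j; rewrite !mxE !nE (inj_eq perm_inj).
Qed.
End ListDet.

Section FredholmSum.
Variable M : nat -> nat -> R.

Definition flag_entry (b : bool) (x y : nat * bool) : R := M x.1 y.1 + (b && x.2)%:R.
Definition fdet := ldet (0%N, false) flag_entry.
Definition pdet (s : seq nat) : R := fdet (map (fun x => (x, false)) s).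

Lemma fdet_cons x s : fdet ((x, true) :: s) = fdet s + fdet ((x, false) :: s).
Proof.
rewrite /fdet /ldet /=.
set A := \matrix_(i, j) _; set A0 := (X in _ = _ + \det X); set A1 := (X in _ = \det X + _).
pose E := \matrix_(i, j) (if i == ord0 then (j == ord0)%:R else A i j) : 'M[R]_((size s).+1).
have n1 (j : nat) : (nth (0%N, false) ((x, true) :: s) j).1 = (nth (0%N, false) ((x, false) :: s) j).1.
  by case: j.
rewrite -[RHS]addrC (@determinant_multilinear _ _ A A0 E ord0 1 1).
- rewrite !mul1r; congr (_ + _).
  rewrite (expand_det_row _ ord0) (bigD1 ord0) //= big1 ?addr0 => [|j /negbTE nj].
    rewrite !mxE eqxx mul1r /cofactor addn0 expr0 mul1r; congr (\det _).
    by apply/matrixP => i j; rewrite !mxE /= (inj_eq lift_inj).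
  by rewrite !mxE nj mul0r.
- rewrite !scale1r; apply/rowP => j; rewrite !mxE /= /flag_entry /=.
  by rewrite n1 andbT andbF addr0 eq_sym.
- by apply/matrixP => i j; rewrite !mxE /= /flag_entry n1.
- by apply/matrixP => i j; rewrite !mxE /=.
Qed.

Lemma fdet_perm s t : perm_eq s t -> fdet s = fdet t.
Proof. exact: ldet_perm. Qed.

Lemma pdet_perm s t : perm_eq s t -> pdet s = pdet t.
Proof. by move=> st; apply/fdet_perm/perm_map. Qed.

Lemma pdet_nuniq s : ~~ uniq s -> pdet s = 0.
Proof.
move=> /(uniqPn 0%N) [i [j [ij js e]]].
have sz : size (map (fun x => (x, false)) s) = size s by rewrite size_map.
have i1 : (i < size (map (fun x => (x, false)) s))%N by rewrite sz (ltn_trans ij).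
have j1 : (j < size (map (fun x => (x, false)) s))%N by rewrite sz.
apply: (@determinant_alternate _ _ _ (Ordinal i1) (Ordinal j1)).
  by rewrite -val_eqE /= ltn_eqF.
have nm k : (k < size s)%N ->
    nth (0%N, false) (map (fun x => (x, false)) s) k = (nth 0%N s k, false).
  by move=> ks; rewrite (nth_map 0%N).
by move=> k; rewrite !mxE /= /flag_entry (nm i) ?(nm j) ?(ltn_trans ij) //= e !andbF.
Qed.

Fixpoint Sq (r : seq nat) (n : nat) (F : seq nat -> R) : R :=
  if n is m.+1 then \sum_(k <- r) Sq r m (fun f => F (k :: f)) else F [::].

Lemma eq_Sq r n F G : F =1 G -> Sq r n F = Sq r n G.
Proof.
elim: n F G => [|n IHn] F G FG /=; first exact: FG.
by apply: eq_bigr => k _; apply: IHn => f; apply: FG.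
Qed.

Lemma Sq_0 r n F : (forall f, F f = 0) -> Sq r n F = 0.
Proof.
elim: n F => [|n IHn] F F0 /=; first exact: F0.
by apply: big1 => k _; apply: IHn => f; apply: F0.
Qed.

Lemma Sq_cons x r n c : Sq (x :: r) n (fun f => pdet (c ++ f))
  = Sq r n (fun f => pdet (c ++ f)) + n%:R * Sq r n.-1 (fun f => pdet (x :: c ++ f)).
Proof.
elim: n c => [|n IHn] c; first by rewrite mul0r addr0.
have rc k m (r' : seq nat) : Sq r' m (fun f => pdet (c ++ k :: f)) = Sq r' m (fun f => pdet (rcons c k ++ f)).
  by apply: eq_Sq => f; rewrite cat_rcons.
rewrite [LHS]/= big_cons rc IHn.
have -> : Sq r n.-1 (fun f => pdet (x :: rcons c x ++ f)) = 0.
  apply: Sq_0 => f; apply: pdet_nuniq.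
  by rewrite /= mem_cat mem_rcons inE eqxx.
rewrite mulr0 addr0.
have -> : Sq r n (fun f => pdet (rcons c x ++ f)) = Sq r n (fun f => pdet (x :: c ++ f)).
  apply: eq_Sq => f; apply: pdet_perm.
  by rewrite cat_rcons -cat1s (perm_catCA c [:: x] f).
under eq_bigr => k _ do rewrite rc IHn.
rewrite big_split /= -natr1 mulrDl mul1r [RHS]addrA [RHS]addrC; congr (_ + _); congr (_ + _).
  by apply: eq_bigr => k _; rewrite -rc.
rewrite -big_distrr /=; case: n {IHn rc} => [|n]; first by rewrite !mul0r.
congr (_ * _); rewrite /=; apply: eq_bigr => k _; apply: eq_Sq => f.
by rewrite cat_rcons.
Qed.

Lemma Sq_big r n c : (size r < n)%N -> Sq r n (fun f => pdet (c ++ f)) = 0.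
Proof.
elim: r n c => [|x r IHr] [|n] c //= rn; first by rewrite big_nil.
rewrite -[LHS]/(Sq (x :: r) n.+1 (fun f => pdet (c ++ f))) Sq_cons IHr ?(ltnW rn) //.
by rewrite (IHr _ (x :: c)) // mulr0 addr0.
Qed.

Lemma fredholm_sum (fi : nat -> R) r c :
  fi 0%N = 1 -> (forall n, fi n.+1 * n.+1%:R = fi n) ->
  \sum_(n < (size r).+1) fi n * Sq r n (fun f => pdet (c ++ f))
  = fdet (map (fun x => (x, true)) r ++ map (fun x => (x, false)) c).
Proof.
move=> fi0 fiS; elim: r c => [|x r IHr] c.
  by rewrite big_ord_recl big_ord0 addr0 fi0 mul1r /= cats0.
rewrite [RHS]/= fdet_cons -IHr.
have -> : fdet ((x, false) :: map (fun x => (x, true)) r ++ map (fun x => (x, false)) c)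
        = fdet (map (fun x => (x, true)) r ++ map (fun x => (x, false)) (x :: c)).
  by apply: fdet_perm; rewrite /= -cat1s perm_catCA.
rewrite -IHr.
under eq_bigr => n _ do rewrite Sq_cons mulrDr.
rewrite big_split; congr (_ + _).
  by rewrite big_ord_recr -[RHS]addr0; congr (_ + _); rewrite Sq_big ?mulr0.
rewrite big_ord_recl /= mul0r mulr0 add0r; apply: eq_bigr => n _.
by rewrite /= /bump /= add1n mulrA fiS.
Qed.

Lemma fredholm_sum_iota (fi : nat -> R) N :
  fi 0%N = 1 -> (forall n, fi n.+1 * n.+1%:R = fi n) ->
  \sum_(n < N.+1) fi n * Sq (iota 0 N) n (fun f => pdet f)
  = \det (\matrix_(i < N, j < N) ((i == j)%:R + M i j)).
Proof.
move=> fi0 fiS; have := @fredholm_sum fi (iota 0 N) [::] fi0 fiS.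
rewrite size_iota /= cats0 => ->; rewrite /fdet /ldet.
have sz : size (map (fun x => (x, true)) (iota 0 N)) = N by rewrite size_map size_iota.
rewrite sz; congr (\det _); apply/matrixP => i j; rewrite !mxE /flag_entry.
by rewrite !(nth_map 0%N) ?size_iota // !nth_iota // !add0n andbT addrC.
Qed.
End FredholmSum.

Lemma andreief n (e eps : 'I_n -> 'I_n -> R) (h : 'I_n -> R) :
  \det (\matrix_(i, k) e k i) * \det (\matrix_(i, l) eps l i) * \prod_i h i
  = \sum_(s : 'S_n) (-1) ^+ s * \det (\matrix_(i, l) (e (s i) i * h i * eps l i)).
Proof.
rewrite {1}/determinant !big_distrl /=; apply: eq_bigr => s _.
rewrite -!mulrA; congr (_ * _).
have -> : \matrix_(i, l) (e (s i) i * h i * eps l i)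
        = diag_mx (\row_i (e (s i) i * h i)) *m \matrix_(i, l) eps l i.
  by rewrite mul_diag_mx; apply/matrixP => i l; rewrite !mxE.
rewrite det_mulmx det_diag.
have -> : \prod_i (\row_i (e (s i) i * h i)) 0 i = (\prod_i e (s i) i) * \prod_i h i.
  by rewrite -big_split /=; apply: eq_bigr => i _; rewrite mxE.
rewrite [RHS]mulrAC mulrA; congr (_ * _ * _); apply: eq_bigr => i _; by rewrite mxE.
Qed.

Lemma andreief_const n (L : 'I_n -> 'I_n -> R) :
  \sum_(s : 'S_n) (-1) ^+ s * \det (\matrix_(i, l) L l (s i)) = n`!%:R * \det (\matrix_(l, j) L l j).
Proof.
transitivity (\sum_(s : 'S_n) \det (\matrix_(l, j) L l j)).
  apply: eq_bigr => s _.
  have -> : \matrix_(i, l) L l (s i) = row_perm s (\matrix_(l, j) L l j)^T.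
    by apply/matrixP => i l; rewrite !mxE.
  by rewrite row_permE det_mulmx det_perm det_tr mulrA -signr_addb addbb mul1r.
by rewrite sumr_const card_Sn mulr_natl.
Qed.

Lemma det_monic n (x : 'I_n -> R) (q : 'I_n -> {poly R}) :
  (forall k, q k \is monic) -> (forall k, size (q k) = k.+1) ->
  \det (\matrix_(i, k) (q k).[x i]) = \prod_(i < n) \prod_(j < n | (i < j)%N) (x j - x i).
Proof.
move=> mq sq.
have -> : \matrix_(i, k) (q k).[x i]
   = (Vandermonde n (\row_i x i))^T *m (\matrix_(k, j) (q k)`_j)^T :> 'M[R]_n.
  apply/matrixP => i k; rewrite !mxE (@horner_coef_wide _ n) ?sq //.
  by apply: eq_bigr => j _; rewrite !mxE mulrC.
rewrite det_mulmx !det_tr det_Vandermonde det_trig.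
  rewrite [X in _ * X]big1 ?mulr1 => [|k _]; last first.
    by rewrite mxE; have /monicP := mq k; rewrite /lead_coef sq.
  by apply: eq_bigr => i _; apply: eq_bigr => j _; rewrite !mxE.
by apply/is_trig_mxP => i j ij; rewrite mxE nth_default // sq.
Qed.

Lemma prod_rev n (F : 'I_n -> 'I_n -> R) :
  \prod_(i < n) \prod_(j < n | (i < j)%N) F (rev_ord j) (rev_ord i)
  = \prod_(i < n) \prod_(j < n | (i < j)%N) F i j.
Proof.
rewrite (reindex_inj rev_ord_inj) /=.
under eq_bigr => i _ do rewrite (reindex_inj rev_ord_inj) /= rev_ordK.
under eq_bigr => i _ do under eq_bigr => j _ do rewrite rev_ordK.
rewrite (exchange_big_dep xpredT) //=.
apply: eq_bigr => j _; apply: eq_bigl => i.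
by have := ltn_ord i; have := ltn_ord j; lia.
Qed.

Lemma prod_pairs n (X : 'I_n -> 'I_n -> R) :
  \prod_i \prod_j (if i == j then 1 else X i j)
  = \prod_(i < n) \prod_(j < n | (i < j)%N) (X i j * X j i).
Proof.
have -> : \prod_i \prod_j (if i == j then 1 else X i j)
   = \prod_(i < n) (\prod_(j < n | (i < j)%N) X i j * \prod_(j < n | (j < i)%N) X i j).
  apply: eq_bigr => i _.
  rewrite [X in X * _]big_mkcond [X in _ * X]big_mkcond -big_split /=; apply: eq_bigr => j _.
  by rewrite -val_eqE /=; case: ltngtP; rewrite ?mulr1 ?mul1r.
rewrite big_split /= [X in _ * X](exchange_big_dep xpredT) //= -big_split /=.
by apply: eq_bigr => i _; rewrite big_split.
Qed.

Lemma det_newton_pair n (w a W A : 'I_n -> R) (X : 'I_n -> 'I_n -> R) :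
  (forall i j : 'I_n, (i < j)%N -> X i j * X j i = (w i - w j) * (W j - W i)) ->
  \det (\matrix_(i, k) \prod_(m < n | (k < m)%N) (w i - a m))
  * \det (\matrix_(i, l) \prod_(m < n | (m < l)%N) (W i - A m))
  = \prod_i \prod_j (if i == j then 1 else X i j).
Proof.
move=> XX; rewrite prod_pairs.
pose q (l : 'I_n) := \prod_(m < n | (m < l)%N) ('X - (A m)%:P).
pose p (k : 'I_n) := \prod_(m < n | (rev_ord k < m)%N) ('X - (a m)%:P).
have szc (P : pred 'I_n) (c : 'I_n -> R) :
    size (\prod_(m | P m) ('X - (c m)%:P)) = (\sum_(m | P m) 1).+1.
  by rewrite -big_filter size_prod_XsubC size_filter sum1_count.
have cnt (l : 'I_n) : (\sum_(m < n | (m < l)%N) 1 = l)%N.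
  by rewrite -(big_ord_widen n (fun=> 1%N)) ?sum1_card ?card_ord // ltnW.
have -> : \matrix_(i, l) \prod_(m < n | (m < l)%N) (W i - A m) = \matrix_(i, l) (q l).[W i] :> 'M[R]_n.
  apply/matrixP => i l; rewrite !mxE horner_prod; apply: eq_bigr => m _; by rewrite hornerXsubC.
have -> : \det (\matrix_(i, k) \prod_(m < n | (k < m)%N) (w i - a m))
   = \det (\matrix_(i, k) (p k).[w (rev_ord i)]).
  pose rp := perm (@rev_ord_inj n).
  rewrite -[RHS](det_perm_conj _ rp); congr (\det _); apply/matrixP => i k.
  rewrite !mxE !permE /p !rev_ordK horner_prod; apply: eq_bigr => m _; by rewrite hornerXsubC.
rewrite !det_monic //; first last.
- move=> k; rewrite szc (reindex_inj rev_ord_inj) -[in RHS](cnt k); congr _.+1.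
  by apply: eq_bigl => m /=; have := ltn_ord m; have := ltn_ord k; lia.
- by move=> k; apply: monic_prod_XsubC.
- by move=> k; rewrite szc cnt.
- by move=> k; apply: monic_prod_XsubC.
rewrite (prod_rev (fun i j => w i - w j)). rewrite -[LHS]big_split /=; apply: eq_bigr => i _.
by rewrite -big_split /=; apply: eq_bigr => j ij; rewrite XX.
Qed.

Lemma det_mul_utrig n (G L : 'M[R]_n) : (forall i j : 'I_n, (j < i)%N -> G i j = 0) ->
  \det (G *m L) = (\prod_i G i i) * \det L.
Proof.
move=> G0; rewrite det_mulmx -(det_tr G) det_trig; last first.
  by apply/is_trig_mxP => i j ij; rewrite mxE G0.
by congr (_ * _); apply: eq_bigr => i _; rewrite mxE.
Qed.
End DetComRing.

Definition CC : Type := Complex.C.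

HB.instance Definition _ := gen_eqMixin CC.
HB.instance Definition _ := gen_choiceMixin CC.

Lemma CC_addA : associative (Cplus : CC -> CC -> CC).
Proof. exact: Cplus_assoc. Qed.
Lemma CC_addC : commutative (Cplus : CC -> CC -> CC).
Proof. exact: Cplus_comm. Qed.
Lemma CC_add0 : left_id (RtoC R0 : CC) Cplus.
Proof. exact: Cplus_0_l. Qed.
Lemma CC_addN : left_inverse (RtoC R0 : CC) Copp Cplus.
Proof. by move=> x; rewrite [LHS]Cplus_comm; exact: Cplus_opp_r. Qed.
HB.instance Definition _ := GRing.isZmodule.Build CC CC_addA CC_addC CC_add0 CC_addN.

Lemma CC_mulA : associative (Cmult : CC -> CC -> CC).
Proof. exact: Cmult_assoc. Qed.
Lemma CC_mulC : commutative (Cmult : CC -> CC -> CC).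
Proof. exact: Cmult_comm. Qed.
Lemma CC_mul1 : left_id (RtoC R1 : CC) Cmult.
Proof. exact: Cmult_1_l. Qed.
Lemma CC_mulDl : left_distributive (Cmult : CC -> CC -> CC) Cplus.
Proof. by move=> x y z; exact: Cmult_plus_distr_r. Qed.
Lemma CC_1_neq_0 : (RtoC R1 : CC) != RtoC R0.
Proof. by apply/eqP => -[]; exact: R1_neq_R0. Qed.
HB.instance Definition _ :=
  GRing.Zmodule_isComNzRing.Build CC CC_mulA CC_mulC CC_mul1 CC_mulDl CC_1_neq_0.

Lemma CsumE (n : nat) (f : nat -> CC) : Csum n f = \sum_(i < n) f i.
Proof. by elim: n => [|n IHn]; rewrite ?big_ord0 // big_ord_recr /= -IHn. Qed.

Lemma CprodE (n : nat) (f : nat -> CC) : Cprod n f = \prod_(i < n) f i.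
Proof. by elim: n => [|n IHn]; rewrite ?big_ord0 // big_ord_recr /= -IHn. Qed.

Lemma RtoC_sign (j : nat) : (RtoC (pow (Ropp R1) j) : CC) = (-1) ^+ j.
Proof.
elim: j => [//|j IHj]; rewrite exprS -IHj.
change (RtoC (Rmult (Ropp R1) (pow (Ropp R1) j)) = Cmult (Copp (RtoC R1)) (RtoC (pow (Ropp R1) j))).
by rewrite RtoC_mult RtoC_opp.
Qed.

Lemma cdetE (n : nat) (M : nat -> nat -> CC) :
  cdet n M = \det (\matrix_(i < n, j < n) M i j).
Proof.
elim: n M => [|n IHn] M; first by rewrite det_mx00.
rewrite (expand_det_row _ ord0).
transitivity (Csum n.+1 (fun j => Cmult (Cmult (RtoC (pow (Ropp R1) j)) (M O j))
  (cdet n (fun i k => M (S i) (if Nat.ltb k j then k else S k))))); first by [].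
rewrite CsumE; apply: eq_bigr => j _; rewrite /cofactor mxE add0n -RtoC_sign IHn.
have CmulCA (x y z : CC) : Cmult (Cmult x y) z = y * (x * z) by rewrite mulrCA mulrA.
rewrite CmulCA. congr (@GRing.mul CC _ (@GRing.mul CC _ _)).
congr (\det _); apply/matrixP => i k; rewrite !mxE /= /bump leq0n add1n.
congr (M _ _); case: Nat.ltb_spec => [/ltP kj|/leP jk]; last by rewrite jk.
by rewrite leqNgt kj.
Qed.

Lemma eqbE (i j : nat) : Nat.eqb i j = (i == j).
Proof. by apply/idP/eqP => [/Nat.eqb_eq|->]; rewrite ?Nat.eqb_refl. Qed.

Lemma ltbE (i j : nat) : Nat.ltb i j = (i < j)%N.
Proof. by apply/idP/ltP => /Nat.ltb_lt. Qed.

Definition ext0 n (f : 'I_n -> CC) (i : nat) : CC := if insub i is Some j then f j else 0.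

Lemma ext0E n (f : 'I_n -> CC) (i : 'I_n) : ext0 f i = f i.
Proof. by rewrite /ext0 valK. Qed.

Lemma cdet_cross (n : nat) (M : nat -> nat -> CC) (i : nat) : Peano.lt i n ->
  exists C0 (Cab : nat -> nat -> CC), forall (u r : nat -> CC) (d : CC),
  cdet n (fun a b => if Nat.eqb a i then (if Nat.eqb b i then d else r b)
                     else if Nat.eqb b i then u a else M a b)
  = Cplus (Cmult C0 d) (Csum n (fun a => Csum n (fun b => Cmult (Cmult (Cab a b) (u a)) (r b)))).
Proof.
move=> /ltP lin; have [C0 [Cab H]] := det_cross (\matrix_(a, b) M a b) (Ordinal lin).
exists C0, (fun a b => ext0 (fun a' => ext0 (Cab a') b) a) => u r d.
have {H} := H (fun a => u a) (fun b => r b) d.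
rewrite cdetE CsumE => H; rewrite -[RHS]/(C0 * d + _).
rewrite (_ : (\matrix_(_, _) _) = (\matrix_(a, b) if a == Ordinal lin then if b == Ordinal lin then d else r b
       else if b == Ordinal lin then u a else (\matrix_(a, b) M a b) a b)) ?H.
  congr (@GRing.add CC _ _); apply: eq_bigr => a _; rewrite CsumE; apply: eq_bigr => b _.
  by rewrite !ext0E.
by apply/matrixP => a b; rewrite !mxE !eqbE -!val_eqE.
Qed.

Lemma nthE (s : seq nat) (i : nat) : List.nth i s O = nth 0%N s i.
Proof. by elim: s i => [|x s IHs] [|i] /=. Qed.

Lemma SumseqE (N n : nat) (F : seq nat -> CC) : Sumseq N n F = Sq (iota 0 N) n F.
Proof.
elim: n F => [//|n IHn] F /=; rewrite CsumE.
transitivity (\sum_(k <- index_iota 0 N) Sq (iota 0 N) n (fun f => F (k :: f))).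
  by rewrite big_mkord; apply: eq_bigr => k _; apply: IHn.
by rewrite /index_iota subn0.
Qed.

Lemma eq_Sq_size r n (F G : seq nat -> CC) :
  (forall f, size f = n -> F f = G f) -> Sq r n F = Sq r n G.
Proof.
elim: n F G => [|n IHn] F G FG /=; first exact: FG.
by apply: eq_bigr => k _; apply: IHn => f sf; apply: FG; rewrite /= sf.
Qed.

Lemma pdetE (M : nat -> nat -> CC) (f : seq nat) :
  pdet M f = cdet (size f) (fun i j => M (List.nth i f O) (List.nth j f O)).
Proof.
rewrite cdetE /pdet /fdet /ldet.
have : size (map (fun x => (x, false)) f) = size f by rewrite size_map.
have nm k : (k < size f)%N ->
    nth (0%N, false) (map (fun x => (x, false)) f) k = (nth 0%N f k, false).
  by move=> ks; rewrite (nth_map 0%N).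
move: nm; set g := map _ f; move: (size g) => m nm em; rewrite {m}em.
congr (\det _); apply/matrixP => i j; rewrite !mxE !nm // /flag_entry /= andbF addr0.
by rewrite !nthE.
Qed.

Lemma fredholm_pdet (N n : nat) (M : nat -> nat -> CC) :
  Sumseq N n (fun f => cdet n (fun i j => M (List.nth i f O) (List.nth j f O)))
  = Sq (iota 0 N) n (fun f => pdet M f).
Proof. by rewrite SumseqE; apply: eq_Sq_size => f <-; rewrite pdetE. Qed.

Lemma RtoC_natr (n : nat) : (RtoC (INR n) : CC) = n%:R.
Proof.
elim: n => [//|n IHn]; rewrite S_INR -natr1 -IHn.
by rewrite RtoC_plus.
Qed.

Lemma cdet_fredholm (N : nat) (M : nat -> nat -> CC) :
  Csum (S N) (fun n => Cmult (Cinv (RtoC (INR (Factorial.fact n))))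
    (Sumseq N n (fun f => cdet n (fun i j => M (List.nth i f O) (List.nth j f O)))))
  = cdet N (fun i j => Cplus (if Nat.eqb i j then RtoC R1 else RtoC R0) (M i j)).
Proof.
rewrite CsumE cdetE.
rewrite (eq_bigr (fun n : 'I_N.+1 => (Cinv (RtoC (INR (Factorial.fact n))) : CC)
   * Sq (iota 0 N) n (fun f => pdet M f))); last by move=> n _; rewrite fredholm_pdet.
rewrite (@fredholm_sum_iota CC M (fun n => Cinv (RtoC (INR (Factorial.fact n))))).
- congr (@determinant CC N _); apply/matrixP => i j; rewrite !mxE eqbE -val_eqE.
  by case: (_ == _).
- have := Cinv_r (RtoC R1); rewrite Cmult_1_l; apply; exact: (RtoC_neq0 _ R1_neq_R0).
- move=> n; rewrite -RtoC_natr.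
  rewrite (_ : Factorial.fact n.+1 = Nat.mul n.+1 (Factorial.fact n)) // mult_INR RtoC_mult.
  have nf : RtoC (INR (Factorial.fact n)) <> RtoC R0 by exact: fact_neq0C.
  have nn : RtoC (INR n.+1) <> RtoC R0 by apply: RtoC_neq0; apply: not_0_INR.
  exact: (Cinv_mult_cancel _ _ nn nf).
Qed.

Lemma cdet_fredholm_0 (N n : nat) (M : nat -> nat -> CC) : Peano.lt N n ->
  Sumseq N n (fun f => cdet n (fun i j => M (List.nth i f O) (List.nth j f O))) = RtoC R0.
Proof.
move=> /ltP lt; rewrite fredholm_pdet.
by apply: (@Sq_big _ M (iota 0 N) n [::]); rewrite size_iota.
Qed.

Lemma cdet_mul_utrig (N : nat) (G L : nat -> nat -> CC) :
  (forall i j, Peano.lt j i -> Peano.lt i N -> G i j = RtoC R0) ->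
  cdet N (fun i j => Csum N (fun l => Cmult (G i l) (L l j)))
  = Cmult (Cprod N (fun i => G i i)) (cdet N L).
Proof.
move=> G0; rewrite !cdetE CprodE.
rewrite (_ : \matrix_(i, j) _ = (\matrix_(i < N, j < N) G i j) *m (\matrix_(i < N, j < N) L i j)).
  rewrite det_mul_utrig; first by congr (@GRing.mul CC _ _); apply: eq_bigr => i _; rewrite mxE.
  by move=> i j ij; rewrite mxE G0 //; apply/ltP.
by apply/matrixP => i j; rewrite !mxE CsumE; apply: eq_bigr => l _; rewrite !mxE.
Qed.

Lemma lsumE (X : Type) (l : seq X) (F : X -> CC) : lsum l F = \sum_(x <- l) F x.
Proof. by elim: l => [|x l IHl]; rewrite ?big_nil // big_cons /= IHl. Qed.

Definition natperm n (s : 'S_n) (i : nat) : nat := if insub i is Some j then val (s j) else 0%N.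

Lemma natpermE n (s : 'S_n) (i : 'I_n) : natperm s i = s i.
Proof. by rewrite /natperm valK. Qed.

Lemma cdet_andreief (N : nat) : exists S : list (CC * (nat -> nat)),
  (forall s, List.In s S -> forall i, Peano.lt i N -> Peano.lt (snd s i) N) /\
  (forall (e eps : nat -> nat -> CC) (h : nat -> CC),
    Cmult (Cmult (cdet N (fun i k => e k i)) (cdet N (fun i l => eps l i))) (Cprod N h)
    = lsum S (fun s => Cmult (fst s) (cdet N (fun i l => Cmult (Cmult (e (snd s i) i) (h i)) (eps l i))))) /\
  (forall L : nat -> nat -> CC,
    lsum S (fun s => Cmult (fst s) (cdet N (fun i l => L l (snd s i))))
    = Cmult (RtoC (INR (Factorial.fact N))) (cdet N L)).
Proof.
pose S := map (fun s : {perm 'I_N} => ((-1) ^+ odd_perm s : CC, natperm s)) (index_enum {perm 'I_N}).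
exists S; split; [|split].
- move=> s /List.in_map_iff [p [<- _]] i /ltP iN /=; apply/ltP.
  by rewrite -[i]/(val (Ordinal iN)) natpermE.
- move=> e eps h; rewrite lsumE big_map /= !cdetE CprodE.
  have := andreief (fun k i : 'I_N => e k i) (fun l i : 'I_N => eps l i) (fun i : 'I_N => h i).
  rewrite -[Cmult]/(@GRing.mul CC) => ->; apply: eq_bigr => p _; rewrite cdetE.
  congr (@GRing.mul CC _ (\det _)); apply/matrixP => i l; by rewrite !mxE natpermE.
- move=> L; rewrite lsumE big_map /= cdetE.
  have := andreief_const (fun l j : 'I_N => L l j).
  have -> : N`!%:R = RtoC (INR (Factorial.fact N)) :> CC.
    rewrite RtoC_natr; congr (_%:R).
    by elim: (N) => [//|n IHn]; rewrite factS IHn.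
  rewrite -[Cmult]/(@GRing.mul CC) => <-; apply: eq_bigr => p _; rewrite cdetE.
  congr (@GRing.mul CC _ (\det _)); apply/matrixP => i l; by rewrite !mxE natpermE.
Qed.

Lemma CCprodE (N : nat) (X : nat -> nat -> CC) :
  Cprod N (fun i => Cprod N (fun j => if Nat.eqb i j then RtoC R1 else X i j))
  = \prod_(i < N) \prod_(j < N) (if i == j then 1 else X i j).
Proof.
rewrite CprodE; apply: eq_bigr => i _; rewrite CprodE; apply: eq_bigr => j _.
by rewrite eqbE -val_eqE; case: (_ == _).
Qed.

Lemma cdet_newton_pair (N : nat) (w a W A : nat -> CC) (X : nat -> nat -> CC) :
  (forall i j, Peano.lt i j -> Peano.lt j N ->
     Cmult (X i j) (X j i) = Cmult (Cminus (w i) (w j)) (Cminus (W j) (W i))) ->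
  Cmult (cdet N (fun i k => Cprod N (fun m => if Nat.ltb k m then Cminus (w i) (a m) else RtoC R1)))
        (cdet N (fun i l => Cprod N (fun m => if Nat.ltb m l then Cminus (W i) (A m) else RtoC R1)))
  = Cprod N (fun i => Cprod N (fun j => if Nat.eqb i j then RtoC R1 else X i j)).
Proof.
move=> XX; rewrite CCprodE !cdetE.
rewrite -(@det_newton_pair CC N (fun i => w i) (fun i => a i) (fun i => W i) (fun i => A i)); last first.
  by move=> i j ij; apply: XX; apply/ltP.
rewrite -[Cmult]/(@GRing.mul CC); congr (@GRing.mul CC (@determinant CC N _) (@determinant CC N _)); apply/matrixP => i k;
  rewrite !mxE CprodE [RHS]big_mkcond; apply: eq_bigr => m _; by rewrite ltbE.
Qed.

Lemma Cprod_pairs_eq (N : nat) (X Y : nat -> nat -> CC) :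
  (forall i j, Peano.lt i j -> Peano.lt j N -> Cmult (X i j) (X j i) = Cmult (Y i j) (Y j i)) ->
  Cprod N (fun i => Cprod N (fun j => if Nat.eqb i j then RtoC R1 else X i j))
  = Cprod N (fun i => Cprod N (fun j => if Nat.eqb i j then RtoC R1 else Y i j)).
Proof.
move=> XY; rewrite !CCprodE.
rewrite (@prod_pairs CC N (fun i j => X i j)) (@prod_pairs CC N (fun i j => Y i j)).
by apply: eq_bigr => i _; apply: eq_bigr => j ij; apply: XY; apply/ltP.
Qed.
End Det.

(** * Iterated integrals of determinants *)

Lemma Csum_ext (n : nat) (f g : nat -> C) :
  (forall i, (i < n)%nat -> f i = g i) -> Csum n f = Csum n g.
Proof. induction n; intros H; simpl; [auto|]. rewrite IHn, H; auto. Qed.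

Lemma Cprod_ext (n : nat) (f g : nat -> C) :
  (forall i, (i < n)%nat -> f i = g i) -> Cprod n f = Cprod n g.
Proof. induction n; intros H; simpl; [auto|]. rewrite IHn, H; auto. Qed.

Lemma Cprod_S_l (n : nat) (f : nat -> C) : Cprod (S n) f = (f O * Cprod n (fun i => f (S i)))%C.
Proof.
  induction n; [simpl; ring|].
  change (Cprod (S (S n)) f) with (Cprod (S n) f * f (S n))%C. rewrite IHn. simpl. ring.
Qed.

Lemma cdet_ext (n : nat) (M M' : nat -> nat -> C) :
  (forall i j, (i < n)%nat -> (j < n)%nat -> M i j = M' i j) -> cdet n M = cdet n M'.
Proof.
  revert M M'. induction n; intros M M' H; [auto|].
  apply Csum_ext. intros j Hj. rewrite H by lia. f_equal. apply IHn. intros i k Hi Hk.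
  apply H; [lia|]. destruct (k <? j)%nat; lia.
Qed.

Lemma Csum_plus (n : nat) (f g : nat -> C) :
  Csum n (fun i => f i + g i)%C = (Csum n f + Csum n g)%C.
Proof. induction n; simpl; [ring|rewrite IHn; ring]. Qed.

Lemma Csum_scal (n : nat) (c : C) (f : nat -> C) :
  Csum n (fun i => c * f i)%C = (c * Csum n f)%C.
Proof. induction n; simpl; [ring|rewrite IHn; ring]. Qed.

Lemma Csum_scal_r (n : nat) (c : C) (f : nat -> C) :
  Csum n (fun i => f i * c)%C = (Csum n f * c)%C.
Proof. induction n; simpl; [ring|rewrite IHn; ring]. Qed.

Lemma Csum_0 (n : nat) (f : nat -> C) : (forall i, (i < n)%nat -> f i = 0) -> Csum n f = 0.
Proof. induction n; intros H; simpl; [auto|]. rewrite IHn, H; auto. ring. Qed.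

Lemma Csum_exchange (n m : nat) (f : nat -> nat -> C) :
  Csum n (fun i => Csum m (fun j => f i j)) = Csum m (fun j => Csum n (fun i => f i j)).
Proof.
  induction n; simpl.
  - symmetry. now apply Csum_0.
  - rewrite IHn, <- Csum_plus. apply Csum_ext; auto.
Qed.

Lemma Sumseq_ext (N n : nat) (F G : list nat -> C) :
  (forall f, length f = n -> F f = G f) -> Sumseq N n F = Sumseq N n G.
Proof.
  revert F G. induction n; intros F G H; simpl; [auto|].
  apply Csum_ext. intros k _. apply IHn. intros f Hf. apply H. simpl. now rewrite Hf.
Qed.

Lemma Sumseq_Csum (N n m : nat) (F : nat -> list nat -> C) :
  Sumseq N n (fun f => Csum m (fun k => F k f)) = Csum m (fun k => Sumseq N n (F k)).
Proof.
  revert F. induction n; intros F; simpl; [auto|].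
  rewrite Csum_exchange. apply Csum_ext. intros k _.
  apply (IHn (fun i f => F i (k :: f))).
Qed.

Section LinearIntegral.
Variable I : (R -> C) -> C -> Prop.
Hypothesis I_ext : forall f g v, (forall t, f t = g t) -> I f v -> I g v.
Hypothesis I_0 : I (fun _ => RtoC 0) 0.
Hypothesis I_plus : forall f g u v, I f u -> I g v -> I (fun t => f t + g t)%C (u + v).
Hypothesis I_scal : forall f c v, I f v -> I (fun t => c * f t)%C (c * v).

Lemma I_Csum (n : nat) (f : nat -> R -> C) (v : nat -> C) :
  (forall i, (i < n)%nat -> I (f i) (v i)) -> I (fun t => Csum n (fun i => f i t)) (Csum n v).
Proof. induction n; intros H; simpl; [apply I_0|apply I_plus; auto]. Qed.

Lemma I_Sumseq (N n : nat) (F : list nat -> R -> C) (v : list nat -> C) :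
  (forall f, I (F f) (v f)) -> I (fun t => Sumseq N n (fun f => F f t)) (Sumseq N n v).
Proof.
  revert F v. induction n; intros F v H; simpl; [auto|].
  apply (I_Csum N (fun k t => Sumseq N n (fun f => F (k :: f) t))).
  intros k _. apply (IHn (fun f => F (k :: f))). auto.
Qed.

Fixpoint is_iter (n : nat) (f : list R -> C) (v : C) : Prop :=
  match n with
  | O => v = f nil
  | S m => exists g : R -> C, (forall t, is_iter m (fun ts => f (t :: ts)) (g t)) /\ I g v
  end.

Lemma is_iter_ext (n : nat) (f g : list R -> C) (v : C) :
  (forall ts, length ts = n -> f ts = g ts) -> is_iter n f v -> is_iter n g v.
Proof.
  revert f g v. induction n; intros f g v H; simpl.
  - intros ->. auto.
  - intros [k [Hk Hv]]. exists k. split; auto. intros t. eapply IHn; [|apply Hk].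
    intros ts Hts. apply H. simpl. now rewrite Hts.
Qed.

Lemma is_iter_0 (n : nat) : is_iter n (fun _ => RtoC 0) 0.
Proof. induction n; simpl; [auto|]. exists (fun _ => RtoC 0). split; auto. Qed.

Lemma is_iter_plus (n : nat) (f g : list R -> C) (u v : C) :
  is_iter n f u -> is_iter n g v -> is_iter n (fun ts => f ts + g ts)%C (u + v).
Proof.
  revert f g u v. induction n; intros f g u v; simpl.
  - intros -> ->. auto.
  - intros [k [Hk Hu]] [l [Hl Hv]]. exists (fun t => k t + l t)%C. split; [|now apply I_plus].
    intros t. apply (IHn (fun ts => f (t :: ts)) (fun ts => g (t :: ts))); auto.
Qed.

Lemma is_iter_scal (n : nat) (f : list R -> C) (c v : C) :
  is_iter n f v -> is_iter n (fun ts => c * f ts)%C (c * v).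
Proof.
  revert f v. induction n; intros f v; simpl.
  - intros ->. auto.
  - intros [k [Hk Hv]]. exists (fun t => c * k t)%C. split; [|now apply I_scal].
    intros t. apply (IHn (fun ts => f (t :: ts))); auto.
Qed.

Lemma is_iter_Csum (m n : nat) (f : nat -> list R -> C) (v : nat -> C) :
  (forall i, (i < m)%nat -> is_iter n (f i) (v i)) ->
  is_iter n (fun ts => Csum m (fun i => f i ts)) (Csum m v).
Proof.
  induction m; intros H; simpl; [apply is_iter_0|].
  apply (is_iter_plus n (fun ts => Csum m (fun i => f i ts)) (f m)); auto.
Qed.

Lemma is_iter_lsum {X : Type} (l : list X) (n : nat) (f : X -> list R -> C) (v : X -> C) :
  (forall x, In x l -> is_iter n (f x) (v x)) ->
  is_iter n (fun ts => lsum l (fun x => f x ts)) (lsum l v).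
Proof.
  induction l as [|x l IHl]; intros H; simpl; [apply is_iter_0|].
  apply (is_iter_plus n (f x) (fun ts => lsum l (fun x => f x ts))); [apply H; now left|].
  apply IHl. intros y Hy. apply H. now right.
Qed.

Lemma is_iter_cdet (n : nat) (f : nat -> nat -> R -> C) (m : nat -> nat -> C) :
  (forall i j, (i < n)%nat -> (j < n)%nat -> I (f i j) (m i j)) ->
  is_iter n (fun ts => cdet n (fun i j => f i j (nth i ts 0))) (cdet n m).
Proof.
  revert f m. induction n; intros f m H; [simpl; auto|].
  set (k := fun j (c : nat) => if (c <? j)%nat then c else S c).
  assert (Hk : forall j c, (j < S n)%nat -> (c < n)%nat -> (k j c < S n)%nat).
  { intros j c Hj Hc. unfold k. destruct (c <? j)%nat; lia. }
  exists (fun t => Csum (S n) (fun j => cdet n (fun i c => m (S i) (k j c)) * RtoC ((-1) ^ j) * f O j t)%C).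
  split.
  - intros t. 
    apply (is_iter_ext n (fun ts => Csum (S n) (fun j => (RtoC ((-1) ^ j) * f O j t)
       * cdet n (fun i c => f (S i) (k j c) (nth i ts 0)))%C)); [auto|].
    replace (Csum (S n) (fun j => cdet n (fun i c => m (S i) (k j c)) * RtoC ((-1) ^ j) * f O j t)%C)
      with (Csum (S n) (fun j => (RtoC ((-1) ^ j) * f O j t) * cdet n (fun i c => m (S i) (k j c)))%C)
      by (apply Csum_ext; intros; ring).
    apply (is_iter_Csum (S n) n (fun j ts => (RtoC ((-1) ^ j) * f O j t)
       * cdet n (fun i c => f (S i) (k j c) (nth i ts 0)))%C).
    intros j Hj. apply is_iter_scal.
    apply (IHn (fun i c => f (S i) (k j c)) (fun i c => m (S i) (k j c))).
    intros i c Hi Hc. apply H; auto. lia.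
  - replace (cdet (S n) m) with
      (Csum (S n) (fun j => cdet n (fun i c => m (S i) (k j c)) * RtoC ((-1) ^ j) * m O j)%C).
    + apply (I_Csum (S n) (fun j t => cdet n (fun i c => m (S i) (k j c)) * RtoC ((-1) ^ j) * f O j t)%C).
      intros j Hj. apply I_scal, H; lia.
    + change (cdet (S n) m) with
        (Csum (S n) (fun j => RtoC ((-1) ^ j) * m O j * cdet n (fun i c => m (S i) (k j c)))%C).
      apply Csum_ext. intros j Hj. ring.
Qed.

(* Labels are either points of the contour or indices of a finite basis: integrating out a point
   label amounts to summing over the corresponding index label. *)
Section Labels.
Variables (N : nat) (KK : R + nat -> R + nat -> C).
Hypothesis KK_trace : I (fun t => KK (inl t) (inl t)) (Csum N (fun k => KK (inr k) (inr k))).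
Hypothesis KK_comp : forall x y, I (fun t => KK x (inl t) * KK (inl t) y)%C
                                   (Csum N (fun k => KK x (inr k) * KK (inr k) y)%C).

Definition Ldet (s : list (R + nat)) : C :=
  cdet (length s) (fun i j => KK (nth i s (inr O)) (nth j s (inr O))).

Lemma Ldet_step (c d : list (R + nat)) :
  I (fun t => Ldet (c ++ inl t :: d)) (Csum N (fun k => Ldet (c ++ inr k :: d))).
Proof.
  set (n := (length c + S (length d))%nat). set (i := length c).
  set (lab := fun a => nth a (c ++ inr O :: d) (inr O)).
  assert (Hi : (i < n)%nat) by (unfold i, n; lia).
  destruct (@Det.cdet_cross n (fun a b => KK (lab a) (lab b)) i Hi) as [C0 [Cab H]].
  assert (Lz : forall z a, nth a (c ++ z :: d) (inr O) = if Nat.eqb a i then z else lab a).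
  { intros z a. unfold lab, i. destruct (Nat.eqb_spec a (length c)) as [->|ne].
    - rewrite app_nth2, Nat.sub_diag by lia. reflexivity.
    - destruct (lt_dec a (length c)).
      + rewrite !app_nth1 by auto. auto.
      + rewrite !app_nth2 by lia. destruct (a - length c)%nat eqn:E; [lia|]. reflexivity. }
  assert (E : forall z, Ldet (c ++ z :: d) = (C0 * KK z z
     + Csum n (fun a => Csum n (fun b => Cab a b * (KK (lab a) z * KK z (lab b)))))%C).
  { intros z. unfold Ldet. rewrite length_app. cbn [length]. fold n.
    transitivity (C0 * KK z z
      + Csum n (fun a => Csum n (fun b => Cab a b * KK (lab a) z * KK z (lab b))))%C.
    - etransitivity; [|apply (H (fun a => KK (lab a) z) (fun b => KK z (lab b)))].
      apply cdet_ext. intros a b _ _. rewrite !Lz.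
      destruct (Nat.eqb a i), (Nat.eqb b i); auto.
    - f_equal. apply Csum_ext. intros a _. apply Csum_ext. intros b _. ring. }
  replace (Csum N (fun k => Ldet (c ++ inr k :: d))) with
    (C0 * Csum N (fun k => KK (inr k) (inr k))
     + Csum n (fun a => Csum n (fun b => Cab a b
         * Csum N (fun k => KK (lab a) (inr k) * KK (inr k) (lab b)))))%C.
  - apply (I_ext (fun z => (C0 * KK (inl z) (inl z)
     + Csum n (fun a => Csum n (fun b => Cab a b * (KK (lab a) (inl z) * KK (inl z) (lab b)))))%C)).
    { intros t. now rewrite E. }
    apply I_plus; [apply I_scal; auto|].
    apply (I_Csum n (fun a t => Csum n (fun b => Cab a b * (KK (lab a) (inl t) * KK (inl t) (lab b)))%C)).
    intros a _.
    apply (I_Csum n (fun b t => Cab a b * (KK (lab a) (inl t) * KK (inl t) (lab b)))%C).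
    intros b _. apply I_scal, KK_comp.
  - rewrite (Csum_ext N (fun k => Ldet (c ++ inr k :: d)) _ (fun k _ => E (inr k))).
    rewrite Csum_plus, Csum_scal. f_equal. symmetry.
    rewrite Csum_exchange. apply Csum_ext. intros a _.
    rewrite Csum_exchange. apply Csum_ext. intros b _. now rewrite Csum_scal.
Qed.

Lemma is_iter_Ldet (m : nat) (c : list (R + nat)) :
  is_iter m (fun v => Ldet (c ++ map inl v)) (Sumseq N m (fun f => Ldet (c ++ map inr f))).
Proof.
  revert c. induction m; intros c; simpl; [auto|].
  exists (fun t => Sumseq N m (fun f => Ldet (c ++ inl t :: map inr f))). split.
  - intros t. specialize (IHm (c ++ inl t :: nil)).
    replace (Sumseq N m (fun f => Ldet (c ++ inl t :: map inr f)))
      with (Sumseq N m (fun f => Ldet ((c ++ inl t :: nil) ++ map inr f)))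
      by (apply Sumseq_ext; intros f _; now rewrite <- app_assoc).
    eapply is_iter_ext; [|exact IHm]. intros ts _. cbv beta. now rewrite <- app_assoc.
  - rewrite <- (Sumseq_Csum N m N (fun k f => Ldet (c ++ inr k :: map inr f))).
    apply (I_Sumseq N m (fun f t => Ldet (c ++ inl t :: map inr f))).
    intros f. apply Ldet_step.
Qed.

Lemma is_iter_fredholm (n : nat) :
  is_iter n (fun v => cdet n (fun i j => KK (inl (nth i v 0)) (inl (nth j v 0))))
    (Sumseq N n (fun f => cdet n (fun i j => KK (inr (nth i f O)) (inr (nth j f O))))).
Proof.
  pose proof (is_iter_Ldet n nil) as H.
  replace (Sumseq N n (fun f => cdet n (fun i j => KK (inr (nth i f O)) (inr (nth j f O)))))
    with (Sumseq N n (fun f => Ldet (nil ++ map inr f))).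
  - eapply is_iter_ext; [|exact H]. intros ts Hts. unfold Ldet. simpl. rewrite length_map, Hts.
    apply cdet_ext. intros i j Hi Hj.
    rewrite !(nth_indep (map inl ts) (inr O) (inl 0)) by (rewrite length_map; lia).
    now rewrite !map_nth.
  - apply Sumseq_ext. intros f Hf. unfold Ldet. simpl. rewrite length_map, Hf.
    apply cdet_ext. intros i j Hi Hj. now rewrite !map_nth.
Qed.
End Labels.
End LinearIntegral.

Lemma is_iter_RInt_genP (n : nat) (f : list R -> C) (v : C) :
  is_iter (fun g l => @is_RInt_gen C_R_NormedModule g (Rbar_locally m_infty) (Rbar_locally p_infty) l) n f v
  -> is_iter_RInt_gen n f v.
Proof.
  revert f v. induction n; intros f v; simpl; [auto|].
  intros [g [Hg Hv]]. exists g. split; auto.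
Qed.

Lemma is_iter_RIntP (a b : R) (n : nat) (f : list R -> C) (v : C) :
  is_iter (fun g l => is_cint g a b l) n f v -> iter_RInt n f a b = v.
Proof.
  revert f v. induction n; intros f v; simpl; [auto|].
  intros [g [Hg Hv]].
  replace (fun t => iter_RInt n (fun ts => f (t :: ts)) a b) with g.
  - now apply cint_unique.
  - apply functional_extensionality. intros t. symmetry. now apply IHn.
Qed.

Lemma is_iter_weight (a b : R) (w : R -> C) (n : nat) (f : list R -> C) (v : C) :
  is_iter (fun g l => is_cint (fun t => g t * w t)%C a b l) n f v ->
  is_iter (fun g l => is_cint g a b l) n (fun ts => f ts * Cprod n (fun i => w (nth i ts 0%R)))%C v.
Proof.
  revert f v. induction n; intros f v.
  - simpl. intros ->. ring.
  - intros [g [Hg Hv]]. exists (fun t => g t * w t)%C. split; auto.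
    intros t. rewrite Cmult_comm.
    eapply is_iter_ext; [|apply (is_iter_scal (fun g l => is_cint g a b l)), IHn, Hg].
    + intros ts _. cbv beta. rewrite Cprod_S_l. simpl. ring.
    + intros h c u Hu. now apply is_cint_scal.
Qed.

(** * Newton expansions of the kernels *)

Definition ev (z : C) : C := Cexp (Ci * (RtoC PI * z)).
Definition VV (z : C) : C := (ev z * ev z / two_pi_i)%C.

Lemma ev_neq0 (z : C) : ev z <> 0.
Proof. apply Cexp_neq0. Qed.

Lemma VV_diff (x y : C) : (VV x - VV y = ev x * ev y * sg (x - y))%C.
Proof.
  unfold VV, sg, Csin.
  replace (Ci * (RtoC PI * (x - y)))%C with (Ci * (RtoC PI * x) + - (Ci * (RtoC PI * y)))%C by ring.
  replace (- (Ci * (RtoC PI * x) + - (Ci * (RtoC PI * y))))%C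
    with (- (Ci * (RtoC PI * x)) + Ci * (RtoC PI * y))%C by ring.
  rewrite !Cexp_plus, !Cexp_opp. fold (ev x) (ev y). unfold two_pi_i. rewrite RtoC_mult.
  field. repeat split; try apply ev_neq0; try apply PI_neq0C.
  intros E; injection E; lra.
Qed.

Lemma Cmod_ev (z : C) : Cmod (ev z) = exp (- (PI * snd z)).
Proof. unfold ev. rewrite Cmod_Cexp. f_equal. simpl. ring. Qed.

Lemma hol_ev (z : C) : hol ev z.
Proof.
  unfold ev. apply hol_Cexp. apply hol_mult; [apply hol_const|].
  apply hol_mult; [apply hol_const|apply hol_id].
Qed.

Lemma hol_VV (z : C) : hol VV z.
Proof.
  unfold VV. apply hol_div; [apply hol_mult; apply hol_ev|apply hol_const|apply two_pi_i_neq0].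
Qed.

Lemma Cprod_neq0 (n : nat) (f : nat -> C) : (forall i, (i < n)%nat -> f i <> 0) -> Cprod n f <> 0.
Proof.
  induction n; intros H; simpl; [intros E; injection E; lra|]. apply Cmult_neq_0; auto.
Qed.

Lemma Cprod_mult (n : nat) (f g : nat -> C) :
  Cprod n (fun i => f i * g i)%C = (Cprod n f * Cprod n g)%C.
Proof. induction n; simpl; [ring|rewrite IHn; ring]. Qed.

Lemma Cprod_inv (n : nat) (f : nat -> C) : (forall i, (i < n)%nat -> f i <> 0) ->
  Cprod n (fun i => / f i)%C = (/ Cprod n f)%C.
Proof.
  induction n; intros H; simpl; [field; intros E; injection E; lra|].
  rewrite IHn by auto. field. split; auto using Cprod_neq0.
Qed.

Lemma Cprod_1 (n : nat) (f : nat -> C) : (forall i, (i < n)%nat -> f i = 1) -> Cprod n f = 1.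
Proof. induction n; intros H; simpl; [auto|]. rewrite IHn, H by auto. ring. Qed.

Lemma Cprod_pick (n k : nat) (x : C) : (k < n)%nat ->
  Cprod n (fun m => if Nat.eqb m k then x else 1%C) = x.
Proof.
  induction n; intros H; [lia|]. simpl. destruct (Nat.eqb_spec n k) as [->|ne].
  - rewrite Cprod_1; [ring|]. intros i Hi. destruct (Nat.eqb_spec i k); [lia|auto].
  - rewrite IHn by lia. ring.
Qed.

Section NewtonPoly.
Variables (N : nat) (b : nat -> C).

(* The products are cut by a test instead of a bound so that factors can be compared at a fixed length [N]. *)
Definition plo (k : nat) (v : C) : C := Cprod N (fun m => if (m <? k)%nat then v - b m else 1)%C.
Definition phi (l : nat) (v : C) : C := Cprod N (fun m => if (m <? l)%nat then 1 else v - b m)%C.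

Lemma plo_S (k : nat) (v : C) : (k < N)%nat -> plo (S k) v = (plo k v * (v - b k))%C.
Proof.
  intros Hk. unfold plo. rewrite <- (Cprod_pick N k (v - b k)%C Hk), <- Cprod_mult.
  apply Cprod_ext. intros m Hm.
  destruct (Nat.ltb_spec m (S k)); destruct (Nat.ltb_spec m k); destruct (Nat.eqb_spec m k);
    subst; try lia; ring.
Qed.

Lemma phi_S (l : nat) (v : C) : (l < N)%nat -> phi l v = (phi (S l) v * (v - b l))%C.
Proof.
  intros Hk. unfold phi. rewrite <- (Cprod_pick N l (v - b l)%C Hk), <- Cprod_mult.
  apply Cprod_ext. intros m Hm.
  destruct (Nat.ltb_spec m (S l)); destruct (Nat.ltb_spec m l); destruct (Nat.eqb_spec m l);
    subst; try lia; ring.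
Qed.

Lemma plo_0 (v : C) : plo 0 v = 1.
Proof. apply Cprod_1. auto. Qed.

Lemma phi_N (v : C) : phi N v = 1.
Proof. apply Cprod_1. intros i Hi. destruct (Nat.ltb_spec i N); [auto|lia]. Qed.

Lemma plo_neq0 (k : nat) (v : C) : (forall m, (m < N)%nat -> v <> b m) -> plo k v <> 0.
Proof.
  intros H. apply Cprod_neq0. intros i Hi. destruct (i <? k)%nat.
  - apply Cminus_neq0; auto.
  - intros E; injection E; lra.
Qed.

Lemma phi_neq0 (k : nat) (v : C) : (forall m, (m < N)%nat -> v <> b m) -> phi k v <> 0.
Proof.
  intros H. apply Cprod_neq0. intros i Hi. destruct (i <? k)%nat.
  - intros E; injection E; lra.
  - apply Cminus_neq0; auto.
Qed.

Lemma newton_lo (v w : C) : (forall m, (m < N)%nat -> w <> b m) -> w <> v ->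
  (/ (w - v) = Csum N (fun k => plo k v * / plo (S k) w) + plo N v * / (plo N w * (w - v)))%C.
Proof.
  intros Hw n. apply Cminus_neq0 in n.
  assert (T : forall k, (k <= N)%nat ->
    ((w - v) * Csum k (fun k => plo k v * / plo (S k) w) = 1 - plo k v / plo k w)%C).
  { induction k; intros Hk.
    - simpl. rewrite !plo_0. field.
    - cbn [Csum]. rewrite Cmult_plus_distr_l, IHk by lia.
      rewrite !plo_S by lia.
      assert (w - b k <> 0)%C by (apply Cminus_neq0, Hw; lia).
      pose proof (plo_neq0 k w Hw). field. split; auto. }
  specialize (T N (le_n N)). pose proof (plo_neq0 N w Hw).
  transitivity (/ (w - v) * ((w - v) * Csum N (fun k => plo k v * / plo (S k) w) + plo N v / plo N w))%C.
  - rewrite T. field. split; auto.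
  - field. split; auto.
Qed.

Lemma newton_hi (v w : C) : (forall m, (m < N)%nat -> w <> b m) -> w <> v ->
  (/ (w - v) = Csum N (fun l => phi (S l) v * / phi l w) + phi 0 v * / (phi 0 w * (w - v)))%C.
Proof.
  intros Hw n. apply Cminus_neq0 in n.
  assert (T : forall k, (k <= N)%nat ->
    ((w - v) * Csum k (fun l => phi (S l) v * / phi l w) = phi k v / phi k w - phi 0 v / phi 0 w)%C).
  { induction k; intros Hk.
    - simpl. ring.
    - cbn [Csum]. rewrite Cmult_plus_distr_l, IHk by lia.
      rewrite !(phi_S k) by lia.
      assert (w - b k <> 0)%C by (apply Cminus_neq0, Hw; lia).
      pose proof (phi_neq0 (S k) w Hw). pose proof (phi_neq0 0 w Hw). field. repeat split; auto. }
  specialize (T N (le_n N)). rewrite !phi_N in T. pose proof (phi_neq0 0 w Hw).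
  transitivity (/ (w - v) * ((w - v) * Csum N (fun l => phi (S l) v * / phi l w) + phi 0 v / phi 0 w))%C.
  - rewrite T. field. split; auto.
  - field. split; auto.
Qed.
End NewtonPoly.

Lemma hol_plo (N k : nat) (b : nat -> C) (z : C) : hol (plo N b k) z.
Proof.
  unfold plo. apply (hol_Cprod N (fun m v => if (m <? k)%nat then v - b m else 1)%C).
  intros i _. destruct (i <? k)%nat; [apply hol_minus; [apply hol_id|apply hol_const]|apply hol_const].
Qed.

Section Kernels.
Variables (N : nat) (a : nat -> C) (F : C -> C).

Definition Aa (m : nat) : C := VV (a m).
Definition qq (l : nat) (v : C) : C := (ev v * phi N Aa (S l) (VV v))%C.
Definition QQ (v : C) : C := phi N Aa 0 (VV v).
Definition eps (l : nat) (w : C) : C := (- (ev w * / phi N Aa l (VV w)))%C.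
Definition SS (v w : C) : C := (/ sg (v - w))%C.
Definition hh (w : C) : C := (F w * Cprod N (fun m => RecipGamma (w - a m)))%C.
(* [hh w / prod_(m < k) (w - a m)], written so that it makes sense at the points [a m] *)
Definition HH (k : nat) (w : C) : C :=
  (F w * Cprod N (fun m => if (m <? k)%nat then RecipGamma (1 + (w - a m)) else RecipGamma (w - a m)))%C.

Definition regular (w : C) : Prop := forall m, (m < N)%nat -> sg (w - a m) <> 0.

Lemma regular_VV (w : C) : regular w -> forall m, (m < N)%nat -> VV w <> Aa m.
Proof.
  intros H m Hm E. apply (H m Hm). pose proof (VV_diff w (a m)) as D.
  unfold Aa in E. rewrite E in D. replace (VV (a m) - VV (a m))%C with (RtoC 0) in D by ring.
  transitivity (/ (ev w * ev (a m)) * (ev w * ev (a m) * sg (w - a m)))%C.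
  - field. split; apply ev_neq0.
  - rewrite <- D. ring.
Qed.

Lemma sg_0 : sg 0 = 0.
Proof. rewrite <- RG_succ_reflect. ring. Qed.

Lemma regular_a (w : C) : regular w -> forall m, (m < N)%nat -> w <> a m.
Proof.
  intros H m Hm E. apply (H m Hm). rewrite E. replace (a m - a m)%C with (RtoC 0) by ring. apply sg_0.
Qed.

Lemma hh_HH (k : nat) (w : C) : hh w = (HH k w * plo N a k w)%C.
Proof.
  unfold hh, HH, plo. rewrite <- Cmult_assoc, <- Cprod_mult. f_equal. apply Cprod_ext. intros m Hm.
  destruct (m <? k)%nat; [rewrite (RG_succ (w - a m)); ring|ring].
Qed.

Lemma HH_div (k : nat) (w : C) : regular w -> HH k w = (hh w * / plo N a k w)%C.
Proof.
  intros H. rewrite (hh_HH k). field. apply plo_neq0. now apply regular_a.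
Qed.

Lemma newton_S (v w : C) : regular w -> sg (v - w) <> 0 ->
  (SS v w = Csum N (fun l => qq l v * eps l w) + QQ v * (SS v w * / QQ w))%C.
Proof.
  intros Hw Hs.
  assert (E : (SS v w = - (ev v * ev w) * / (VV w - VV v))%C).
  { replace (VV w - VV v)%C with (- (VV v - VV w))%C by ring. rewrite VV_diff.
    unfold SS. field. repeat split; auto using ev_neq0. }
  assert (n : VV w <> VV v).
  { intros E0. apply Hs. pose proof (VV_diff v w) as D. rewrite E0 in D.
    replace (VV v - VV v)%C with (RtoC 0) in D by ring.
    transitivity (/ (ev v * ev w) * (ev v * ev w * sg (v - w)))%C; [field; split; apply ev_neq0|].
    rewrite <- D. ring. }
  rewrite E. rewrite (newton_hi N Aa (VV v) (VV w) (regular_VV w Hw) n) at 1.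
  rewrite Cmult_plus_distr_l, <- Csum_scal. f_equal.
  - apply Csum_ext. intros l _. unfold qq, eps. ring.
  - unfold QQ. pose proof (phi_neq0 N Aa 0 (VV w) (regular_VV w Hw)).
    pose proof (Cminus_neq0 _ _ n). field. split; auto.
Qed.

(* In [QQ / hh] the zeros of the reciprocal Gamma functions cancel. *)
Lemma VV_RG (v x : C) : (VV v - VV x = ev v * ev x * RecipGamma (1 - (v - x)) * RecipGamma (v - x))%C.
Proof. rewrite VV_diff, <- RG_reflect. ring. Qed.

Lemma eps_alt (l : nat) (w : C) : (l < N)%nat -> regular w ->
  (eps l w = - (/ (ev (a l) * sg (w - a l)) * / phi N Aa (S l) (VV w)))%C.
Proof.
  intros Hl Hw. unfold eps. rewrite (phi_S N Aa l) by auto. unfold Aa at 2. rewrite VV_diff.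
  pose proof (phi_neq0 N Aa (S l) (VV w) (regular_VV w Hw)).
  pose proof (Hw l Hl). field. repeat split; auto using ev_neq0.
Qed.

Lemma hol_qq (l : nat) (z : C) : hol (qq l) z.
Proof.
  unfold qq. apply hol_mult; [apply hol_ev|]. unfold phi.
  apply (hol_Cprod N (fun m v => if (m <? S l)%nat then 1 else VV v - Aa m)%C).
  intros i _. destruct (i <? S l)%nat; [apply hol_const|].
  apply hol_minus; [apply hol_VV|apply hol_const].
Qed.

Lemma hol_QQ (z : C) : hol QQ z.
Proof.
  unfold QQ, phi. apply (hol_Cprod N (fun m v => if (m <? 0)%nat then 1 else VV v - Aa m)%C).
  intros i _. destruct (i <? 0)%nat; [apply hol_const|].
  apply hol_minus; [apply hol_VV|apply hol_const].
Qed.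

Lemma hol_eps (l : nat) (z : C) : regular z -> hol (eps l) z.
Proof.
  intros H. unfold eps. apply hol_opp, hol_mult; [apply hol_ev|].
  apply (hol_inv (fun w => phi N Aa l (VV w))).
  - unfold phi. apply (hol_Cprod N (fun m v => if (m <? l)%nat then 1 else VV v - Aa m)%C).
    intros i _. destruct (i <? l)%nat; [apply hol_const|].
    apply hol_minus; [apply hol_VV|apply hol_const].
  - apply phi_neq0. now apply regular_VV.
Qed.

Lemma hol_HH (k : nat) (z : C) : hol F z -> hol (HH k) z.
Proof.
  intros H. unfold HH. apply hol_mult; auto.
  apply (hol_Cprod N (fun m w => if (m <? k)%nat then RecipGamma (1 + (w - a m)) else RecipGamma (w - a m))%C).
  intros i _. destruct (i <? k)%nat; apply hol_RG.
  - apply hol_plus; [apply hol_const|]. apply hol_minus; [apply hol_id|apply hol_const].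
  - apply hol_minus; [apply hol_id|apply hol_const].
Qed.

End Kernels.

(** * Improper integrals over the line *)

Definition IG (f : R -> C) (v : C) : Prop :=
  @is_RInt_gen C_R_NormedModule f (Rbar_locally m_infty) (Rbar_locally p_infty) v.

Lemma IG_spec (f : R -> C) (v : C) :
  IG f v <-> forall eps, 0 < eps -> exists M, 0 < M /\ forall x y, x < - M -> M < y ->
    exists u, is_cint f x y u /\ Cmod (u - v) < eps.
Proof.
  split.
  - intros H eps He.
    assert (He' : 0 < eps / 2) by lra.
    assert (L : @locally C_UniformSpace v (fun u => Cmod (u - v) < eps)).
    { exists (mkposreal _ He'). intros u Hu.
      pose proof (C_NormedModule_mixin_compat2 v u (mkposreal _ He') Hu) as B. simpl in B.
      change (Cmod (u - v) < sqrt 2 * (eps / 2)) in B.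
      assert (sqrt 2 <= 2).
      { rewrite <- (sqrt_square 2) at 2 by lra. apply sqrt_le_1_alt; lra. }
      nra. }
    destruct (H _ L) as [Q1 Q2 [M1 H1] [M2 H2] HQ].
    exists (Rmax 1 (Rmax (- M1) M2)). split.
    + eapply Rlt_le_trans; [|apply Rmax_l]. lra.
    + pose proof (Rmax_r 1 (Rmax (- M1) M2)). pose proof (Rmax_l (- M1) M2). pose proof (Rmax_r (- M1) M2).
      intros x y Hx Hy. apply (HQ x y); [apply H1; lra|apply H2; lra].
  - intros H P [eps HP]. destruct (H eps (cond_pos eps)) as [M [HM K]].
    exists (fun x => x < - M) (fun y => M < y).
    + exists (- M). auto.
    + exists M. auto.
    + intros x y Hx Hy. destruct (K x y Hx Hy) as [u [Hu Hd]]. exists u. split; auto.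
      apply HP. apply C_NormedModule_mixin_compat1. exact Hd.
Qed.

Lemma real_gen_spec (g : R -> R) (l : R) :
  @is_RInt_gen R_NormedModule g (Rbar_locally m_infty) (Rbar_locally p_infty) l ->
  forall eps, 0 < eps -> exists M, 0 < M /\ forall x y, x < - M -> M < y ->
    exists u, is_RInt g x y u /\ Rabs (u - l) < eps.
Proof.
  intros H eps He.
  assert (L : locally l (fun u => Rabs (u - l) < eps)) by (exists (mkposreal _ He); auto).
  destruct (H _ L) as [Q1 Q2 [M1 H1] [M2 H2] HQ].
  exists (Rmax 1 (Rmax (- M1) M2)). split.
  + eapply Rlt_le_trans; [|apply Rmax_l]. lra.
  + pose proof (Rmax_r 1 (Rmax (- M1) M2)). pose proof (Rmax_l (- M1) M2). pose proof (Rmax_r (- M1) M2).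
    intros x y Hx Hy. apply (HQ x y); [apply H1; lra|apply H2; lra].
Qed.

Lemma IG_ext (f g : R -> C) (v : C) : (forall t, f t = g t) -> IG f v -> IG g v.
Proof.
  intros H Hf. apply IG_spec. intros e He. destruct (proj1 (IG_spec _ _) Hf e He) as [M [HM K]].
  exists M. split; auto. intros x y Hx Hy. destruct (K x y Hx Hy) as [u [Hu Hd]].
  exists u. split; auto. eapply is_cint_ext; [|exact Hu]. auto.
Qed.

Lemma IG_0 : IG (fun _ => RtoC 0) 0.
Proof.
  apply IG_spec. intros e He. exists 1. split; [lra|]. intros x y _ _. exists 0. split.
  - apply (eq_rect (RtoC (y - x) * 0)%C (is_cint _ x y)); [apply is_cint_const|ring].
  - replace (0 - 0)%C with (RtoC 0) by ring. now rewrite Cmod_0.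
Qed.

Lemma IG_plus (f g : R -> C) (u v : C) : IG f u -> IG g v -> IG (fun t => f t + g t)%C (u + v).
Proof.
  intros Hf Hg. apply IG_spec. intros e He.
  destruct (proj1 (IG_spec _ _) Hf (e/2) ltac:(lra)) as [M [HM K]].
  destruct (proj1 (IG_spec _ _) Hg (e/2) ltac:(lra)) as [M' [HM' K']].
  exists (Rmax M M'). pose proof (Rmax_l M M'). pose proof (Rmax_r M M'). split; [lra|].
  intros x y Hx Hy. destruct (K x y ltac:(lra) ltac:(lra)) as [u1 [Hu Hd]].
  destruct (K' x y ltac:(lra) ltac:(lra)) as [v1 [Hv Hd']].
  exists (u1 + v1)%C. split; [now apply is_cint_plus|].
  replace (u1 + v1 - (u + v))%C with ((u1 - u) + (v1 - v))%C by ring.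
  eapply Rle_lt_trans; [apply Cmod_triangle|]. lra.
Qed.

Lemma IG_scal (f : R -> C) (c v : C) : IG f v -> IG (fun t => c * f t)%C (c * v).
Proof.
  intros Hf. apply IG_spec. intros e He. pose proof (Cmod_ge_0 c).
  destruct (proj1 (IG_spec _ _) Hf (e / (Cmod c + 1))) as [M [HM K]]; [apply Rdiv_lt_0_compat; lra|].
  exists M. split; auto. intros x y Hx Hy. destruct (K x y Hx Hy) as [u [Hu Hd]].
  exists (c * u)%C. split; [now apply is_cint_scal|].
  replace (c * u - c * v)%C with (c * (u - v))%C by ring. rewrite Cmod_mult.
  apply Rle_lt_trans with ((Cmod c + 1) * Cmod (u - v)).
  - pose proof (Cmod_ge_0 (u - v)). nra.
  - apply Rmult_lt_compat_l with (r := Cmod c + 1) in Hd; [|lra].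
    replace ((Cmod c + 1) * (e / (Cmod c + 1))) with e in Hd by (field; lra). exact Hd.
Qed.

Lemma IG_RInt_gen (f : R -> C) (v : C) : IG f v ->
  @RInt_gen C_R_CompleteNormedModule f (Rbar_locally m_infty) (Rbar_locally p_infty) = v.
Proof. intros H. apply (is_RInt_gen_unique (V := C_R_CompleteNormedModule) f v H). Qed.

Lemma IG_norm (f : R -> C) (g : R -> R) (v : C) (l : R) :
  (forall t, Cmod (f t) <= g t) -> IG f v ->
  @is_RInt_gen R_NormedModule g (Rbar_locally m_infty) (Rbar_locally p_infty) l -> Cmod v <= l.
Proof.
  intros H Hf Hg. apply Rle_plus_epsilon. intros e He.
  destruct (proj1 (IG_spec _ _) Hf (e/2) ltac:(lra)) as [M [HM K]].
  destruct (real_gen_spec _ _ Hg (e/2) ltac:(lra)) as [M' [HM' K']].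
  set (X := Rmax M M' + 1). pose proof (Rmax_l M M'). pose proof (Rmax_r M M').
  destruct (K (- X) X ltac:(unfold X; lra) ltac:(unfold X; lra)) as [u [Hu Hd]].
  destruct (K' (- X) X ltac:(unfold X; lra) ltac:(unfold X; lra)) as [w [Hw Hd']].
  assert (HX : - X <= X) by (unfold X; lra).
  pose proof (is_cint_le f g (- X) X w u HX (fun t _ => H t) Hu Hw).
  pose proof (Cmod_le_plus v u). rewrite Cmod_minus_sym in H3. apply Rabs_def2 in Hd'. lra.
Qed.

Lemma IG_dominated (f : R -> C) (g : R -> R) (T : R) :
  (forall t, Rcont f t) -> (forall t, T <= Rabs t -> Cmod (f t) <= g t) ->
  @ex_RInt_gen R_NormedModule g (Rbar_locally m_infty) (Rbar_locally p_infty) ->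
  exists v, IG f v.
Proof.
  intros Hc Hd [l Hl].
  assert (If : forall x y, is_cint f x y (cint f x y)) by (intros; apply ex_cint; auto).
  assert (Key : forall eps, 0 < eps -> exists M, 0 < M /\ forall x y x' y',
    x <= x' -> x' < - M -> M < y' -> y' <= y -> Cmod (cint f x y - cint f x' y') < eps).
  { intros e He. destruct (real_gen_spec g l Hl (e/2) ltac:(lra)) as [M [HM K]].
    exists (Rmax M T). pose proof (Rmax_l M T). pose proof (Rmax_r M T). split; [lra|].
    intros x y x' y' H1 H2 H3 H4.
    destruct (K x y ltac:(lra) ltac:(lra)) as [w [Hw Dw]].
    destruct (K x' y' ltac:(lra) ltac:(lra)) as [w' [Hw' Dw']].
    assert (E1 : ex_RInt g x x').
    { apply (ex_RInt_Chasles_1 g x x' y); [lra|]. now exists w. }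
    assert (E2 : ex_RInt g y' y).
    { apply (ex_RInt_Chasles_2 g x y' y); [lra|]. now exists w. }
    destruct E1 as [w1 Hw1]. destruct E2 as [w2 Hw2].
    assert (Ew : w = w1 + w' + w2).
    { pose proof (is_RInt_Chasles _ _ _ _ _ _ (is_RInt_Chasles _ _ _ _ _ _ Hw1 Hw') Hw2) as Hs.
      rewrite <- (is_RInt_unique _ _ _ _ Hw). apply is_RInt_unique. exact Hs. }
    assert (Ec : cint f x y = (cint f x x' + cint f x' y' + cint f y' y)%C).
    { apply cint_unique. eapply is_cint_Chasles; [eapply is_cint_Chasles|]; apply If. }
    rewrite Ec. replace (cint f x x' + cint f x' y' + cint f y' y - cint f x' y')%C
      with (cint f x x' + cint f y' y)%C by ring.
    assert (B1 : Cmod (cint f x x') <= w1).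
    { apply (is_cint_le f g x x'); auto. intros t Ht. apply Hd. rewrite Rabs_left; lra. }
    assert (B2 : Cmod (cint f y' y) <= w2).
    { apply (is_cint_le f g y' y); auto. intros t Ht. apply Hd. rewrite Rabs_pos_eq; lra. }
    apply Rabs_def2 in Dw. apply Rabs_def2 in Dw'.
    eapply Rle_lt_trans; [apply Cmod_triangle|]. lra. }
  destruct (Clim_cauchy (fun n => cint f (- INR n) (INR n))) as [v Hv].
  { intros e He. destruct (Key (e/2) ltac:(lra)) as [M [HM K]].
    destruct (INR_unbounded M) as [n0 Hn0]. exists n0. intros n m Hn Hm.
    apply le_INR in Hn. apply le_INR in Hm.
    pose proof (K (- INR n) (INR n) (- INR n0) (INR n0) ltac:(lra) ltac:(lra) ltac:(lra) ltac:(lra)).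
    pose proof (K (- INR m) (INR m) (- INR n0) (INR n0) ltac:(lra) ltac:(lra) ltac:(lra) ltac:(lra)).
    rewrite Cmod_minus_sym in H0.
    pose proof (Cmod_minus_triangle (cint f (- INR n) (INR n)) (cint f (- INR n0) (INR n0)) (cint f (- INR m) (INR m))).
    lra. }
  exists v. apply IG_spec. intros e He. destruct (Key (e/2) ltac:(lra)) as [M [HM K]].
  destruct (Hv (e/2) ltac:(lra)) as [n1 Hn1].
  destruct (INR_unbounded M) as [n0 Hn0]. set (n := Nat.max n0 n1).
  assert (Hn : M < INR n) by (eapply Rlt_le_trans; [exact Hn0|apply le_INR; unfold n; lia]).
  exists (INR n). split; [lra|]. intros x y Hx Hy. exists (cint f x y). split; auto.
  pose proof (K x y (- INR n) (INR n) ltac:(lra) ltac:(lra) ltac:(lra) ltac:(lra)).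
  specialize (Hn1 n ltac:(unfold n; lia)).
  pose proof (Cmod_minus_triangle (cint f x y) (cint f (- INR n) (INR n)) v). lra.
Qed.

Lemma Rcont_Cmod (f : R -> C) (t : R) : Rcont f t -> Rcont (fun s => RtoC (Cmod (f s))) t.
Proof.
  intros H eps He. destruct (H eps He) as [d [Hd K]]. exists d; split; auto.
  intros s Hs. rewrite <- RtoC_minus, Cmod_R. eapply Rle_lt_trans; [|apply (K s Hs)].
  pose proof (Cmod_le_plus (f s) (f t)). pose proof (Cmod_le_plus (f t) (f s)).
  rewrite (Cmod_minus_sym (f t)) in H1. apply Rabs_le. lra.
Qed.

Lemma Rcont_RtoC_id (t : R) : Rcont RtoC t.
Proof.
  intros eps He. exists eps. split; auto. intros s Hs. rewrite <- RtoC_minus, Cmod_R. auto.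
Qed.

Lemma Rcont_abs (t : R) : Rcont (fun s => RtoC (Rabs s)) t.
Proof.
  apply (Rcont_ext (fun s => RtoC (Cmod (RtoC s)))); [intros; now rewrite Cmod_R|].
  apply Rcont_Cmod, Rcont_RtoC_id.
Qed.

Lemma Rcont_pow (f : R -> R) (n : nat) (t : R) :
  Rcont (fun s => RtoC (f s)) t -> Rcont (fun s => RtoC (f s ^ n)) t.
Proof.
  intros H. induction n; simpl; [apply Rcont_const|].
  apply (Rcont_ext (fun s => RtoC (f s) * RtoC (f s ^ n))%C); [intros; now rewrite RtoC_mult|].
  now apply Rcont_mult.
Qed.

Lemma Rcont_exp (f : R -> R) (t : R) : Rcont (fun s => RtoC (f s)) t -> Rcont (fun s => RtoC (exp (f s))) t.
Proof.
  intros H. apply (Rcont_ext (fun s => Cexp (RtoC (f s)))).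
  - intros s. unfold Cexp; simpl. rewrite cos_0, sin_0. apply injective_projections; simpl; ring.
  - apply (Rcont_comp Cexp (fun s => RtoC (f s))); auto. apply hol_cont. eexists; apply Cder_Cexp.
Qed.

Lemma hol_param (J : (R -> C) -> C -> Prop) (D : R -> Prop) (G : R -> R) (B M rho : R)
  (f : C -> R -> C) (Phi : C -> C) (z : C) :
  (forall g c v, J g v -> J (fun t => c * g t)%C (c * v)%C) ->
  (forall g g' u v, J g u -> J g' v -> J (fun t => g t - g' t)%C (u - v)%C) ->
  (forall g v K, 0 <= K -> J g v -> (forall t, D t -> Cmod (g t) <= K * G t) -> Cmod v <= K * B) ->
  0 <= B -> (forall t, D t -> 0 <= G t) -> 0 <= M -> 0 < rho ->
  (forall w, Cmod (w - z) < rho -> J (f w) (Phi w)) ->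
  (forall t w, D t -> Cmod (w - z) < rho -> hol (fun u => f u t) w) ->
  (forall t w, D t -> Cmod (w - z) < rho -> Cmod (f w t) <= M * G t) ->
  hol Phi z.
Proof.
  intros Js Jm Jn HB HG HM Hrho HJ Hh Hb.
  assert (P : 0 < rho * rho) by nra. assert (Pi : 0 < / (rho * rho)) by now apply Rinv_0_lt_compat.
  set (K := 32 * M / (rho * rho)).
  assert (HK : 0 <= K) by (unfold K; apply Rmult_le_pos; lra).
  apply (lip_dq_hol Phi z (rho / 4) (K * B)); [lra|apply Rmult_le_pos; auto|].
  intros w w' n n' Hw Hw'.
  assert (Hz : Cmod (z - z) < rho) by (replace (z - z)%C with (RtoC 0) by ring; rewrite Cmod_0; lra).
  pose proof (Jm _ _ _ _ (Js _ (/ (w - z))%C _ (Jm _ _ _ _ (HJ w ltac:(lra)) (HJ z Hz)))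
     (Js _ (/ (w' - z))%C _ (Jm _ _ _ _ (HJ w' ltac:(lra)) (HJ z Hz)))) as E.
  replace (dq Phi z w - dq Phi z w')%C with
    (/ (w - z) * (Phi w - Phi z) - / (w' - z) * (Phi w' - Phi z))%C by (unfold dq, Cdiv; ring).
  replace (K * B * Cmod (w - w')) with (K * Cmod (w - w') * B) by ring.
  apply (Jn _ _ (K * Cmod (w - w'))) with (2 := E).
  - apply Rmult_le_pos; auto. apply Cmod_ge_0.
  - intros t Ht. cbv beta.
    pose proof (hol_bounded_lip_dq (fun u => f u t) z rho (M * G t) Hrho
      (fun u Hu => Hh t u Ht Hu) (fun u Hu => Hb t u Ht Hu) w w' n n' Hw Hw') as L.
    unfold dq, Cdiv in L.
    replace (/ (w - z) * (f w t - f z t) - / (w' - z) * (f w' t - f z t))%C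
      with ((f w t - f z t) * / (w - z) - (f w' t - f z t) * / (w' - z))%C by ring.
    eapply Rle_trans; [exact L|]. right. unfold K. field. lra.
Qed.

Lemma powabs_INR (t : R) (k : nat) : (0 < k)%nat -> powabs t (INR k) = Rabs t ^ k.
Proof.
  intros Hk. unfold powabs. destruct Req_EM_T as [->|n].
  - rewrite Rabs_R0. rewrite pow_i; auto.
  - apply Rpower_pow. now apply Rabs_pos_lt.
Qed.

Lemma one_plus_pow (t : R) (k : nat) : 1 <= Rabs t -> (1 + Rabs t) ^ k <= 2 ^ k * Rabs t ^ k.
Proof.
  intros H. rewrite <- Rpow_mult_distr. apply pow_incr. lra.
Qed.

(** * Estimates on the vertical line *)

Lemma sg_lower_strip (eta : R) (z : C) : 0 < eta <= / 2 -> eta <= Rabs (fst z) <= 1 - eta ->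
  sin (PI * eta) / (2 * PI) * exp (PI * Rabs (snd z)) <= Cmod (sg z).
Proof.
  intros He Hz. pose proof PI_RGT_0 as P.
  eapply Rle_trans; [|apply sg_lower_sin].
  replace (Rabs (sin (PI * fst z)) * exp (PI * Rabs (snd z)) / 2 / PI)
    with (Rabs (sin (PI * fst z)) / (2 * PI) * exp (PI * Rabs (snd z))) by (field; lra).
  apply Rmult_le_compat_r; [apply Rlt_le, exp_pos|].
  apply Rmult_le_compat_r; [apply Rlt_le, Rinv_0_lt_compat; lra|].
  assert (S : sin (PI * eta) <= sin (PI * Rabs (fst z))).
  { set (x := Rabs (fst z)) in *. destruct (Rle_lt_dec x (/ 2)).
    - apply sin_incr_1; nra.
    - rewrite <- (sin_PI_x (PI * x)). apply sin_incr_1; nra. }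
  eapply Rle_trans; [exact S|].
  unfold Rabs. destruct (Rcase_abs (fst z)) as [L|L].
  - rewrite <- Ropp_mult_distr_r, sin_neg. destruct Rcase_abs; lra.
  - destruct Rcase_abs; lra.
Qed.

Lemma sin_eta_pos (eta : R) : 0 < eta <= / 2 -> 0 < sin (PI * eta).
Proof. intros H. pose proof PI_RGT_0. apply sin_gt_0; nra. Qed.

Lemma exp_shift (t y b : R) : 0 <= b -> Rabs t - b <= Rabs y ->
  exp (- (PI * b)) * exp (PI * Rabs t) <= exp (PI * Rabs y).
Proof.
  intros Hb H. pose proof PI_RGT_0. rewrite <- exp_plus. apply exp_le. nra.
Qed.

Lemma Cprod_norm (n : nat) (f : nat -> C) (K : R) : 0 <= K ->
  (forall i, (i < n)%nat -> Cmod (f i) <= K) -> Cmod (Cprod n f) <= K ^ n.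
Proof.
  intros HK. induction n; intros H; simpl.
  - rewrite Cmod_1. lra.
  - rewrite Cmod_mult, Rmult_comm. apply Rmult_le_compat; auto using Cmod_ge_0.
Qed.

Section Line.
Variables (d1 d2 rho : R) (N : nat) (a : nat -> C) (F : C -> C).
Hypothesis Hd2 : 0 < d2 < 1.
Hypothesis Hd1 : 0 < d1.
Hypothesis Hrho : d1 < rho /\ rho < d2 /\ rho < 1 - d2.
Hypothesis HN : (1 <= N)%nat.
Hypothesis Ha : forall i, (i < N)%nat -> Cmod (a i) < d1.
Hypothesis HFhol : forall z : C, fst z <= d2 -> hol F z.
Hypothesis HFnz : forall z : C, Cmod z < rho -> F z <> 0.
Hypothesis Hline : forall kappa, 0 < kappa ->
  ex_RInt_gen (fun t => exp (PI * (INR N / 2 - 1) * Rabs t) * powabs t kappa * Cmod (F (vline d2 t)))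
              (Rbar_locally m_infty) (Rbar_locally p_infty).

Definition Wgt (t : R) : R :=
  exp (PI * (INR N / 2 - 1) * Rabs t) * (1 + Rabs t) ^ (2 * N) * Cmod (F (d2, t)).

Lemma Wgt_pos (t : R) : 0 <= Wgt t.
Proof.
  unfold Wgt. pose proof (Rabs_pos t). repeat apply Rmult_le_pos.
  - apply Rlt_le, exp_pos.
  - apply pow_le; lra.
  - apply Cmod_ge_0.
Qed.

Lemma Ccont_F (t : R) : Ccont F (d2, t).
Proof. apply hol_cont, HFhol. simpl. lra. Qed.

Lemma Wgt_int : exists l, 0 <= l /\
  @is_RInt_gen R_NormedModule Wgt (Rbar_locally m_infty) (Rbar_locally p_infty) l.
Proof.
  set (g := fun t => exp (PI * (INR N / 2 - 1) * Rabs t) * powabs t (INR (2 * N)) * Cmod (F (vline d2 t))).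
  assert (PN : (0 < 2 * N)%nat) by lia.
  assert (Hg : ex_RInt_gen g (Rbar_locally m_infty) (Rbar_locally p_infty)).
  { apply Hline. now apply lt_0_INR. }
  destruct Hg as [lg Hg].
  assert (Hg2 : @ex_RInt_gen R_NormedModule (fun t => scal (2 ^ (2 * N)) (g t))
      (Rbar_locally m_infty) (Rbar_locally p_infty)).
  { eexists. apply (@is_RInt_gen_scal R_NormedModule); [| |exact Hg]; apply Rbar_locally_filter. }
  destruct (IG_dominated (fun t => RtoC (Wgt t)) (fun t => scal (2 ^ (2 * N)) (g t)) 1) as [v Hv]; auto.
  - intros t. unfold Wgt.
    apply (Rcont_ext (fun t => RtoC (exp (PI * (INR N / 2 - 1) * Rabs t)) * RtoC ((1 + Rabs t) ^ (2 * N))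
        * RtoC (Cmod (F (d2, t))))%C); [intros; now rewrite !RtoC_mult|].
    apply Rcont_mult; [apply Rcont_mult|].
    + apply Rcont_exp.
      apply (Rcont_ext (fun t => RtoC (PI * (INR N / 2 - 1)) * RtoC (Rabs t))%C);
        [intros; now rewrite <- RtoC_mult|].
      apply Rcont_mult; [apply Rcont_const|apply Rcont_abs].
    + apply (Rcont_pow (fun t => 1 + Rabs t)).
      apply (Rcont_ext (fun t => 1 + RtoC (Rabs t))%C); [intros; now rewrite <- RtoC_plus|].
      apply Rcont_plus; [apply Rcont_const|apply Rcont_abs].
    + apply Rcont_Cmod. apply Rcont_vline, Ccont_F.
  - intros t Ht. rewrite Cmod_R, Rabs_pos_eq by apply Wgt_pos.
    unfold Wgt, g, scal; simpl. unfold mult; simpl. rewrite powabs_INR by auto.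
    pose proof (one_plus_pow t (2 * N) Ht).
    change (vline d2 t) with (d2, t).
    pose proof (exp_pos (PI * (INR N / 2 - 1) * Rabs t)). pose proof (Cmod_ge_0 (F (d2, t))).
    change (N + (N + 0))%nat with (2 * N)%nat.
    replace (2 ^ (2 * N) * (exp (PI * (INR N / 2 - 1) * Rabs t) * Rabs t ^ (2 * N) * Cmod (F (d2, t))))
      with (exp (PI * (INR N / 2 - 1) * Rabs t) * (2 ^ (2 * N) * Rabs t ^ (2 * N)) * Cmod (F (d2, t))) by ring.
    apply Rmult_le_compat_r; auto. apply Rmult_le_compat_l; lra.
  - assert (E : @is_RInt_gen R_NormedModule Wgt (Rbar_locally m_infty) (Rbar_locally p_infty) (fst v)).
    { intros P [eps HP].
      destruct (proj1 (IG_spec _ _) Hv eps (cond_pos eps)) as [M [HM K]].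
      exists (fun x => x < - M) (fun y => M < y); [exists (- M); auto|exists M; auto|].
      intros x y Hx Hy. destruct (K x y Hx Hy) as [u [Hu Hd]].
      exists (fst u). split; [exact (is_RInt_fct_extend_fst _ _ _ _ Hu)|].
      apply HP. change (Rabs (fst u - fst v) < eps).
      eapply Rle_lt_trans; [apply (Re_le_Cmod (u - v))|exact Hd]. }
    exists (fst v). split; auto.
    eapply Rle_trans; [apply (Cmod_ge_0 0)|].
    apply (IG_norm (fun _ => RtoC 0) Wgt); auto; [|apply IG_0].
    intros t. rewrite Cmod_0. apply Wgt_pos.
Qed.

Definition HHw (t : R) : R := (1 + Rabs t) ^ (2 * N) * exp (PI * (INR N / 2) * Rabs t).

Lemma HHw_pos (t : R) : 0 <= HHw t.
Proof.
  unfold HHw. pose proof (Rabs_pos t). apply Rmult_le_pos; [apply pow_le; lra|apply Rlt_le, exp_pos].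
Qed.

Lemma d1_half : d1 < / 2.
Proof. lra. Qed.

Lemma a_re (m : nat) : (m < N)%nat -> Rabs (fst (a m)) < d1 /\ Rabs (snd (a m)) < d1.
Proof.
  intros Hm. pose proof (Ha m Hm). pose proof (Re_le_Cmod (a m)). pose proof (Im_le_Cmod (a m)). lra.
Qed.

Lemma HH_bound : exists K, 0 <= K /\ forall k w, - d1 <= fst w <= d2 ->
  Cmod (HH N a F k w) <= K * HHw (snd w) * Cmod (F w).
Proof.
  destruct RG_growth as [Kg [PKg HK]].
  set (K1 := Kg * (4 * exp (PI / 2))). pose proof PI_RGT_0 as PP.
  assert (PK1 : 0 <= K1) by (unfold K1; pose proof (exp_pos (PI / 2)); nra).
  exists (K1 ^ N). split; [now apply pow_le|]. intros k w Hw.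
  unfold HH. rewrite Cmod_mult, Rmult_comm. apply Rmult_le_compat_r; [apply Cmod_ge_0|].
  set (t := snd w). pose proof (Rabs_pos t) as Pt.
  assert (B : forall m z, (m < N)%nat -> snd z = snd (w - a m)%C -> -1 <= fst z <= 2 ->
    Cmod (RecipGamma z) <= K1 * ((1 + Rabs t) ^ 2 * exp (PI / 2 * Rabs t))).
  { intros m z Hm Ez Hz. eapply Rle_trans; [now apply HK|].
    destruct (a_re m Hm) as [_ Am]. pose proof d1_half.
    assert (Hy : Rabs (snd z) <= Rabs t + 1).
    { rewrite Ez. simpl. eapply Rle_trans; [apply Rabs_triang|]. rewrite Rabs_Ropp. fold t. lra. }
    pose proof (Rabs_pos (snd z)) as Py.
    assert (B1 : (1 + Rabs (snd z)) ^ 2 <= 4 * (1 + Rabs t) ^ 2) by nra.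
    assert (B2 : exp (PI * Rabs (snd z) / 2) <= exp (PI / 2) * exp (PI / 2 * Rabs t)).
    { rewrite <- exp_plus. apply exp_le. nra. }
    unfold K1.
    replace (Kg * (4 * exp (PI / 2)) * ((1 + Rabs t) ^ 2 * exp (PI / 2 * Rabs t)))
      with (Kg * (4 * (1 + Rabs t) ^ 2 * (exp (PI / 2) * exp (PI / 2 * Rabs t)))) by ring.
    apply Rmult_le_compat_l; [lra|]. apply Rmult_le_compat; auto; [nra|apply Rlt_le, exp_pos]. }
  replace (K1 ^ N * HHw t) with ((K1 * ((1 + Rabs t) ^ 2 * exp (PI / 2 * Rabs t))) ^ N).
  - apply Cprod_norm.
    + apply Rmult_le_pos; auto. apply Rmult_le_pos; [nra|apply Rlt_le, exp_pos].
    + intros m Hm. destruct (a_re m Hm) as [Ar _]. pose proof d1_half. apply Rabs_def2 in Ar.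
      destruct (m <? k)%nat; apply (B m); auto; simpl; lra.
  - unfold HHw. rewrite !Rpow_mult_distr. f_equal. rewrite <- pow_mult. f_equal.
    clear. replace (PI * (INR N / 2) * Rabs t) with (INR N * (PI / 2 * Rabs t)) by field.
    induction N as [|n IHn]; [simpl; rewrite Rmult_0_l, exp_0; auto|].
    rewrite S_INR. simpl pow. rewrite IHn, <- exp_plus. f_equal. ring.
Qed.

Lemma HHw_Wgt (t : R) : HHw t * Cmod (F (d2, t)) = exp (PI * Rabs t) * Wgt t.
Proof.
  unfold HHw, Wgt.
  replace (exp (PI * (INR N / 2) * Rabs t)) with (exp (PI * Rabs t) * exp (PI * (INR N / 2 - 1) * Rabs t))
    by (rewrite <- exp_plus; f_equal; field).
  ring.
Qed.

(* A multiplier gains the factor [exp (- PI |t|)] that makes a member of [fun_class] integrable. *)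

Definition mul_class (s : C -> C) : Prop :=
  (forall t, Ccont s (d2, t)) /\
  exists K, 0 <= K /\ forall t, Cmod (s (d2, t)) * exp (PI * Rabs t) <= K.

Definition fun_class (c : C -> C) : Prop :=
  (forall t, Ccont c (d2, t)) /\
  exists K, 0 <= K /\ forall t, Cmod (c (d2, t)) <= K * (exp (PI * Rabs t) * Wgt t).

Definition eta : R := Rmin (d2 - rho) (1 - d2 - rho).
Lemma eta_spec : 0 < eta <= / 2 /\ eta <= d2 - rho /\ eta <= 1 - d2 - rho.
Proof.
  unfold eta. pose proof (Rmin_l (d2 - rho) (1 - d2 - rho)). pose proof (Rmin_r (d2 - rho) (1 - d2 - rho)).
  split; [|lra]. split; [apply Rmin_glb_lt; lra|]. lra.
Qed.

Definition sgc : R := sin (PI * eta) / (2 * PI) * exp (- (PI * 1)).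
Lemma sgc_pos : 0 < sgc.
Proof.
  unfold sgc. pose proof PI_RGT_0. destruct eta_spec as [E _].
  apply Rmult_lt_0_compat; [|apply exp_pos]. apply Rdiv_lt_0_compat; [now apply sin_eta_pos|lra].
Qed.

Lemma sg_line (v : C) (t : R) : Cmod v < rho ->
  sgc * exp (PI * Rabs t) <= Cmod (sg ((d2, t) - v)).
Proof.
  intros Hv. destruct eta_spec as [E1 [E2 E3]].
  pose proof (Re_le_Cmod v) as Rv. pose proof (Im_le_Cmod v) as Iv.
  assert (Rabs (fst v) < rho) as R1 by lra. apply Rabs_def2 in R1.
  eapply Rle_trans; [|apply (sg_lower_strip eta); auto].
  - unfold sgc. rewrite Rmult_assoc. apply Rmult_le_compat_l.
    + apply Rlt_le, Rdiv_lt_0_compat; [now apply sin_eta_pos|pose proof PI_RGT_0; lra].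
    + apply exp_shift; [lra|]. simpl. pose proof (Rabs_triang_inv t (snd v)). unfold Rminus in *. lra.
  - simpl. rewrite Rabs_pos_eq by lra. lra.
Qed.

Lemma sg_line_neq0 (v : C) (t : R) : Cmod v < rho -> sg ((d2, t) - v) <> 0.
Proof.
  intros Hv E. pose proof (sg_line v t Hv) as L. rewrite E, Cmod_0 in L.
  pose proof sgc_pos. pose proof (exp_pos (PI * Rabs t)). nra.
Qed.

Lemma regular_line (t : R) : regular N a (d2, t).
Proof. intros m Hm. apply sg_line_neq0. pose proof (Ha m Hm). lra. Qed.

Lemma SS_line (v : C) (t : R) : Cmod v < rho -> sg (v - (d2, t)) <> 0.
Proof.
  intros Hv E. apply (sg_line_neq0 v t Hv).
  replace ((d2, t) - v)%C with (- (v - (d2, t)))%C by ring. rewrite sg_opp, E. ring.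
Qed.

Lemma SS_bound (v : C) (t : R) : Cmod v < rho -> Cmod (SS v (d2, t)) * exp (PI * Rabs t) <= / sgc.
Proof.
  intros Hv. unfold SS. rewrite Cmod_inv by now apply SS_line.
  replace (v - (d2, t))%C with (- ((d2, t) - v))%C by ring. rewrite sg_opp, Cmod_opp.
  pose proof (sg_line v t Hv) as L. pose proof sgc_pos as Pc. pose proof (exp_pos (PI * Rabs t)) as Pe.
  assert (P : 0 < Cmod (sg ((d2, t) - v))) by nra.
  apply Rmult_le_reg_l with (Cmod (sg ((d2, t) - v))); auto.
  rewrite <- Rmult_assoc, Rinv_r, Rmult_1_l by lra.
  apply Rmult_le_reg_r with sgc; auto. rewrite Rmult_assoc, Rinv_l by lra. lra.
Qed.

Lemma hol_SS_l (v w : C) : sg (v - w) <> 0 -> hol (fun u => SS u w) v.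
Proof.
  intros H. unfold SS. apply (hol_inv (fun u => sg (u - w))); auto.
  apply hol_sg, hol_minus; [apply hol_id|apply hol_const].
Qed.

Lemma hol_SS_r (v w : C) : sg (v - w) <> 0 -> hol (SS v) w.
Proof.
  intros H. unfold SS. apply (hol_inv (fun u => sg (v - u))); auto.
  apply hol_sg, hol_minus; [apply hol_const|apply hol_id].
Qed.

Lemma SS_mul (v : C) : Cmod v < rho -> mul_class (SS v).
Proof.
  intros Hv. split.
  - intros t. apply hol_cont, hol_SS_r. now apply SS_line.
  - exists (/ sgc). split; [apply Rlt_le, Rinv_0_lt_compat, sgc_pos|].
    intros t. now apply SS_bound.
Qed.

Definition phiK (c : R) : R := Rmax 1 (/ (c * exp (- PI))).

Lemma phi_lower (c : R) (w : C) (l : nat) : 0 < c ->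
  (forall m, (m < N)%nat -> c * exp (PI * Rabs (snd w)) <= Cmod (sg (w - a m))) ->
  Cmod (/ phi N (Aa a) l (VV w)) <= phiK c ^ N.
Proof.
  intros Hc H. pose proof PI_RGT_0 as PP.
  assert (Pk : 1 <= phiK c) by apply Rmax_l.
  assert (L : forall m, (m < N)%nat -> c * exp (- PI) <= Cmod (VV w - Aa a m)).
  { intros m Hm. unfold Aa. rewrite VV_diff, !Cmod_mult, !Cmod_ev. specialize (H m Hm).
    destruct (a_re m Hm) as [_ Am]. apply Rabs_def2 in Am. pose proof d1_half as D.
    assert (E1 : exp (- PI) <= exp (- (PI * snd (a m)))) by (apply exp_le; nra).
    assert (E2 : 1 <= exp (- (PI * snd w)) * exp (PI * Rabs (snd w))).
    { rewrite <- exp_plus, <- exp_0. apply exp_le. pose proof (Rle_abs (snd w)). nra. }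
    pose proof (exp_pos (- PI)) as X1. pose proof (exp_pos (- (PI * snd w))) as X2.
    pose proof (exp_pos (- (PI * snd (a m)))) as X3. pose proof (exp_pos (PI * Rabs (snd w))) as X4.
    apply Rle_trans with (exp (- (PI * snd w)) * exp (- PI) * (c * exp (PI * Rabs (snd w)))).
    - replace (exp (- (PI * snd w)) * exp (- PI) * (c * exp (PI * Rabs (snd w))))
        with (c * exp (- PI) * (exp (- (PI * snd w)) * exp (PI * Rabs (snd w)))) by ring.
      assert (0 < c * exp (- PI)) by nra. nra.
    - apply Rmult_le_compat; auto; [nra|nra|]. apply Rmult_le_compat_l; lra. }
  assert (Pc : 0 < c * exp (- PI)) by (pose proof (exp_pos (- PI)); nra).
  unfold phi. rewrite <- Cprod_inv.
  - apply Cprod_norm; [lra|]. intros m Hm. destruct (m <? l)%nat.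
    + replace (/ 1)%C with (RtoC 1) by field. rewrite Cmod_1. auto.
    + specialize (L m Hm). rewrite Cmod_inv by (apply Cmod_gt_0; lra).
      eapply Rle_trans; [|apply Rmax_r]. now apply Rinv_le_contravar.
  - intros m Hm. destruct (m <? l)%nat; [intros E; injection E; lra|].
    apply Cmod_gt_0. specialize (L m Hm). lra.
Qed.

Lemma eps_bound (c : R) : 0 < c -> exists K, 0 <= K /\ forall l w, (l < N)%nat ->
  (forall m, (m < N)%nat -> c * exp (PI * Rabs (snd w)) <= Cmod (sg (w - a m))) ->
  Cmod (eps N a l w) * exp (PI * Rabs (snd w)) <= K.
Proof.
  intros Hc. pose proof PI_RGT_0 as PP.
  assert (Pk : 1 <= phiK c) by apply Rmax_l.
  assert (Pc : 0 < c * exp (- PI)) by (pose proof (exp_pos (- PI)); nra).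
  exists (/ (c * exp (- PI)) * phiK c ^ N). split.
  { apply Rmult_le_pos; [apply Rlt_le, Rinv_0_lt_compat; auto|apply pow_le; lra]. }
  intros l w Hl H.
  assert (Hr : regular N a w).
  { intros m Hm E. specialize (H m Hm). rewrite E, Cmod_0 in H. pose proof (exp_pos (PI * Rabs (snd w))). nra. }
  rewrite eps_alt, Cmod_opp, Cmod_mult by auto.
  pose proof (phi_lower c w (S l) Hc H) as B.
  rewrite Cmod_inv by (apply Cmult_neq_0; [apply ev_neq0|now apply Hr]).
  rewrite Cmod_mult, Cmod_ev. specialize (H l Hl).
  destruct (a_re l Hl) as [_ Am]. apply Rabs_def2 in Am. pose proof d1_half as D.
  assert (E1 : exp (- PI) <= exp (- (PI * snd (a l)))) by (apply exp_le; nra).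
  pose proof (exp_pos (- PI)) as X1. pose proof (exp_pos (PI * Rabs (snd w))) as X4.
  set (X := exp (- (PI * snd (a l))) * Cmod (sg (w - a l))).
  assert (LX : c * exp (- PI) * exp (PI * Rabs (snd w)) <= X).
  { unfold X. replace (c * exp (- PI) * exp (PI * Rabs (snd w))) with (exp (- PI) * (c * exp (PI * Rabs (snd w)))) by ring.
    apply Rmult_le_compat; nra. }
  assert (PX : 0 < X) by nra.
  assert (Q : / X * exp (PI * Rabs (snd w)) <= / (c * exp (- PI))).
  { apply Rmult_le_reg_l with X; auto. rewrite <- Rmult_assoc, Rinv_r, Rmult_1_l by lra.
    apply Rmult_le_reg_r with (c * exp (- PI)); auto. rewrite Rmult_assoc, Rinv_l by lra. lra. }
  replace (/ X * Cmod (/ phi N (Aa a) (S l) (VV w)) * exp (PI * Rabs (snd w)))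
    with (/ X * exp (PI * Rabs (snd w)) * Cmod (/ phi N (Aa a) (S l) (VV w))) by ring.
  apply Rmult_le_compat; auto using Cmod_ge_0.
  apply Rmult_le_pos; [apply Rlt_le, Rinv_0_lt_compat; auto|lra].
Qed.

Lemma sg_line_a (t : R) (m : nat) : (m < N)%nat ->
  sgc * exp (PI * Rabs (snd (d2, t))) <= Cmod (sg ((d2, t) - a m)).
Proof. intros Hm. apply sg_line. pose proof (Ha m Hm). lra. Qed.

Lemma eps_mul (l : nat) : (l < N)%nat -> mul_class (eps N a l).
Proof.
  intros Hl. split.
  - intros t. apply hol_cont, hol_eps, regular_line.
  - destruct (eps_bound sgc sgc_pos) as [K [PK HK]]. exists K. split; auto.
    intros t. apply (HK l (d2, t) Hl). intros m Hm. now apply sg_line_a.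
Qed.

Lemma HH_fun (k : nat) : fun_class (HH N a F k).
Proof.
  split.
  - intros t. apply hol_cont, hol_HH, HFhol. simpl; lra.
  - destruct HH_bound as [K [PK HK]]. exists K. split; auto. intros t.
    rewrite <- HHw_Wgt, <- Rmult_assoc. apply (HK k (d2, t)). simpl. lra.
Qed.

Lemma fun_class_mult (c b : C -> C) (B : R) : fun_class c ->
  (forall t, Ccont b (d2, t)) -> (forall t, Cmod (b (d2, t)) <= B) ->
  fun_class (fun w => c w * b w)%C.
Proof.
  intros [Hc [K [PK HK]]] Hb HB. split; [intros t; apply Ccont_mult; auto|].
  assert (PB : 0 <= B) by (eapply Rle_trans; [apply Cmod_ge_0|apply (HB 0)]).
  exists (K * B). split; [now apply Rmult_le_pos|]. intros t. rewrite Cmod_mult.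
  replace (K * B * (exp (PI * Rabs t) * Wgt t)) with (K * (exp (PI * Rabs t) * Wgt t) * B) by ring.
  apply Rmult_le_compat; auto using Cmod_ge_0.
Qed.

Lemma line_neq (y : C) (t : R) : Cmod y < rho -> ((d2, t) - y <> 0)%C /\ Cmod (/ ((d2, t) - y)) <= / (d2 - rho).
Proof.
  intros Hy. pose proof (Re_le_Cmod y). assert (Rabs (fst y) < rho) as R1 by lra. apply Rabs_def2 in R1.
  pose proof (Re_le_Cmod ((d2, t) - y)) as L. simpl in L. rewrite Rabs_pos_eq in L by lra.
  assert (P : d2 - rho <= Cmod ((d2, t) - y)) by lra.
  assert (n : ((d2, t) - y <> 0)%C) by (apply Cmod_gt_0; lra). split; auto.
  rewrite Cmod_inv by auto. apply Rinv_le_contravar; lra.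
Qed.

Lemma hol_inv_l (w y : C) : (w - y <> 0)%C -> hol (fun u => / (w - u))%C y.
Proof. intros H. apply (hol_inv (fun u => w - u)%C); auto. apply hol_minus; [apply hol_const|apply hol_id]. Qed.

Lemma hol_inv_r (w y : C) : (w - y <> 0)%C -> hol (fun u => / (u - y))%C w.
Proof. intros H. apply (hol_inv (fun u => u - y)%C); auto. apply hol_minus; [apply hol_id|apply hol_const]. Qed.

Lemma fun_class_pole (c : C -> C) (y : C) : Cmod y < rho -> fun_class c ->
  fun_class (fun w => c w * / (w - y))%C.
Proof.
  intros Hy Hc. apply (fun_class_mult c (fun w => / (w - y))%C (/ (d2 - rho))); auto.
  - intros t. apply hol_cont, hol_inv_r. now apply line_neq.
  - intros t. now apply line_neq.
Qed.

Lemma fun_class_QQ (c : C -> C) : fun_class c -> fun_class (fun w => c w * / QQ N a w)%C.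
Proof.
  intros Hc. apply (fun_class_mult c (fun w => / QQ N a w)%C (phiK sgc ^ N)); auto.
  - intros t. apply hol_cont. apply (hol_inv (QQ N a)); [apply hol_QQ|].
    apply phi_neq0. apply regular_VV, regular_line.
  - intros t. apply phi_lower; [apply sgc_pos|]. intros m Hm. now apply sg_line_a.
Qed.

(** * The contour integral over the line, divided by [2 pi i] *)

Definition is_LI (f : C -> C) (v : C) : Prop := IG (fun t => Ci * f (d2, t))%C (two_pi_i * v).
Definition LI (f : C -> C) : C :=
  (@RInt_gen C_R_CompleteNormedModule (fun t => Ci * f (d2, t))%C
     (Rbar_locally m_infty) (Rbar_locally p_infty) / two_pi_i)%C.

Lemma is_LI_unique (f : C -> C) (v : C) : is_LI f v -> LI f = v.
Proof. intros H. unfold LI. rewrite (IG_RInt_gen _ _ H). field. apply two_pi_i_neq0. Qed.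

Lemma is_LI_ext (f g : C -> C) (v : C) : (forall t, f (d2, t) = g (d2, t)) -> is_LI f v -> is_LI g v.
Proof. intros H. apply IG_ext. intros t. now rewrite H. Qed.

Lemma is_LI_plus (f g : C -> C) (u v : C) : is_LI f u -> is_LI g v -> is_LI (fun w => f w + g w)%C (u + v).
Proof.
  intros Hf Hg. unfold is_LI. rewrite Cmult_plus_distr_l.
  eapply IG_ext; [|apply (IG_plus _ _ _ _ Hf Hg)]. intros t; cbv beta; ring.
Qed.

Lemma is_LI_scal (f : C -> C) (c v : C) : is_LI f v -> is_LI (fun w => c * f w)%C (c * v).
Proof.
  intros Hf. unfold is_LI. replace (two_pi_i * (c * v))%C with (c * (two_pi_i * v))%C by ring.
  eapply IG_ext; [|apply (IG_scal _ c _ Hf)]. intros t; cbv beta; ring.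
Qed.

Lemma is_LI_Csum (n : nat) (f : nat -> C -> C) (v : nat -> C) :
  (forall i, (i < n)%nat -> is_LI (f i) (v i)) -> is_LI (fun w => Csum n (fun i => f i w)) (Csum n v).
Proof.
  induction n; intros H; simpl.
  - unfold is_LI. replace (two_pi_i * 0)%C with (RtoC 0) by ring.
    eapply IG_ext; [|apply IG_0]. intros; cbv beta; ring.
  - apply (is_LI_plus (fun w => Csum n (fun i => f i w))); auto.
Qed.

Lemma LI_adm (f : C -> C) (K : R) : (forall t, Ccont f (d2, t)) ->
  (forall t, Cmod (f (d2, t)) <= K * Wgt t) -> is_LI f (LI f).
Proof.
  intros Hc HK. destruct Wgt_int as [l [Pl Hl]].
  destruct (IG_dominated (fun t => Ci * f (d2, t))%C (fun t => scal K (Wgt t)) 0) as [v Hv].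
  - intros t. apply Rcont_mult; [apply Rcont_const|]. now apply Rcont_vline.
  - intros t _. rewrite Cmod_mult, Cmod_Ci, Rmult_1_l. apply HK.
  - eexists. apply (@is_RInt_gen_scal R_NormedModule); [| |exact Hl]; apply Rbar_locally_filter.
  - assert (E : is_LI f (v / two_pi_i)).
    { unfold is_LI. replace (two_pi_i * (v / two_pi_i))%C with v; auto. field. apply two_pi_i_neq0. }
    now rewrite (is_LI_unique _ _ E).
Qed.

Lemma adm_bound (s c : C -> C) (K1 K2 : R) (t : R) : 0 <= K2 ->
  Cmod (s (d2, t)) * exp (PI * Rabs t) <= K1 ->
  Cmod (c (d2, t)) <= K2 * (exp (PI * Rabs t) * Wgt t) ->
  Cmod (s (d2, t) * c (d2, t)) <= K1 * K2 * Wgt t.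
Proof.
  intros P2 H1 H2. rewrite Cmod_mult. pose proof (Wgt_pos t) as PW.
  eapply Rle_trans; [apply Rmult_le_compat_l; [apply Cmod_ge_0|exact H2]|].
  replace (Cmod (s (d2, t)) * (K2 * (exp (PI * Rabs t) * Wgt t)))
    with (Cmod (s (d2, t)) * exp (PI * Rabs t) * (K2 * Wgt t)) by ring.
  rewrite (Rmult_assoc K1). apply Rmult_le_compat_r; auto. now apply Rmult_le_pos.
Qed.

Lemma LI_mul_fun (s c : C -> C) : mul_class s -> fun_class c ->
  is_LI (fun w => s w * c w)%C (LI (fun w => s w * c w)%C).
Proof.
  intros [Hs [K1 [P1 H1]]] [Hc [K2 [P2 H2]]]. apply (LI_adm _ (K1 * K2)).
  - intros t. apply Ccont_mult; auto.
  - intros t. now apply adm_bound.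
Qed.

Lemma LI_hol (f : C -> C -> C) (z : C) (M : R) : 0 <= M -> Cmod z < rho ->
  (forall v, Cmod v < rho -> forall t, Ccont (f v) (d2, t)) ->
  (forall v, Cmod v < rho -> forall t, Cmod (f v (d2, t)) <= M * Wgt t) ->
  (forall v, Cmod v < rho -> forall t, hol (fun u => f u (d2, t)) v) ->
  hol (fun v => LI (f v)) z.
Proof.
  intros HM Hz Hc Hb Hh. destruct Wgt_int as [l [Pl Hl]].
  assert (D : forall w, Cmod (w - z) < rho - Cmod z -> Cmod w < rho).
  { intros w Hw. pose proof (Cmod_le_plus w z). lra. }
  apply (hol_ext (fun v => / two_pi_i * (two_pi_i * LI (f v)))%C).
  { intros w. field. apply two_pi_i_neq0. }
  apply hol_mult; [apply hol_const|].
  apply (hol_param (fun g v => IG g v) (fun _ => True) Wgt l M (rho - Cmod z)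
    (fun v t => Ci * f v (d2, t))%C); auto; try lra.
  - intros; now apply IG_scal.
  - intros g g' u v Hg Hg'.
    replace (u - v)%C with (u + (- (1)) * v)%C by ring.
    eapply IG_ext; [|apply (IG_plus _ _ _ _ Hg (IG_scal _ (- (1)) _ Hg'))]. intros t; cbv beta; ring.
  - intros g v K PK Hg HK.
    apply (IG_norm g (fun t => scal K (Wgt t)) v (scal K l)); auto.
    apply (@is_RInt_gen_scal R_NormedModule); [| |exact Hl]; apply Rbar_locally_filter.
  - intros; apply Wgt_pos.
  - intros w Hw. change (is_LI (f w) (LI (f w))). apply (LI_adm (f w) M); [intros t; apply Hc; auto|intros t; apply Hb; auto].
  - intros t w _ Hw. apply hol_mult; [apply hol_const|]. apply Hh. auto.
  - intros t w _ Hw. rewrite Cmod_mult, Cmod_Ci, Rmult_1_l. apply Hb. auto.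
Qed.

Lemma LI_hol_SS (c : C -> C) (z : C) : fun_class c -> Cmod z < rho ->
  hol (fun v => LI (fun w => SS v w * c w)%C) z.
Proof.
  intros [Hc [K [PK HK]]] Hz. pose proof sgc_pos as Ps.
  assert (Pi : 0 < / sgc) by now apply Rinv_0_lt_compat.
  apply (LI_hol (fun v w => SS v w * c w)%C z (/ sgc * K)); auto.
  - apply Rmult_le_pos; lra.
  - intros v Hv t. apply Ccont_mult; auto. now apply SS_mul.
  - intros v Hv t. apply adm_bound; auto. now apply SS_bound.
  - intros v Hv t. apply hol_mult; [|apply hol_const]. apply hol_SS_l. now apply SS_line.
Qed.

Lemma LI_hol_pole (s c : C -> C) (z : C) : mul_class s -> fun_class c -> Cmod z < rho ->
  hol (fun y => LI (fun w => s w * (c w * / (w - y)))%C) z.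
Proof.
  intros [Hs [K1 [P1 H1]]] [Hc [K2 [P2 H2]]] Hz.
  assert (Pi : 0 < / (d2 - rho)) by (apply Rinv_0_lt_compat; lra).
  apply (LI_hol (fun y w => s w * (c w * / (w - y)))%C z (K1 * K2 * / (d2 - rho))); auto.
  - repeat apply Rmult_le_pos; lra.
  - intros y Hy t. apply Ccont_mult; auto. apply Ccont_mult; auto.
    apply hol_cont, hol_inv_r. now apply line_neq.
  - intros y Hy t. rewrite Cmult_assoc, Cmod_mult.
    replace (K1 * K2 * / (d2 - rho) * Wgt t) with (K1 * K2 * Wgt t * / (d2 - rho)) by ring.
    apply Rmult_le_compat; try apply Cmod_ge_0; [now apply adm_bound|now apply line_neq].
  - intros y Hy t. apply hol_mult; [apply hol_const|]. apply hol_mult; [apply hol_const|].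
    apply hol_inv_l. now apply line_neq.
Qed.

Lemma LI_hol_diag (c : C -> C) (z : C) : fun_class c -> Cmod z < rho ->
  hol (fun y => LI (fun w => SS y w * (c w * / (w - y)))%C) z.
Proof.
  intros [Hc [K [PK HK]]] Hz. pose proof sgc_pos as Ps.
  assert (Pi : 0 < / sgc) by now apply Rinv_0_lt_compat.
  assert (Pi' : 0 < / (d2 - rho)) by (apply Rinv_0_lt_compat; lra).
  apply (LI_hol (fun y w => SS y w * (c w * / (w - y)))%C z (/ sgc * K * / (d2 - rho))); auto.
  - repeat apply Rmult_le_pos; lra.
  - intros y Hy t. apply Ccont_mult; [now apply SS_mul|]. apply Ccont_mult; auto.
    apply hol_cont, hol_inv_r. now apply line_neq.
  - intros y Hy t. rewrite Cmult_assoc, Cmod_mult.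
    replace (/ sgc * K * / (d2 - rho) * Wgt t) with (/ sgc * K * Wgt t * / (d2 - rho)) by ring.
    apply Rmult_le_compat; try apply Cmod_ge_0; [|now apply line_neq].
    apply (adm_bound (SS y) c); auto. now apply SS_bound.
  - intros y Hy t. apply hol_mult; [apply hol_SS_l; now apply SS_line|].
    apply hol_mult; [apply hol_const|]. apply hol_inv_l. now apply line_neq.
Qed.

Lemma LI_expand_lo (s : C -> C) (y : C) : mul_class s -> Cmod y < rho ->
  (LI (fun w => s w * (hh N a F w * / (w - y)))
   = Csum N (fun k => plo N a k y * LI (fun w => s w * HH N a F (S k) w))
     + plo N a N y * LI (fun w => s w * (HH N a F N w * / (w - y))))%C.
Proof.
  intros Hs Hy. apply is_LI_unique.
  apply (is_LI_ext (fun w => Csum N (fun k => plo N a k y * (s w * HH N a F (S k) w))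
     + plo N a N y * (s w * (HH N a F N w * / (w - y))))%C).
  - intros t. destruct (line_neq y t Hy) as [n _].
    pose proof (regular_line t) as Rg.
    assert (nw : (d2, t) <> y) by (intros E; apply n; rewrite E; ring).
    rewrite (newton_lo N a y (d2, t) (regular_a N a _ Rg) nw) at 2.
    rewrite (HH_div N a F N) by auto.
    pose proof (plo_neq0 N a N (d2, t) (regular_a N a _ Rg)) as nP.
    rewrite !Cmult_plus_distr_l. rewrite <- !Csum_scal.
    f_equal.
    + apply Csum_ext. intros k _. rewrite (HH_div N a F (S k)) by auto. ring.
    + field. split; auto.
  - apply (is_LI_plus (fun w => Csum N (fun k => plo N a k y * (s w * HH N a F (S k) w))%C)).
    + apply (is_LI_Csum N (fun k w => plo N a k y * (s w * HH N a F (S k) w))%C).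
      intros k _. apply is_LI_scal. apply LI_mul_fun; auto. apply HH_fun.
    + apply is_LI_scal. apply (LI_mul_fun s); auto. apply fun_class_pole; auto. apply HH_fun.
Qed.

Lemma LI_expand_hi (c : C -> C) (v : C) : fun_class c -> Cmod v < rho ->
  (LI (fun w => SS v w * c w)
   = Csum N (fun l => qq N a l v * LI (fun w => eps N a l w * c w))
     + QQ N a v * LI (fun w => SS v w * (c w * / QQ N a w)))%C.
Proof.
  intros Hc Hv. apply is_LI_unique.
  apply (is_LI_ext (fun w => Csum N (fun l => qq N a l v * (eps N a l w * c w))
     + QQ N a v * (SS v w * (c w * / QQ N a w)))%C).
  - intros t. rewrite (newton_S N a v (d2, t) (regular_line t) (SS_line v t Hv)) at 2.
    rewrite Cmult_plus_distr_r, <- Csum_scal_r. f_equal.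
    + apply Csum_ext. intros l _. ring.
    + ring.
  - apply (is_LI_plus (fun w => Csum N (fun l => qq N a l v * (eps N a l w * c w))%C)).
    + apply (is_LI_Csum N (fun l w => qq N a l v * (eps N a l w * c w))%C).
      intros l Hl. apply is_LI_scal. apply LI_mul_fun; auto. now apply eps_mul.
    + apply is_LI_scal. apply (LI_mul_fun (SS v)); [now apply SS_mul|now apply fun_class_QQ].
Qed.

(** * Integration over the circle *)

Definition jac (th : R) : C := (circ_deriv d1 th / two_pi_i)%C.
Definition ILam (g : R -> C) (v : C) : Prop := is_cint (fun th => g th * jac th)%C 0 (2 * PI) v.
Definition is_Lam (f : C -> C) (v : C) : Prop := ILam (fun th => f (circ d1 th)) v.
Definition Lam (f : C -> C) : C := cint (fun th => f (circ d1 th) * jac th)%C 0 (2 * PI).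

Lemma circ_rho (th : R) : Cmod (circ d1 th) < rho.
Proof. rewrite Cmod_circ; lra. Qed.

Lemma Rcont_jac (th : R) : Rcont jac th.
Proof. apply Rcont_mult; [apply Rcont_circ_deriv|apply Rcont_const]. Qed.

Lemma ILam_ext (f g : R -> C) (v : C) : (forall t, f t = g t) -> ILam f v -> ILam g v.
Proof. intros H. apply is_cint_ext. intros t _. now rewrite H. Qed.

Lemma ILam_0 : ILam (fun _ => RtoC 0) 0.
Proof.
  apply (eq_rect (RtoC (2 * PI - 0) * 0)%C (ILam _)); [|ring].
  eapply is_cint_ext; [|apply is_cint_const]. intros; cbv beta; ring.
Qed.

Lemma ILam_plus (f g : R -> C) (u v : C) : ILam f u -> ILam g v -> ILam (fun t => f t + g t)%C (u + v).
Proof.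
  intros Hf Hg. eapply is_cint_ext; [|apply (is_cint_plus _ _ _ _ _ _ Hf Hg)]. intros; cbv beta; ring.
Qed.

Lemma ILam_scal (f : R -> C) (c v : C) : ILam f v -> ILam (fun t => c * f t)%C (c * v).
Proof.
  intros Hf. eapply is_cint_ext; [|apply (is_cint_scal _ _ _ c _ Hf)]. intros; cbv beta; ring.
Qed.

Lemma is_Lam_ext (f g : C -> C) (v : C) :
  (forall th, f (circ d1 th) = g (circ d1 th)) -> is_Lam f v -> is_Lam g v.
Proof. intros H. now apply ILam_ext. Qed.

Lemma is_Lam_plus (f g : C -> C) (u v : C) : is_Lam f u -> is_Lam g v -> is_Lam (fun w => f w + g w)%C (u + v).
Proof. apply ILam_plus. Qed.

Lemma is_Lam_scal (f : C -> C) (c v : C) : is_Lam f v -> is_Lam (fun w => c * f w)%C (c * v).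
Proof. apply ILam_scal. Qed.

Lemma is_Lam_Csum (n : nat) (f : nat -> C -> C) (v : nat -> C) :
  (forall i, (i < n)%nat -> is_Lam (f i) (v i)) -> is_Lam (fun w => Csum n (fun i => f i w)) (Csum n v).
Proof.
  intros H. apply (I_Csum ILam ILam_0 ILam_plus n (fun i th => f i (circ d1 th))). exact H.
Qed.

Lemma is_Lam_unique (f : C -> C) (u v : C) : is_Lam f u -> is_Lam f v -> u = v.
Proof. apply is_cint_uniq. Qed.

Lemma is_Lam_cont (f : C -> C) : (forall th, Ccont f (circ d1 th)) -> is_Lam f (Lam f).
Proof.
  intros H. apply ex_cint. intros t _. apply Rcont_mult; [|apply Rcont_jac].
  apply Rcont_comp; auto. apply Rcont_circ.
Qed.

Lemma is_Lam_hol (f : C -> C) : (forall z, Cmod z < rho -> hol f z) -> is_Lam f 0.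
Proof.
  intros H. pose proof (circle_cauchy f d1 rho ltac:(lra) H) as E.
  apply (eq_rect (/ two_pi_i * 0)%C (is_Lam f)); [|ring].
  eapply is_cint_ext; [|apply (is_cint_scal _ _ _ (/ two_pi_i)%C _ E)].
  intros; cbv beta; unfold jac, Cdiv; ring.
Qed.

Lemma disc_re (v : C) (m : nat) : (m < N)%nat -> Cmod v < rho -> -1 < fst (v - a m)%C < 1.
Proof.
  intros Hm Hv. destruct (a_re m Hm) as [Ar _]. apply Rabs_def2 in Ar.
  pose proof (Re_le_Cmod v). assert (Rabs (fst v) < rho) as R1 by lra. apply Rabs_def2 in R1.
  simpl. lra.
Qed.

Lemma circ_regular (th : R) : regular N a (circ d1 th).
Proof.
  intros m Hm. apply sg_neq0; [apply disc_re; auto; apply circ_rho|].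
  apply circ_neq. auto.
Qed.

Lemma HH_disc_neq0 (v : C) : Cmod v < rho -> HH N a F N v <> 0.
Proof.
  intros Hv. unfold HH. apply Cmult_neq_0; [auto|]. apply Cprod_neq0. intros m Hm.
  destruct (Nat.ltb_spec m N); [|lia]. apply RG_neq0_1p. now apply disc_re.
Qed.

Lemma hh_circ_neq0 (th : R) : hh N a F (circ d1 th) <> 0.
Proof.
  rewrite (hh_HH N a F N). apply Cmult_neq_0; [apply HH_disc_neq0, circ_rho|].
  apply plo_neq0, regular_a, circ_regular.
Qed.

Lemma disc_fst (z : C) : Cmod z < rho -> fst z <= d2.
Proof. intros H. pose proof (Re_le_Cmod z). pose proof (Rle_abs (fst z)). lra. Qed.

Lemma hol_hh (z : C) : Cmod z < rho -> hol (hh N a F) z.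
Proof. intros H. apply (hol_HH N a F 0). apply HFhol. now apply disc_fst. Qed.

Lemma cont_inv_hh (th : R) : Ccont (fun v => / hh N a F v)%C (circ d1 th).
Proof.
  apply Ccont_inv; [apply hol_cont, hol_hh, circ_rho|apply hh_circ_neq0].
Qed.

Lemma Lam_plo (f : C -> C) : (forall z, Cmod z < rho -> hol f z) ->
  is_Lam (fun v => plo N a N v * / hh N a F v * f v)%C 0.
Proof.
  intros Hf. apply (is_Lam_ext (fun v => / HH N a F N v * f v)%C).
  - intros th. rewrite (hh_HH N a F N).
    pose proof (plo_neq0 N a N _ (regular_a N a _ (circ_regular th))).
    pose proof (HH_disc_neq0 _ (circ_rho th)). field. auto.
  - apply is_Lam_hol. intros z Hz. apply hol_mult; auto.
    apply (hol_inv (HH N a F N)); [|now apply HH_disc_neq0].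
    apply hol_HH, HFhol. now apply disc_fst.
Qed.

Lemma Lam_QQ (f : C -> C) : (forall z, Cmod z < rho -> hol f z) ->
  is_Lam (fun v => QQ N a v * / hh N a F v * f v)%C 0.
Proof.
  intros Hf.
  apply (is_Lam_ext (fun v => / F v * Cprod N (fun m => ev v * ev (a m) * RecipGamma (1 - (v - a m))) * f v)%C).
  - intros th. set (v := circ d1 th).
    assert (nF : F v <> 0) by (apply HFnz, circ_rho).
    assert (nR : forall m, (m < N)%nat -> RecipGamma (v - a m) <> 0).
    { intros m Hm. apply RG_neq0; [apply disc_re; auto; apply circ_rho|apply circ_neq; auto]. }
    unfold QQ, phi, hh.
    replace (Cprod N (fun m => if (m <? 0)%nat then 1%C else VV v - Aa a m)%C)
      with (Cprod N (fun m => ev v * ev (a m) * RecipGamma (1 - (v - a m)))%C * Cprod N (fun m => RecipGamma (v - a m)))%C.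
    + pose proof (Cprod_neq0 N _ nR). field. auto.
    + rewrite <- Cprod_mult. apply Cprod_ext. intros m Hm. simpl. unfold Aa. now rewrite VV_RG.
  - apply is_Lam_hol. intros z Hz. apply hol_mult; auto. apply hol_mult.
    + apply (hol_inv F); auto. apply HFhol. now apply disc_fst.
    + apply (hol_Cprod N (fun m v => ev v * ev (a m) * RecipGamma (1 - (v - a m)))%C).
      intros m _. apply hol_mult; [apply hol_mult; [apply hol_ev|apply hol_const]|].
      apply hol_RG, hol_minus; [apply hol_const|]. apply hol_minus; [apply hol_id|apply hol_const].
Qed.

Definition GG (k l : nat) : C := Lam (fun v => plo N a k v * qq N a l v * / hh N a F v)%C.

Lemma is_Lam_GG (k l : nat) : is_Lam (fun v => plo N a k v * qq N a l v * / hh N a F v)%C (GG k l).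
Proof.
  apply is_Lam_cont. intros th. apply Ccont_mult; [|apply cont_inv_hh].
  apply Ccont_mult; apply hol_cont; [apply hol_plo|apply hol_qq].
Qed.

Lemma Lam_pY (i : nat) (Y Y'' : C -> C) (Yl : nat -> C) :
  (forall z, Cmod z < rho -> hol Y'' z) ->
  (forall z, Cmod z < rho -> Y z = Csum N (fun l => qq N a l z * Yl l) + QQ N a z * Y'' z)%C ->
  is_Lam (fun v => plo N a i v * (Y v * / hh N a F v))%C (Csum N (fun l => GG i l * Yl l)%C).
Proof.
  intros HY'' HY.
  apply (eq_rect (Csum N (fun l => Yl l * GG i l) + 0)%C (is_Lam _)).
  2: { transitivity (Csum N (fun l => Yl l * GG i l)%C); [ring|]. apply Csum_ext. intros; ring. }
  apply (is_Lam_ext (fun v => Csum N (fun l => Yl l * (plo N a i v * qq N a l v * / hh N a F v))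
     + QQ N a v * / hh N a F v * (plo N a i v * Y'' v))%C).
  - intros th. rewrite HY by apply circ_rho. set (v := circ d1 th).
    transitivity (plo N a i v * / hh N a F v * Csum N (fun l => qq N a l v * Yl l)
      + QQ N a v * / hh N a F v * (plo N a i v * Y'' v))%C; [|ring].
    f_equal. rewrite <- Csum_scal. apply Csum_ext. intros; ring.
  - apply (is_Lam_plus (fun v => Csum N (fun l => Yl l * (plo N a i v * qq N a l v * / hh N a F v))%C)).
    + apply (is_Lam_Csum N (fun l v => Yl l * (plo N a i v * qq N a l v * / hh N a F v))%C).
      intros l _. apply is_Lam_scal, is_Lam_GG.
    + apply Lam_QQ. intros z Hz. apply hol_mult; [apply hol_plo|auto].
Qed.

Lemma Lam_comp (X : nat -> C) (X' Y Y'' : C -> C) (Yl : nat -> C) :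
  (forall z, Cmod z < rho -> hol X' z) ->
  (forall z, Cmod z < rho -> hol Y z) ->
  (forall z, Cmod z < rho -> hol Y'' z) ->
  (forall z, Cmod z < rho -> Y z = Csum N (fun l => qq N a l z * Yl l) + QQ N a z * Y'' z)%C ->
  is_Lam (fun v => (Csum N (fun i => X i * plo N a i v) + plo N a N v * X' v) * (Y v * / hh N a F v))%C
         (Csum N (fun i => X i * Csum N (fun l => GG i l * Yl l))%C).
Proof.
  intros HX' HhY HY'' HY.
  apply (eq_rect (Csum N (fun i => X i * Csum N (fun l => GG i l * Yl l)) + 0)%C (is_Lam _)); [|ring].
  apply (is_Lam_ext (fun v => Csum N (fun i => X i * (plo N a i v * (Y v * / hh N a F v)))
     + plo N a N v * / hh N a F v * (X' v * Y v))%C).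
  - intros th. set (v := circ d1 th).
    transitivity (Csum N (fun i => X i * plo N a i v) * (Y v * / hh N a F v)
      + plo N a N v * / hh N a F v * (X' v * Y v))%C; [|ring].
    f_equal. rewrite <- Csum_scal_r. apply Csum_ext. intros; ring.
  - apply (is_Lam_plus (fun v => Csum N (fun i => X i * (plo N a i v * (Y v * / hh N a F v)))%C)).
    + apply (is_Lam_Csum N (fun i v => X i * (plo N a i v * (Y v * / hh N a F v)))%C).
      intros i _. apply is_Lam_scal, Lam_pY with Y''; auto.
    + apply Lam_plo. intros z Hz. apply hol_mult; auto.
Qed.

(** * The kernel on the extended label set *)

Definition kap (v y : C) : C := LI (fun w => SS v w * (hh N a F w * / (w - y)))%C.
Definition Jk (k : nat) (v : C) : C := LI (fun w => SS v w * HH N a F (S k) w)%C.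
Definition Bl (l : nat) (y : C) : C := LI (fun w => eps N a l w * (hh N a F w * / (w - y)))%C.
Definition Bk (l k : nat) : C := LI (fun w => eps N a l w * HH N a F (S k) w)%C.

(* A label [inl s] is the point [circ d1 s]; [KK (inr k) y] is the circle integral of [plo k v * KK v y]. *)
Definition KK (x y : R + nat) : C :=
  match x, y with
  | inl s, inl t => (kap (circ d1 s) (circ d1 t) * / hh N a F (circ d1 s))%C
  | inl s, inr k => (Jk k (circ d1 s) * / hh N a F (circ d1 s))%C
  | inr k, inl t => Csum N (fun l => GG k l * Bl l (circ d1 t))%C
  | inr k, inr j => Csum N (fun l => GG k l * Bk l j)%C
  end.

Lemma hh_fun : fun_class (hh N a F).
Proof. apply (HH_fun 0). Qed.

Lemma kap_lo (v y : C) : Cmod v < rho -> Cmod y < rho ->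
  (kap v y = Csum N (fun k => plo N a k y * Jk k v)
     + plo N a N y * LI (fun w => SS v w * (HH N a F N w * / (w - y))))%C.
Proof. intros Hv Hy. apply LI_expand_lo; auto. now apply SS_mul. Qed.

Lemma Bl_lo (l : nat) (y : C) : (l < N)%nat -> Cmod y < rho ->
  (Bl l y = Csum N (fun k => plo N a k y * Bk l k)
     + plo N a N y * LI (fun w => eps N a l w * (HH N a F N w * / (w - y))))%C.
Proof. intros Hl Hy. apply LI_expand_lo; auto. now apply eps_mul. Qed.

Lemma Jk_hi (k : nat) (v : C) : Cmod v < rho ->
  (Jk k v = Csum N (fun l => qq N a l v * Bk l k)
     + QQ N a v * LI (fun w => SS v w * (HH N a F (S k) w * / QQ N a w)))%C.
Proof. intros Hv. apply LI_expand_hi; auto. apply HH_fun. Qed.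

Lemma kap_hi (v y : C) : Cmod v < rho -> Cmod y < rho ->
  (kap v y = Csum N (fun l => qq N a l v * Bl l y)
     + QQ N a v * LI (fun w => SS v w * ((hh N a F w * / (w - y)) * / QQ N a w)))%C.
Proof.
  intros Hv Hy. apply (LI_expand_hi (fun w => hh N a F w * / (w - y))%C); auto.
  apply fun_class_pole; auto. apply hh_fun.
Qed.

Lemma KK_right (y : R + nat) : exists (Y Y'' : C -> C) (Yl : nat -> C),
  (forall z, Cmod z < rho -> hol Y z) /\
  (forall z, Cmod z < rho -> hol Y'' z) /\
  (forall z, Cmod z < rho -> Y z = Csum N (fun l => qq N a l z * Yl l) + QQ N a z * Y'' z)%C /\
  (forall t, KK (inl t) y = Y (circ d1 t) * / hh N a F (circ d1 t))%C /\
  (forall k, KK (inr k) y = Csum N (fun l => GG k l * Yl l)%C).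
Proof.
  destruct y as [s|j].
  - set (y := circ d1 s). assert (Hy : Cmod y < rho) by apply circ_rho.
    exists (fun v => kap v y),
      (fun v => LI (fun w => SS v w * ((hh N a F w * / (w - y)) * / QQ N a w))%C), (fun l => Bl l y).
    assert (Cf : fun_class (fun w => hh N a F w * / (w - y))%C) by (apply fun_class_pole; auto; apply hh_fun).
    repeat split.
    + intros z Hz. apply LI_hol_SS; auto.
    + intros z Hz. apply (LI_hol_SS (fun w => (hh N a F w * / (w - y)) * / QQ N a w)%C); auto.
      now apply (fun_class_QQ (fun w => hh N a F w * / (w - y))%C).
    + intros z Hz. now apply kap_hi.
  - exists (Jk j), (fun v => LI (fun w => SS v w * (HH N a F (S j) w * / QQ N a w))%C), (fun l => Bk l j).
    repeat split.
    + intros z Hz. apply LI_hol_SS; auto. apply HH_fun.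
    + intros z Hz. apply (LI_hol_SS (fun w => HH N a F (S j) w * / QQ N a w)%C); auto.
      apply fun_class_QQ, HH_fun.
    + intros z Hz. now apply Jk_hi.
Qed.

Lemma KK_left (x : R + nat) : exists X' : C -> C,
  (forall z, Cmod z < rho -> hol X' z) /\
  (forall t, KK x (inl t) = Csum N (fun i => KK x (inr i) * plo N a i (circ d1 t))
      + plo N a N (circ d1 t) * X' (circ d1 t))%C.
Proof.
  destruct x as [s|k].
  - set (v := circ d1 s). assert (Hv : Cmod v < rho) by apply circ_rho.
    exists (fun y => LI (fun w => SS v w * (HH N a F N w * / (w - y)))%C * / hh N a F v)%C. split.
    + intros z Hz. apply hol_mult; [|apply hol_const]. apply LI_hol_pole; auto; [now apply SS_mul|apply HH_fun].
    + intros t. unfold KK. fold v. rewrite kap_lo by (auto; apply circ_rho).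
      rewrite Cmult_plus_distr_r, <- Csum_scal_r. f_equal; [|ring]. apply Csum_ext. intros; ring.
  - exists (fun y => Csum N (fun l => GG k l * LI (fun w => eps N a l w * (HH N a F N w * / (w - y)))%C)%C). split.
    + intros z Hz. apply (hol_Csum N (fun l y => GG k l * LI (fun w => eps N a l w * (HH N a F N w * / (w - y)))%C)%C).
      intros l Hl. apply hol_mult; [apply hol_const|]. apply LI_hol_pole; auto; [now apply eps_mul|apply HH_fun].
    + intros t. set (y := circ d1 t). assert (Hy : Cmod y < rho) by apply circ_rho.
      change (Csum N (fun l => GG k l * Bl l y)%C = (Csum N (fun i => Csum N (fun l => GG k l * Bk l i) * plo N a i y)
         + plo N a N y * Csum N (fun l => GG k l * LI (fun w => eps N a l w * (HH N a F N w * / (w - y)))))%C).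
      rewrite <- Csum_scal.
      rewrite (Csum_ext N (fun i => Csum N (fun l => GG k l * Bk l i) * plo N a i y)%C
        (fun i => Csum N (fun l => GG k l * Bk l i * plo N a i y)%C)) by (intros; now rewrite Csum_scal_r).
      rewrite Csum_exchange, <- Csum_plus. apply Csum_ext. intros l Hl. rewrite (Bl_lo l y Hl Hy).
      rewrite Cmult_plus_distr_l, <- Csum_scal. f_equal; [|ring]. apply Csum_ext. intros; ring.
Qed.

Lemma KK_comp_Lam (x y : R + nat) :
  ILam (fun t => KK x (inl t) * KK (inl t) y)%C (Csum N (fun k => KK x (inr k) * KK (inr k) y)%C).
Proof.
  destruct (KK_left x) as [X' [HX' EX]].
  destruct (KK_right y) as [Y [Y'' [Yl [HY [HY'' [EY [E1 E2]]]]]]].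
  pose proof (Lam_comp (fun i => KK x (inr i)) X' Y Y'' Yl HX' HY HY'' EY) as H.
  apply (eq_rect (Csum N (fun i => KK x (inr i) * Csum N (fun l => GG i l * Yl l))%C) (ILam _)).
  - eapply ILam_ext; [|exact H]. intros t. cbv beta. now rewrite EX, E1.
  - apply Csum_ext. intros i _. now rewrite E2.
Qed.

Lemma KK_trace_Lam : ILam (fun t => KK (inl t) (inl t)) (Csum N (fun k => KK (inr k) (inr k))).
Proof.
  apply (eq_rect (Csum N (fun k => Csum N (fun l => GG k l * Bk l k)%C) + 0)%C (ILam _)).
  2: { transitivity (Csum N (fun k => Csum N (fun l => GG k l * Bk l k)%C)); [ring|reflexivity]. }
  change (is_Lam (fun v => kap v v * / hh N a F v)%C (Csum N (fun k => Csum N (fun l => GG k l * Bk l k)%C) + 0)%C).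
  apply (is_Lam_ext (fun v => Csum N (fun k => plo N a k v * (Jk k v * / hh N a F v))
     + plo N a N v * / hh N a F v * LI (fun w => SS v w * (HH N a F N w * / (w - v))))%C).
  - intros th. rewrite (kap_lo (circ d1 th)) by apply circ_rho.
    rewrite Cmult_plus_distr_r, <- Csum_scal_r. f_equal; [|ring]. apply Csum_ext. intros; ring.
  - apply (is_Lam_plus (fun v => Csum N (fun k => plo N a k v * (Jk k v * / hh N a F v))%C)).
    + apply (is_Lam_Csum N (fun k v => plo N a k v * (Jk k v * / hh N a F v))%C).
      intros k _. apply (Lam_pY k (Jk k) (fun v => LI (fun w => SS v w * (HH N a F (S k) w * / QQ N a w))%C) (fun l => Bk l k)).
      * intros z Hz. apply (LI_hol_SS (fun w => HH N a F (S k) w * / QQ N a w)%C); auto.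
        apply fun_class_QQ, HH_fun.
      * intros z Hz. now apply Jk_hi.
    + apply Lam_plo. intros z Hz. apply LI_hol_diag; auto. apply HH_fun.
Qed.

Lemma Lam_winding (x : C) : Cmod x < d1 -> is_Lam (fun v => / (v - x))%C 1.
Proof.
  intros Hx. apply (eq_rect (/ two_pi_i * two_pi_i)%C (is_Lam _)); [|field; apply two_pi_i_neq0].
  eapply is_cint_ext; [|apply (is_cint_scal _ _ _ (/ two_pi_i)%C _ (circle_winding d1 x Hx))].
  intros; cbv beta; unfold jac, Cdiv; ring.
Qed.

Lemma Lam_formula (f : C -> C) (x : C) : Cmod x < d1 -> (forall z, Cmod z < rho -> hol f z) ->
  is_Lam (fun v => f v / (v - x))%C (f x).
Proof.
  intros Hx Hf. apply (eq_rect (/ two_pi_i * (two_pi_i * f x))%C (is_Lam _)); [|field; apply two_pi_i_neq0].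
  eapply is_cint_ext; [|apply (is_cint_scal _ _ _ (/ two_pi_i)%C _ (circle_formula f d1 rho x ltac:(lra) Hx Hf))].
  intros; cbv beta; unfold jac, Cdiv; ring.
Qed.

Lemma a_max : exists am, 0 < am < d1 /\ forall m, (m < N)%nat -> Cmod (a m) <= am.
Proof.
  assert (H : forall n, (n <= N)%nat -> exists am, 0 < am < d1 /\ forall m, (m < n)%nat -> Cmod (a m) <= am).
  { induction n; intros Hn.
    - exists (d1 / 2). split; [lra|]. intros; lia.
    - destruct (IHn ltac:(lia)) as [am [H1 H2]]. exists (Rmax am (Cmod (a n))).
      pose proof (Rmax_l am (Cmod (a n))). pose proof (Rmax_r am (Cmod (a n))).
      split; [split; [lra|apply Rmax_lub_lt; [lra|apply Ha; lia]]|].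
      intros m Hm. destruct (Nat.eq_dec m n) as [->|]; auto. eapply Rle_trans; [apply H2; lia|auto]. }
  apply (H N); auto.
Qed.

Lemma plo_ratio (k j : nat) (v : C) : (k < N)%nat -> (j < N)%nat -> (forall m, (m < N)%nat -> v <> a m) ->
  (plo N a k v * / plo N a (S j) v = Cprod N (fun m =>
     if (m <? k)%nat then (if (m <? S j)%nat then 1 else v - a m)
     else if (m <? S j)%nat then / (v - a m) else 1))%C.
Proof.
  intros Hk Hj Hv. unfold plo. rewrite <- Cprod_inv.
  - rewrite <- Cprod_mult. apply Cprod_ext. intros m Hm. pose proof (Cminus_neq0 _ _ (Hv m Hm)).
    destruct (m <? k)%nat, (m <? S j)%nat; field; auto.
  - intros m Hm. pose proof (Cminus_neq0 _ _ (Hv m Hm)). destruct (m <? S j)%nat; auto.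
    intros E; injection E; lra.
Qed.

Lemma Lam_biorth (k j : nat) : (k < N)%nat -> (j < N)%nat ->
  is_Lam (fun v => plo N a k v * / plo N a (S j) v)%C (if Nat.eqb k j then RtoC 1 else RtoC 0).
Proof.
  intros Hk Hj.
  assert (Ne : forall th m, (m < N)%nat -> circ d1 th <> a m).
  { intros th. apply regular_a, circ_regular. }
  destruct (Nat.eqb_spec k j) as [->|ne].
  { apply (is_Lam_ext (fun v => / (v - a j))%C); [|apply Lam_winding; auto].
    intros th. rewrite plo_S by auto. pose proof (plo_neq0 N a j _ (Ne th)).
    pose proof (Cminus_neq0 _ _ (Ne th j Hj)). field. auto. }
  destruct (le_lt_dec k j) as [L|L].
  - (* at least two poles inside and none outside: the circle is contracted at infinity *)
    assert (Lt : (k < j)%nat) by lia. clear L ne.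
    destruct a_max as [am [Pam Ham]].
    set (g := fun u => (/ (1 - a k * u) * / (1 - a j * u)
       * Cprod N (fun m => if (k <? m)%nat then (if (m <? j)%nat then u * / (1 - a m * u) else 1) else 1))%C).
    assert (Nz : forall m u, (m < N)%nat -> Cmod u < / am -> (1 - a m * u <> 0)%C).
    { intros m u Hm Hu. apply Cminus_neq0. intros E. apply (f_equal Cmod) in E.
      rewrite Cmod_1, Cmod_mult in E. specialize (Ham m Hm).
      apply Rmult_lt_compat_l with (r := am) in Hu; [|lra]. rewrite Rinv_r in Hu by lra.
      pose proof (Cmod_ge_0 u). pose proof (Cmod_ge_0 (a m)). nra. }
    assert (Hol1 : forall m u, (m < N)%nat -> Cmod u < / am -> hol (fun u => / (1 - a m * u))%C u).
    { intros m u Hm Hu. apply (hol_inv (fun u => 1 - a m * u)%C); auto.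
      apply hol_minus; [apply hol_const|]. apply hol_mult; [apply hol_const|apply hol_id]. }
    assert (I : / d1 < / am) by (apply Rinv_lt_contravar; nra).
    pose proof (circle_cauchy_inv g d1 (/ am) Hd1 I) as E.
    assert (Hg : forall u, Cmod u < / am -> hol g u).
    { intros u Hu. apply hol_mult; [apply hol_mult; apply Hol1; auto|].
      apply (hol_Cprod N (fun m u => if (k <? m)%nat then (if (m <? j)%nat then u * / (1 - a m * u) else 1) else 1)%C).
      intros m Hm. destruct (k <? m)%nat; [|apply hol_const]. destruct (m <? j)%nat; [|apply hol_const].
      apply hol_mult; [apply hol_id|auto]. }
    specialize (E Hg).
    apply (eq_rect (/ two_pi_i * 0)%C (is_Lam _)); [|ring].
    eapply is_cint_ext; [|apply (is_cint_scal _ _ _ (/ two_pi_i)%C _ E)].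
    intros th _. cbv beta. rewrite plo_ratio by auto.
    set (v := circ d1 th) in *.
    assert (Nv : v <> 0) by (apply Cmod_gt_0; unfold v; rewrite Cmod_circ; lra).
    assert (Hm : forall m, (m < N)%nat -> (v - a m <> 0)%C) by (intros m Hm; apply Cminus_neq0, Ne; auto).
    assert (P : (Cprod N (fun m => if (m <? k)%nat then (if (m <? S j)%nat then 1 else v - a m)
       else if (m <? S j)%nat then / (v - a m) else 1) = g (/ v) * / (v * v))%C).
    { transitivity (/ (v - a k) * / (v - a j) * Cprod N (fun m => if (k <? m)%nat then
         (if (m <? j)%nat then / v * / (1 - a m * / v) else 1) else 1))%C.
      - rewrite <- (Cprod_pick N k (/ (v - a k))%C Hk), <- (Cprod_pick N j (/ (v - a j))%C Hj).
        rewrite <- !Cprod_mult. apply Cprod_ext. intros m Hmm. pose proof (Hm m Hmm).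
        destruct (Nat.ltb_spec m k); destruct (Nat.ltb_spec m (S j)); destruct (Nat.ltb_spec k m);
          destruct (Nat.ltb_spec m j); destruct (Nat.eqb_spec m k); destruct (Nat.eqb_spec m j);
          subst; try lia; try ring.
        field. auto.
      - unfold g. set (Z := Cprod N _). pose proof (Hm k Hk). pose proof (Hm j Hj).
        field. auto. }
    rewrite P. unfold jac, Cdiv. ring.
  - apply (is_Lam_ext (fun v => Cprod N (fun m => if (m <? k)%nat then (if (m <? S j)%nat then 1 else v - a m) else 1))%C).
    + intros th. rewrite plo_ratio by auto. apply Cprod_ext. intros m Hm.
      destruct (Nat.ltb_spec m k); destruct (Nat.ltb_spec m (S j)); auto; lia.
    + apply is_Lam_hol. intros z _.
      apply (hol_Cprod N (fun m v => if (m <? k)%nat then (if (m <? S j)%nat then 1 else v - a m) else 1)%C).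
      intros m _. destruct (m <? k)%nat; [|apply hol_const]. destruct (m <? S j)%nat; [apply hol_const|].
      apply hol_minus; [apply hol_id|apply hol_const].
Qed.

(** * Cauchy's formula on a rectangle *)

Definition c1 : R := (rho + d2) / 2.

Definition on_sides (x1 x2 y1 y2 : R) (P : C -> Prop) : Prop :=
  (forall x, x1 <= x <= x2 -> P (x, y1)) /\ (forall x, x1 <= x <= x2 -> P (x, y2)) /\
  (forall y, y1 <= y <= y2 -> P (x1, y)) /\ (forall y, y1 <= y <= y2 -> P (x2, y)).

Definition is_rect (x1 x2 y1 y2 : R) (f : C -> C) (v : C) : Prop :=
  exists s1 s2 s3 s4, is_cint (fun x => f (x, y1)) x1 x2 s1 /\ is_cint (fun y => f (x2, y)) y1 y2 s2 /\
    is_cint (fun x => f (x, y2)) x1 x2 s3 /\ is_cint (fun y => f (x1, y)) y1 y2 s4 /\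
    v = (s1 + Ci * s2 - s3 - Ci * s4)%C.

Lemma is_rect_unique (x1 x2 y1 y2 : R) (f : C -> C) (v : C) :
  is_rect x1 x2 y1 y2 f v -> rect_int f x1 x2 y1 y2 = v.
Proof.
  intros [s1 [s2 [s3 [s4 [H1 [H2 [H3 [H4 ->]]]]]]]]. unfold rect_int.
  now rewrite (cint_unique _ _ _ _ H1), (cint_unique _ _ _ _ H2), (cint_unique _ _ _ _ H3), (cint_unique _ _ _ _ H4).
Qed.

Lemma is_rect_cont (x1 x2 y1 y2 : R) (f : C -> C) : x1 <= x2 -> y1 <= y2 ->
  on_sides x1 x2 y1 y2 (Ccont f) -> is_rect x1 x2 y1 y2 f (rect_int f x1 x2 y1 y2).
Proof.
  intros Hx Hy [H1 [H2 [H3 H4]]].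
  exists (cint (fun x => f (x, y1)) x1 x2), (cint (fun y => f (x2, y)) y1 y2),
    (cint (fun x => f (x, y2)) x1 x2), (cint (fun y => f (x1, y)) y1 y2).
  repeat split; apply ex_cint; intros t Ht; rewrite Rmin_left, Rmax_right in Ht by auto;
    first [apply Rcont_hline; auto; fail | apply Rcont_vline; auto].
Qed.

Lemma is_rect_ext (x1 x2 y1 y2 : R) (f g : C -> C) (v : C) : x1 <= x2 -> y1 <= y2 ->
  on_sides x1 x2 y1 y2 (fun z => f z = g z) -> is_rect x1 x2 y1 y2 f v -> is_rect x1 x2 y1 y2 g v.
Proof.
  intros Hx Hy [H1 [H2 [H3 H4]]] [s1 [s2 [s3 [s4 [E1 [E2 [E3 [E4 Ev]]]]]]]].
  exists s1, s2, s3, s4. repeat split; auto;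
    (eapply is_cint_ext; [|first [exact E1|exact E2|exact E3|exact E4]]);
    intros t Ht; rewrite Rmin_left, Rmax_right in Ht by auto; first [apply H1; lra|apply H2; lra|apply H3; lra|apply H4; lra].
Qed.

Lemma is_rect_plus (x1 x2 y1 y2 : R) (f g : C -> C) (u v : C) :
  is_rect x1 x2 y1 y2 f u -> is_rect x1 x2 y1 y2 g v -> is_rect x1 x2 y1 y2 (fun w => f w + g w)%C (u + v).
Proof.
  intros [s1 [s2 [s3 [s4 [E1 [E2 [E3 [E4 ->]]]]]]]] [r1 [r2 [r3 [r4 [D1 [D2 [D3 [D4 ->]]]]]]]].
  exists (s1 + r1)%C, (s2 + r2)%C, (s3 + r3)%C, (s4 + r4)%C.
  repeat split; [apply (is_cint_plus _ _ _ _ _ _ E1 D1)|apply (is_cint_plus _ _ _ _ _ _ E2 D2)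
    |apply (is_cint_plus _ _ _ _ _ _ E3 D3)|apply (is_cint_plus _ _ _ _ _ _ E4 D4)|ring].
Qed.

Lemma is_rect_scal (x1 x2 y1 y2 : R) (f : C -> C) (c v : C) :
  is_rect x1 x2 y1 y2 f v -> is_rect x1 x2 y1 y2 (fun w => c * f w)%C (c * v).
Proof.
  intros [s1 [s2 [s3 [s4 [E1 [E2 [E3 [E4 ->]]]]]]]].
  exists (c * s1)%C, (c * s2)%C, (c * s3)%C, (c * s4)%C.
  repeat split; [apply (is_cint_scal _ _ _ c _ E1)|apply (is_cint_scal _ _ _ c _ E2)
    |apply (is_cint_scal _ _ _ c _ E3)|apply (is_cint_scal _ _ _ c _ E4)|ring].
Qed.

Lemma is_rect_Csum (x1 x2 y1 y2 : R) (n : nat) (f : nat -> C -> C) (v : nat -> C) :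
  (forall i, (i < n)%nat -> is_rect x1 x2 y1 y2 (f i) (v i)) ->
  is_rect x1 x2 y1 y2 (fun w => Csum n (fun i => f i w)) (Csum n v).
Proof.
  induction n; intros H; simpl.
  - assert (Z : forall x y, is_cint (fun _ => RtoC 0) x y 0).
    { intros x y. apply (eq_rect (RtoC (y - x) * 0)%C (is_cint _ x y)); [apply is_cint_const|ring]. }
    exists 0, 0, 0, 0. repeat split; try apply Z. ring.
  - apply (is_rect_plus _ _ _ _ (fun w => Csum n (fun i => f i w))); auto.
Qed.

Lemma c1_spec : rho < c1 < d2.
Proof. unfold c1. lra. Qed.

Definition eta1 : R := Rmin (c1 - rho) (1 - c1 - rho).
Lemma eta1_spec : 0 < eta1 <= / 2 /\ eta1 <= c1 - rho /\ eta1 <= 1 - c1 - rho.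
Proof.
  pose proof c1_spec. unfold eta1.
  pose proof (Rmin_l (c1 - rho) (1 - c1 - rho)). pose proof (Rmin_r (c1 - rho) (1 - c1 - rho)).
  split; [|lra]. split; [apply Rmin_glb_lt; lra|]. lra.
Qed.

Lemma sides_lower : exists c, 0 < c /\ forall v, Cmod v < rho ->
  on_sides (- c1) d2 (-1) 1 (fun w => c <= Cmod (sg (w - v))).
Proof.
  pose proof PI_RGT_0 as PP. destruct eta1_spec as [E1 [E2 E3]]. pose proof c1_spec as Hc.
  set (k1 := sin (PI * eta1) / (2 * PI)). set (k2 := (exp (PI * / 2) - exp (- (PI * / 2))) / 2 / PI).
  assert (P1 : 0 < k1) by (apply Rdiv_lt_0_compat; [now apply sin_eta_pos|lra]).
  assert (P2 : 0 < k2).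
  { unfold k2. assert (exp (- (PI * / 2)) < exp (PI * / 2)) by (apply exp_increasing; lra).
    repeat apply Rdiv_lt_0_compat; lra. }
  pose proof sgc_pos as P3.
  assert (Ex : forall t, 1 <= exp (PI * Rabs t)).
  { intros t. rewrite <- exp_0. apply exp_le. pose proof (Rabs_pos t). nra. }
  exists (Rmin (Rmin k1 k2) sgc). split; [repeat apply Rmin_glb_lt; auto|].
  pose proof (Rmin_l (Rmin k1 k2) sgc) as M1. pose proof (Rmin_r (Rmin k1 k2) sgc) as M2.
  pose proof (Rmin_l k1 k2) as M3. pose proof (Rmin_r k1 k2) as M4.
  intros v Hv. pose proof (Re_le_Cmod v). pose proof (Im_le_Cmod v).
  assert (Rabs (fst v) < rho) as R1 by lra. apply Rabs_def2 in R1.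
  assert (Rabs (snd v) < rho) as R2 by lra. apply Rabs_def2 in R2.
  assert (TB : forall x y, / 2 <= Rabs (y - snd v) -> k2 <= Cmod (sg ((x, y) - v))).
  { intros x y Hy. eapply Rle_trans; [|apply sg_lower_sinh]. simpl. fold (y - snd v).
    unfold k2. apply Rmult_le_compat_r; [apply Rlt_le, Rinv_0_lt_compat; lra|].
    apply Rmult_le_compat_r; [lra|].
    assert (exp (PI * / 2) <= exp (PI * Rabs (y - snd v))) by (apply exp_le; nra).
    assert (exp (- (PI * Rabs (y - snd v))) <= exp (- (PI * / 2))) by (apply exp_le; nra). lra. }
  repeat split; intros s Hs.
  - assert (k2 <= Cmod (sg ((s, -1) - v))); [|lra]. apply TB. rewrite Rabs_left; lra.
  - assert (k2 <= Cmod (sg ((s, 1) - v))); [|lra]. apply TB. rewrite Rabs_pos_eq; lra.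
  - assert (k1 <= Cmod (sg (((- c1)%R, s) - v))); [|lra].
    eapply Rle_trans; [|apply (sg_lower_strip eta1); auto].
    + fold k1. pose proof (Ex (snd (((- c1)%R, s) - v)%C)). nra.
    + simpl. rewrite Rabs_left by lra. lra.
  - assert (sgc <= Cmod (sg ((d2, s) - v))); [|lra].
    eapply Rle_trans; [|apply sg_line; auto]. pose proof (Ex s). nra.
Qed.

Lemma on_sides_imp (x1 x2 y1 y2 : R) (P Q : C -> Prop) :
  (forall z, fst z <= x2 \/ x2 < x1 -> P z -> Q z) -> on_sides x1 x2 y1 y2 P -> on_sides x1 x2 y1 y2 Q.
Proof.
  intros H [H1 [H2 [H3 H4]]].
  repeat split; intros s Hs; apply H; auto; simpl; try lra.
Qed.

Lemma sides_sg (v : C) : Cmod v < rho -> on_sides (- c1) d2 (-1) 1 (fun w => fst w <= d2 /\ sg (v - w) <> 0).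
Proof.
  intros Hv. pose proof c1_spec. destruct sides_lower as [c [Pc Hc]].
  eapply on_sides_imp; [|apply (Hc v Hv)]. intros w Hw L. split; [lra|]. intros E. cbv beta in L.
  replace (w - v)%C with (- (v - w))%C in L by ring. rewrite sg_opp, E, Cmod_opp, Cmod_0 in L. lra.
Qed.

Lemma sides_regular : on_sides (- c1) d2 (-1) 1 (fun w => fst w <= d2 /\ regular N a w).
Proof.
  pose proof c1_spec. destruct sides_lower as [c [Pc Hc]].
  assert (H' : on_sides (- c1) d2 (-1) 1 (fun w => forall m, (m < N)%nat -> c <= Cmod (sg (w - a m)))).
  { assert (Hm' : forall m, (m < N)%nat -> on_sides (- c1) d2 (-1) 1 (fun w => c <= Cmod (sg (w - a m)))).
    { intros m Hm. apply Hc. pose proof (Ha m Hm). lra. }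
    repeat split; intros s Hs m Hm; destruct (Hm' m Hm) as [U1 [U2 [U3 U4]]];
      [apply U1|apply U2|apply U3|apply U4]; exact Hs. }
  eapply on_sides_imp; [|apply H']. intros w Hw L. split; [lra|]. intros m Hm E.
  specialize (L m Hm). rewrite E, Cmod_0 in L. lra.
Qed.

Lemma on_sides_and (x1 x2 y1 y2 : R) (P Q : C -> Prop) :
  on_sides x1 x2 y1 y2 P -> on_sides x1 x2 y1 y2 Q -> on_sides x1 x2 y1 y2 (fun z => P z /\ Q z).
Proof. intros [H1 [H2 [H3 H4]]] [G1 [G2 [G3 G4]]]. repeat split; auto. Qed.

Lemma on_sides_box (x1 x2 y1 y2 : R) : x1 <= x2 -> y1 <= y2 ->
  on_sides x1 x2 y1 y2 (in_box x1 x2 y1 y2).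
Proof. intros Hx Hy. unfold on_sides, in_box. simpl. repeat split; lra. Qed.

Lemma HH_rect (k : nat) (v : C) : Cmod v < rho ->
  is_rect (- c1) d2 (-1) 1 (fun w => SS v w * HH N a F k w)%C (- (two_pi_i * HH N a F k v))%C.
Proof.
  intros Hv. pose proof c1_spec as Hc.
  pose proof (Re_le_Cmod v). pose proof (Im_le_Cmod v).
  assert (Rabs (fst v) < rho) as R1 by lra. apply Rabs_def2 in R1.
  assert (Rabs (snd v) < rho) as R2 by lra. apply Rabs_def2 in R2.
  set (Phi := fun w => (- (HH N a F k w * / (RecipGamma (1 + (w - v)) * RecipGamma (1 - (w - v)))))%C).
  assert (NR : forall w, in_box (- c1) d2 (-1) 1 w ->
    RecipGamma (1 + (w - v)) <> 0 /\ RecipGamma (1 - (w - v)) <> 0).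
  { intros w [Hw _]. split; [apply RG_neq0_1p; simpl; lra|].
    replace (1 - (w - v))%C with (1 + - (w - v))%C by ring. apply RG_neq0_1p; simpl; lra. }
  assert (Hf : rect_int (fun w => Phi w / (w - v))%C (- c1) d2 (-1) 1 = (two_pi_i * Phi v)%C).
  { apply rect_formula; try lra. intros w Hw. destruct (NR w Hw). unfold Phi.
    apply hol_opp, hol_mult; [apply hol_HH, HFhol; destruct Hw; lra|].
    apply (hol_inv (fun w => RecipGamma (1 + (w - v)) * RecipGamma (1 - (w - v)))%C).
    - apply hol_mult; apply hol_RG; [apply hol_plus|apply hol_minus]; try apply hol_const;
        apply hol_minus; [apply hol_id|apply hol_const|apply hol_id|apply hol_const].
    - now apply Cmult_neq_0. }
  assert (Ev : (two_pi_i * Phi v = - (two_pi_i * HH N a F k v))%C).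
  { unfold Phi. replace (v - v)%C with (RtoC 0) by ring.
    replace (1 + 0)%C with (RtoC 1) by ring. replace (1 - 0)%C with (RtoC 1) by ring. rewrite RG_1; field; intros E; injection E; lra. }
  rewrite <- Ev, <- Hf.
  assert (Hs : is_rect (- c1) d2 (-1) 1 (fun w => SS v w * HH N a F k w)%C
     (rect_int (fun w => SS v w * HH N a F k w)%C (- c1) d2 (-1) 1)).
  { apply is_rect_cont; try lra. eapply on_sides_imp; [|apply (sides_sg v Hv)].
    intros w _ [W1 W2]. apply hol_cont, hol_mult; [now apply hol_SS_r|]. now apply hol_HH, HFhol. }
  apply (eq_rect _ (is_rect _ _ _ _ _) Hs).
  symmetry. apply is_rect_unique.
  eapply is_rect_ext; [lra|lra| |exact Hs].
  assert (Bx : on_sides (- c1) d2 (-1) 1 (fun w => in_box (- c1) d2 (-1) 1 w /\ sg (v - w) <> 0)).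
  { apply on_sides_and; [|eapply on_sides_imp; [|apply (sides_sg v Hv)]; intros w _ [_ Hw]; exact Hw].
    apply on_sides_box; lra. }
  eapply on_sides_imp; [|exact Bx]. intros w _ [Hw Hn]. destruct (NR w Hw) as [n1 n2].
  unfold SS, Phi.
  replace (v - w)%C with (- (w - v))%C in * by ring. rewrite sg_opp in *.
  rewrite <- RG_succ_reflect in *.
  assert (n3 : (w - v <> 0)%C).
  { intros E. apply Hn. rewrite E. ring. }
  field. repeat split; auto.
Qed.

Definition Rk (l k : nat) : C :=
  (- (rect_int (fun w => eps N a l w * HH N a F k w)%C (- c1) d2 (-1) 1 / two_pi_i))%C.
Definition sig (k : nat) (v : C) : C :=
  (- (rect_int (fun w => SS v w * (HH N a F k w * / QQ N a w))%C (- c1) d2 (-1) 1 / two_pi_i))%C.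

Lemma QQ_neq0 (w : C) : regular N a w -> QQ N a w <> 0.
Proof. intros H. apply phi_neq0. now apply regular_VV. Qed.

Lemma HH_QQ_cont (k : nat) (w : C) : fst w <= d2 -> regular N a w ->
  Ccont (fun w => HH N a F k w * / QQ N a w)%C w.
Proof.
  intros H1 H2. apply hol_cont, hol_mult; [now apply hol_HH, HFhol|].
  apply (hol_inv (QQ N a)); [apply hol_QQ|now apply QQ_neq0].
Qed.

Lemma HH_expand (k : nat) (v : C) : Cmod v < rho ->
  (HH N a F k v = Csum N (fun l => qq N a l v * Rk l k) + QQ N a v * sig k v)%C.
Proof.
  intros Hv. pose proof c1_spec as Hc.
  assert (E : is_rect (- c1) d2 (-1) 1
    (fun w => Csum N (fun l => qq N a l v * (eps N a l w * HH N a F k w))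
       + QQ N a v * (SS v w * (HH N a F k w * / QQ N a w)))%C
    (Csum N (fun l => qq N a l v * rect_int (fun w => eps N a l w * HH N a F k w)%C (- c1) d2 (-1) 1)
       + QQ N a v * rect_int (fun w => SS v w * (HH N a F k w * / QQ N a w))%C (- c1) d2 (-1) 1)%C).
  { apply (is_rect_plus _ _ _ _ (fun w => Csum N (fun l => qq N a l v * (eps N a l w * HH N a F k w))%C)).
    - apply (is_rect_Csum _ _ _ _ N (fun l w => qq N a l v * (eps N a l w * HH N a F k w))%C).
      intros l _. apply is_rect_scal. apply is_rect_cont; try lra.
      eapply on_sides_imp; [|apply sides_regular]. intros w _ [W1 W2].
      apply hol_cont, hol_mult; [now apply hol_eps|now apply hol_HH, HFhol].
    - apply is_rect_scal. apply is_rect_cont; try lra.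
      eapply on_sides_imp; [|apply (on_sides_and _ _ _ _ _ _ sides_regular (sides_sg v Hv))].
      intros w _ [[W1 W2] [_ W3]]. apply Ccont_mult; [now apply hol_cont, hol_SS_r|now apply HH_QQ_cont]. }
  assert (E2 : is_rect (- c1) d2 (-1) 1 (fun w => SS v w * HH N a F k w)%C
    (Csum N (fun l => qq N a l v * rect_int (fun w => eps N a l w * HH N a F k w)%C (- c1) d2 (-1) 1)
       + QQ N a v * rect_int (fun w => SS v w * (HH N a F k w * / QQ N a w))%C (- c1) d2 (-1) 1)%C).
  { eapply is_rect_ext; [lra|lra| |exact E].
    eapply on_sides_imp; [|apply (on_sides_and _ _ _ _ _ _ sides_regular (sides_sg v Hv))].
    intros w _ [[W1 W2] [_ W3]]. cbv beta. rewrite (newton_S N a v w W2 W3) at 2.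
    rewrite Cmult_plus_distr_r, <- Csum_scal_r. f_equal; [apply Csum_ext; intros; ring|ring]. }
  apply is_rect_unique in E2. rewrite (is_rect_unique _ _ _ _ _ _ (HH_rect k v Hv)) in E2.
  pose proof two_pi_i_neq0 as nT.
  transitivity (- / two_pi_i * (- (two_pi_i * HH N a F k v)))%C; [field; auto|].
  rewrite E2, Cmult_plus_distr_l, <- Csum_scal. unfold Rk, sig, Cdiv.
  f_equal; [apply Csum_ext; intros; ring|ring].
Qed.

Lemma Rcont_bounded (f : R -> C) (x y : R) : x <= y -> (forall t, x <= t <= y -> Rcont f t) ->
  exists M, 0 <= M /\ forall t, x <= t <= y -> Cmod (f t) <= M.
Proof.
  intros Hxy Hf.
  destruct (continuity_ab_maj (fun t => Cmod (f t)) x y Hxy) as [m [Hm _]].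
  - intros t Ht e He. destruct (Rcont_Cmod f t (Hf t Ht) e He) as [d [Hd K]].
    exists d. split; auto. intros s [_ Hs]. specialize (K s Hs).
    rewrite <- RtoC_minus, Cmod_R in K. exact K.
  - exists (Cmod (f m)). split; [apply Cmod_ge_0|auto].
Qed.

Lemma hol_segment (g : C -> C) (path : R -> C) (x y c : R) (z : C) : x <= y -> 0 < c -> Cmod z < rho ->
  (forall t, x <= t <= y -> Rcont path t) -> (forall t, x <= t <= y -> Ccont g (path t)) ->
  (forall v t, Cmod v < rho -> x <= t <= y -> c <= Cmod (sg (path t - v))) ->
  hol (fun v => cint (fun t => SS v (path t) * g (path t))%C x y) z.
Proof.
  intros Hxy Hc Hz Hp Hg Hl.
  assert (Hl' : forall v t, Cmod v < rho -> x <= t <= y -> c <= Cmod (sg (v - path t))).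
  { intros v t Hv Ht. replace (v - path t)%C with (- (path t - v))%C by ring.
    rewrite sg_opp, Cmod_opp. auto. }
  assert (Nz : forall v t, Cmod v < rho -> x <= t <= y -> sg (v - path t) <> 0).
  { intros v t Hv Ht. apply Cmod_gt_0. specialize (Hl' v t Hv Ht). lra. }
  destruct (Rcont_bounded (fun t => g (path t)) x y Hxy) as [M [PM HM]].
  { intros t Ht. apply (Rcont_comp g path); auto. }
  assert (D : forall w, Cmod (w - z) < rho - Cmod z -> Cmod w < rho).
  { intros w Hw. pose proof (Cmod_le_plus w z). lra. }
  apply (hol_param (fun h v => is_cint h x y v) (fun t => x <= t <= y) (fun _ => 1) (y - x)
    (/ c * M) (rho - Cmod z) (fun v t => SS v (path t) * g (path t))%C); try lra.
  - intros; now apply is_cint_scal.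
  - intros; now apply is_cint_minus.
  - intros h v K PK Hh HK. pose proof (is_cint_norm h x y K v Hxy) as B.
    rewrite Rmult_comm. apply B; auto. intros t Ht. specialize (HK t Ht). lra.
  - intros; lra.
  - apply Rmult_le_pos; [apply Rlt_le, Rinv_0_lt_compat|]; auto.
  - intros w Hw. apply ex_cint. intros t Ht. rewrite Rmin_left, Rmax_right in Ht by auto.
    apply (Rcont_comp (fun u => SS w u * g u)%C path); auto.
    apply Ccont_mult; auto. apply hol_cont, hol_SS_r; auto.
  - intros t w Ht Hw. apply hol_mult; [apply hol_SS_l; auto|apply hol_const].
  - intros t w Ht Hw. rewrite Cmod_mult, Rmult_1_r. apply Rmult_le_compat; auto using Cmod_ge_0.
    unfold SS. rewrite Cmod_inv by auto. apply Rinv_le_contravar; auto.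
Qed.

Lemma hol_sig (k : nat) (z : C) : Cmod z < rho -> hol (sig k) z.
Proof.
  intros Hz. pose proof c1_spec as Hc. destruct sides_lower as [c [Pc Hl]].
  destruct sides_regular as [S1 [S2 [S3 S4]]].
  unfold sig. apply hol_opp. apply hol_mult; [|apply hol_const].
  assert (G : forall path x y, x <= y -> (forall t, x <= t <= y -> Rcont path t) ->
    (forall t, x <= t <= y -> fst (path t) <= d2 /\ regular N a (path t)) ->
    (forall v t, Cmod v < rho -> x <= t <= y -> c <= Cmod (sg (path t - v))) ->
    hol (fun v => cint (fun t => SS v (path t) * (HH N a F k (path t) * / QQ N a (path t)))%C x y) z).
  { intros path x y Hxy Hp Hr Hb.
    apply (hol_segment (fun w => HH N a F k w * / QQ N a w)%C path x y c); auto.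
    intros t Ht. destruct (Hr t Ht). now apply HH_QQ_cont. }
  assert (Rv : forall x t, Rcont (fun y => (x, y)) t).
  { intros x t. apply (Rcont_vline (fun w => w)). apply hol_cont, hol_id. }
  assert (Rh : forall y t, Rcont (fun x => (x, y)) t).
  { intros y t. apply (Rcont_hline (fun w => w)). apply hol_cont, hol_id. }
  unfold rect_int. repeat first [apply hol_minus|apply hol_plus].
  - apply (G (fun x => (x, -1))); try lra; auto. intros v t Hv Ht. destruct (Hl v Hv) as [U1 [U2 [U3 U4]]]. apply U1; exact Ht.
  - apply hol_mult; [apply hol_const|]. apply (G (fun y => (d2, y))); try lra; auto.
    intros v t Hv Ht. destruct (Hl v Hv) as [U1 [U2 [U3 U4]]]. apply U4; exact Ht.
  - apply (G (fun x => (x, 1))); try lra; auto. intros v t Hv Ht. destruct (Hl v Hv) as [U1 [U2 [U3 U4]]]. apply U2; exact Ht.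
  - apply hol_mult; [apply hol_const|]. apply (G (fun y => (- c1, y))); try lra; auto.
    intros v t Hv Ht. destruct (Hl v Hv) as [U1 [U2 [U3 U4]]]. apply U3; exact Ht.
Qed.

Definition Lk (l j : nat) : C := (Bk l j + Rk l (S j))%C.

Lemma GG_Rk (k j : nat) : (k < N)%nat -> (j < N)%nat ->
  Csum N (fun l => GG k l * Rk l (S j))%C = if Nat.eqb k j then RtoC 1 else RtoC 0.
Proof.
  intros Hk Hj. apply (is_Lam_unique (fun v => plo N a k v * / plo N a (S j) v)%C); [|now apply Lam_biorth].
  eapply is_Lam_ext; [|apply (Lam_pY k (HH N a F (S j)) (sig (S j)) (fun l => Rk l (S j)))].
  - intros th. cbv beta. rewrite (HH_div N a F (S j)) by apply circ_regular.
    pose proof (hh_circ_neq0 th). pose proof (plo_neq0 N a (S j) _ (regular_a N a _ (circ_regular th))).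
    field. auto.
  - intros z Hz. now apply hol_sig.
  - intros z Hz. now apply HH_expand.
Qed.

Lemma KK_GG_Lk (k j : nat) : (k < N)%nat -> (j < N)%nat ->
  ((if Nat.eqb k j then RtoC 1 else RtoC 0) + KK (inr k) (inr j) = Csum N (fun l => GG k l * Lk l j))%C.
Proof.
  intros Hk Hj. rewrite <- GG_Rk by auto. unfold KK. rewrite <- Csum_plus. apply Csum_ext. intros l _.
  unfold Lk. ring.
Qed.

(* After cancelling the zeros of the reciprocal Gamma functions the only possible
   poles of the integrand of [GG k l] are the [a m] with [k <= m <= l]. *)
Definition tf (k l m : nat) (v : C) : C :=
  if (m <? S l)%nat then (/ RecipGamma (1 + (v - a m)))%C
  else ((if (m <? k)%nat then v - a m else 1) * (ev v * ev (a m) * RecipGamma (1 - (v - a m))))%C.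

Lemma GG_integrand (k l : nat) (th : R) : let v := circ d1 th in
  (plo N a k v * qq N a l v * / hh N a F v
   = ev v * / F v * Cprod N (fun m => tf k l m v)
     * Cprod N (fun m => if (m <? k)%nat then 1 else if (m <? S l)%nat then / (v - a m) else 1))%C.
Proof.
  intros v.
  assert (nF : F v <> 0) by (apply HFnz, circ_rho).
  assert (nR : forall m, (m < N)%nat -> RecipGamma (v - a m) <> 0).
  { intros m Hm. apply RG_neq0; [apply disc_re; auto; apply circ_rho|apply circ_neq; auto]. }
  assert (nR1 : forall m, (m < N)%nat -> RecipGamma (1 + (v - a m)) <> 0).
  { intros m Hm. apply RG_neq0_1p, disc_re; auto; apply circ_rho. }
  pose proof (Cprod_neq0 N _ nR) as nP.
  unfold qq, hh, plo, phi.
  transitivity (ev v * / F v * (Cprod N (fun m => if (m <? k)%nat then v - a m else 1)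
     * Cprod N (fun m => if (m <? S l)%nat then 1 else VV v - Aa a m)
     * / Cprod N (fun m => RecipGamma (v - a m))))%C; [field; auto|].
  rewrite <- !Cmult_assoc. do 2 f_equal. rewrite <- Cprod_inv by auto.
  rewrite <- !Cprod_mult. apply Cprod_ext. intros m Hm. unfold tf.
  pose proof (nR m Hm) as n1. pose proof (nR1 m Hm) as n2.
  unfold Aa. rewrite VV_RG.
  assert (n3 : (v - a m <> 0)%C) by (apply circ_neq; auto).
  destruct (m <? k)%nat, (m <? S l)%nat; try (field; auto; fail); rewrite (RG_succ (v - a m)); field; auto.
Qed.

Lemma hol_tf (k l m : nat) (z : C) : (m < N)%nat -> Cmod z < rho -> hol (tf k l m) z.
Proof.
  intros Hm Hz. unfold tf.
  assert (Hd : hol (fun v => v - a m)%C z) by (apply hol_minus; [apply hol_id|apply hol_const]).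
  destruct (m <? S l)%nat.
  - apply (hol_inv (fun v => RecipGamma (1 + (v - a m)))); [|apply RG_neq0_1p; now apply disc_re].
    apply hol_RG, hol_plus; [apply hol_const|auto].
  - apply hol_mult; [destruct (m <? k)%nat; [auto|apply hol_const]|].
    apply hol_mult; [apply hol_mult; [apply hol_ev|apply hol_const]|].
    apply hol_RG, hol_minus; [apply hol_const|auto].
Qed.

Lemma hol_tf_prod (k l : nat) (z : C) : Cmod z < rho ->
  hol (fun v => ev v * / F v * Cprod N (fun m => tf k l m v))%C z.
Proof.
  intros Hz. apply hol_mult; [apply hol_mult; [apply hol_ev|]|].
  - apply (hol_inv F); [apply HFhol; now apply disc_fst|auto].
  - apply (hol_Cprod N (fun m v => tf k l m v)). intros m Hm. now apply hol_tf.
Qed.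

Lemma GG_lower (k l : nat) : (l < k)%nat -> GG k l = 0.
Proof.
  intros Hl. apply (is_Lam_unique _ _ _ (is_Lam_GG k l)).
  apply (is_Lam_ext (fun v => ev v * / F v * Cprod N (fun m => tf k l m v))%C).
  - intros th. rewrite (GG_integrand k l th). cbv zeta.
    rewrite (Cprod_1 N (fun m => if (m <? k)%nat then 1%C else _)); [ring|].
    intros m Hm. destruct (Nat.ltb_spec m k); destruct (Nat.ltb_spec m (S l)); auto; lia.
  - apply is_Lam_hol. intros z Hz. now apply hol_tf_prod.
Qed.

Lemma GG_diag (k : nat) : (k < N)%nat ->
  GG k k = (ev (a k) * / F (a k) * Cprod N (fun m => tf k k m (a k)))%C.
Proof.
  intros Hk. apply (is_Lam_unique _ _ _ (is_Lam_GG k k)).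
  eapply is_Lam_ext; [|apply (Lam_formula (fun v => ev v * / F v * Cprod N (fun m => tf k k m v))%C (a k));
    [auto|intros z Hz; now apply hol_tf_prod]].
  intros th. rewrite (GG_integrand k k th). cbv zeta. unfold Cdiv. f_equal.
  rewrite <- (Cprod_pick N k (/ (circ d1 th - a k))%C Hk). apply Cprod_ext. intros m Hm.
  destruct (Nat.ltb_spec m k); destruct (Nat.ltb_spec m (S k)); destruct (Nat.eqb_spec m k); subst; auto; lia.
Qed.

Lemma GG_diag_prod :
  Cprod N (fun k => GG k k) = (Cprod N (fun k => / F (a k)) * Cprod N (fun k => Cprod N (fun _ => ev (a k))))%C.
Proof.
  assert (H0 : forall k, (k < N)%nat -> Cmod (a k) < rho) by (intros k Hk; pose proof (Ha k Hk); lra).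
  set (X := fun k m => if (m <? k)%nat then (/ RecipGamma (1 + (a k - a m)))%C
     else (ev (a k) * ev (a m) * RecipGamma (1 - (a k - a m)))%C).
  transitivity (Cprod N (fun k => / F (a k)) * (Cprod N (fun k => ev (a k))
     * Cprod N (fun k => Cprod N (fun m => if Nat.eqb k m then RtoC 1 else X k m))))%C.
  - rewrite <- !Cprod_mult. apply Cprod_ext. intros k Hk. rewrite GG_diag by auto.
    transitivity (/ F (a k) * (ev (a k) * Cprod N (fun m => tf k k m (a k))))%C; [ring|].
    do 2 f_equal. apply Cprod_ext. intros m Hm. unfold tf, X.
    destruct (Nat.ltb_spec m (S k)); destruct (Nat.ltb_spec m k); destruct (Nat.eqb_spec k m); subst; try lia; auto.
    + replace (a m - a m)%C with (RtoC 0) by ring. replace (1 + 0)%C with (RtoC 1) by ring.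
      rewrite RG_1; field; intros E; injection E; lra.
    + ring.
  - f_equal.
    assert (PE : Cprod N (fun k => Cprod N (fun m => if Nat.eqb k m then RtoC 1 else X k m))
       = Cprod N (fun k => Cprod N (fun m => if Nat.eqb k m then RtoC 1 else ev (a k)))).
    { apply (@Det.Cprod_pairs_eq N X (fun i _ => ev (a i))).
      intros i j Hij Hj. unfold X. destruct (Nat.ltb_spec j i); [lia|]. destruct (Nat.ltb_spec i j); [|lia].
      replace (1 + (a j - a i))%C with (1 - (a i - a j))%C by ring.
      assert (RecipGamma (1 - (a i - a j)) <> 0).
      { replace (1 - (a i - a j))%C with (1 + (a j - a i))%C by ring.
        apply RG_neq0_1p. apply disc_re; [lia|apply H0; lia]. }
      field. auto. }
    rewrite PE, <- Cprod_mult. apply Cprod_ext. intros k Hk.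
    rewrite <- (Cprod_pick N k (ev (a k)) Hk) at 1. rewrite <- Cprod_mult. apply Cprod_ext. intros m Hm.
    destruct (Nat.eqb_spec m k); destruct (Nat.eqb_spec k m); subst; try congruence; ring.
Qed.

(** * Moving the line of integration *)

Lemma is_rect_split_x (f : C -> C) (x1 x x2 y1 y2 : R) (u v : C) :
  is_rect x1 x y1 y2 f u -> is_rect x x2 y1 y2 f v -> is_rect x1 x2 y1 y2 f (u + v).
Proof.
  intros [s1 [s2 [s3 [s4 [E1 [E2 [E3 [E4 ->]]]]]]]] [r1 [r2 [r3 [r4 [D1 [D2 [D3 [D4 ->]]]]]]]].
  exists (s1 + r1)%C, r2, (s3 + r3)%C, s4.
  repeat split; auto; [apply (is_cint_Chasles _ _ _ _ _ _ E1 D1)|apply (is_cint_Chasles _ _ _ _ _ _ E3 D3)|].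
  rewrite (is_cint_uniq _ _ _ _ _ D4 E2). ring.
Qed.

Lemma is_rect_split_y (f : C -> C) (x1 x2 y1 y y2 : R) (u v : C) :
  is_rect x1 x2 y1 y f u -> is_rect x1 x2 y y2 f v -> is_rect x1 x2 y1 y2 f (u + v).
Proof.
  intros [s1 [s2 [s3 [s4 [E1 [E2 [E3 [E4 ->]]]]]]]] [r1 [r2 [r3 [r4 [D1 [D2 [D3 [D4 ->]]]]]]]].
  exists s1, (s2 + r2)%C, r3, (s4 + r4)%C.
  repeat split; auto; [apply (is_cint_Chasles _ _ _ _ _ _ E2 D2)|apply (is_cint_Chasles _ _ _ _ _ _ E4 D4)|].
  rewrite (is_cint_uniq _ _ _ _ _ D1 E3). ring.
Qed.

Lemma is_rect_goursat (f : C -> C) (x1 x2 y1 y2 : R) : x1 <= x2 -> y1 <= y2 ->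
  (forall z, in_box x1 x2 y1 y2 z -> hol f z) -> is_rect x1 x2 y1 y2 f 0.
Proof.
  intros Hx Hy H. rewrite <- (goursat f x1 x2 y1 y2 Hx Hy H). apply is_rect_cont; auto.
  eapply on_sides_imp; [|apply (on_sides_box x1 x2 y1 y2 Hx Hy)]. intros w _ Hw. apply hol_cont. now apply H.
Qed.

Lemma regular_off (w : C) : - c1 <= fst w <= d2 -> (fst w <= - d1 \/ 1 <= Rabs (snd w) \/ d1 <= fst w) ->
  regular N a w.
Proof.
  intros H1 H2 m Hm. pose proof c1_spec. destruct (a_re m Hm) as [A1 A2]. pose proof A2 as A3.
  apply Rabs_def2 in A1. apply sg_neq0; [simpl; lra|].
  apply Cminus_neq0. intros ->. pose proof d1_half. destruct H2 as [H2|[H2|H2]]; lra.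
Qed.

Definition ff (l j : nat) (w : C) : C := (eps N a l w * HH N a F (S j) w)%C.

Lemma hol_ff (l j : nat) (w : C) : - c1 <= fst w <= d2 ->
  (fst w <= - d1 \/ 1 <= Rabs (snd w) \/ d1 <= fst w) -> hol (ff l j) w.
Proof.
  intros H1 H2. apply hol_mult; [now apply hol_eps, regular_off|apply hol_HH, HFhol; lra].
Qed.

Lemma ff_rect (l j : nat) (T1 T2 : R) : T1 <= -1 -> 1 <= T2 ->
  is_rect (- d1) d2 T1 T2 (ff l j) (- (two_pi_i * Rk l (S j)))%C.
Proof.
  intros H1 H2. pose proof c1_spec as Hc.
  assert (M1 : 1 <= Rabs (-1)) by (rewrite Rabs_left; lra).
  assert (M2 : 1 <= Rabs 1) by (rewrite Rabs_pos_eq; lra).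
  assert (R1 : is_rect (- d1) d2 (-1) 1 (ff l j) (rect_int (ff l j) (- d1) d2 (-1) 1)).
  { apply is_rect_cont; try lra.
    repeat split; intros s Hs; apply hol_cont, hol_ff; simpl; lra. }
  assert (R2 : is_rect (- c1) (- d1) (-1) 1 (ff l j) 0).
  { apply is_rect_goursat; try lra. intros z [Z1 Z2]. apply hol_ff; lra. }
  assert (R3 : is_rect (- d1) d2 T1 (-1) (ff l j) 0).
  { apply is_rect_goursat; try lra. intros z [Z1 Z2]. apply hol_ff; [lra|].
    right; left. rewrite Rabs_left; lra. }
  assert (R4 : is_rect (- d1) d2 1 T2 (ff l j) 0).
  { apply is_rect_goursat; try lra. intros z [Z1 Z2]. apply hol_ff; [lra|].
    right; left. rewrite Rabs_pos_eq; lra. }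
  pose proof (is_rect_unique _ _ _ _ _ _ (is_rect_split_x _ _ _ _ _ _ _ _ R2 R1)) as E.
  apply (eq_rect (0 + rect_int (ff l j) (- d1) d2 (-1) 1 + 0)%C (is_rect _ _ _ _ _)).
  - apply (is_rect_split_y _ _ _ _ 1); auto. now apply (is_rect_split_y _ _ _ _ (-1)).
  - unfold Rk. change (fun w => eps N a l w * HH N a F (S j) w)%C with (ff l j). rewrite E.
    field. apply two_pi_i_neq0.
Qed.

Hypothesis Hseg : forall kappa, 0 < kappa ->
  let seg := fun M : R =>
    RInt (fun x => exp (PI * (INR N / 2 - 1) * Rabs M) * powabs M kappa * Cmod (F (x, M))) (- d1) d2 in
  is_lim seg p_infty 0 /\ is_lim seg m_infty 0.

Definition seg (T : R) : R :=
  RInt (fun x => exp (PI * (INR N / 2 - 1) * Rabs T) * powabs T (INR (2 * N)) * Cmod (F (x, T))) (- d1) d2.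

Lemma seg_small (e : R) : 0 < e -> exists M, 0 < M /\ forall T, M < Rabs T -> Rabs (seg T) < e.
Proof.
  intros He. assert (PN : 0 < INR (2 * N)) by (apply lt_0_INR; lia).
  destruct (Hseg _ PN) as [L1 L2]. apply is_lim_spec in L1. apply is_lim_spec in L2.
  destruct (L1 (mkposreal e He)) as [M1 K1]. destruct (L2 (mkposreal e He)) as [M2 K2]. simpl in K1, K2.
  exists (Rmax 1 (Rmax M1 (- M2))).
  pose proof (Rmax_l 1 (Rmax M1 (- M2))). pose proof (Rmax_r 1 (Rmax M1 (- M2))).
  pose proof (Rmax_l M1 (- M2)). pose proof (Rmax_r M1 (- M2)).
  split; [lra|]. intros T HT.
  unfold Rabs in HT at 1. destruct (Rcase_abs T).
  - specialize (K2 T ltac:(lra)). now rewrite Rminus_0_r in K2.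
  - specialize (K1 T ltac:(lra)). now rewrite Rminus_0_r in K1.
Qed.

Lemma sg_far : exists c, 0 < c /\ forall w m, (m < N)%nat -> 2 <= Rabs (snd w) ->
  c * exp (PI * Rabs (snd w)) <= Cmod (sg (w - a m)).
Proof.
  pose proof PI_RGT_0 as PP. pose proof PI2_3_2 as P3.
  exists (/ (4 * PI) * exp (- (PI * 1))). split.
  { apply Rmult_lt_0_compat; [apply Rinv_0_lt_compat; lra|apply exp_pos]. }
  intros w m Hm Hw. eapply Rle_trans; [|apply sg_lower_sinh].
  destruct (a_re m Hm) as [_ A2]. pose proof d1_half.
  set (y := snd (w - a m)%C).
  assert (Hy : Rabs (snd w) - 1 <= Rabs y).
  { unfold y; simpl. pose proof (Rabs_triang_inv (snd w) (snd (a m))). unfold Rminus in *. lra. }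
  pose proof (exp_shift (snd w) y 1 ltac:(lra) Hy) as E.
  set (X := exp (PI * Rabs y)) in *.
  assert (X1 : 2 <= X).
  { unfold X. eapply Rle_trans; [|apply exp_ineq1_le]. nra. }
  assert (X2 : exp (- (PI * Rabs y)) <= 1).
  { rewrite <- exp_0. apply exp_le. nra. }
  apply Rle_trans with (/ (4 * PI) * X).
  - rewrite Rmult_assoc. apply Rmult_le_compat_l; [apply Rlt_le, Rinv_0_lt_compat; lra|lra].
  - replace (/ (4 * PI) * X) with (X / 2 / 2 / PI) by (field; lra).
    apply Rmult_le_compat_r; [apply Rlt_le, Rinv_0_lt_compat; lra|].
    apply Rmult_le_compat_r; lra.
Qed.

Lemma ff_horizontal (l j : nat) : (l < N)%nat -> exists K, 0 < K /\ forall T v, 2 <= Rabs T ->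
  is_cint (fun x => ff l j (x, T)) (- d1) d2 v -> Cmod v <= K * Rabs (seg T).
Proof.
  intros Hl. destruct sg_far as [c [Pc Hc]]. destruct (eps_bound c Pc) as [K1 [PK1 HK1]].
  destruct HH_bound as [K2 [PK2 HK2]].
  set (K := (K1 * K2 + 1) * 2 ^ (2 * N)).
  assert (P2 : 0 < 2 ^ (2 * N)) by (apply pow_lt; lra).
  assert (PK : 0 < K) by (unfold K; apply Rmult_lt_0_compat; nra).
  exists K. split; auto. intros T v HT Hv.
  set (g := fun x => exp (PI * (INR N / 2 - 1) * Rabs T) * powabs T (INR (2 * N)) * Cmod (F (x, T))).
  assert (Ig : is_RInt g (- d1) d2 (seg T)).
  { assert (Ec : is_cint (fun x => RtoC (g x)) (- d1) d2 (cint (fun x => RtoC (g x)) (- d1) d2)).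
    { apply ex_cint. intros t Ht. rewrite Rmin_left, Rmax_right in Ht by lra. unfold g.
      apply (Rcont_ext (fun x => RtoC (exp (PI * (INR N / 2 - 1) * Rabs T) * powabs T (INR (2 * N))) * RtoC (Cmod (F (x, T))))%C);
        [intros; now rewrite <- RtoC_mult|].
      apply Rcont_mult; [apply Rcont_const|]. apply Rcont_Cmod. apply Rcont_hline, hol_cont, HFhol. simpl; lra. }
    apply (is_RInt_fct_extend_fst (U := R_NormedModule) (V := R_NormedModule)) in Ec.
    unfold seg. apply (@RInt_correct R_CompleteNormedModule). eexists. exact Ec. }
  pose proof (is_RInt_scal _ _ _ K _ Ig) as IgK.
  assert (Hd : - d1 <= d2) by lra.
  eapply Rle_trans; [apply (is_cint_le _ _ _ _ _ _ Hd) with (2 := Hv) (3 := IgK)|].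
  - intros x Hx. cbv beta. unfold scal; simpl. unfold mult; simpl. unfold g.
    rewrite powabs_INR by lia. unfold ff. rewrite Cmod_mult.
    specialize (HK1 l (x, T) Hl (fun m Hm => Hc (x, T) m Hm HT)). specialize (HK2 (S j) (x, T) Hx).
    simpl snd in HK1, HK2.
    pose proof (one_plus_pow T (2 * N) ltac:(lra)) as OP.
    pose proof (Cmod_ge_0 (F (x, T))) as PF. pose proof (HHw_pos T) as PH.
    eapply Rle_trans; [apply Rmult_le_compat_l; [apply Cmod_ge_0|exact HK2]|].
    unfold HHw in *.
    replace (exp (PI * (INR N / 2) * Rabs T)) with (exp (PI * Rabs T) * exp (PI * (INR N / 2 - 1) * Rabs T))
      by (rewrite <- exp_plus; f_equal; field).
    set (E := exp (PI * (INR N / 2 - 1) * Rabs T)). pose proof (exp_pos (PI * (INR N / 2 - 1) * Rabs T)) as PE. fold E in PE.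
    set (Q := (1 + Rabs T) ^ (2 * N)) in *. set (Q' := Rabs T ^ (2 * N)) in *.
    change (N + (N + 0))%nat with (2 * N)%nat. fold Q'.
    assert (PQ : 0 <= Q) by (apply pow_le; pose proof (Rabs_pos T); lra).
    apply Rle_trans with (K1 * (K2 * Q * E * Cmod (F (x, T)))).
    + replace (Cmod (eps N a l (x, T)) * (K2 * (Q * (exp (PI * Rabs T) * E)) * Cmod (F (x, T))))
        with (Cmod (eps N a l (x, T)) * exp (PI * Rabs T) * (K2 * Q * E * Cmod (F (x, T)))) by ring.
      apply Rmult_le_compat_r; auto. repeat apply Rmult_le_pos; auto; lra.
    + unfold K. replace (K1 * (K2 * Q * E * Cmod (F (x, T)))) with (K1 * K2 * Q * (E * Cmod (F (x, T)))) by ring.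
      change (N + (N + 0))%nat with (2 * N)%nat.
      replace ((K1 * K2 + 1) * 2 ^ (2 * N) * (E * Q' * Cmod (F (x, T))))
        with ((K1 * K2 + 1) * (2 ^ (2 * N) * Q') * (E * Cmod (F (x, T)))) by ring.
      apply Rmult_le_compat_r; [apply Rmult_le_pos; auto; lra|].
      assert (0 <= K1 * K2) by now apply Rmult_le_pos. apply Rmult_le_compat; lra.
  - unfold scal; simpl. unfold mult; simpl. apply Rmult_le_compat_l; [lra|]. apply Rle_abs.
Qed.

Lemma ff_line (l j : nat) : (l < N)%nat -> IG (fun t => Ci * ff l j (vline (- d1) t))%C (two_pi_i * Lk l j).
Proof.
  intros Hl.
  assert (I2 : IG (fun t => Ci * ff l j (d2, t))%C (two_pi_i * Bk l j)).
  { apply (LI_mul_fun (eps N a l) (HH N a F (S j))); [now apply eps_mul|apply HH_fun]. }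
  destruct (ff_horizontal l j Hl) as [K [PK HK]].
  apply IG_spec. intros e He.
  destruct (proj1 (IG_spec _ _) I2 (e / 2) ltac:(lra)) as [M1 [PM1 H1]].
  destruct (seg_small (e / (4 * K))) as [M2 [PM2 H2]]; [apply Rdiv_lt_0_compat; lra|].
  exists (Rmax 2 (Rmax M1 M2)).
  pose proof (Rmax_l 2 (Rmax M1 M2)). pose proof (Rmax_r 2 (Rmax M1 M2)).
  pose proof (Rmax_l M1 M2). pose proof (Rmax_r M1 M2). split; [lra|].
  intros x y Hx Hy. destruct (H1 x y ltac:(lra) ltac:(lra)) as [u [Hu Du]].
  destruct (ff_rect l j x y ltac:(lra) ltac:(lra)) as [s1 [s2 [s3 [s4 [E1 [E2 [E3 [E4 Ev]]]]]]]].
  exists (Ci * s4)%C. split; [now apply is_cint_scal|].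
  assert (Eu : u = (Ci * s2)%C) by (apply (is_cint_uniq _ _ _ _ _ Hu); now apply is_cint_scal).
  assert (Rx : Rabs x = - x) by (rewrite Rabs_left; lra).
  assert (Ry : Rabs y = y) by (rewrite Rabs_pos_eq; lra).
  assert (SB : forall T v, 2 <= Rabs T -> M2 < Rabs T -> is_cint (fun x => ff l j (x, T)) (- d1) d2 v -> Cmod v < e / 4).
  { intros T v T1 T2 Hv. eapply Rle_lt_trans; [apply (HK T v T1 Hv)|].
    apply Rlt_le_trans with (K * (e / (4 * K))); [apply Rmult_lt_compat_l; auto|]. right. field. lra. }
  pose proof (SB x s1 ltac:(lra) ltac:(lra) E1) as B1. pose proof (SB y s3 ltac:(lra) ltac:(lra) E3) as B3.
  replace (Ci * s4 - two_pi_i * Lk l j)%C with ((u - two_pi_i * Bk l j) + (s1 + - s3))%C.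
  - eapply Rle_lt_trans; [apply Cmod_triangle|]. pose proof (Cmod_triangle s1 (- s3)) as Tr.
    rewrite Cmod_opp in Tr. lra.
  - unfold Lk. replace (two_pi_i * (Bk l j + Rk l (S j)))%C with (two_pi_i * Bk l j - (- (two_pi_i * Rk l (S j))))%C by ring.
    rewrite Ev, Eu. ring.
Qed.

(** * The Sklyanin integral *)

Lemma HH_tail (k : nat) (w : C) :
  (HH N a F (S k) w = HH N a F N w * Cprod N (fun m => if (k <? m)%nat then w - a m else 1))%C.
Proof.
  unfold HH. rewrite <- Cmult_assoc, <- Cprod_mult. f_equal. apply Cprod_ext. intros m Hm.
  destruct (Nat.ltb_spec m (S k)); destruct (Nat.ltb_spec m N); destruct (Nat.ltb_spec k m); try lia.
  - ring.
  - rewrite (RG_succ (w - a m)). ring.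
Qed.

Lemma eps_head (l : nat) (w : C) : regular N a w ->
  (eps N a l w = - (ev w * / QQ N a w) * Cprod N (fun m => if (m <? l)%nat then VV w - Aa a m else 1))%C.
Proof.
  intros Hw. unfold eps.
  assert (E : QQ N a w = (phi N (Aa a) l (VV w) * Cprod N (fun m => if (m <? l)%nat then VV w - Aa a m else 1))%C).
  { unfold QQ, phi. rewrite <- Cprod_mult. apply Cprod_ext. intros m Hm. simpl.
    destruct (m <? l)%nat; ring. }
  pose proof (QQ_neq0 w Hw) as nQ. pose proof (phi_neq0 N (Aa a) l (VV w) (regular_VV N a w Hw)) as nP.
  rewrite E in *. set (Z := Cprod N _) in *.
  assert (Z <> 0) by (intros E0; apply nQ; rewrite E0; ring).
  field. auto.
Qed.

Lemma RG_opp (x : C) : (RecipGamma x * RecipGamma (- x) = - (x * sg x))%C.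
Proof.
  rewrite (RG_succ x), (RG_succ (- x)), <- RG_succ_reflect.
  replace (1 - x)%C with (1 + - x)%C by ring. ring.
Qed.

Lemma CGamma_reflect (w x : C) : sg (w - x) <> 0 ->
  (CGamma (x - w) = - (ev w * ev x * RecipGamma (1 + (w - x)) * / (VV w - VV x)))%C.
Proof.
  intros H. unfold CGamma. rewrite VV_diff.
  replace (x - w)%C with (- (w - x))%C by ring. rewrite (RG_succ (- (w - x))).
  rewrite <- RG_succ_reflect in *.
  replace (1 - (w - x))%C with (1 + - (w - x))%C in * by ring.
  pose proof (ev_neq0 w). pose proof (ev_neq0 x).
  assert (n1 : (w - x <> 0)%C) by (intros E; apply H; rewrite E; ring).
  assert (n2 : RecipGamma (1 + (w - x)) <> 0) by (intros E; apply H; rewrite E; ring).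
  assert (n3 : RecipGamma (1 + - (w - x)) <> 0) by (intros E; apply H; rewrite E; ring).
  field. repeat split; auto.
Qed.

Lemma Cprod_const_neg1 (n : nat) : (Cprod n (fun _ => Cprod n (fun _ => - (1))) * Cprod n (fun _ => - (1)) = 1)%C.
Proof.
  rewrite <- Cprod_mult.
  assert (E : forall k, Cprod k (fun _ => - (1))%C = (if Nat.even k then RtoC 1 else - RtoC 1)%C).
  { induction k; [reflexivity|]. rewrite Nat.even_succ, <- Nat.negb_even. simpl Cprod. rewrite IHk.
    destruct (Nat.even k); simpl; ring. }
  destruct (Nat.even n) eqn:En.
  - rewrite (Cprod_ext n _ (fun _ => - (1))%C), E, En; [auto|]. intros i _. rewrite E, En. ring.
  - apply Cprod_1. intros i _. rewrite E, En. ring.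
Qed.

Lemma Cprod_swap (n : nat) (f : nat -> nat -> C) :
  Cprod n (fun i => Cprod n (fun j => f i j)) = Cprod n (fun j => Cprod n (fun i => f i j)).
Proof.
  assert (H : forall m k, Cprod m (fun i => Cprod k (fun j => f i j)) = Cprod k (fun j => Cprod m (fun i => f i j))).
  { induction m; intros k; simpl.
    - now rewrite Cprod_1.
    - rewrite IHm, <- Cprod_mult. reflexivity. }
  apply H.
Qed.

Definition hw (w : C) : C := (Ci * / two_pi_i * (HH N a F N w * - (ev w * / QQ N a w)))%C.

Lemma row_entry (l k : nat) (w : C) : regular N a w ->
  (Cprod N (fun m => if (k <? m)%nat then w - a m else 1) * hw w
     * Cprod N (fun m => if (m <? l)%nat then VV w - Aa a m else 1)
   = / two_pi_i * (Ci * ff l k w))%C.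
Proof.
  intros Hw. unfold ff, hw. rewrite (eps_head l w Hw), HH_tail. ring.
Qed.

Lemma sklyanin_product (w : nat -> C) : (forall i, (i < N)%nat -> regular N a (w i)) ->
  (Cprod N (fun i => Cprod N (fun j => if Nat.eqb i j then 1 else RecipGamma (w i - w j)))
   * (Cprod N (fun i => Cprod N (fun j => CGamma (a j - w i)))
      * (Cprod N (fun i => F (w i)) * Cprod N (fun i => Ci * / two_pi_i)))
   = Cprod N (fun k => Cprod N (fun _ => ev (a k)))
     * (cdet N (fun i k => Cprod N (fun m => if (k <? m)%nat then w i - a m else 1))
        * cdet N (fun i l => Cprod N (fun m => if (m <? l)%nat then VV (w i) - Aa a m else 1))
        * Cprod N (fun i => hw (w i))))%C.
Proof.
  intros Hw.
  set (X := fun i j => (RecipGamma (w i - w j) * ev (w i))%C).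
  assert (EN : (cdet N (fun i k => Cprod N (fun m => if (k <? m)%nat then w i - a m else 1))
        * cdet N (fun i l => Cprod N (fun m => if (m <? l)%nat then VV (w i) - Aa a m else 1))
      = Cprod N (fun i => Cprod N (fun j => if Nat.eqb i j then 1 else X i j)))%C).
  { apply (@Det.cdet_newton_pair N w a (fun i => VV (w i)) (Aa a) X).
    intros i j Hij Hj. unfold X.
    transitivity (ev (w i) * ev (w j) * (RecipGamma (w i - w j) * RecipGamma (w j - w i)))%C; [ring|].
    replace (w j - w i)%C with (- (w i - w j))%C by ring. rewrite RG_opp.
    replace (VV (w j) - VV (w i))%C with (- (VV (w i) - VV (w j)))%C by ring. rewrite VV_diff. ring. }
  rewrite EN. rewrite (Cprod_swap N (fun k _ => ev (a k))).
  transitivity (Cprod N (fun _ => Cprod N (fun _ => - (1))) * Cprod N (fun _ => - (1)) *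
    (Cprod N (fun j => Cprod N (fun i => ev (a i)))
     * (Cprod N (fun i => Cprod N (fun j => if Nat.eqb i j then 1 else X i j)) * Cprod N (fun i => hw (w i)))))%C;
    [|rewrite Cprod_const_neg1; ring].
  rewrite <- !Cprod_mult. apply Cprod_ext. intros i Hi.
  pose proof (Hw i Hi) as Hr.
  assert (EG : Cprod N (fun j => CGamma (a j - w i))
    = (Cprod N (fun _ => - (1)) * (Cprod N (fun j => ev (a j)) * (Cprod N (fun j => ev (w i))
       * (Cprod N (fun j => RecipGamma (1 + (w i - a j))) * / QQ N a (w i)))))%C).
  { unfold QQ, phi. rewrite <- Cprod_inv.
    - rewrite <- !Cprod_mult. apply Cprod_ext. intros j Hj. simpl. unfold Aa.
      rewrite CGamma_reflect by now apply Hr. ring.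
    - intros j Hj. simpl. apply Cminus_neq0. now apply (regular_VV N a (w i) Hr). }
  assert (EX : (Cprod N (fun j => if Nat.eqb i j then 1 else X i j) * ev (w i)
     = Cprod N (fun j => if Nat.eqb i j then 1 else RecipGamma (w i - w j)) * Cprod N (fun j => ev (w i)))%C).
  { rewrite <- (Cprod_pick N i (ev (w i)) Hi) at 1. rewrite <- !Cprod_mult. apply Cprod_ext. intros j Hj.
    unfold X. destruct (Nat.eqb_spec j i); destruct (Nat.eqb_spec i j); subst; try congruence; ring. }
  assert (EH : HH N a F N (w i) = (F (w i) * Cprod N (fun j => RecipGamma (1 + (w i - a j))))%C).
  { unfold HH. f_equal. apply Cprod_ext. intros j Hj. destruct (Nat.ltb_spec j N); [auto|lia]. }
  unfold hw. rewrite EG, EH.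
  set (P1 := Cprod N (fun j => if Nat.eqb i j then 1%C else X i j)) in *.
  set (P2 := Cprod N (fun j => if Nat.eqb i j then 1%C else RecipGamma (w i - w j))) in *.
  set (P3 := Cprod N (fun j => ev (w i))) in *.
  transitivity (Cprod N (fun _ => - (1)) * Cprod N (fun j => ev (a j)) * Cprod N (fun j => RecipGamma (1 + (w i - a j)))
    * / QQ N a (w i) * F (w i) * (Ci * / two_pi_i) * (P2 * P3))%C; [ring|].
  rewrite <- EX. ring.
Qed.

Lemma Cprod_const (n : nat) (x : C) : Cprod n (fun _ => x) = Cpow x n.
Proof. induction n; simpl; [auto|]. rewrite IHn. ring. Qed.

Lemma INR_fact_neq0C (n : nat) : RtoC (INR (fact n)) <> 0.
Proof. intros E. injection E. apply INR_fact_neq_0. Qed.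

Lemma lhs_value : is_iter_RInt_gen N (lhs_integrand N d1 a F) (Cprod N (fun k => GG k k) * cdet N Lk)%C.
Proof.
  destruct (@Det.cdet_andreief N) as [S0 [HS [HE HL]]].
  set (Kc := (/ RtoC (INR (fact N)) * (Cprod N (fun k => / F (a k)) * Cprod N (fun k => Cprod N (fun _ => ev (a k)))))%C).
  assert (Rg : forall t, regular N a (vline (- d1) t)).
  { intros t. pose proof c1_spec. apply regular_off; simpl; lra. }
  apply is_iter_RInt_genP.
  apply (eq_rect (Kc * lsum S0 (fun s => fst s * cdet N (fun i l => Lk l (snd s i))))%C (is_iter _ _ _)).
  2: { assert (HL' : lsum S0 (fun s => fst s * cdet N (fun i l => Lk l (snd s i)))%C
          = (RtoC (INR (fact N)) * cdet N Lk)%C) by apply (HL Lk).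
       rewrite HL', GG_diag_prod. unfold Kc. field. apply INR_fact_neq0C. }
  apply (is_iter_ext _ N (fun ts => Kc * lsum S0 (fun s => fst s * cdet N (fun i l =>
     / two_pi_i * (Ci * ff l (snd s i) (vline (- d1) (nth i ts 0%R))))))%C).
  - intros ts Hts. set (w := fun i => vline (- d1) (nth i ts 0)).
    pose proof (sklyanin_product w (fun i _ => Rg _)) as SP.
    assert (HE' := HE (fun k i => Cprod N (fun m => if (k <? m)%nat then w i - a m else 1)%C)
      (fun l i => Cprod N (fun m => if (m <? l)%nat then VV (w i) - Aa a m else 1)%C) (fun i => hw (w i))).
    assert (ES : lsum S0 (fun s => fst s * cdet N (fun i l => / two_pi_i * (Ci * ff l (snd s i) (w i))))%C
       = (cdet N (fun i k => Cprod N (fun m => if (k <? m)%nat then w i - a m else 1))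
        * cdet N (fun i l => Cprod N (fun m => if (m <? l)%nat then VV (w i) - Aa a m else 1))
        * Cprod N (fun i => hw (w i)))%C).
    { etransitivity; [|symmetry; exact HE']. f_equal. apply functional_extensionality. intros s.
      change (@eq C (fst s * cdet N (fun i l => / two_pi_i * (Ci * ff l (snd s i) (w i))))%C
        (fst s * cdet N (fun i l => Cprod N (fun m => if (snd s i <? m)%nat then w i - a m else 1) * hw (w i)
            * Cprod N (fun m => if (m <? l)%nat then VV (w i) - Aa a m else 1)))%C).
      f_equal. apply cdet_ext. intros i l Hi Hl. symmetry. apply row_entry. apply Rg. }
    change (fun i => vline (- d1) (nth i ts 0%R)) with w.
    transitivity (Kc * (cdet N (fun i k => Cprod N (fun m => if (k <? m)%nat then w i - a m else 1))
        * cdet N (fun i l => Cprod N (fun m => if (m <? l)%nat then VV (w i) - Aa a m else 1))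
        * Cprod N (fun i => hw (w i))))%C; [now rewrite <- ES|].
    unfold Kc. set (D := (cdet N _ * cdet N _ * _)%C) in *.
    transitivity (/ RtoC (INR (fact N)) * Cprod N (fun k => / F (a k)) * (Cprod N (fun k => Cprod N (fun _ => ev (a k))) * D))%C; [ring|].
    rewrite <- SP.
    assert (EL : lhs_integrand N d1 a F ts = (/ (Cpow two_pi_i N * RtoC (INR (fact N)))
      * (Cprod N (fun i => Cprod N (fun j => if Nat.eqb i j then 1 else RecipGamma (w i - w j)))
      * (Cprod N (fun i => Cprod N (fun j => CGamma (a j - w i)))
      * (Cprod N (fun j => F (w j) * / F (a j)) * Cprod N (fun _ => Ci)))))%C) by reflexivity.
    assert (nT : Cpow two_pi_i N <> 0).
    { rewrite <- Cprod_const. apply Cprod_neq0. intros; apply two_pi_i_neq0. }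
    rewrite (Cprod_mult N (fun _ => Ci)), (Cprod_const N (/ two_pi_i)).
    assert (EI : Cpow (/ two_pi_i) N = (/ Cpow two_pi_i N)%C).
    { rewrite <- !Cprod_const. apply Cprod_inv. intros; apply two_pi_i_neq0. }
    rewrite EI.
    rewrite EL, (Cprod_mult N (fun j => F (w j))). pose proof (INR_fact_neq0C N). field. auto.
  - apply is_iter_scal; [exact IG_scal|].
    apply (is_iter_lsum _ IG_0 IG_plus S0 N (fun s ts => fst s * cdet N (fun i l =>
     / two_pi_i * (Ci * ff l (snd s i) (vline (- d1) (nth i ts 0%R)))))%C).
    intros s Hs. apply is_iter_scal; [exact IG_scal|].
    apply (is_iter_cdet IG IG_0 IG_plus IG_scal N (fun i l t => / two_pi_i * (Ci * ff l (snd s i) (vline (- d1) t)))%C).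
    intros i l Hi Hl.
    apply (eq_rect (/ two_pi_i * (two_pi_i * Lk l (snd s i)))%C (IG _)); [|field; apply two_pi_i_neq0].
    apply (IG_scal (fun t => Ci * ff l (snd s i) (vline (- d1) t))%C). now apply ff_line.
Qed.

(** * The Fredholm series *)

Lemma kernelK_KK (s t : R) : kernelK N d2 a F (circ d1 s) (circ d1 t) = KK (inl s) (inl t).
Proof.
  set (v := circ d1 s). set (y := circ d1 t).
  assert (nh : hh N a F v <> 0) by apply hh_circ_neq0.
  change (KK (inl s) (inl t)) with (kap v y * / hh N a F v)%C.
  assert (Hv : Cmod v < rho) by apply circ_rho. assert (Hy : Cmod y < rho) by apply circ_rho.
  assert (I : is_LI (fun w => SS v w * (hh N a F w * / (w - y)))%C (kap v y)).
  { apply (LI_mul_fun (SS v) (fun w => hh N a F w * / (w - y))%C); [now apply SS_mul|].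
    apply fun_class_pole; auto. apply hh_fun. }
  unfold kernelK.
  rewrite (IG_RInt_gen _ (/ hh N a F v * (two_pi_i * kap v y))%C).
  - field. split; auto. apply two_pi_i_neq0.
  - eapply IG_ext; [|apply (IG_scal _ (/ hh N a F v)%C _ I)].
    intros r. cbv beta zeta. unfold vline.
    set (w := (d2, r) : C).
    assert (nF : F v <> 0) by now apply HFnz.
    assert (nS : sg (v - w) <> 0) by now apply SS_line.
    assert (nw : (w - y <> 0)%C) by now apply line_neq.
    assert (ES : (RtoC PI / Csin (RtoC PI * (v - w)) = SS v w)%C).
    { unfold SS, sg in *. pose proof PI_neq0C.
      assert (Csin (RtoC PI * (v - w)) <> 0) by (intros E; apply nS; rewrite E; field; auto).
      field. auto. }
    rewrite ES.
    assert (EP : (Cprod N (fun m => CGamma (v - a m) / CGamma (w - a m))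
       = / Cprod N (fun m => RecipGamma (v - a m)) * Cprod N (fun m => RecipGamma (w - a m)))%C).
    { assert (nR : forall m, (m < N)%nat -> RecipGamma (v - a m) <> 0).
      { intros m Hm. apply RG_neq0; [apply disc_re; auto|apply circ_neq; auto]. }
      rewrite <- Cprod_inv by auto. rewrite <- Cprod_mult. apply Cprod_ext. intros m Hm.
      unfold CGamma, Cdiv. f_equal.
      destruct (excluded_middle_informative (RecipGamma (w - a m) = 0)) as [E|n].
      - exfalso. apply (regular_line r m Hm). rewrite <- RG_reflect. fold w. rewrite E. ring.
      - field. auto. }
    rewrite EP. unfold hh in *. set (A1 := Cprod N (fun m => RecipGamma (v - a m))) in *.
    assert (A1 <> 0) by (intros E; apply nh; rewrite E; ring).
    field. repeat split; auto.
Qed.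

Lemma fredholm_term_value (n : nat) : fredholm_term N d1 d2 a F n
  = (/ RtoC (INR (fact n)) * Sumseq N n (fun f => cdet n (fun i j => KK (inr (nth i f O)) (inr (nth j f O)))))%C.
Proof.
  unfold fredholm_term. f_equal. apply is_iter_RIntP.
  apply (is_iter_ext _ n (fun ts => cdet n (fun i j => KK (inl (nth i ts 0%R)) (inl (nth j ts 0%R)))
     * Cprod n (fun i => jac (nth i ts 0%R)))%C).
  - intros ts _. cbv zeta. f_equal. apply cdet_ext. intros i j _ _. now rewrite kernelK_KK.
  - apply is_iter_weight.
    apply (is_iter_fredholm ILam ILam_ext ILam_0 ILam_plus ILam_scal N KK KK_trace_Lam KK_comp_Lam n).
Qed.

Lemma fredholm_series : @is_series C_AbsRing C_NormedModule (fredholm_term N d1 d2 a F)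
  (Cprod N (fun k => GG k k) * cdet N Lk)%C.
Proof.
  assert (E : Csum (S N) (fredholm_term N d1 d2 a F) = (Cprod N (fun k => GG k k) * cdet N Lk)%C).
  { transitivity (cdet N (fun i j => (if Nat.eqb i j then RtoC 1 else RtoC 0) + KK (inr i) (inr j))%C).
    - etransitivity; [|apply (@Det.cdet_fredholm N (fun i j => KK (inr i) (inr j)))].
      apply Csum_ext. intros n _. apply fredholm_term_value.
    - rewrite (cdet_ext N _ (fun i j => Csum N (fun l => GG i l * Lk l j)%C)) by (intros; now apply KK_GG_Lk).
      apply (@Det.cdet_mul_utrig N GG Lk). intros i j Hj _. now apply GG_lower. }
  rewrite <- E.
  assert (Z : forall n, (N < n)%nat -> fredholm_term N d1 d2 a F n = 0).
  { intros n Hn. rewrite fredholm_term_value.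
    rewrite (@Det.cdet_fredholm_0 N n (fun i j => KK (inr i) (inr j)) Hn). apply Cmult_0_r. }
  assert (Sn : forall n, @sum_n C_NormedModule (fredholm_term N d1 d2 a F) n = Csum (S n) (fredholm_term N d1 d2 a F)).
  { induction n.
    - rewrite sum_O. simpl. ring.
    - rewrite sum_Sn, IHn. reflexivity. }
  assert (St : forall n, Csum (S (N + n)) (fredholm_term N d1 d2 a F) = Csum (S N) (fredholm_term N d1 d2 a F)).
  { induction n; [now rewrite Nat.add_0_r|]. rewrite <- IHn, Nat.add_succ_r.
    change (Csum (S (S (N + n))) (fredholm_term N d1 d2 a F))
      with (Csum (S (N + n)) (fredholm_term N d1 d2 a F) + fredholm_term N d1 d2 a F (S (N + n)))%C.
    rewrite (Z (S (N + n))) by lia. ring. }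
  intros P HP. exists N. intros n Hn.
  rewrite Sn. replace n with (N + (n - N))%nat by lia. rewrite St. now apply locally_singleton.
Qed.

End Line.

Lemma nonvanishing_margin (F : C -> C) (r : R) : 0 < r ->
  (forall z, Cmod z <= r -> F z <> 0) -> (forall z, Cmod z <= r -> Ccont F z) ->
  exists e, 0 < e /\ forall z, Cmod z < r + e -> F z <> 0.
Proof.
  intros Hr Hnz Hc.
  assert (D : forall p : C, exists d : posreal,
    (Cmod p <= r -> forall w, Cmod (w - p) < 4 * d -> F w <> 0) /\ (r < Cmod p -> 4 * d <= Cmod p - r)).
  { intros p. destruct (Rle_lt_dec (Cmod p) r) as [L|L].
    - pose proof (Hnz p L) as n. apply Cmod_gt_0 in n. destruct (Hc p L _ n) as [d [Pd Hd]].
      exists (mkposreal (d / 4) ltac:(lra)). simpl. split; [|lra].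
      intros _ w Hw E. specialize (Hd w ltac:(lra)). rewrite E in Hd.
      replace (0 - F p)%C with (- F p)%C in Hd by ring. rewrite Cmod_opp in Hd. lra.
    - exists (mkposreal ((Cmod p - r) / 4) ltac:(lra)). simpl. split; lra. }
  set (delta := fun u v : R => proj1_sig (constructive_indefinite_description _ (D (u, v)))).
  assert (Hdelta : forall u v, let d := delta u v in
    (Cmod (u, v) <= r -> forall w, Cmod (w - (u, v)) < 4 * d -> F w <> 0) /\
    (r < Cmod (u, v) -> 4 * d <= Cmod (u, v) - r)).
  { intros u v. unfold delta. apply (proj2_sig (constructive_indefinite_description _ (D (u, v)))). }
  destruct (compactness_value_2d (- r) r (- r) r delta) as [e He].
  exists e. split; [apply cond_pos|]. intros z Hz.
  destruct (Rle_lt_dec (Cmod z) r) as [L|L]; [auto|].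
  set (z' := (RtoC (r / Cmod z) * z)%C).
  assert (Mz' : Cmod z' = r).
  { unfold z'. rewrite Cmod_mult, Cmod_R, Rabs_pos_eq; [field; lra|]. apply Rlt_le, Rdiv_lt_0_compat; lra. }
  assert (Dz : Cmod (z - z') < e).
  { replace (z - z')%C with (RtoC (1 - r / Cmod z) * z)%C by (unfold z'; rewrite RtoC_minus; ring).
    rewrite Cmod_mult, Cmod_R, Rabs_pos_eq.
    - replace ((1 - r / Cmod z) * Cmod z) with (Cmod z - r) by (field; lra). lra.
    - assert (r / Cmod z <= 1); [|lra]. apply Rle_div_l; lra. }
  pose proof (Re_le_Cmod z') as Rz. pose proof (Im_le_Cmod z') as Iz. rewrite Mz' in Rz, Iz.
  apply Rabs_le_between in Rz. apply Rabs_le_between in Iz.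
  intros E0. apply (He (fst z') (snd z') Rz Iz). intros [u [v [_ [_ [H1 [H2 H3]]]]]].
  pose proof (cond_pos (delta u v)) as Pd. destruct (Hdelta u v) as [K1 K2].
  assert (B : Cmod (z' - (u, v)) < 2 * delta u v).
  { eapply Rle_lt_trans; [apply Cmod_ReIm|]. 
    change (Rabs (fst z' - u) + Rabs (snd z' - v) < 2 * delta u v). lra. }
  destruct (Rle_lt_dec (Cmod (u, v)) r) as [L'|L'].
  - apply (K1 L' z); auto. pose proof (Cmod_minus_triangle z z' (u, v)). lra.
  - specialize (K2 L'). pose proof (Cmod_le_plus (u, v) z') as T. rewrite Cmod_minus_sym in T. lra.
Qed.

Theorem theorem1p7
  (delta1 delta2 : R) (N : nat) (a : nat -> C) (F : C -> C) (P : C -> Prop)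
  (Hd2 : 0 < delta2 < 1)
  (Hd1 : 0 < delta1 /\ delta1 < Rmin delta2 (1 - delta2))
  (HN : (1 <= N)%nat)
  (Ha : forall i : nat, (i < N)%nat -> Cmod (a i) < delta1)
  (HF : meromorphic_with_poles F P)
  (HP : forall p : C, P p -> delta2 < fst p)
  (Hnz : forall z : C, Cmod z <= delta1 -> F z <> RtoC 0)
  (Hline : forall kappa : R, 0 < kappa ->
     forall c : R, (c = delta2 \/ c = - delta2) ->
     ex_RInt_gen (fun t => exp (PI * (INR N / 2 - 1) * Rabs t)
                             * powabs t kappa * Cmod (F (vline c t)))
                 (Rbar_locally m_infty) (Rbar_locally p_infty))
  (Hseg : forall kappa : R, 0 < kappa ->
     let seg := fun M : R =>
       RInt (fun x => exp (PI * (INR N / 2 - 1) * Rabs M)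
                        * powabs M kappa * Cmod (F (x, M))) (- delta1) delta2 in
     is_lim seg p_infty 0 /\ is_lim seg m_infty 0) :
  exists v : C,
    is_iter_RInt_gen N (lhs_integrand N delta1 a F) v
    /\ @is_series C_AbsRing C_NormedModule (fredholm_term N delta1 delta2 a F) v.
Proof.
  destruct Hd1 as [Pd1 Hd1]. pose proof (Rmin_l delta2 (1 - delta2)) as M1. pose proof (Rmin_r delta2 (1 - delta2)) as M2.
  destruct HF as [_ [HFd _]].
  assert (HFhol : forall z : C, fst z <= delta2 -> hol F z).
  { intros z Hz. apply ex_derive_hol, HFd. intros Hp. specialize (HP z Hp). lra. }
  destruct (nonvanishing_margin F delta1 Pd1 Hnz) as [e [Pe He]].
  { intros z Hz. apply hol_cont, HFhol. pose proof (Re_le_Cmod z). pose proof (Rle_abs (fst z)). lra. }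
  set (mu := Rmin delta2 (1 - delta2)) in *.
  set (rho := Rmin (delta1 + e) ((delta1 + mu) / 2)).
  assert (Hrho : delta1 < rho /\ rho < delta2 /\ rho < 1 - delta2).
  { pose proof (Rmin_r (delta1 + e) ((delta1 + mu) / 2)) as B. fold rho in B.
    split; [apply Rmin_glb_lt; lra|lra]. }
  assert (HFnz : forall z : C, Cmod z < rho -> F z <> 0).
  { intros z Hz. apply He. pose proof (Rmin_l (delta1 + e) ((delta1 + mu) / 2)) as B. fold rho in B. lra. }
  assert (Hl : forall kappa, 0 < kappa -> ex_RInt_gen (fun t => exp (PI * (INR N / 2 - 1) * Rabs t)
     * powabs t kappa * Cmod (F (vline delta2 t))) (Rbar_locally m_infty) (Rbar_locally p_infty)).
  { intros kappa Hk. apply Hline; auto. }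
  exists (Cprod N (fun k => GG delta1 N a F k k) * cdet N (Lk delta2 rho N a F))%C.
  split.
  - apply lhs_value; auto.
  - apply fredholm_series; auto.
Qed.
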